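(* Let $X_1,\dots,X_n$ be iid mean zero random vectors in $\mathbb{R}^p$ with covariance matrix $\Sigma\in\mathcal{G}(r,\zeta_p)$, $r\in[0,1)$, such that $\|\max_{1\le k\le p}|X_{1k}|\|_8\le\nu_n$. Suppose that there exist constants $C_1,C_2,C_3>0$ such that $\Gamma_{(j,k),(j,k)}\ge C_1$ for all $j,k=1,\dots,p$, $\xi_6\le C_2\nu_n^{1/3}$ and $\xi_8\le C_3\nu_n^{1/2}$. Let $\alpha,\beta,K\in(0,1)$ and $\tau_*=\beta^{-1}a_{\bar T_n^\sharp}(1-\alpha)$. If $\nu_n^8\log^7(np)\le C_4n^{1-7K/6}$ for a constant $C_4>0$, then $$\|\hat\Sigma(\tau_* )-\Sigma\|_2\le\left[\frac{3+2\beta}{\beta^{1-r}}+\left(\frac{\beta}{1-\beta}\right)^r\right]\zeta_p\,a_{\bar T_n^\sharp}^{1-r}(1-\alpha),$$ $$\frac1p|\hat\Sigma(\tau_* )-\Sigma|_F^2\le2\left[\frac{4+3\beta^2}{\beta^{2-r}}+2\left(\frac{\beta}{1-\beta}\right)^r\right]\zeta_p\,a_{\bar T_n^\sharp}^{2-r}(1-\alpha)$$ hold with probability at least $1-\alpha-Cn^{-K/6}$ for some constant $C>0$ depending only on $C_1,\dots,C_4$. In addition, $$\mathbb{E}[\tau_*]\le C'\beta^{-1}\xi_4^2(\log(p)/n)^{1/2}$$ for some constant $C'>0$ depending only on $\alpha$ and $C_1,\dots,C_4$.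
   Context: Throughout $n\ge4$ and $d=p^2\ge3$; $p$, $\nu_n>0$ and the distribution of $X_i$ may depend on $n$. For $q>0$, $\|X\|_q=(\mathbb{E}|X|^q)^{1/q}$ and $\xi_q=\max_{1\le k\le p}\|X_{1k}\|_q$. For $r\in[0,1)$ and $\zeta_p>0$, $\mathcal{G}(r,\zeta_p)$ is the class of $p\times p$ covariance matrices $\Sigma=\{\sigma_{mk}\}$ with $\max_{1\le m\le p}\sum_{k=1}^p|\sigma_{mk}|^r\le\zeta_p$ (for $r=0$, $|\sigma|^0$ means $\mathbf 1\{\sigma\ne0\}$). Covariance kernel: $h(x_1,x_2)=(x_1-x_2)(x_1-x_2)^\top/2\in\mathbb{R}^{p\times p}$; the corresponding U-statistic $\frac1{n(n-1)}\sum_{i\ne j}h(X_i,X_j)$ is the sample covariance matrix $\hat S_n=\{\hat s_{mk}\}=(n-1)^{-1}\sum_{i=1}^n(X_i-\bar X_n)(X_i-\bar X_n)^\top$. Here $g(x)=(xx^\top-\Sigma)/2$ and $\Gamma=\mathrm{Cov}(g(X_1))$ is indexed by pairs, so $\Gamma_{(j,k),(j,k)}=\mathrm{Var}(g_{jk}(X_1))$. Thresholded estimator: $\hat\Sigma(\tau)=\{\hat s_{mk}\mathbf 1\{|\hat s_{mk}|>\tau\}\}_{m,k=1}^p$. Bootstrap: $e_1,\dots,e_n$ are iid $N(0,1)$ independent of $X_1^n=(X_1,\dots,X_n)$, $T_n^\sharp=\frac1{\sqrt n}\sum_{i=1}^n[\frac1{n-1}\sum_{j\ne i}h(X_i,X_j)-\hat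 S_n]e_i$, $\bar T_n^\sharp=2n^{-1/2}\max_{1\le m,k\le p}|T^\sharp_{n,mk}|$, and $a_{\bar T_n^\sharp}(\alpha)=\inf\{t\in\mathbb{R}:\mathbb{P}_e(\bar T_n^\sharp\le t)\ge\alpha\}$, where $\mathbb{P}_e$ is the probability with respect to $e_1,\dots,e_n$ only (conditional on $X_1^n$). $\|\cdot\|_2$ is the spectral norm and $|\cdot|_F$ the Frobenius norm; $a^{s}(1-\alpha)$ denotes the $s$-th power of $a(1-\alpha)$. *)

(* Defs.v *)
From HB Require Import structures.
From mathcomp Require Import all_boot all_order all_algebra.
From mathcomp Require Import all_classical all_reals all_analysis.

Set Implicit Arguments.
Unset Strict Implicit.
Unset Printing Implicit Defensive.

Import Order.TTheory GRing.Theory Num.Theory.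
Import numFieldNormedType.Exports.

Local Open Scope classical_set_scope.
Local Open Scope ring_scope.

Section Matrices.
Context {R : realType}.

(* On column vectors this is the Euclidean norm. *)
Definition frob_norm {m n : nat} (A : 'M[R]_(m, n)) : R :=
  Num.sqrt (\sum_(i < m) \sum_(j < n) A i j ^+ 2).

(* Operator norm induced by the Euclidean norm. *)
Definition spectral_norm {p : nat} (A : 'M[R]_p) : R :=
  sup [set frob_norm (A *m v) | v in [set v : 'cV[R]_p | frob_norm v <= 1]].

Definition covariance_matrix {p : nat} (S : 'M[R]_p) : Prop :=
  S^T = S /\ forall v : 'cV[R]_p, 0 <= (v^T *m S *m v) 0 0.

(* |s|^r with the convention |s|^0 = 1{s <> 0}; powR has 0 `^ 0 = 1, and
   0 `^ r = 0 for r != 0, so the case split only matters at r = 0. *)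
Definition abs_pow (s r : R) : R := if s == 0 then 0 else `|s| `^ r.

(* The index 0 of the maximum is harmless: the row sums are nonnegative. *)
Definition sparse_class (p : nat) (r zeta : R) : set 'M[R]_p :=
  [set S | covariance_matrix S /\
    \big[Num.max/0]_(m < p) \sum_(k < p) abs_pow (S m k) r <= zeta].

Definition threshold {p : nat} (tau : R) (S : 'M[R]_p) : 'M[R]_p :=
  \matrix_(m, k) (if tau < `|S m k| then S m k else 0).

End Matrices.

Section Statistics.
Context {R : realType} {n p : nat}.
Implicit Types (x : 'I_n -> 'cV[R]_p) (e : 'I_n -> R).

Definition cov_kernel (x1 x2 : 'cV[R]_p) : 'M[R]_p :=
  2^-1 *: ((x1 - x2) *m (x1 - x2)^T).

Definition sample_mean x : 'cV[R]_p := n%:R^-1 *: \sum_(i < n) x i.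

Definition sample_cov x : 'M[R]_p :=
  n.-1%:R^-1 *:
    \sum_(i < n) ((x i - sample_mean x) *m (x i - sample_mean x)^T).

Definition boot_T x e : 'M[R]_p :=
  (Num.sqrt n%:R)^-1 *:
    \sum_(i < n) e i *:
      (n.-1%:R^-1 *: (\sum_(j < n | j != i) cov_kernel (x i) (x j))
       - sample_cov x).

Definition boot_Tbar x e : R :=
  2 * (Num.sqrt n%:R)^-1 *
    \big[Num.max/0]_(m < p) \big[Num.max/0]_(k < p) `|boot_T x e m k|.

Definition hajek (Sigma : 'M[R]_p) (x : 'cV[R]_p) : 'M[R]_p :=
  2^-1 *: (x *m x^T - Sigma).

End Statistics.

Section Probability.
Context d (T : measurableType d) (R : realType) (P : probability T R).

(* Product rule for the whole family; B i = setT covers the subfamilies. *)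
Definition mutually_independent (n : nat) d' (T' : measurableType d')
    (X : 'I_n -> {RV P >-> T'}) : Prop :=
  forall B : 'I_n -> set T', (forall i, measurable (B i)) ->
    P (\bigcap_(i in [set: 'I_n]) (X i @^-1` B i)) =
    (\prod_(i < n) P (X i @^-1` B i))%E.

Definition identically_distributed (n : nat) d' (T' : measurableType d')
    (X : 'I_n -> {RV P >-> T'}) : Prop :=
  forall (i j : 'I_n) (B : set T'), measurable B ->
    distribution P (X i) B = distribution P (X j) B.

Definition iid (n : nat) d' (T' : measurableType d')
    (X : 'I_n -> {RV P >-> T'}) : Prop :=
  mutually_independent X /\ identically_distributed X.

Definition standard_normal (Z : {RV P >-> R}) : Prop :=
  forall B : set R, measurable B -> distribution P Z B = normal_prob 0 1 B.

Definition independent_families (n : nat)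
    d1 (T1 : measurableType d1) (X : 'I_n -> {RV P >-> T1})
    d2 (T2 : measurableType d2) (Y : 'I_n -> {RV P >-> T2}) : Prop :=
  forall (A : set (n.-tuple T1)) (B : set (n.-tuple T2)),
    measurable A -> measurable B ->
    P [set w | A [tuple X i w | i < n] /\ B [tuple Y i w | i < n]] =
    (P [set w | A [tuple X i w | i < n]] *
     P [set w | B [tuple Y i w | i < n]])%E.

(* p.-tuple R carries the product Borel sigma-algebra, the column vectors
   'cV[R]_p carry the linear algebra. *)
Definition vec (p : nat) (x : p.-tuple R) : 'cV[R]_p := \col_k tnth x k.

Definition rv_coord (p : nat) (Z : {RV P >-> p.-tuple R}) (k : 'I_p) : T -> R :=
  fun w => tnth (Z w) k.

Definition max_abs (p : nat) (Z : {RV P >-> p.-tuple R}) : T -> R :=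
  fun w => \big[Num.max/0]_(k < p) `|rv_coord Z k w|.

Definition LqNorm (q : R) (f : T -> R) : \bar R := 'N[P]_(q%:E)[EFin \o f]%E.

Definition xi (p : nat) (Z : {RV P >-> p.-tuple R}) (q : R) : \bar R :=
  \big[maxe/0%E]_(k < p) LqNorm q (rv_coord Z k).

Definition hajek_cov (p : nat) (Sigma : 'M[R]_p) (Z : {RV P >-> p.-tuple R})
    (a b : 'I_p * 'I_p) : \bar R :=
  covariance P (fun w => hajek Sigma (vec (Z w)) a.1 a.2)
               (fun w => hajek Sigma (vec (Z w)) b.1 b.2).

Section Bootstrap.
Context (n p : nat).
Variables (X : 'I_n -> {RV P >-> p.-tuple R}) (e : 'I_n -> {RV P >-> R}).

Definition data (w : T) : 'I_n -> 'cV[R]_p := fun i => vec (X i w).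

(* Since e is independent of X, the conditional probability P_e given X = x
   is P with x frozen. *)
Definition boot_cdf (x : 'I_n -> 'cV[R]_p) (t : R) : \bar R :=
  P [set w | boot_Tbar x (fun i => e i w) <= t].

Definition boot_quantile (w : T) (alpha : R) : R :=
  inf [set t : R | (alpha%:E <= boot_cdf (data w) t)%E].

End Bootstrap.

End Probability.

Definition first_ord (n : nat) (hn : (4 <= n)%N) : 'I_n :=
  Ordinal (leq_trans (isT : (1 <= 4)%N) hn).

(* Main.v *)
(* Up to lower order terms, sqrt n (S_n - Sigma) is a normalized sum of the
   centred products x_m x_k - Sigma_mk, while the bootstrap statistic, given the
   data, is the maximum of a Gaussian field whose covariance is an empirical
   version of that of the summands. The probabilities that all coordinates stay
   below a threshold are compared after smoothing by 1/(1 + sum_j exp v_j). Along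
   the path cos th * (sum) + sin th * (Gaussian field) the smoothed probability
   has a derivative that Stein's identity (Gaussian part) and a leave-one-out
   Taylor expansion (sum) bound by K1 w + K2, where w is the mass of the window
   in which the soft maximum is of order one. As w is itself an increment of the
   smoothed probability in the threshold, averaging over about log(np) adjacent
   windows turns this into a self-bounding inequality; no coupling and no
   truncation is needed. The Gaussian field has small window masses because of
   Gaussian integration by parts. A first moment maximal inequality and Markov's
   inequality provide a set of data of probability 1 - O(n^(-K/6)) on which the
   bootstrap covariance is close to the true one. Hence the bootstrap quantile
   a(1 - alpha) bounds max |S_n - Sigma| with the stated probability, and on that
   event the thresholding bounds are deterministic. The bound on E[tau] follows
   from a(1 - alpha) <= E_e[T]/alpha and the same maximal inequalities. *)
Require Import Defs.
From HB Require Import structures.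
From mathcomp Require Import all_boot all_order all_algebra.
From mathcomp Require Import all_classical all_reals all_analysis.
From mathcomp Require Import measurable_realfun ring lra.

Set Implicit Arguments.
Unset Strict Implicit.
Unset Printing Implicit Defensive.

Import Order.TTheory GRing.Theory Num.Theory.
Import numFieldNormedType.Exports.

Local Open Scope classical_set_scope.
Local Open Scope ring_scope.

(** * Expectations, probabilities and independence *)

Section Expectation.
Context d (T : measurableType d) (R : realType) (P : probability T R).
Implicit Types f g : T -> R.

(** The obstacle is that the interpolated vector is not Gaussian, so nothing bounds its window mass
    directly, while every derivative of a smoothed maximum lives on the window. The choice of [sm0]
    answers this: its derivatives are bounded by fixed multiples of its own logistic density, and an
    increment of size at most one changes that density by a bounded factor only. Remainders are
    therefore relative, and independence turns the summand inside them into coordinatewise third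
    moments. Only when an increment exceeds one is a trivial bound used, paid for by the fourth
    moment of the envelope; this takes the place of truncation. A second obstacle is that the
    quantile is random. Data and multipliers are independent on one space, so the bootstrap field
    frozen at a fixed good data point is a Gaussian field independent of the sample, and the
    interpolation runs against it. Freezing at data where the quantile nearly attains its infimum
    over the good set gives one deterministic level that serves all good data; the gap m / beta left
    by the comparison absorbs the defect. *)

Definition L1 f := P.-integrable setT (EFin \o f).
(** Expectations are kept as real numbers so that linear arithmetic applies; [L1_EFin] leads back to
    the extended integral of an integrable function. *)
Definition Ex f : R := fine (\int[P]_w (f w)%:E)%E.

Lemma L1_meas f : L1 f -> measurable_fun setT f.
Proof. by move=> /measurable_int /measurable_EFinP. Qed.

Lemma L1_EFin f : L1 f -> (\int[P]_w (f w)%:E)%E = (Ex f)%:E.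
Proof. by move=> hf; rewrite /Ex fineK//; apply: integrable_fin_num. Qed.

Lemma L1_cst c : L1 (fun=> c).
Proof. exact: finite_measure_integrable_cst. Qed.

Lemma L1_le f g : measurable_fun setT f -> (forall w, `|f w| <= g w) ->
  L1 g -> L1 f.
Proof.
move=> mf fg hg; apply: (le_integrable measurableT _ _ hg) => //.
  exact/measurable_EFinP.
move=> w _ /=; rewrite lee_fin (le_trans (fg w))//; exact: ler_norm.
Qed.

Lemma L1_bnd f c : measurable_fun setT f -> (forall w, `|f w| <= c) -> L1 f.
Proof. by move=> mf h; apply: (L1_le mf h); apply: L1_cst. Qed.

Lemma L1_ext f g : f =1 g -> L1 f -> L1 g.
Proof. by move=> /funext->. Qed.

Lemma L1D f g : L1 f -> L1 g -> L1 (fun w => f w + g w).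
Proof. by move=> hf hg; have := integrableD measurableT hf hg. Qed.

Lemma L1N f : L1 f -> L1 (fun w => - f w).
Proof. by move=> hf; have := integrableN hf. Qed.

Lemma L1B f g : L1 f -> L1 g -> L1 (fun w => f w - g w).
Proof. by move=> hf /L1N; exact: L1D. Qed.

Lemma L1Z c f : L1 f -> L1 (fun w => c * f w).
Proof. by move=> hf; have := integrableZl measurableT c hf. Qed.

Lemma L1_norm f : L1 f -> L1 (fun w => `|f w|).
Proof. exact: integrable_norm. Qed.

Lemma L1_sum (I : Type) (r : seq I) (p : pred I) (F : I -> T -> R) :
  (forall i, p i -> L1 (F i)) -> L1 (fun w => \sum_(i <- r | p i) F i w).
Proof.
move=> h; elim: r => [|i r ih].
  by apply: L1_ext (L1_cst 0) => w; rewrite big_nil.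
have [pi|pi] := boolP (p i).
  by apply: L1_ext (L1D (h _ pi) ih) => w; rewrite big_cons pi.
by apply: L1_ext ih => w; rewrite big_cons (negbTE pi).
Qed.

Lemma Ex_cst c : Ex (fun=> c) = c.
Proof.
by rewrite /Ex integral_cst//= [P setT]probability_setT mule1.
Qed.

Lemma ExD f g : L1 f -> L1 g -> Ex (fun w => f w + g w) = Ex f + Ex g.
Proof.
move=> hf hg; apply: EFin_inj; rewrite -L1_EFin ?EFinD -?L1_EFin//; last exact: L1D.
under eq_integral do rewrite EFinD.
by rewrite integralD.
Qed.

Lemma ExZ c f : L1 f -> Ex (fun w => c * f w) = c * Ex f.
Proof.
move=> hf; apply: EFin_inj; rewrite -L1_EFin ?EFinM -?L1_EFin//; last exact: L1Z.
under eq_integral do rewrite EFinM.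
by rewrite integralZl.
Qed.

Lemma ExN f : L1 f -> Ex (fun w => - f w) = - Ex f.
Proof.
move=> hf; rewrite -mulN1r -ExZ//; congr Ex; apply/funext => w.
by rewrite mulN1r.
Qed.

Lemma ExB f g : L1 f -> L1 g -> Ex (fun w => f w - g w) = Ex f - Ex g.
Proof. by move=> hf hg; rewrite ExD ?ExN//; exact: L1N. Qed.

Lemma Ex_sum (I : Type) (r : seq I) (p : pred I) (F : I -> T -> R) :
  (forall i, p i -> L1 (F i)) ->
  Ex (fun w => \sum_(i <- r | p i) F i w) = \sum_(i <- r | p i) Ex (F i).
Proof.
move=> h; elim: r => [|i r ih].
  by rewrite big_nil -[RHS](Ex_cst 0); congr Ex; apply/funext => w; rewrite big_nil.
rewrite big_cons; case: ifPn => pi; last first.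
  by rewrite -ih; congr Ex; apply/funext => w; rewrite big_cons (negbTE pi).
rewrite -ih -ExD; [|exact: h|exact: L1_sum].
by congr Ex; apply/funext => w; rewrite big_cons pi.
Qed.

Lemma Ex_le f g : L1 f -> L1 g -> (forall w, f w <= g w) -> Ex f <= Ex g.
Proof.
move=> hf hg fg; rewrite -lee_fin -!L1_EFin//.
by apply: le_integral => // w _; rewrite lee_fin.
Qed.

Lemma Ex_ge0 f : (forall w, 0 <= f w) -> 0 <= Ex f.
Proof. by move=> f0; apply/fine_ge0/integral_ge0 => w _; rewrite lee_fin. Qed.

Lemma Ex_norm f : L1 f -> `|Ex f| <= Ex (fun w => `|f w|).
Proof.
move=> hf; have ha := L1_norm hf; rewrite ler_norml -ExN//; apply/andP; split.
  by apply: Ex_le => //; [exact: L1N|move=> w; rewrite lerNl -normrN ler_norm].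
by apply: Ex_le => // w; exact: ler_norm.
Qed.

Lemma Ex_le_cst f c : L1 f -> (forall w, f w <= c) -> Ex f <= c.
Proof. by move=> hf h; rewrite -[leRHS]Ex_cst; apply: Ex_le => //; exact: L1_cst. Qed.

Lemma Ex_norm_le f g : L1 f -> L1 g -> (forall w, `|f w| <= g w) ->
  `|Ex f| <= Ex g.
Proof.
by move=> hf hg h; apply: le_trans (Ex_norm hf) _; apply: Ex_le => //; exact: L1_norm.
Qed.

Definition Pr (A : set T) : R := fine (P A).

Lemma PrE A : measurable A -> P A = (Pr A)%:E.
Proof.
move=> mA; rewrite /Pr fineK//; apply: fin_num_measure => //.
Qed.

Lemma Pr_indic A : measurable A -> Ex (\1_A) = Pr A.
Proof. by move=> mA; rewrite /Ex /Pr integral_indic// setIT. Qed.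

Lemma L1_indic A : measurable A -> L1 (\1_A).
Proof. by move=> mA; exact: integrable_indic. Qed.

Lemma Pr_le A B : measurable A -> measurable B -> A `<=` B -> Pr A <= Pr B.
Proof.
move=> mA mB AB; rewrite -lee_fin -!PrE//; apply: le_measure => //; exact: mem_set.
Qed.

Lemma PrC A : measurable A -> Pr (~` A) = 1 - Pr A.
Proof.
move=> mA; apply: EFin_inj; rewrite -PrE ?EFinB -?PrE//; last exact: measurableC.
by rewrite probability_setC.
Qed.

Lemma PrU A B : measurable A -> measurable B -> Pr (A `|` B) <= Pr A + Pr B.
Proof.
move=> mA mB; rewrite -lee_fin EFinD -!PrE//; last exact: measurableU.
exact: measureU2.
Qed.

Lemma Pr_Ex_le A f : measurable A -> L1 f -> (forall w, \1_A w <= f w) ->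
  Pr A <= Ex f.
Proof. by move=> mA hf h; rewrite -Pr_indic//; apply: Ex_le => //; exact: L1_indic. Qed.

Lemma Pr_Ex_ge A f : measurable A -> L1 f -> (forall w, f w <= \1_A w) ->
  Ex f <= Pr A.
Proof. by move=> mA hf h; rewrite -Pr_indic//; apply: Ex_le => //; exact: L1_indic. Qed.

Lemma Pr_markov f c : L1 f -> (forall w, 0 <= f w) -> 0 < c ->
  Pr [set w | c < f w] <= Ex f / c.
Proof.
move=> hf f0 c0; have mf := L1_meas hf.
have -> : Ex f / c = Ex (fun w => c^-1 * f w) by rewrite ExZ// mulrC.
apply: Pr_Ex_le; [|exact: L1Z|].
  rewrite (_ : [set w | c < f w] = f @^-1` `]c, +oo[%classic); last first.
    by apply/seteqP; split=> w /=; rewrite in_itv/= andbT.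
  by rewrite -[X in measurable X]setTI; apply: mf.
move=> w; rewrite indicE; case: (boolP (w \in _)) => [/set_mem/= h|_] /=.
  by rewrite mulrC ler_pdivlMr// mul1r ltW.
by rewrite mulr_ge0// invr_ge0 ltW.
Qed.

End Expectation.

Lemma measurable_funB' d (T : measurableType d) (R : realType) D (f g : T -> R) :
  measurable_fun D f -> measurable_fun D g -> measurable_fun D (fun w => f w - g w).
Proof. exact: measurable_funB. Qed.

Lemma meas_le d (T : measurableType d) (R : realType) (f g : T -> R) :
  measurable_fun setT f -> measurable_fun setT g ->
  measurable [set w | f w <= g w].
Proof.
by move=> mf mg; rewrite -[X in measurable X]setTI; exact: measurable_fun_le.
Qed.

Lemma meas_lt d (T : measurableType d) (R : realType) (f g : T -> R) :
  measurable_fun setT f -> measurable_fun setT g ->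
  measurable [set w | f w < g w].
Proof.
move=> mf mg; rewrite (_ : [set w | _] = ~` [set w | g w <= f w]).
  exact/measurableC/meas_le.
by apply/seteqP; split=> w /=; rewrite ltNge => /negP.
Qed.

Lemma meas_sum d (T : measurableType d) (R : realType) (I : Type) (r : seq I)
    (p : pred I) (F : I -> T -> R) :
  (forall i, measurable_fun setT (F i)) ->
  measurable_fun setT (fun w => \sum_(i <- r | p i) F i w).
Proof.
move=> h; elim: r => [|i r ih].
  by rewrite [X in measurable_fun _ X](_ : _ = cst 0)//; apply/funext => w; rewrite big_nil.
have [pi|pi] := boolP (p i).
  rewrite [X in measurable_fun _ X](_ : _ = fun w => F i w + \sum_(i <- r | p i) F i w).
    exact: measurable_funD.
  by apply/funext => w; rewrite big_cons pi.
rewrite [X in measurable_fun _ X](_ : _ = fun w => \sum_(i <- r | p i) F i w)//.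
by apply/funext => w; rewrite big_cons (negbTE pi).
Qed.

Lemma meas_bigmax d (T : measurableType d) (R : realType) (I : Type) (r : seq I)
    (p : pred I) (F : I -> T -> R) (x0 : R) :
  (forall i, measurable_fun setT (F i)) ->
  measurable_fun setT (fun w => \big[Num.max/x0]_(i <- r | p i) F i w).
Proof.
move=> h; elim: r => [|i r ih].
  by rewrite [X in measurable_fun _ X](_ : _ = cst x0)//; apply/funext => w; rewrite big_nil.
have [pi|pi] := boolP (p i).
  rewrite [X in measurable_fun _ X](_ : _ =
      fun w => Num.max (F i w) (\big[Num.max/x0]_(i <- r | p i) F i w)).
    exact: measurable_maxr.
  by apply/funext => w; rewrite big_cons pi.
rewrite [X in measurable_fun _ X](_ : _ = fun w => \big[Num.max/x0]_(i <- r | p i) F i w)//.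
by apply/funext => w; rewrite big_cons (negbTE pi).
Qed.

Lemma meas_normr d (T : measurableType d) (R : realType) (f : T -> R) :
  measurable_fun setT f -> measurable_fun setT (fun w => `|f w|).
Proof. by move=> mf; apply: measurableT_comp => //; exact: normr_measurable. Qed.

(** * Independent pairs and Fubini's theorem *)

Section Independence.
Context d (T : measurableType d) (R : realType) (P : probability T R).
Context d1 (T1 : measurableType d1) d2 (T2 : measurableType d2).

Definition indep (U : T -> T1) (V : T -> T2) :=
  [/\ measurable_fun setT U, measurable_fun setT V &
  forall A B, measurable A -> measurable B ->
    P (U @^-1` A `&` V @^-1` B) = (P (U @^-1` A) * P (V @^-1` B))%E].

(* Dynkin's lemma; the identity from the sigma-algebra generated by G to T2
   is measurable, which is often easier to check than an equality of
   generated sigma-algebras. *)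
Lemma indep_dynkin (G : set (set T2)) (U : T -> T1) (V : T -> T2) :
  setI_closed G -> G [set: T2] ->
  measurable_fun setT U -> measurable_fun setT V ->
  measurable `<=` <<s G >> -> G `<=` measurable ->
  (forall A B, measurable A -> G B ->
    P (U @^-1` A `&` V @^-1` B) = (P (U @^-1` A) * P (V @^-1` B))%E) ->
  indep U V.
Proof.
move=> GI GT mU mV mG Gm h; split => // A B mA mB.
have mUA : measurable (U @^-1` A) by rewrite -[X in measurable X]setTI; exact: mU.
have mVS S : measurable S -> measurable (V @^-1` S).
  by move=> mS; rewrite -[X in measurable X]setTI; exact: mV.
have GE : @measurable _ T2 = <<s G >>.
  apply/seteqP; split => //; apply: smallest_sub => //; exact: sigma_algebra_measurable.
pose Q (B : set T2) := P (U @^-1` A `&` V @^-1` B) = (P (U @^-1` A) * P (V @^-1` B))%E.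
apply: (@dynkin_induction _ T2 G Q) => //.
- by rewrite /Q; apply: h.
- by move=> B' GB'; apply: h.
- move=> S mS QS; rewrite /Q preimage_setC.
  have mv := mVS _ mS.
  have Aoo : (P (U @^-1` A) < +oo)%E by rewrite (PrE _ mUA) ltry.
  rewrite -setDE (measureD mUA mv Aoo).
  transitivity (P (U @^-1` A) - P (U @^-1` A) * P (V @^-1` S))%E; first by rewrite -QS.
  by rewrite probability_setC// !PrE// -EFinM -!EFinB -EFinM mulrBr mulr1.
- move=> F mF tF QF; rewrite /Q preimage_bigcup setI_bigcupr.
  have tVF : trivIset setT (fun k => V @^-1` F k).
    apply/trivIsetP => i j _ _ ij; move/trivIsetP : tF => /(_ i j Logic.I Logic.I ij).
    by rewrite -preimage_setI => ->; rewrite preimage_set0.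
  rewrite measure_bigcup//=; last 2 first.
    - by move=> i _; apply: measurableI => //; exact: mVS.
    - apply/trivIsetP => i j _ _ ij; move/trivIsetP : tVF => /(_ i j Logic.I Logic.I ij).
      by rewrite setIACA => ->; rewrite setI0.
  rewrite measure_bigcup//=; last by move=> i _; exact: mVS.
  rewrite [P (U @^-1` A)]PrE// -nneseriesZl//.
  by apply: eq_eseriesr => i _; rewrite -PrE//; exact: QF.
- by rewrite -GE.
Qed.

(** By independence the joint law of the pair is the product of its marginals, so this is Fubini's
    theorem. Integrability of [f (U w, v)] for every [v] makes the inner expectation a finite
    function defined everywhere. *)
Lemma indep_law (U : T -> T1) (V : T -> T2) (f : T1 * T2 -> R) : indep U V ->
  measurable_fun setT f -> L1 P (fun w => f (U w, V w)) ->
  (forall v, L1 P (fun w => f (U w, v))) ->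
  L1 P (fun w' => Ex P (fun w => f (U w, V w'))) /\
  Ex P (fun w => f (U w, V w)) = Ex P (fun w' => Ex P (fun w => f (U w, V w'))).
Proof.
move=> [mU mV iUV] mf hf hfv.
pose U' : {RV P >-> T1} := HB.pack U (isMeasurableFun.Build _ _ _ _ U mU).
pose V' : {RV P >-> T2} := HB.pack V (isMeasurableFun.Build _ _ _ _ V mV).
(* The coordinates are swapped because the iterated integral used below integrates over the second
   factor first. *)
pose g (z : T2 * T1) := f (z.2, z.1).
have mg : measurable_fun setT g by apply: measurableT_comp mf _; exact: measurable_swap.
have mVU : measurable_fun setT (fun w => (V w, U w)) by exact: measurable_fun_pair.
pose VU : {RV P >-> (T2 * T1)%type} := HB.pack (fun w => (V w, U w))
  (isMeasurableFun.Build _ _ _ _ _ mVU).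
have hE X : measurable X ->
   (distribution P V' \x distribution P U')%E X = distribution P VU X.
  move=> mX; apply: product_measure_unique; last exact: mX.
  move=> B A mB mA; have := iUV A B mA mB.
  by rewrite setIC muleC.
have mgE : measurable_fun setT (EFin \o g) by exact/measurable_EFinP.
have hi : (distribution P VU).-integrable setT (EFin \o g).
  by apply: integrable_pushforward => //; rewrite preimage_setT.
have hi2 : (distribution P V' \x distribution P U')%E.-integrable setT (EFin \o g).
  apply/integrableP; split => //.
  move/integrableP : hi => [_].
  rewrite (eq_measure_integral (distribution P V' \x distribution P U')%E)//.
  by move=> A mA _; apply/esym/hE.
have h1 v : (\int[distribution P U']_u (f (u, v))%:E)%E = (Ex P (fun w => f (U w, v)))%:E.
  rewrite -(L1_EFin (hfv v)) integral_distribution//; last exact: hfv.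
  by apply/measurable_EFinP; exact: measurableT_comp mf (pair2_measurable v).
have hG := integrable_fubini_F hi2.
rewrite [X in _.-integrable _ X](_ : _ = EFin \o (fun v => Ex P (fun w => f (U w, v)))) in hG; last first.
  by apply/funext => v; exact: h1.
have mG := measurable_int _ hG.
have hL : L1 P (fun w' => Ex P (fun w => f (U w, V w'))).
  apply/integrableP; split.
    have /measurable_EFinP mH := mG; apply/measurable_EFinP; exact: (measurableT_comp mH mV).
  move/integrableP : hG => [_].
  by rewrite ge0_integral_distribution//; apply: measurableT_comp.
split=> //.
rewrite /Ex; congr fine.
have -> : (\int[P]_w (f (U w, V w))%:E)%E = (\int[distribution P VU]_z (g z)%:E)%E.
  by rewrite integral_distribution.
rewrite (eq_measure_integral (distribution P V' \x distribution P U')%E); last first.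
  by move=> A mA _; apply/esym/hE.
transitivity (\int[distribution P V']_v (Ex P (fun w => f (U w, v)))%:E)%E; last by rewrite integral_distribution.
rewrite -(integral12_prod_meas1 hi2); apply: eq_integral => v _; exact: h1.
Qed.

Lemma indep_prod (U : T -> T1) (V : T -> T2) (a : T1 -> R) (b : T2 -> R) :
  indep U V -> measurable_fun setT a -> measurable_fun setT b ->
  L1 P (a \o U) -> L1 P (fun w => a (U w) * b (V w)) ->
  Ex P (fun w => a (U w) * b (V w)) = Ex P (a \o U) * Ex P (b \o V).
Proof.
move=> iUV ma mb la lab.
have mf : measurable_fun setT (fun z : T1 * T2 => a z.1 * b z.2).
  by apply: measurable_funM; apply: measurableT_comp.
have lv v : L1 P (fun w => a (U w) * b v).
  by apply: L1_ext (L1Z (b v) la) => w /=; rewrite mulrC.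
have [hL ->] := indep_law iUV mf lab lv => /=.
have e w' : Ex P (fun w => a (U w) * b (V w')) = b (V w') * Ex P (a \o U).
  by rewrite -ExZ//; congr Ex; apply/funext => w; rewrite mulrC.
(* If the mean of [a \o U] vanishes, both sides are 0. Otherwise integrability of [b \o V] is read
   off from that of the inner expectation, which is [b (V w')] times this mean. *)
have [z|nz] := eqVneq (Ex P (a \o U)) 0.
  rewrite z mul0r -[RHS](Ex_cst P 0); congr Ex; apply/funext => w'.
  by rewrite e z mulr0.
have lb : L1 P (b \o V).
  have := L1Z (Ex P (a \o U))^-1 hL; apply: L1_ext => w /=.
  by rewrite e mulrC mulfK.
by rewrite -ExZ//; congr Ex; apply/funext => w'; rewrite e mulrC.
Qed.

End Independence.

(** * Soft maximum *)

Section ScalarExp.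
Context {R : realType}.
Implicit Types x e l a m : R.

(** From exp(-x/2) >= 1 - x/2 follows exp(x) (1 - x/2)^2 <= 1, while (1 + x + 4 x^2) (1 - x/2)^2 = 1
    + x^2 (13 - 15 x + 4 x^2) / 4 is at least 1 on [-1, 1]. *)
Lemma expR_taylor2 x : `|x| <= 1 -> 0 <= expR x - 1 - x <= 4 * x ^+ 2.
Proof.
rewrite ler_norml => /andP[x1 x2]; apply/andP; split.
  by have := expR_ge1Dx x; lra.
have h : expR (- (x / 2)) >= 1 - x / 2 by have := expR_ge1Dx (- (x / 2)); lra.
have hp : 0 < 1 - x / 2 by lra.
have e2 : expR x * expR (- (x / 2)) ^+ 2 = 1.
  by rewrite expr2 -!expRD (_ : _ + _ = 0) ?expR0//; field.
have h2 : expR x * (1 - x / 2) ^+ 2 <= 1.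
  rewrite -[leRHS]e2 ler_pM2l ?expR_gt0//; exact: (lerXn2r 2 (ltW hp) (expR_ge0 _) h).
have : (1 + x + 4 * x ^+ 2) * (1 - x / 2) ^+ 2 >= 1.
  have hs := sqr_ge0 (x - 1); have hx := sqr_ge0 x.
  have hq : 0 <= 13 - 15 * x + 4 * x ^+ 2 by lra.
  rewrite (_ : _ * _ = 1 + x ^+ 2 * (13 - 15 * x + 4 * x ^+ 2) / 4); last by field.
  by rewrite lerDl divr_ge0//; apply: mulr_ge0.
have hq : 0 < (1 - x / 2) ^+ 2 by rewrite exprn_gt0.
move=> h3; suff : expR x <= 1 + x + 4 * x ^+ 2 by lra.
by rewrite -(ler_pM2r hq); lra.
Qed.

Lemma expR_taylor1 x : `|x| <= 1 -> `|expR x - 1| <= 5 * `|x|.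
Proof.
move=> hx; have /andP[h1 h2] := expR_taylor2 hx.
have hx2 : x ^+ 2 <= `|x|.
  by rewrite -real_normK ?num_real// expr2 ler_piMr.
have : `|expR x - 1| <= `|x| + `|expR x - 1 - x|.
  have e : expR x - 1 = x + (expR x - 1 - x) by ring.
  by rewrite [X in `|X| <= _]e; exact: ler_normD.
by rewrite (ger0_norm h1); lra.
Qed.

Lemma expR_bounds x : `|x| <= 1 -> 1 / 4 <= expR x <= 4.
Proof.
have ub (y : R) : `|y| <= 1 -> expR y <= 4.
  rewrite ler_norml => /andP[y1 y2].
  have h : expR (- (y / 2)) >= 1 - y / 2 by have := expR_ge1Dx (- (y / 2)); lra.
  have e2 : expR y * expR (- (y / 2)) ^+ 2 = 1.
    by rewrite expr2 -!expRD (_ : _ + _ = 0) ?expR0//; field.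
  have hp := expR_gt0 y.
  have h4 : 1 / 4 <= expR (- (y / 2)) ^+ 2 by rewrite expr2; nra.
  nra.
move=> hx; rewrite ub// andbT.
have := ub (- x); rewrite normrN => /(_ hx); rewrite expRN => h.
by rewrite div1r -[leRHS]invrK lef_pV2 ?posrE// invr_gt0 expR_gt0.
Qed.

Lemma sqr_le_norm x a : `|x| <= a -> x ^+ 2 <= a ^+ 2.
Proof.
by move=> h; rewrite -[x ^+ 2]real_normK ?num_real// lerXn2r// nnegrE// (le_trans _ h).
Qed.

(** Here x is the increment of one coordinate, 1 + e the factor by which the normalizer grows, and
    l, a, m are the averages of the increments, of their absolute values and of their squares. The
    quotient is a weight after the increment over the weight before, so the error is relative;
    bounds in terms of the window mass depend on this. *)
Lemma rel_taylor1 x e l a m : `|x| <= 1 -> 1 / 4 <= 1 + e -> `|e| <= 5 * a ->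
  `|l| <= a -> `|e - l| <= 4 * m -> a ^+ 2 <= m ->
  `|expR x / (1 + e) - 1 - x + l| <= 3000 * (x ^+ 2 + m).
Proof.
move=> x1 D4 ea la elm am; have /andP[s0 s1] := expR_taylor2 x1.
have e2 := sqr_le_norm ea; have l2 := sqr_le_norm la; rewrite exprMn in e2.
have D0 : 0 < 1 + e by lra.
have -> : expR x / (1 + e) - 1 - x + l = (expR x - (1 + x - l) * (1 + e)) / (1 + e).
  by field; rewrite gt_eqF.
have x20 := sqr_ge0 x.
have m0 : 0 <= m by apply: le_trans am; exact: sqr_ge0.
have : `|expR x - (1 + x - l) * (1 + e)| <= 750 * (x ^+ 2 + m).
  have p1 := sqr_ge0 (x - e); have p2 := sqr_ge0 (x + e).
  have p3 := sqr_ge0 (l - e); have p4 := sqr_ge0 (l + e).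
  move: elm; rewrite !ler_norml => /andP[? ?]; apply/andP; split; lra.
move=> h; rewrite normrM normfV [`|1 + e|]gtr0_norm//.
by rewrite ler_pdivrMr//; nra.
Qed.

(** The normalizer is squared because [sm0] and [smp] share it: this is the relative expansion of
    their product. *)
Lemma rel_taylor2 x e l a m : `|x| <= 1 -> 1 / 4 <= 1 + e -> `|e| <= 5 * a ->
  `|l| <= a -> a <= 1 -> `|e - l| <= 4 * m -> a ^+ 2 <= m ->
  `|expR x / (1 + e) ^+ 2 - 1 - x + 2 * l| <= 3000 * (x ^+ 2 + m).
Proof.
move=> x1 D4 ea la a1 elm am; have /andP[s0 s1] := expR_taylor2 x1.
have e2 := sqr_le_norm ea; have l2 := sqr_le_norm la; rewrite exprMn in e2.
have D0 : 0 < (1 + e) ^+ 2 by rewrite exprn_gt0//; lra.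
have -> : expR x / (1 + e) ^+ 2 - 1 - x + 2 * l =
    (expR x - (1 + x - 2 * l) * (1 + e) ^+ 2) / (1 + e) ^+ 2.
  by field; rewrite gt_eqF//; lra.
have x20 := sqr_ge0 x.
have m0 : 0 <= m by apply: le_trans am; exact: sqr_ge0.
have : `|expR x - (1 + x - 2 * l) * (1 + e) ^+ 2| <= 185 * (x ^+ 2 + m).
  have p1 := sqr_ge0 (x - e); have p2 := sqr_ge0 (x + e).
  have p3 := sqr_ge0 (l - e); have p4 := sqr_ge0 (l + e).
  have [q1 q2] : -4 <= 1 + x - 2 * l /\ 1 + x - 2 * l <= 4.
    by move: x1 la; rewrite !ler_norml => /andP[? ?] /andP[? ?]; split; lra.
  have e20 := sqr_ge0 e.
  have p5 : e ^+ 2 * (1 + x - 2 * l) <= e ^+ 2 * 4 by rewrite ler_wpM2l.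
  have p6 : e ^+ 2 * -4 <= e ^+ 2 * (1 + x - 2 * l) by rewrite ler_wpM2l.
  move: elm; rewrite !ler_norml => /andP[? ?]; apply/andP; split; lra.
move=> h; rewrite normrM normfV [`|(1 + e) ^+ 2|]gtr0_norm//.
have D16 : 1 / 16 <= (1 + e) ^+ 2 by nra.
by rewrite ler_pdivrMr//; nra.
Qed.

(* First-order bounds on the relative variation of sm0 * smp and of
   sm0 * smp * smp. *)
Lemma rel_taylor0 x e a : `|x| <= 1 -> 1 / 4 <= 1 + e -> `|e| <= 5 * a -> a <= 1 ->
  `|expR x / (1 + e) ^+ 2 - 1| <= 3000 * (`|x| + a).
Proof.
move=> x1 D4 ea a1; have h1 := expR_taylor1 x1.
have a0 : 0 <= a by have := normr_ge0 e; lra.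
have D0 : 0 < (1 + e) ^+ 2 by rewrite exprn_gt0//; lra.
have -> : expR x / (1 + e) ^+ 2 - 1 = (expR x - (1 + e) ^+ 2) / (1 + e) ^+ 2.
  by field; rewrite gt_eqF//; lra.
have D16 : 1 / 16 <= (1 + e) ^+ 2 by nra.
have x0 := normr_ge0 x.
have : `|expR x - (1 + e) ^+ 2| <= 180 * (`|x| + a).
  have e1 : -35 * a <= 2 * e + e ^+ 2 <= 35 * a.
    by move: ea; rewrite ler_norml => /andP[? ?]; apply/andP; split; nra.
  move: h1 e1; rewrite !ler_norml => /andP[? ?] /andP[? ?]; apply/andP; split; lra.
move=> h; rewrite normrM normfV [`|(1 + e) ^+ 2|]gtr0_norm//.
by rewrite ler_pdivrMr//; nra.
Qed.

Lemma rel_taylor00 x y e a : `|x| <= 1 -> `|y| <= 1 ->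
  1 / 4 <= 1 + e -> `|e| <= 5 * a -> a <= 1 ->
  `|expR x * expR y / (1 + e) ^+ 3 - 1| <= 20000 * (`|x| + `|y| + a).
Proof.
move=> x1 y1 D4 ea a1; have h1 := expR_taylor1 x1; have h2 := expR_taylor1 y1.
have /andP[_ bx] := expR_bounds x1; have ey := expR_gt0 y.
have a0 : 0 <= a by have := normr_ge0 e; lra.
have D0 : 0 < (1 + e) ^+ 3 by rewrite exprn_gt0//; lra.
have -> : expR x * expR y / (1 + e) ^+ 3 - 1 = (expR x * expR y - (1 + e) ^+ 3) / (1 + e) ^+ 3.
  by field; rewrite gt_eqF//; lra.
have D64 : 1 / 64 <= (1 + e) ^+ 3.
  have : 1 / 16 <= (1 + e) ^+ 2 by nra.
  rewrite [_ ^+ 3]exprS; nra.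
have x0 := normr_ge0 x; have y0 := normr_ge0 y.
have : `|expR x * expR y - (1 + e) ^+ 3| <= 310 * (`|x| + `|y| + a).
  have e1 : -230 * a <= e * (3 + 3 * e + e ^+ 2) <= 230 * a.
    have : 0 <= 3 + 3 * e + e ^+ 2 <= 46.
      by move: ea; rewrite ler_norml => /andP[? ?]; apply/andP; split; nra.
    move: ea; rewrite ler_norml => /andP[? ?] /andP[? ?].
    by apply/andP; split; nra.
  have ee : -(5 * `|x| + 20 * `|y|) <= expR x * expR y - 1 <= 5 * `|x| + 20 * `|y|.
    rewrite -ler_norml (_ : _ - 1 = (expR x - 1) + expR x * (expR y - 1)); last by ring.
    apply: le_trans (ler_normD _ _) _; rewrite normrM gtr0_norm ?expR_gt0//.
    have := ler_pM (expR_ge0 x) (normr_ge0 (expR y - 1)) bx h2; lra.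
  move: e1 ee; rewrite !ler_norml => /andP[? ?] /andP[? ?]; apply/andP; split; lra.
move=> h; rewrite normrM normfV [`|(1 + e) ^+ 3|]gtr0_norm//.
by rewrite ler_pdivrMr//; nra.
Qed.

End ScalarExp.

Lemma norm_scale (R : realType) (c r k x : R) : 0 < c -> `|r| <= k * x ->
  `|c * r| <= k * c * x.
Proof. by move=> c0 h; rewrite normrM gtr0_norm// mulrAC [leRHS]mulrC ler_pM2l. Qed.

Section Softmax.
Context {R : realType} {J : finType}.
Implicit Types v z y : J -> R.

(** The weights of a Gibbs law on the values v_j together with one extra atom of value 0. [sm0] is
    the weight of the extra atom, a smooth indicator that all v_j are negative, and [smp] are the
    remaining weights; the gradient of [sm0] is minus the product of the two. *)
Definition smZ v : R := \sum_j expR (v j).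
Definition sm0 v : R := (1 + smZ v)^-1.
Definition smp v j : R := expR (v j) * sm0 v.

Lemma smZ_ge0 v : 0 <= smZ v.
Proof. by apply: sumr_ge0 => j _; exact: expR_ge0. Qed.

Lemma smZ1_gt0 v : 0 < 1 + smZ v.
Proof. by have := smZ_ge0 v; lra. Qed.

Lemma sm0_gt0 v : 0 < sm0 v.
Proof. by rewrite invr_gt0 smZ1_gt0. Qed.

Lemma sm0_le1 v : sm0 v <= 1.
Proof. by rewrite invf_le1 ?smZ1_gt0// lerDl smZ_ge0. Qed.

Lemma smp_gt0 v j : 0 < smp v j.
Proof. by rewrite mulr_gt0 ?expR_gt0 ?sm0_gt0. Qed.

Lemma smp_ge0 v j : 0 <= smp v j.
Proof. exact/ltW/smp_gt0. Qed.

Lemma smp_sum v : \sum_j smp v j = 1 - sm0 v.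
Proof.
rewrite /smp -mulr_suml -/(smZ v) /sm0; have := smZ1_gt0 v => h.
by field; rewrite gt_eqF.
Qed.

Lemma smp_sum_le1 v : \sum_j smp v j <= 1.
Proof. by rewrite smp_sum; have := sm0_gt0 v; lra. Qed.

Lemma smp_le1 v j : smp v j <= 1.
Proof.
apply: le_trans (smp_sum_le1 v); rewrite (bigD1 j)//= lerDl.
by apply: sumr_ge0 => k _; exact: smp_ge0.
Qed.

(** An average against a subprobability: the extra atom contributes 0, so a constant c has average
    (1 - sm0) c. *)
Definition smE v (f : J -> R) : R := \sum_j smp v j * f j.

Lemma smE_ge0 v f : (forall j, 0 <= f j) -> 0 <= smE v f.
Proof. by move=> h; apply: sumr_ge0 => j _; rewrite mulr_ge0 ?smp_ge0. Qed.

Lemma smE_le v f g : (forall j, f j <= g j) -> smE v f <= smE v g.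
Proof. by move=> h; apply: ler_sum => j _; rewrite ler_wpM2l ?smp_ge0. Qed.

Lemma smE_le_cst v f c : 0 <= c -> (forall j, f j <= c) -> smE v f <= c.
Proof.
move=> c0 h; apply: (le_trans (smE_le (g := fun=> c) v h)).
by rewrite /smE -mulr_suml ler_piMl// smp_sum_le1.
Qed.

Lemma smED v f g : smE v (fun j => f j + g j) = smE v f + smE v g.
Proof. by rewrite /smE -big_split/=; apply: eq_bigr => j _; rewrite mulrDr. Qed.

Lemma smEZ v c f : smE v (fun j => c * f j) = c * smE v f.
Proof. by rewrite /smE mulr_sumr; apply: eq_bigr => j _; rewrite mulrCA. Qed.

Lemma smE_norm v f : `|smE v f| <= smE v (fun j => `|f j|).
Proof.
apply: le_trans (ler_norm_sum _ _ _) _; apply: ler_sum => j _.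
by rewrite normrM ger0_norm ?smp_ge0.
Qed.

Lemma smE_cst v c : smE v (fun=> c) = (1 - sm0 v) * c.
Proof. by rewrite /smE -mulr_suml smp_sum. Qed.

Lemma smE_cauchy v f : smE v f ^+ 2 <= smE v (fun j => f j ^+ 2).
Proof.
set a := smE v f; have h0 : 0 <= smE v (fun j => (f j - a) ^+ 2).
  by apply: smE_ge0 => j; exact: sqr_ge0.
have e : smE v (fun j => (f j - a) ^+ 2) =
    smE v (fun j => f j ^+ 2) + (-2 * a * a + (1 - sm0 v) * a ^+ 2).
  rewrite -(smE_cst v (a ^+ 2)) -[in -2 * a * a](smEZ v (-2 * a) f) -!smED.
  by congr smE; apply/funext => j; ring.
have := sqr_ge0 a; have := sm0_gt0 v; rewrite e in h0; nra.
Qed.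

(** The factor by which the normalizer [1 + smZ v] grows under the increment z, written as one plus
    an average so that scalar expansions apply term by term. *)
Definition smD v z : R := 1 + smE v (fun j => expR (z j) - 1).

Lemma smDE v z : smD v z = sm0 v + smE v (fun j => expR (z j)).
Proof.
rewrite /smD /smE; under eq_bigr do rewrite mulrBr mulr1.
rewrite big_split/= sumrN smp_sum; ring.
Qed.

Lemma smD_gt0 v z : 0 < smD v z.
Proof.
by rewrite smDE ltr_wpDr ?sm0_gt0// smE_ge0// => j; exact: expR_ge0.
Qed.

Local Notation "v |+| z" := (fun j => v j + z j) (at level 50).

Lemma sm0_add v z : sm0 (v |+| z) = sm0 v / smD v z.
Proof.
have e : smD v z = sm0 v * (1 + smZ (v |+| z)).
  rewrite smDE mulrDr mulr1 /smZ mulr_sumr; congr (_ + _); apply: eq_bigr => j _.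
  by rewrite /smp expRD; ring.
have nz : sm0 v != 0 by rewrite gt_eqF ?sm0_gt0.
by rewrite e invfM mulrA mulfV ?mul1r.
Qed.

Lemma smp_add v z j : smp (v |+| z) j = smp v j * expR (z j) / smD v z.
Proof. by rewrite /smp sm0_add expRD; ring. Qed.

Section SmallIncrement.
Variables v z : J -> R.
Hypothesis z1 : forall j, `|z j| <= 1.
Let e := smE v (fun j => expR (z j) - 1).
Let a := smE v (fun j => `|z j|).
Let m := smE v (fun j => z j ^+ 2).
Let l := smE v z.

Lemma smD_small : [/\ 1 / 4 <= 1 + e, `|e| <= 5 * a & 1 + e <= 4].
Proof.
split.
- have -> : 1 + e = smD v z by [].
  rewrite smDE; have -> : 1 / 4 = sm0 v * (1 / 4) + smE v (fun=> 1 / 4).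
    by rewrite /smE -mulr_suml smp_sum; field.
  apply: lerD; first by have := sm0_gt0 v; lra.
  by apply: smE_le => j; have /andP[] := expR_bounds (z1 j).
- apply: le_trans (smE_norm _ _) _; rewrite -smEZ; apply: smE_le => j.
  exact: expR_taylor1.
- have -> : 1 + e = smD v z by [].
  rewrite smDE; have -> : 4 = sm0 v * 4 + smE v (fun=> 4).
    by rewrite /smE -mulr_suml smp_sum; field.
  apply: lerD; first by have := sm0_gt0 v; lra.
  by apply: smE_le => j; have /andP[] := expR_bounds (z1 j).
Qed.

Lemma smE_small : [/\ `|l| <= a, a <= 1, `|e - l| <= 4 * m & a ^+ 2 <= m].
Proof.
split.
- exact: smE_norm.
- exact: smE_le_cst.
- rewrite -smEZ (_ : e - l = smE v (fun j => expR (z j) - 1 - z j)).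
    apply: le_trans (smE_norm _ _) _; apply: smE_le => j.
    by have /andP[h ?] := expR_taylor2 (z1 j); rewrite ger0_norm.
  by rewrite /e /l /smE -sumrB; apply: eq_bigr => j _; ring.
- apply: le_trans (smE_cauchy _ _) _; apply: smE_le => j.
  by rewrite real_normK ?num_real.
Qed.

(** [sm0] is the weight of the atom whose value never moves, so this is the relative expansion at x
    = 0. *)
Lemma sm0_small : `|sm0 (v |+| z) - sm0 v + sm0 v * l| <= 3000 * sm0 v * m.
Proof.
have [h1 h2 _] := smD_small; have [h3 h4 h5 h6] := smE_small.
have h : `|0 : R| <= 1 by rewrite normr0.
have := rel_taylor1 h h1 h2 h3 h5 h6; rewrite expR0 expr0n add0r => hh.
rewrite sm0_add -/e (_ : _ + _ = sm0 v * (1 / (1 + e) - 1 - 0 + l)); last first.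
  by rewrite /smD -/e; ring.
exact: norm_scale (sm0_gt0 v) hh.
Qed.

Lemma smp_small j : `|smp (v |+| z) j - smp v j - smp v j * (z j - l)| <=
  3000 * smp v j * (z j ^+ 2 + m).
Proof.
have [h1 h2 _] := smD_small; have [h3 h4 h5 h6] := smE_small.
have hh := rel_taylor1 (z1 j) h1 h2 h3 h5 h6.
rewrite smp_add (_ : _ - _ = smp v j * (expR (z j) / (1 + e) - 1 - z j + l)); last first.
  by rewrite /smD -/e; ring.
exact: norm_scale (smp_gt0 v j) hh.
Qed.

Lemma smPhi_small j :
  `|sm0 (v |+| z) * smp (v |+| z) j - sm0 v * smp v j
     - sm0 v * smp v j * (z j - 2 * l)| <=
  3000 * (sm0 v * smp v j) * (z j ^+ 2 + m).
Proof.
have [h1 h2 _] := smD_small; have [h3 h4 h5 h6] := smE_small.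
have hh := rel_taylor2 (z1 j) h1 h2 h3 h4 h5 h6.
have D0 : 1 + e != 0 by rewrite gt_eqF//; lra.
rewrite sm0_add smp_add (_ : _ - _ = (sm0 v * smp v j) *
    (expR (z j) / (1 + e) ^+ 2 - 1 - z j + 2 * l)); last first.
  by rewrite /smD -/e; field.
have pp : 0 < sm0 v * smp v j by rewrite mulr_gt0 ?smp_gt0 ?sm0_gt0.
exact: norm_scale.
Qed.

Lemma smPhi_small0 j :
  `|sm0 (v |+| z) * smp (v |+| z) j - sm0 v * smp v j| <=
  3000 * (sm0 v * smp v j) * (`|z j| + a).
Proof.
have [h1 h2 _] := smD_small; have [h3 h4 h5 h6] := smE_small.
have hh := rel_taylor0 (z1 j) h1 h2 h4.
have D0 : 1 + e != 0 by rewrite gt_eqF//; lra.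
rewrite sm0_add smp_add (_ : _ - _ = (sm0 v * smp v j) *
    (expR (z j) / (1 + e) ^+ 2 - 1)); last first.
  by rewrite /smD -/e; field.
have pp : 0 < sm0 v * smp v j by rewrite mulr_gt0 ?smp_gt0 ?sm0_gt0.
exact: norm_scale.
Qed.

Lemma smPhi_small00 j k :
  `|sm0 (v |+| z) * smp (v |+| z) j * smp (v |+| z) k - sm0 v * smp v j * smp v k| <=
  20000 * (sm0 v * smp v j * smp v k) * (`|z j| + `|z k| + a).
Proof.
have [h1 h2 _] := smD_small; have [h3 h4 h5 h6] := smE_small.
have hh := rel_taylor00 (z1 j) (z1 k) h1 h2 h4.
have D0 : 1 + e != 0 by rewrite gt_eqF//; lra.
rewrite sm0_add !smp_add (_ : _ - _ = (sm0 v * smp v j * smp v k) *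
    (expR (z j) * expR (z k) / (1 + e) ^+ 3 - 1)); last first.
  by rewrite /smD -/e; field.
have pp : 0 < sm0 v * smp v j * smp v k.
  by apply: mulr_gt0; [apply: mulr_gt0; [exact: sm0_gt0 | exact: smp_gt0] | exact: smp_gt0].
exact: norm_scale.
Qed.

End SmallIncrement.

(* The logistic density w(1 - w) at w = sm0 v, localized where the soft
   maximum of v is of order one. *)
Definition smw v : R := sm0 v * (1 - sm0 v).

Lemma smw_bounds v : 0 <= smw v <= 1.
Proof. move: (sm0_gt0 v) (sm0_le1 v); rewrite /smw => ? ?; apply/andP; split; nra. Qed.

(** [smw] is the sum of the products of [sm0] and [smp]. Each is multiplied by exp(z_j) / D^2, which
    is at least (1/4) / 4^2 = 1/64. *)
Lemma smw_stable v z : (forall j, `|z j| <= 1) -> smw v <= 64 * smw (v |+| z).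
Proof.
move=> z1; have [h1 _ h2] := smD_small v z1.
rewrite /smw -!smp_sum !mulr_sumr; apply: ler_sum => j _.
rewrite sm0_add smp_add /smD.
set D := 1 + _ in h1 h2 *.
have /andP[e1 _] := expR_bounds (z1 j).
have D0 : 0 < D by lra.
rewrite (_ : 64 * _ = (sm0 v * smp v j) * (64 * expR (z j) / D ^+ 2)); last first.
  by field; rewrite gt_eqF.
rewrite ler_peMr//; first by rewrite mulr_ge0// ltW ?sm0_gt0 ?smp_gt0.
by rewrite ler_pdivlMr ?exprn_gt0// mul1r; nra.
Qed.

(** Lowering all coordinates by 1 multiplies u = [smZ v] by q = exp(-1), so [sm0] increases by u (1
    - q) / ((1 + u q) (1 + u)). With q between 1/4 and 1/2 this is comparable to u / (1 + u)^2, the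
    logistic density. *)
Lemma smw_shift v :
  smw v <= 2 * (sm0 (fun j => v j - 1) - sm0 v) <= 6 * smw v.
Proof.
have Z0 := smZ_ge0 v; set u := smZ v in Z0.
have e0 : 0 < expR (-1 : R) by exact: expR_gt0.
have -> : sm0 (fun j => v j - 1) = (1 + u * expR (-1))^-1.
  by rewrite /sm0 /u /smZ mulr_suml; under eq_bigr do rewrite expRD.
rewrite /smw /sm0 -/u; set q := expR (-1) in e0 *.
have q1 : q <= 1 / 2.
  rewrite /q expRN div1r lef_pV2 ?posrE ?expR_gt0//.
  by have := expR_ge1Dx (1 : R); lra.
have q4 : 1 / 4 <= q.
  have n1 : `|-1 : R| <= 1 by rewrite normrN1.
  by have /andP[] := expR_bounds n1.
have d1 : 0 < 1 + u by lra.
have d2 : 0 < 1 + u * q by nra.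
have -> : (1 + u)^-1 * (1 - (1 + u)^-1) = u / (1 + u) ^+ 2.
  by field; rewrite gt_eqF.
have -> : (1 + u * q)^-1 - (1 + u)^-1 = u * (1 - q) / ((1 + u * q) * (1 + u)).
  by field; rewrite !gt_eqF.
have d3 : 0 < (1 + u * q) * (1 + u) by rewrite mulr_gt0.
apply/andP; split.
  rewrite ler_pdivrMr ?exprn_gt0// mulrAC mulrA ler_pdivlMr//.
  have : 0 <= u * (1 + u) * (2 * (1 - q) * (1 + u) - (1 + u * q)) by rewrite !mulr_ge0//; nra.
  nra.
rewrite mulrA ler_pdivrMr// (_ : 6 * _ * _ =
  6 * u * ((1 + u * q) * (1 + u)) / (1 + u) ^+ 2); last by ring.
rewrite ler_pdivlMr ?exprn_gt0//.
have : 0 <= u * (1 + u) * (6 * (1 + u * q) - 2 * (1 - q) * (1 + u)) by rewrite !mulr_ge0//; nra.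
nra.
Qed.

Lemma sm0_mono v y : (forall j, v j <= y j) -> sm0 y <= sm0 v.
Proof.
move=> h; rewrite /sm0 lef_pV2 ?posrE ?smZ1_gt0// lerD2l.
by apply: ler_sum => j _; rewrite ler_expR.
Qed.

End Softmax.

(** * Expansions of the soft maximum and its gradient for increments of any size *)

Section SoftmaxTaylor.
Context {R : realType} {J : finType}.
Implicit Types v z y : J -> R.
Local Notation "v |+| z" := (fun j => v j + z j) (at level 50).

Lemma smE_abs_le v z M : 0 <= M -> (forall j, `|z j| <= M) ->
  [/\ `|smE v z| <= M, smE v (fun j => `|z j|) <= M & smE v (fun j => z j ^+ 2) <= M ^+ 2].
Proof.
move=> M0 h; split.
- by apply: le_trans (smE_norm _ _) _; exact: smE_le_cst.
- exact: smE_le_cst.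
- by apply: smE_le_cst; [exact: sqr_ge0|move=> j; exact: sqr_le_norm].
Qed.

(** For M <= 1 the relative expansion applies; for M > 1 every term is at most 1 or M, hence below
    M^2. The same dichotomy proves the two analogues for [smp] and [smPhi]. *)
Lemma sm0_taylor v z M : (forall j, `|z j| <= M) -> 0 <= M ->
  `|sm0 (v |+| z) - sm0 v + sm0 v * smE v z| <= 3000 * M ^+ 2.
Proof.
move=> h M0; have [h1 h2 h3] := smE_abs_le v M0 h.
have [M1|M1] := leP M 1.
  have z1 j : `|z j| <= 1 by exact: le_trans (h j) M1.
  apply: le_trans (sm0_small v z1) _.
  have m0 : 0 <= smE v (fun j => z j ^+ 2) by apply: smE_ge0 => j; exact: sqr_ge0.
  have := sm0_gt0 v; have := sm0_le1 v; nra.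
have [a0 a1] := (sm0_gt0 v, sm0_le1 v).
have [b0 b1] := (sm0_gt0 (v |+| z), sm0_le1 (v |+| z)).
have : `|sm0 v * smE v z| <= M.
  by rewrite normrM gtr0_norm//; apply: le_trans h1; rewrite ler_piMl.
rewrite !ler_norml => /andP[? ?]; apply/andP; split; nra.
Qed.

(** Minus the partial derivative of [sm0] in coordinate j. *)
Definition smPhi v j := sm0 v * smp v j.

Lemma smPhi_ge0 v j : 0 <= smPhi v j.
Proof. by rewrite mulr_ge0 ?smp_ge0// ltW ?sm0_gt0. Qed.

Lemma smPhi_le1 v j : smPhi v j <= 1.
Proof.
by rewrite /smPhi; have := sm0_gt0 v; have := sm0_le1 v; have := smp_ge0 v j; have := smp_le1 v j; nra.
Qed.

Lemma smp_taylor v z M j : (forall j, `|z j| <= M) -> 0 <= M ->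
  `|smp (v |+| z) j - smp v j - smp v j * (z j - smE v z)| <= 6000 * M ^+ 2.
Proof.
move=> h M0; have [h1 h2 h3] := smE_abs_le v M0 h.
have zj := sqr_le_norm (h j).
have [M1|M1] := leP M 1.
  have z1 k : `|z k| <= 1 by exact: le_trans (h k) M1.
  apply: le_trans (smp_small v z1 j) _.
  have m0 : 0 <= smE v (fun j => z j ^+ 2) by apply: smE_ge0 => k; exact: sqr_ge0.
  have zj0 := sqr_ge0 (z j).
  have := smp_gt0 v j; have := smp_le1 v j; nra.
have [a0 a1] := (smp_ge0 v j, smp_le1 v j).
have [b0 b1] := (smp_ge0 (v |+| z) j, smp_le1 (v |+| z) j).
have : `|smp v j * (z j - smE v z)| <= 2 * M.
  rewrite normrM ger0_norm//; have := ler_normB (z j) (smE v z).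
  have := normr_ge0 (z j - smE v z); have := h j; nra.
rewrite !ler_norml => /andP[? ?]; apply/andP; split; nra.
Qed.

Lemma smPhi_taylor v z M j : (forall j, `|z j| <= M) -> 0 <= M ->
  `|smPhi (v |+| z) j - smPhi v j - smPhi v j * (z j - 2 * smE v z)| <= 6000 * M ^+ 2.
Proof.
move=> h M0; have [h1 h2 h3] := smE_abs_le v M0 h.
have zj := sqr_le_norm (h j).
have [a0 a1] := (smPhi_ge0 v j, smPhi_le1 v j).
have [M1|M1] := leP M 1.
  have z1 k : `|z k| <= 1 by exact: le_trans (h k) M1.
  apply: le_trans (smPhi_small v z1 j) _; rewrite -/(smPhi v j).
  have m0 : 0 <= smE v (fun j => z j ^+ 2) by apply: smE_ge0 => k; exact: sqr_ge0.
  have zj0 := sqr_ge0 (z j); nra.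
have [b0 b1] := (smPhi_ge0 (v |+| z) j, smPhi_le1 (v |+| z) j).
have : `|smPhi v j * (z j - 2 * smE v z)| <= 3 * M.
  rewrite normrM ger0_norm//; have := ler_normB (z j) (2 * smE v z).
  rewrite normrM ger0_norm//.
  have := normr_ge0 (z j - 2 * smE v z); have := h j; nra.
rewrite !ler_norml => /andP[? ?]; apply/andP; split; nra.
Qed.

(** The Jacobian of [smPhi], that is, minus the Hessian of [sm0]; [smH] contracts it with a
    matrix. *)
Definition smdPhi v j k : R :=
  sm0 v * ((j == k)%:R * smp v j - 2 * (smp v j * smp v k)).

Definition smH v (A : J -> J -> R) : R := \sum_j \sum_k A j k * smdPhi v j k.

Lemma smHE v A : smH v A =
  \sum_j A j j * smPhi v j - 2 * \sum_j \sum_k A j k * (sm0 v * smp v j * smp v k).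
Proof.
rewrite /smH mulr_sumr -sumrB; apply: eq_bigr => j _.
have -> : A j j * smPhi v j = \sum_k (j == k)%:R * (A j k * smPhi v j).
  rewrite (bigD1 j)//= eqxx mul1r big1 ?addr0// => k /negbTE kj.
  by rewrite eq_sym kj mul0r.
rewrite mulr_sumr -sumrB; apply: eq_bigr => k _.
by rewrite /smdPhi /smPhi; ring.
Qed.

Lemma sum_smp2 v (f : J -> J -> R) :
  \sum_j \sum_k f j k * (sm0 v * smp v j * smp v k) =
  sm0 v * smE v (fun j => smE v (f j)).
Proof.
rewrite /smE mulr_sumr; apply: eq_bigr => j _.
rewrite !mulr_sumr; apply: eq_bigr => k _; ring.
Qed.

(** The diagonal part has total weight [smw v], and the weights of the double sum add up to at most
    [smw v]; the factors 1 and 2 in front of them give 3. *)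
Lemma smH_bound v A D : (forall j k, `|A j k| <= D) -> `|smH v A| <= 3 * D * smw v.
Proof.
move=> h; have w : smw v = sm0 v * \sum_j smp v j by rewrite smp_sum.
have p0 := sm0_gt0 v.
have S0 : 0 <= \sum_j smp v j by apply: sumr_ge0 => j _; exact: smp_ge0.
have S1 := smp_sum_le1 v; set S := \sum_j _ in w S0 S1.
(* An entry of A is what gives 0 <= D; for an empty index type both sides are 0. *)
case: (pickP (predT : pred J)) => [j0 _|noJ]; last first.
  by rewrite /smH w /S !big1 ?normr0 ?mulr0// => j; have := noJ j.
have D0 : 0 <= D := le_trans (normr_ge0 _) (h j0 j0).
rewrite smHE; apply: le_trans (ler_normB _ _) _.
have h1 : `|\sum_j A j j * smPhi v j| <= D * smw v.
  rewrite w 2!mulr_sumr; apply: le_trans (ler_norm_sum _ _ _) _; apply: ler_sum => j _.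
  by rewrite normrM (ger0_norm (smPhi_ge0 _ _)) ler_wpM2r ?smPhi_ge0.
have h2 : `|\sum_j \sum_k A j k * (sm0 v * smp v j * smp v k)| <= D * smw v.
  rewrite sum_smp2 normrM gtr0_norm// w mulrCA ler_pM2l//.
  apply: le_trans (smE_norm _ _) _.
  rewrite [D * S]mulrC mulr_suml; apply: ler_sum => j _.
  rewrite ler_wpM2l ?smp_ge0//; apply: le_trans (smE_norm _ _) _.
  exact: smE_le_cst.
by rewrite normrM (ger0_norm (ler0n _ 2)); lra.
Qed.

(** Pointwise a b^2 <= a^3 + b^3, integrated over two copies of the weights. It turns the product of
    averages produced by the normalizer into a single third moment. *)
Lemma smE_young v y : (forall j, 0 <= y j) ->
  smE v y * smE v (fun j => y j ^+ 2) <= 2 * smE v (fun j => y j ^+ 3).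
Proof.
move=> y0; set c := smE v (fun j => y j ^+ 3).
have c0 : 0 <= c by apply: smE_ge0 => j; rewrite exprn_ge0.
have -> : smE v y * smE v (fun j => y j ^+ 2) = smE v (fun j => smE v (fun k => y j * y k ^+ 2)).
  by rewrite mulrC -smEZ; congr smE; apply/funext => j; rewrite smEZ mulrC.
apply: (@le_trans _ _ (smE v (fun j => y j ^+ 3 + c))).
  apply: smE_le => j; apply: (@le_trans _ _ (smE v (fun k => y j ^+ 3 + y k ^+ 3))).
    apply: smE_le => k.
    have [h|h] := leP (y j) (y k).
      by rewrite -[leLHS]add0r lerD ?exprn_ge0// [y k ^+ 3]exprS ler_wpM2r ?sqr_ge0.
    by rewrite -[leLHS]addr0 lerD ?exprn_ge0// [y j ^+ 3]exprS ler_wpM2l// lerXn2r ?nnegrE// ltW.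
  rewrite smED lerD2r smE_cst ler_piMl ?exprn_ge0//.
  by have := sm0_gt0 v; lra.
by rewrite smED -/c smE_cst; have := sm0_gt0 v; nra.
Qed.

(** When |t| B <= 1 the relative expansion leaves an error carried by [sm0] and the Gibbs average of
    |y|^3, later a third moment times the window mass. When |t| B > 1 the three terms on the left
    are bounded trivially, at the price of a factor (|t| B)^3 >= 1. The exact increment is kept
    throughout, so no truncation error arises. *)
Lemma smPhi_sum_taylor v y t B : (forall j, `|y j| <= B) -> 0 <= B ->
  `|\sum_j y j * smPhi (fun j => v j + t * y j) j - \sum_j y j * smPhi v j
     - t * smH v (fun j k => y j * y k)| <=
  9000 * t ^+ 2 * (sm0 v * smE v (fun j => `|y j| ^+ 3)) + 5 * `|t| ^+ 3 * B ^+ 4.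
Proof.
move=> h B0; have t0 := normr_ge0 t.
set c := smE v (fun j => `|y j| ^+ 3).
have c0 : 0 <= c by apply: smE_ge0 => j; rewrite exprn_ge0.
have p0 := sm0_gt0 v.
have [h1 h2 h3] := smE_abs_le v B0 h.
have eH : smH v (fun j k => y j * y k) =
    \sum_j y j * (smPhi v j * (y j - 2 * smE v y)).
  rewrite smHE sum_smp2 (_ : smE v _ = smE v y * smE v y); last first.
    by rewrite -smEZ; congr smE; apply/funext => j; rewrite smEZ mulrC.
  rewrite (_ : 2 * _ = \sum_j smPhi v j * y j * (2 * smE v y)).
    by rewrite -sumrB; apply: eq_bigr => j _; ring.
  rewrite -mulr_suml (_ : \sum_j smPhi v j * y j = sm0 v * smE v y); first by ring.
  by rewrite /smE mulr_sumr; apply: eq_bigr => j _; rewrite /smPhi; ring.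
have eL : \sum_j y j * smPhi (fun j => v j + t * y j) j - \sum_j y j * smPhi v j
     - t * smH v (fun j k => y j * y k) =
  \sum_j y j * (smPhi (fun j => v j + t * y j) j - smPhi v j
     - smPhi v j * (t * y j - 2 * smE v (fun j => t * y j))).
  by rewrite eH mulr_sumr -!sumrB; apply: eq_bigr => j _; rewrite smEZ; ring.
have [tB|tB] := leP (`|t| * B) 1.
  have z1 j : `|t * y j| <= 1.
    by rewrite normrM (le_trans _ tB)// ler_wpM2l.
  rewrite eL -[leLHS]addr0 lerD ?mulr_ge0 ?exprn_ge0//.
  apply: le_trans (ler_norm_sum _ _ _) _.
  have hj j : `|y j * (smPhi (fun j => v j + t * y j) j - smPhi v j
     - smPhi v j * (t * y j - 2 * smE v (fun j => t * y j)))| <=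
     3000 * t ^+ 2 * sm0 v * (smp v j * (`|y j| ^+ 3 + `|y j| * smE v (fun j => y j ^+ 2))).
    rewrite normrM; have := smPhi_small v z1 j.
    rewrite (_ : (fun j => (t * y j) ^+ 2) = fun j => t ^+ 2 * y j ^+ 2); last first.
      by apply/funext => k; rewrite exprMn.
    rewrite [smE v (fun j => t ^+ 2 * _)]smEZ => hh.
    apply: le_trans (ler_wpM2l (normr_ge0 (y j)) hh) _.
    by rewrite exprMn -[y j ^+ 2]real_normK ?num_real// le_eqVlt; apply/orP; left; apply/eqP; ring.
  apply: le_trans (ler_sum _ (fun j _ => hj j)) _.
  rewrite -mulr_sumr -/(smE v _) smED.
  under [X in _ + smE _ X]funext do rewrite mulrC.
  rewrite smEZ.
  have := smE_young v (fun j => normr_ge0 (y j)).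
  rewrite (_ : (fun j => `|y j| ^+ 2) = (fun j => y j ^+ 2)); last first.
    by apply/funext => j; rewrite real_normK ?num_real.
  rewrite -/c => hy.
  have tt := sqr_ge0 t.
  have q : 0 <= 3000 * t ^+ 2 * sm0 v by apply: mulr_ge0 (ltW p0); apply: mulr_ge0 tt; exact: ler0n.
  rewrite (_ : 9000 * _ * _ = 3000 * t ^+ 2 * sm0 v * (3 * c)); last by ring.
  by rewrite ler_wpM2l//; lra.
have S u : `|\sum_j y j * smPhi u j| <= B.
  rewrite (_ : \sum_j _ = sm0 u * smE u y); last first.
    by rewrite /smE mulr_sumr; apply: eq_bigr => j _; rewrite /smPhi; ring.
  have [k1 _ _] := smE_abs_le u B0 h.
  by rewrite normrM gtr0_norm ?sm0_gt0// (le_trans _ k1)// ler_piMl// sm0_le1.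
have HB : `|smH v (fun j k => y j * y k)| <= 3 * B ^+ 2.
  have hyy j k : `|y j * y k| <= B ^+ 2 by rewrite normrM expr2 ler_pM.
  apply: le_trans (smH_bound v hyy) _.
  have /andP[? ?] := smw_bounds v; have := sqr_ge0 B; nra.
apply: le_trans (ler_normB _ _) _.
apply: le_trans (lerD (ler_normB _ _) (lexx _)) _.
have S1 := S (fun j => v j + t * y j); have S2 := S v.
have : `|t * smH v (fun j k => y j * y k)| <= `|t| * (3 * B ^+ 2).
  by rewrite normrM ler_wpM2l.
have u0 : 0 <= t ^+ 2 * (sm0 v * c) by rewrite mulr_ge0 ?sqr_ge0// mulr_ge0// ltW.
set u := `|t| * B in tB.
rewrite (_ : 5 * `|t| ^+ 3 * B ^+ 4 = 5 * B * u ^+ 3); last by rewrite /u; ring.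
rewrite (_ : `|t| * (3 * B ^+ 2) = 3 * B * u); last by rewrite /u; ring.
have u2 : 1 <= u ^+ 2 by rewrite exprn_ege1// ltW.
have uu : 0 <= u by lra.
have u3 : u <= u ^+ 3 by rewrite exprS ler_peMr.
have u1 : 1 <= u ^+ 3 by rewrite exprn_ege1// ltW.
nra.
Qed.

(** The zeroth-order relative bounds give 2 * 3000 for the diagonal and 2 * 3 * 20000 for the double
    sum, together below 130 * 1000. If |t| B > 1, both values of [smH] are at most 3, and 6 is
    multiplied by (|t| B)^4. *)
Lemma smH_taylor v y t B A : (forall j, `|y j| <= B) -> 0 <= B ->
  (forall j k, `|A j k| <= 1) ->
  `|smH (fun j => v j + t * y j) A - smH v A| <=
  130 * 1000 * `|t| * (sm0 v * smE v (fun j => `|y j|)) + 6 * `|t| ^+ 4 * B ^+ 4.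
Proof.
move=> h B0 A1; have t0 := normr_ge0 t.
have p0 := sm0_gt0 v.
have a0 : 0 <= smE v (fun j => `|y j|) by exact: smE_ge0.
have [tB|tB] := leP (`|t| * B) 1; last first.
  have u1 : 1 <= `|t| ^+ 4 * B ^+ 4 by rewrite -exprMn exprn_ege1// ltW.
  have k u : `|smH u A| <= 3.
    apply: le_trans (smH_bound u A1) _; have /andP[? ?] := smw_bounds u; lra.
  apply: le_trans (ler_normB _ _) _.
  have u0 : 0 <= `|t| * (sm0 v * smE v (fun j => `|y j|)) by rewrite mulr_ge0// mulr_ge0// ltW.
  have := k v; have := k (fun j => v j + t * y j); lra.
have z1 j : `|t * y j| <= 1 by rewrite normrM (le_trans _ tB)// ler_wpM2l.
rewrite -[leLHS]addr0 lerD ?mulr_ge0 ?exprn_ge0//.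
set y' := fun j => v j + t * y j.
have -> : smH y' A - smH v A = \sum_j A j j * (smPhi y' j - smPhi v j)
   - 2 * \sum_j \sum_k A j k *
      (sm0 y' * smp y' j * smp y' k - sm0 v * smp v j * smp v k).
  rewrite !smHE [2 * (\sum_j \sum_k A j k * (_ - _))](_ : _ =
    2 * \sum_j \sum_k A j k * (sm0 y' * smp y' j * smp y' k) -
    2 * \sum_j \sum_k A j k * (sm0 v * smp v j * smp v k)); last first.
    rewrite -mulrBr -sumrB; congr (_ * _); apply: eq_bigr => j _.
    by rewrite -sumrB; apply: eq_bigr => k _; ring.
  rewrite [\sum_j A j j * (_ - _)](_ : _ =
     \sum_j A j j * smPhi y' j - \sum_j A j j * smPhi v j); last first.
    by rewrite -sumrB; apply: eq_bigr => j _; ring.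
  by ring.
set a := smE v (fun j => `|t * y j|).
have ea : a = `|t| * smE v (fun j => `|y j|).
  by rewrite -smEZ; congr smE; apply/funext => j; rewrite normrM.
have aa0 : 0 <= a by exact: smE_ge0.
have Sa c : 0 <= c -> smE v (fun=> c) <= c.
  by move=> c0; exact: smE_le_cst.
have h1 : `|\sum_j A j j * (smPhi y' j - smPhi v j)| <= 3000 * sm0 v * (2 * a).
  apply: le_trans (ler_norm_sum _ _ _) _.
  apply: (@le_trans _ _ (\sum_j 3000 * sm0 v * (smp v j * (`|t * y j| + a)))).
    apply: ler_sum => j _; rewrite normrM.
    have hh := smPhi_small0 v z1 j.
    apply: (@le_trans _ _ `|smPhi y' j - smPhi v j|); first by rewrite ler_piMl.
    by apply: le_trans hh _; rewrite -/a le_eqVlt; apply/orP; left; apply/eqP; ring.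
  rewrite -mulr_sumr; apply: ler_wpM2l; first exact: mulr_ge0 (ler0n _ _) (ltW p0).
  rewrite -/(smE v _) smED -/a.
  by have := Sa a aa0; lra.
have h2 : `|\sum_j \sum_k A j k *
      (sm0 y' * smp y' j * smp y' k - sm0 v * smp v j * smp v k)| <= 20000 * sm0 v * (3 * a).
  apply: le_trans (ler_norm_sum _ _ _) _.
  apply: (@le_trans _ _ (\sum_j \sum_k 20000 * sm0 v * (smp v j * (smp v k * (`|t * y j| + `|t * y k| + a))))).
    apply: ler_sum => j _; apply: le_trans (ler_norm_sum _ _ _) _.
    apply: ler_sum => k _; rewrite normrM.
    have hh := smPhi_small00 v z1 j k.
    apply: (@le_trans _ _ `|sm0 y' * smp y' j * smp y' k - sm0 v * smp v j * smp v k|).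
      by rewrite ler_piMl.
    by apply: le_trans hh _; rewrite -/a le_eqVlt; apply/orP; left; apply/eqP; ring.
  rewrite (_ : \sum_j _ = 20000 * sm0 v * smE v (fun j => smE v (fun k => `|t * y j| + `|t * y k| + a))); last first.
    rewrite /smE [RHS]mulr_sumr; apply: eq_bigr => j _.
    by rewrite !mulr_sumr.
  apply: ler_wpM2l; first exact: mulr_ge0 (ler0n _ _) (ltW p0).
  apply: (@le_trans _ _ (smE v (fun j => `|t * y j| + 2 * a))).
    apply: smE_le => j; rewrite !smED -/a.
    by have := Sa a aa0; have := Sa _ (normr_ge0 (t * y j)); lra.
  rewrite smED -/a; have := Sa (2 * a); lra.
apply: le_trans (ler_normB _ _) _; rewrite normrM (ger0_norm (ler0n _ 2)).
rewrite (_ : 130 * 1000 * _ * _ = 130 * 1000 * (sm0 v * a)); last by rewrite ea; ring.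
have : 0 <= sm0 v * a by rewrite mulr_ge0// ltW.
lra.
Qed.

End SoftmaxTaylor.

(** * Gaussian integration by parts *)

Section NormalShift.
Context {R : realType}.
Local Notation mu := (@lebesgue_measure R).
Local Notation N01 := (@normal_prob R 0 1).

(** The Radon-Nikodym derivative of the normal law agrees almost everywhere with [normal_pdf]. *)
Lemma ge0_integral_normal (f : R -> \bar R) : measurable_fun setT f ->
  (forall x, 0 <= f x)%E ->
  (\int[N01]_x f x = \int[mu]_x (f x * (normal_pdf 0 1 x)%:E))%E.
Proof.
move=> mf f0.
have dom := normal_prob_dominates (0 : R) 1.
rewrite -(Radon_Nikodym_SigmaFinite.change_of_variables dom)//.
apply: ae_eq_integral => //.
- apply: emeasurable_funM => //; apply: (measurable_int mu).
  exact: Radon_Nikodym_SigmaFinite.f_integrable.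
- apply: emeasurable_funM => //=; apply/measurableT_comp => //=.
  exact: measurable_normal_pdf.
- apply: ae_eqe_mul2l => /=; apply: integral_ae_eq => //=.
  + exact: Radon_Nikodym_SigmaFinite.f_integrable.
  + by apply/measurableT_comp => //; exact: measurable_normal_pdf.
  + by move=> E E01 mE; rewrite -Radon_Nikodym_SigmaFinite.f_integral.
Qed.

Lemma normal_pdf01 (x : R) : normal_pdf 0 1 x = normal_peak 1 * expR (- (x ^+ 2) / 2).
Proof.
rewrite normal_pdfE ?oner_eq0// /normal_fun subr0; congr (_ * expR _).
by rewrite expr1n.
Qed.

(** The one-dimensional Cameron-Martin formula: substitute y = x + h and compare the densities at y
    - h and y. *)
Lemma normal_shift (g : R -> R) (h : R) : continuous g -> (forall x, 0 <= g x) ->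
  (\int[N01]_x (g (x + h))%:E = \int[N01]_x (g x * expR (h * x - h ^+ 2 / 2))%:E)%E.
Proof.
move=> cg g0.
have mg : measurable_fun setT g by exact: continuous_measurable_fun.
have maff : measurable_fun setT (fun x : R => x + h) by exact: measurable_funD.
have mgh : measurable_fun setT (fun x : R => g (x + h)) by exact: measurableT_comp mg maff.
rewrite ge0_integral_normal; last 2 first.
  exact/measurable_EFinP.
  by move=> x; rewrite lee_fin.
rewrite [RHS]ge0_integral_normal; last 2 first.
  apply/measurable_EFinP; apply: measurable_funM => //; apply: measurableT_comp => //.
  by apply: measurable_funB => //; exact: measurable_funM.
  by move=> x; rewrite lee_fin mulr_ge0 ?expR_ge0.
pose F (x : R) := x + h.
have dF (x : R) : is_derive x 1 F 1.
  have := is_deriveD (is_derive_id x (1 : R)) (is_derive_cst h x (1 : R)).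
  by rewrite addr0.
have F'E : derive1 F = cst 1 by apply/funext => x; rewrite derive1E derive_val.
pose G (y : R) := g y * normal_pdf 0 1 (y - h).
have e1 : (\int[mu]_y (G y)%:E = \int[mu]_x (((G \o F) * derive1 F)%R x)%:E)%E.
  apply: increasing_ge0_integration_by_substitutionT.
  - by move=> x y xy; rewrite /F ltrD2r.
  - by rewrite F'E => x; exact: cvg_cst.
  - by rewrite F'E; exact: is_cvg_cst.
  - by rewrite F'E; exact: is_cvg_cst.
  - by move=> x; exact: ex_derive.
  - exact: cvg_addrr_Ny.
  - exact: cvg_addrr.
  - move=> x; apply: cvgM; first exact: cg.
    apply: (continuous_comp (f := fun y : R => y - h)); last exact: continuous_normal_pdf (oner_neq0 _) _.
    by apply: continuousB; [exact: cvg_id|exact: cvg_cst].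
  - by move=> x; rewrite mulr_ge0// normal_pdf_ge0.
transitivity (\int[mu]_y (G y)%:E)%E.
  rewrite e1; apply: eq_integral => x _.
  rewrite -EFinM F'E; congr EFin; rewrite /GRing.mul/= mulr1 /G /F.
  by rewrite (_ : x + h - h = x)//; ring.
apply: eq_integral => x _; rewrite /G -EFinM; congr EFin.
rewrite !normal_pdf01 (_ : - (x - h) ^+ 2 / 2 = (h * x - h ^+ 2 / 2) + (- x ^+ 2 / 2)).
  by rewrite expRD; ring.
by field.
Qed.

End NormalShift.

(** Reads an identity of first-order terms off a bound whose remainder is quadratic in h, after
    division by h. *)
Lemma small_mul_eq0 (R : realType) (a K : R) :
  (forall h, 0 < h -> h <= 1 -> `|a| <= K * h) -> a = 0.
Proof.
move=> H; apply/eqP/contraT => a0.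
have an : 0 < `|a| by rewrite normr_gt0.
have K0 : 0 < K by have := H 1 ltr01 (lexx _); lra.
have := H (Num.min 1 (`|a| / (2 * K))) _ _.
rewrite lt_min ltr01 divr_gt0 ?mulr_gt0// ge_min lexx => /(_ isT isT) h.
have : K * Num.min 1 (`|a| / (2 * K)) <= K * (`|a| / (2 * K)).
  by rewrite ler_pM2l// ge_min lexx orbT.
rewrite (_ : K * (`|a| / (2 * K)) = `|a| / 2); last by field; rewrite gt_eqF.
lra.
Qed.

Section ExpBounds.
Context {R : realType}.

Lemma expR_rem (y : R) : `|expR y - 1 - y| <= y ^+ 2 * expR `|y|.
Proof.
have h0 : 0 <= expR y - 1 - y by have := expR_ge1Dx y; lra.
rewrite ger0_norm//; have [y0|y0] := leP 0 y.
  have e1 : expR y * expR (- y) = 1 by rewrite -expRD subrr expR0.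
  have e2 := expR_ge1Dx (- y); have e3 := expR_gt0 y.
  have k : expR y - 1 <= y * expR y by nra.
  have : y * (expR y - 1) <= y * (y * expR y) by rewrite ler_wpM2l.
  by rewrite ger0_norm//; lra.
have e1 : expR y * expR (- y) = 1 by rewrite -expRD subrr expR0.
have e2 := expR_ge1Dx y; have e3 := expR_gt0 (- y); have e4 := expR_gt0 y.
have e5 := expR_ge1Dx (- y).
have k1 : expR y <= 1 by rewrite -[leRHS]expR0 ler_expR ltW.
rewrite ltr0_norm//.
have y2 := sqr_ge0 y.
have : expR y - 1 - y <= y ^+ 2 by nra.
have : 1 <= expR (- y) by lra.
nra.
Qed.

Lemma sqr_le_expR (t : R) : 0 <= t -> t ^+ 2 <= 4 * expR t.
Proof.
move=> t0; have h := expR_ge1Dx (t / 2).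
have -> : expR t = expR (t / 2) ^+ 2 by rewrite expr2 -expRD -splitr.
nra.
Qed.

(** One envelope for x, for x^2 and for the second-order remainder of the Cameron-Martin factor.
    Being a sum of exponentials, it is integrable by the shift identity. *)
Definition gauss_env (x : R) : R := 5 * expR 2 * (expR (2 * x) + expR (- (2 * x))).

Lemma gauss_env_ge (x : R) : 5 * expR (2 * `|x| + 2) <= gauss_env x.
Proof.
rewrite expRD mulrCA mulrC /gauss_env ler_wpM2l ?mulr_ge0 ?expR_ge0//.
have [x0|x0] := leP 0 x.
  by rewrite ger0_norm// lerDl expR_ge0.
by rewrite ltr0_norm// mulrN lerDr expR_ge0.
Qed.

Lemma expR_env (x h : R) : `|h| <= 1 ->
  `|expR (h * x - h ^+ 2 / 2) - 1 - h * x| <= h ^+ 2 * gauss_env x.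
Proof.
move=> h1; have hE := gauss_env_ge x.
set y := h * x - h ^+ 2 / 2.
have h2 : h ^+ 2 = `|h| ^+ 2 by rewrite real_normK ?num_real.
have hn := normr_ge0 h; have xn := normr_ge0 x.
have y1 : `|y| <= `|h| * (`|x| + 1).
  have k : `|h ^+ 2 / 2| = `|h| ^+ 2 / 2 by rewrite ger0_norm ?divr_ge0 ?sqr_ge0// h2.
  apply: le_trans (ler_normB _ _) _; rewrite k normrM; nra.
have y2 : `|y| <= `|x| + 1 by apply: le_trans y1 _; rewrite ler_piMl//; lra.
have yy : y ^+ 2 <= h ^+ 2 * (`|x| + 1) ^+ 2.
  by rewrite h2 -exprMn; exact: sqr_le_norm.
have e1 : expR `|y| <= expR (`|x| + 1) by rewrite ler_expR.
have e2 : (`|x| + 1) ^+ 2 <= 4 * expR (`|x| + 1) by apply: sqr_le_expR; lra.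
have e3 : expR (2 * `|x| + 2) = expR (`|x| + 1) ^+ 2.
  by rewrite expr2 -expRD; congr expR; ring.
have e4 : 1 <= expR (`|x| + 1) by have := expR_ge1Dx (`|x| + 1); lra.
have k1 : `|expR y - 1 - y| <= h ^+ 2 * (4 * expR (`|x| + 1) ^+ 2).
  apply: le_trans (expR_rem y) _.
  apply: le_trans (ler_pM (sqr_ge0 y) (expR_ge0 _) yy e1) _.
  by rewrite -mulrA ler_wpM2l ?sqr_ge0// expr2 mulrA ler_wpM2r ?expR_ge0.
have -> : expR y - 1 - h * x = (expR y - 1 - y) - h ^+ 2 / 2 by rewrite /y; ring.
apply: le_trans (ler_normB _ _) _.
rewrite [`|h ^+ 2 / 2|]ger0_norm; last by rewrite divr_ge0 ?sqr_ge0.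
rewrite e3 in hE.
have e5 : 1 <= expR (`|x| + 1) ^+ 2 by rewrite exprn_ege1.
have hh := sqr_ge0 h.
have : h ^+ 2 * (5 * expR (`|x| + 1) ^+ 2) <= h ^+ 2 * gauss_env x by rewrite ler_wpM2l.
have : h ^+ 2 * 1 <= h ^+ 2 * expR (`|x| + 1) ^+ 2 by rewrite ler_wpM2l.
lra.
Qed.

Lemma sqr_le_env (x : R) : x ^+ 2 <= gauss_env x.
Proof.
apply: le_trans (gauss_env_ge x).
rewrite -real_normK ?num_real//; apply: le_trans (sqr_le_expR (normr_ge0 x)) _.
have xn := normr_ge0 x.
have : expR `|x| <= expR (2 * `|x| + 2) by rewrite ler_expR; lra.
have := expR_gt0 `|x|; lra.
Qed.

Lemma norm_le_env (x : R) : `|x| <= gauss_env x.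
Proof.
apply: le_trans (gauss_env_ge x).
have := expR_ge1Dx (2 * `|x| + 2); have := normr_ge0 x; lra.
Qed.

End ExpBounds.

Lemma integral_standard_normal d (T : measurableType d) (R : realType)
  (P : probability T R) (Z : {RV P >-> R}) (a : R -> R) :
  standard_normal Z -> continuous a -> (forall x, 0 <= a x) ->
  (\int[P]_w (a (Z w))%:E = \int[normal_prob 0 1]_x (a x)%:E)%E.
Proof.
move=> hZ ca a0.
have ma : measurable_fun setT a by exact: continuous_measurable_fun.
have maE : measurable_fun setT (EFin \o a) by exact/measurable_EFinP.
rewrite -(ge0_integral_distribution Z maE)//.
(* The identity map; it carries the normal law from [measurableTypeR R] over to [R]. *)
pose phi : measurableTypeR R -> R := fun x => x.
have mphi : measurable_fun setT phi by move=> _ A mA; rewrite setTI.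
transitivity (\int[pushforward (normal_prob 0 1 : {measure set (measurableTypeR R) -> \bar R}) phi]_x (a x)%:E)%E.
  apply: eq_measure_integral => A mA _; exact: hZ.
by rewrite ge0_integral_pushforward// => x _ /=; rewrite lee_fin.
Qed.

(** * Stein's identity in one variable *)

Section SteinNormal.
Context d (T : measurableType d) {R : realType} (P : probability T R).
Variable Z : {RV P >-> R}.
Hypothesis hZ : standard_normal Z.
Implicit Types g : R -> R.

Let mcomp (f : R -> R) : measurable_fun setT f -> measurable_fun setT (fun w => f (Z w)).
Proof. by move=> mf; exact: measurableT_comp. Qed.

Let mexp (t c : R) : measurable_fun setT (fun x : R => expR (t * x - c)).
Proof.
apply: measurableT_comp => //; apply: measurable_funB => //; exact: measurable_funM.
Qed.

Lemma normal_shift_Z g h : continuous g -> (forall x, 0 <= g x) ->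
  (\int[P]_w (g (Z w + h))%:E =
   \int[P]_w (g (Z w) * expR (h * Z w - h ^+ 2 / 2))%:E)%E.
Proof.
move=> cg g0.
rewrite (integral_standard_normal (a := fun x => g (x + h)) hZ)//; last first.
  move=> x; apply: (continuous_comp (f := fun y : R => y + h)); last exact: cg.
  by apply: continuousD; [exact: cvg_id|exact: cvg_cst].
rewrite normal_shift//.
rewrite (integral_standard_normal (a := fun x => g x * expR (h * x - h ^+ 2 / 2)) hZ)//.
  move=> x; apply: cvgM; first exact: cg.
  apply: (continuous_comp (f := fun y : R => h * y - h ^+ 2 / 2)); last exact: continuous_expR.
  apply: continuousB; last exact: cvg_cst.
  by apply: cvgM; [exact: cvg_cst|exact: cvg_id].
by move=> x; rewrite mulr_ge0 ?expR_ge0.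
Qed.

(** The shift identity for g = 1 says that exp(t Z - t^2 / 2) has integral 1, which is finite. *)
Lemma normal_L1_exp (t : R) : L1 P (fun w => expR (t * Z w)).
Proof.
have h : L1 P (fun w => expR (t * Z w - t ^+ 2 / 2)).
  apply/integrableP; split; first by apply/measurable_EFinP; exact: mcomp (mexp _ _).
  have := normal_shift_Z t (@cst_continuous R R 1) (fun=> ler01).
  rewrite /= integral_cst//= [P setT]probability_setT mul1e => e.
  under eq_integral do rewrite ger0_norm ?expR_ge0//.
  under eq_integral do rewrite -[expR _]mul1r.
  by rewrite -e ltry.
apply: L1_ext (L1Z (expR (t ^+ 2 / 2)) h) => x.
by rewrite -expRD; congr expR; ring.
Qed.

Lemma normal_L1_env : L1 P (fun w => gauss_env (Z w)).
Proof.
apply: L1Z; apply: L1D; first exact: normal_L1_exp.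
by apply: L1_ext (normal_L1_exp (- 2)) => x; rewrite mulNr.
Qed.

Lemma normal_L1_le (f : R -> R) c : measurable_fun setT f ->
  (forall x, `|f x| <= c * gauss_env x) -> L1 P (fun w => f (Z w)).
Proof.
move=> mf h; apply: (L1_le (mcomp mf) (fun w => h (Z w))); apply: L1Z.
exact: normal_L1_env.
Qed.

(** The nonnegative case is applied to g + C and to the constant 1; the contributions of C cancel
    because the exponential factor has mean 1. *)
Lemma normal_shift_Ex g (h C : R) : continuous g -> (forall x, `|g x| <= C) ->
  Ex P (fun w => g (Z w + h)) = Ex P (fun w => g (Z w) * expR (h * Z w - h ^+ 2 / 2)).
Proof.
move=> cg gC.
have mg : measurable_fun setT g by exact: continuous_measurable_fun.
have maff : measurable_fun setT (fun x : R => x + h) by exact: measurable_funD.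
have mgh : measurable_fun setT (fun x : R => g (x + h)) by exact: measurableT_comp mg maff.
have Lgh : L1 P (fun w => g (Z w + h)) by apply: (L1_bnd _ (c := C)); [exact: (mcomp mgh)|move=> w; exact: gC].
have LE : L1 P (fun w => expR (h * Z w - h ^+ 2 / 2)).
  apply: L1_ext (L1Z (expR (- (h ^+ 2 / 2))) (normal_L1_exp h)) => x.
  by rewrite -expRD; congr expR; ring.
have LgE : L1 P (fun w => g (Z w) * expR (h * Z w - h ^+ 2 / 2)).
  apply: L1_le (L1Z C LE).
    by apply: measurable_funM; [exact: mcomp|exact: L1_meas LE].
  by move=> x; rewrite normrM [`|expR _|]ger0_norm ?expR_ge0// ler_wpM2r ?expR_ge0.
have e (a : R -> R) : continuous a -> (forall x, 0 <= a x) ->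
    Ex P (fun w => a (Z w + h)) = Ex P (fun w => a (Z w) * expR (h * Z w - h ^+ 2 / 2)).
  by move=> ca a0; rewrite /Ex normal_shift_Z.
have e2 := e (fun=> 1) (@cst_continuous _ _ _) (fun=> ler01).
have : Ex P (fun w => g (Z w + h) + C) =
    Ex P (fun w => g (Z w) * expR (h * Z w - h ^+ 2 / 2) + C * expR (h * Z w - h ^+ 2 / 2)).
  rewrite (e (fun x => g x + C)).
  - by congr Ex; apply/funext => x; rewrite mulrDl.
  - by move=> x; apply: continuousD; [exact: cg|exact: cvg_cst].
  - by move=> x; have := gC x; rewrite ler_norml; lra.
rewrite ExD//; last exact: L1_cst.
rewrite ExD//; last exact: L1Z.
rewrite Ex_cst in e2.
rewrite Ex_cst ExZ//.
have -> : Ex P (fun w => expR (h * Z w - h ^+ 2 / 2)) = 1.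
  by rewrite [RHS]e2; congr Ex; apply/funext => x; rewrite mul1r.
by rewrite mulr1 => /addIr.
Qed.

(** Both sides of the shift identity are expanded to first order in h, the left one by the Taylor
    bound on g and the right one by [expR_env]. The zeroth-order terms agree, and letting h tend to
    0 equates the first-order ones. The derivative g1 is known only through the uniform quadratic
    remainder. *)
Lemma normal_stein g g1 (C : R) : measurable_fun setT g1 ->
  (forall x, `|g x| <= C) -> (forall x, `|g1 x| <= C) ->
  (forall x h, `|g (x + h) - g x - h * g1 x| <= C * h ^+ 2) ->
  Ex P (fun w => Z w * g (Z w)) = Ex P (fun w => g1 (Z w)).
Proof.
move=> mg1 gC g1C gT.
have C0 : 0 <= C := le_trans (normr_ge0 _) (gC 0).
have lip x h : `|h| <= 1 -> `|g (x + h) - g x| <= 2 * C * `|h|.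
  move=> h1; have k1 := g1C x; have k2 := gT x h.
  have -> : g (x + h) - g x = (g (x + h) - g x - h * g1 x) + h * g1 x by ring.
  apply: le_trans (ler_normD _ _) _; rewrite normrM.
  have hn := normr_ge0 h.
  have : `|h| * `|g1 x| <= `|h| * C by rewrite ler_wpM2l.
  have : C * h ^+ 2 <= C * `|h|.
    by rewrite ler_wpM2l// -real_normK ?num_real// expr2 ler_piMl.
  lra.
have cg : continuous g.
  move=> x; apply/cvgrPdist_le => /= e e0.
  have m0 : 0 < Num.min 1 (e / (2 * C + 1)) by rewrite lt_min ltr01 divr_gt0//; lra.
  near=> y.
  have : `|x - y| <= Num.min 1 (e / (2 * C + 1)).
    by near: y; apply/nbhs_normP; exists (Num.min 1 (e / (2 * C + 1))) => //= z /ltW.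
  rewrite distrC le_min => /andP[d1 d2].
  rewrite distrC (_ : y = x + (y - x)); last by ring.
  apply: le_trans (lip x _ d1) _.
  have K0 : 0 < 2 * C + 1 by lra.
  move: d2; rewrite ler_pdivlMr// => d2; have := normr_ge0 (y - x); lra.
have mg : measurable_fun setT g by exact: continuous_measurable_fun.
have Lg : L1 P (fun w => g (Z w)) by apply: (L1_bnd _ (c := C)); [exact: (mcomp mg)|move=> w; exact: gC].
have Lg1 : L1 P (fun w => g1 (Z w)) by apply: (L1_bnd _ (c := C)); [exact: (mcomp mg1)|move=> w; exact: g1C].
have Lxg : L1 P (fun w => Z w * g (Z w)).
  apply: (normal_L1_le (f := fun x => x * g x) (c := C)); first exact: measurable_funM.
  by move=> x; rewrite normrM mulrC ler_pM// norm_le_env.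
apply/eqP; rewrite -subr_eq0; apply/eqP.
apply: (small_mul_eq0 (K := C + C * Ex P (fun w => gauss_env (Z w)))) => h h0 h1.
have hn : `|h| <= 1 by rewrite gtr0_norm.
have e := normal_shift_Ex h cg gC.
have maff : measurable_fun setT (fun x : R => x + h) by exact: measurable_funD.
have Lgh : L1 P (fun w => g (Z w + h)).
  by apply: (L1_bnd _ (c := C)); [exact: (mcomp (measurableT_comp mg maff))|move=> w; exact: gC].
have LE : L1 P (fun w => expR (h * Z w - h ^+ 2 / 2)).
  apply: L1_ext (L1Z (expR (- (h ^+ 2 / 2))) (normal_L1_exp h)) => x.
  by rewrite -expRD; congr expR; ring.
have LgE : L1 P (fun w => g (Z w) * expR (h * Z w - h ^+ 2 / 2)).
  apply: L1_le (L1Z C LE).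
    by apply: measurable_funM; [exact: mcomp|exact: L1_meas LE].
  by move=> x; rewrite normrM [`|expR _|]ger0_norm ?expR_ge0// ler_wpM2r ?expR_ge0.
have k1 : `|Ex P (fun w => g (Z w + h) - g (Z w) - h * g1 (Z w))| <= C * h ^+ 2.
  rewrite -[leRHS](Ex_cst P); apply: Ex_norm_le => //.
    by apply: L1B; [exact: L1B|exact: L1Z].
  exact: L1_cst.
rewrite ExB in k1; [|exact: L1B|exact: L1Z].
rewrite ExB// ExZ// in k1.
have k2 : `|Ex P (fun w => g (Z w) * expR (h * Z w - h ^+ 2 / 2) - g (Z w) - h * (Z w * g (Z w)))|
    <= C * h ^+ 2 * Ex P (fun w => gauss_env (Z w)).
  rewrite -ExZ; last exact: normal_L1_env.
  apply: Ex_norm_le => //.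
  - by apply: L1B; [exact: L1B|exact: L1Z].
  - by apply: L1Z; exact: normal_L1_env.
  - move=> w; rewrite (_ : _ - _ = g (Z w) * (expR (h * Z w - h ^+ 2 / 2) - 1 - h * Z w)); last by ring.
    by rewrite normrM -mulrA ler_pM// expR_env.
rewrite ExB in k2; [|exact: L1B|exact: L1Z].
rewrite ExB// ExZ// -e in k2.
rewrite -(ler_pM2l h0) -[X in X * `|_| <= _](gtr0_norm h0) -normrM.
set a := Ex P (fun w => g (Z w + h)) in k1 k2.
set b := Ex P (fun w => g (Z w)) in k1 k2; set c := Ex P (fun w => g1 (Z w)) in k1 *.
set f := Ex P (fun w => Z w * g (Z w)) in k2 *.
set q := Ex P (fun w => gauss_env (Z w)) in k2 *.
move: k1 k2; rewrite !ler_norml => /andP[? ?] /andP[? ?]; apply/andP; split; nra.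
Unshelve. all: by end_near.
Qed.

End SteinNormal.

Section SoftmaxMeasurable.
Context d (T : measurableType d) {R : realType} {J : finType}.
Variable v : T -> J -> R.
Hypothesis mv : forall j, measurable_fun setT (fun w => v w j).

Lemma meas_sm0 : measurable_fun setT (fun w => sm0 (v w)).
Proof.
rewrite (_ : (fun w => _) = fun w => expR (- ln (1 + smZ (v w)))); last first.
  by apply/funext => w; rewrite expRN lnK ?posrE ?smZ1_gt0.
apply: measurableT_comp => //; apply: measurableT_comp => //.
apply: measurableT_comp; first exact: measurable_ln.
apply: measurable_funD => //; apply: meas_sum => j; exact: measurableT_comp.
Qed.

Lemma meas_smp j : measurable_fun setT (fun w => smp (v w) j).
Proof.
by apply: measurable_funM; [exact: measurableT_comp|exact: meas_sm0].
Qed.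

Lemma meas_smPhi j : measurable_fun setT (fun w => smPhi (v w) j).
Proof. by apply: measurable_funM; [exact: meas_sm0|exact: meas_smp]. Qed.

Lemma meas_smw : measurable_fun setT (fun w => smw (v w)).
Proof.
by apply: measurable_funM; [exact: meas_sm0|apply: measurable_funB => //; exact: meas_sm0].
Qed.

Lemma meas_smdPhi j k : measurable_fun setT (fun w => smdPhi (v w) j k).
Proof.
apply: measurable_funM; first exact: meas_sm0.
apply: measurable_funB; apply: measurable_funM => //; first exact: meas_smp.
by apply: measurable_funM; exact: meas_smp.
Qed.

End SoftmaxMeasurable.

(** * Gaussian integration by parts for functions of sample and multipliers *)

Section SteinVector.
Context d (T : measurableType d) {R : realType} (P : probability T R).
Context dX (TX : measurableType dX) (n : nat) (J : finType).
Variables (X : 'I_n -> T -> TX) (e : 'I_n -> {RV P >-> R}).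

Definition dataX w : n.-tuple TX := [tuple X k w | k < n].
Definition dataE w : n.-tuple R := [tuple e k w | k < n].
(** Leaving one variable out means overwriting it with a fixed value, [x0] for the data and 0 for a
    multiplier, so that the tuples keep their length. *)
Definition looX (x0 : TX) i w : n.-tuple TX * n.-tuple R :=
  ([tuple (if k == i then x0 else X k w) | k < n], dataE w).
Definition looE i w : n.-tuple TX * n.-tuple R :=
  (dataX w, [tuple (if k == i then 0 else e k w) | k < n]).

Variable A : J -> 'I_n -> R.

Definition gaussG w j : R := \sum_i A j i * e i w.
Definition gram j k : R := \sum_i A j i * A k i.

Hypothesis eN : forall i, standard_normal (e i).
Hypothesis eI : forall i, indep P (e i) (looE i).

Variables (F : (J -> R) -> J -> R) (dF : (J -> R) -> J -> J -> R) (K : R).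
Hypothesis F1 : forall v j, `|F v j| <= 1.
Hypothesis dF1 : forall v j k, `|dF v j k| <= 3.
Hypothesis FT : forall v z M j, (forall k, `|z k| <= M) -> 0 <= M ->
  `|F (fun k => v k + z k) j - F v j - \sum_k dF v j k * z k| <= K * M ^+ 2.
Hypothesis mF : forall d' (T' : measurableType d') (v : T' -> J -> R) j,
  (forall k, measurable_fun setT (fun w => v w k)) ->
  measurable_fun setT (fun w => F (v w) j).
Hypothesis mdF : forall d' (T' : measurableType d') (v : T' -> J -> R) j k,
  (forall k, measurable_fun setT (fun w => v w k)) ->
  measurable_fun setT (fun w => dF (v w) j k).

Variable u : n.-tuple TX -> J -> R.
Hypothesis mu : forall k, measurable_fun setT (fun x => u x k).
Variable t : R.

Let v w j := u (dataX w) j + t * gaussG w j.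

Let base (V : n.-tuple TX * n.-tuple R) j := u V.1 j + t * \sum_i A j i * tnth V.2 i.

Let vE i w : v w = fun k => base (looE i w) k + e i w * (t * A k i).
Proof.
apply/funext => k; rewrite /v /base /looE /= /gaussG (bigD1 i)//= [in RHS](bigD1 i)//=.
rewrite tnth_mktuple eqxx mulr0 add0r.
have -> : \sum_(i0 < n | i0 != i) A k i0 * tnth [tuple (if k0 == i then 0 else e k0 w) | k0 < n] i0
   = \sum_(i0 < n | i0 != i) A k i0 * e i0 w.
  by apply: eq_bigr => l /negbTE li; rewrite tnth_mktuple li.
ring.
Qed.

Let mbase k : measurable_fun setT (fun V => base V k).
Proof.
apply: measurable_funD; first exact: measurableT_comp (mu k) measurable_fst.
apply: measurable_funM => //; apply: meas_sum => i; apply: measurable_funM => //.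
exact: measurableT_comp (measurable_tnth _) measurable_snd.
Qed.

(** All variables other than e_i are frozen by [indep_law]; as a function of e_i alone the integrand
    falls under [normal_stein], and [indep_law] then restores the joint expectation. *)
Lemma stein_coord i j :
  [/\ L1 P (fun w => e i w * F (v w) j),
    L1 P (fun w => \sum_k A k i * dF (v w) j k) &
    Ex P (fun w => e i w * F (v w) j) =
    t * Ex P (fun w => \sum_k A k i * dF (v w) j k)].
Proof.
pose z (x : R) (V : n.-tuple TX * n.-tuple R) := fun k => base V k + x * (t * A k i).
pose g x V := F (z x V) j.
pose g1 x V := \sum_k dF (z x V) j k * (t * A k i).
pose B := \sum_k `|t * A k i|.
have B0 : 0 <= B by apply: sumr_ge0.
have Bk k : `|t * A k i| <= B.
  by rewrite /B (bigD1 k)//= lerDl; apply: sumr_ge0.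
(* It dominates the bounds 1 on F, 3 B on the derivative and K B^2 on the remainder; the last term
   compensates a possibly negative K. *)
pose C := 1 + 3 * B + K * B ^+ 2 + `|K| * B ^+ 2.
have hK : K * B ^+ 2 <= `|K| * B ^+ 2 by rewrite ler_wpM2r ?sqr_ge0// ler_norm.
have hK2 : - (K * B ^+ 2) <= `|K| * B ^+ 2.
  by rewrite -mulNr ler_wpM2r ?sqr_ge0// -normrN ler_norm.
have mz k : measurable_fun setT (fun q : R * (n.-tuple TX * n.-tuple R) => z q.1 q.2 k).
  apply: measurable_funD; first exact: measurableT_comp (mbase k) measurable_snd.
  by apply: measurable_funM => //; exact: measurable_fst.
have mg : measurable_fun setT (fun q : R * _ => g q.1 q.2) by exact: mF.
have mg1 : measurable_fun setT (fun q : R * _ => g1 q.1 q.2).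
  by apply: meas_sum => k; apply: measurable_funM => //; exact: mdF.
have g1B x V : `|g1 x V| <= 3 * B.
  apply: le_trans (ler_norm_sum _ _ _) _; rewrite mulr_sumr; apply: ler_sum => k _.
  by rewrite normrM ler_wpM2r.
have C3 : 3 * B <= C by rewrite /C; lra.
have C1 : 1 <= C by rewrite /C; lra.
have CK : K * B ^+ 2 <= C by rewrite /C; lra.
have sV V : Ex P (fun w => e i w * g (e i w) V) = Ex P (fun w => g1 (e i w) V).
  apply: (normal_stein (eN i) (g := g^~ V) (g1 := g1^~ V) (C := C)).
  - exact: measurableT_comp mg1 (pair2_measurable V).
  - by move=> x; exact: le_trans (F1 _ _) C1.
  - by move=> x; exact: le_trans (g1B _ _) C3.
  - move=> x h; have hz k : `|h * (t * A k i)| <= `|h| * B by rewrite normrM ler_wpM2l.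
    have := FT (z x V) j hz (mulr_ge0 (normr_ge0 h) B0).
    rewrite (_ : (fun k => _) = z (x + h) V); last by apply/funext => k; rewrite /z; ring.
    rewrite (_ : \sum_k _ = h * g1 x V); last first.
      by rewrite /g1 mulr_sumr; apply: eq_bigr => k _; rewrite mulrCA.
    move=> hh; apply: le_trans hh _; rewrite exprMn real_normK ?num_real// mulrCA mulrC.
    by rewrite ler_wpM2r ?sqr_ge0.
have ee w : e i w * F (v w) j = e i w * g (e i w) (looE i w) by rewrite (vE i).
have ee1 w : g1 (e i w) (looE i w) = t * \sum_k A k i * dF (v w) j k.
  by rewrite (vE i) mulr_sumr; apply: eq_bigr => k _; rewrite /z; ring.
have mei : measurable_fun setT (e i) by exact: measurable_funPT.
have Le : L1 P (fun w => e i w).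
  apply: (normal_L1_le (eN i) (f := fun x => x) (c := 1)); first exact: measurable_id.
  by move=> x; rewrite mul1r norm_le_env.
have [_ mV _] := eI i.
have Lf V : L1 P (fun w => e i w * g (e i w) V).
  apply: L1_le (L1_norm Le).
    apply: measurable_funM => //.
    exact: measurableT_comp (measurableT_comp mg (pair2_measurable V)) mei.
  by move=> w; rewrite normrM ler_piMr//; exact: F1.
have mpair : measurable_fun setT (fun w => (e i w, looE i w)) by exact: measurable_fun_pair.
have Lf' : L1 P (fun w => e i w * g (e i w) (looE i w)).
  apply: L1_le (L1_norm Le).
    by apply: measurable_funM => //; exact: measurableT_comp mg mpair.
  by move=> w; rewrite normrM ler_piMr//; exact: F1.
have LdF : L1 P (fun w => \sum_k A k i * dF (v w) j k).
  apply: L1_sum => k _; apply: L1Z; apply: (L1_bnd _ (c := 3)) => //.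
  apply: mdF => l; rewrite (_ : (fun w => v w l) = fun w => z (e i w) (looE i w) l).
    exact: measurableT_comp (mz l) mpair.
  by apply/funext => w; rewrite (vE i).
split=> //; first by apply: L1_ext Lf' => w.
rewrite [X in Ex _ X](_ : _ = fun w => e i w * g (e i w) (looE i w)); last exact/funext.
have mf : measurable_fun setT (fun q : R * (n.-tuple TX * n.-tuple R) => q.1 * g q.1 q.2).
  by apply: measurable_funM => //; exact: measurable_fst.
have [_ ->] := indep_law (eI i) mf Lf' Lf.
rewrite (_ : (fun w' => _) = fun w' => Ex P (fun w => g1 (e i w) (looE i w'))); last first.
  by apply/funext => w'; exact: sV.
have L2 : L1 P (fun w => g1 (e i w) (looE i w)).
  by apply: L1_ext (L1Z t LdF) => w; rewrite ee1.
have L3 V : L1 P (fun w => g1 (e i w) V).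
  apply: (L1_bnd _ (c := C)) => [|w].
    exact: measurableT_comp (measurableT_comp mg1 (pair2_measurable V)) mei.
  exact: le_trans (g1B _ _) C3.
have [_ <-] := indep_law (eI i) mg1 L2 L3.
by rewrite -ExZ//; congr Ex; apply/funext => w; rewrite /= ee1.
Qed.

(** Summing the coordinate identities over i with coefficients A j i produces [gram], the covariance
    of the Gaussian field. *)
Lemma stein_vector :
  L1 P (fun w => \sum_j gaussG w j * F (v w) j) /\
  Ex P (fun w => \sum_j gaussG w j * F (v w) j) =
  t * Ex P (fun w => \sum_j \sum_k gram j k * dF (v w) j k).
Proof.
have LdF i j : L1 P (fun w => \sum_k A k i * dF (v w) j k).
  by have [] := stein_coord i j.
have e1 w : \sum_j gaussG w j * F (v w) j = \sum_j \sum_i A j i * (e i w * F (v w) j).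
  by apply: eq_bigr => j _; rewrite mulr_suml; apply: eq_bigr => i _; rewrite mulrA.
have L i j : L1 P (fun w => A j i * (e i w * F (v w) j)).
  by apply: L1Z; have [] := stein_coord i j.
have LL : L1 P (fun w => \sum_j \sum_i A j i * (e i w * F (v w) j)).
  by apply: L1_sum => j _; apply: L1_sum => i _; exact: L.
split; first by apply: L1_ext LL => w.
rewrite [X in Ex _ X](_ : _ = fun w => \sum_j \sum_i A j i * (e i w * F (v w) j)); last exact/funext.
rewrite Ex_sum; last by move=> j _; apply: L1_sum.
have -> : \sum_j Ex P (fun w => \sum_i A j i * (e i w * F (v w) j)) =
    \sum_j \sum_i A j i * (t * Ex P (fun w => \sum_k A k i * dF (v w) j k)).
  apply: eq_bigr => j _; rewrite Ex_sum//; apply: eq_bigr => i _.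
  by have [h1 _ h2] := stein_coord i j; rewrite ExZ// h2.
have -> : (fun w => \sum_j \sum_k gram j k * dF (v w) j k) =
    (fun w => \sum_j \sum_i A j i * \sum_k A k i * dF (v w) j k).
  apply/funext => w; apply: eq_bigr => j _.
  under [RHS]eq_bigr do rewrite mulr_sumr.
  rewrite exchange_big/=; apply: eq_bigr => k _.
  by rewrite /gram mulr_suml; apply: eq_bigr => i _; rewrite mulrA.
rewrite Ex_sum; last by move=> j _; apply: L1_sum => i _; exact: L1Z.
rewrite mulr_sumr; apply: eq_bigr => j _.
rewrite Ex_sum; last by move=> i _; exact: L1Z.
by rewrite mulr_sumr; apply: eq_bigr => i _; rewrite ExZ// mulrCA.
Qed.

End SteinVector.

Section SoftmaxDerivative.
Context {R : realType} {J : finType}.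
Implicit Types v z : J -> R.

(** The Jacobian of the weights [smp]; [smQ] contracts it with a matrix. *)
Definition smdp v j k : R := (j == k)%:R * smp v j - smp v j * smp v k.

Lemma sum_delta (j : J) (f : J -> R) : \sum_k (j == k)%:R * f k = f j.
Proof.
rewrite (bigD1 j)//= eqxx mul1r big1 ?addr0// => k /negbTE kj.
by rewrite eq_sym kj mul0r.
Qed.

Lemma smdp_sum v z j : \sum_k smdp v j k * z k = smp v j * (z j - smE v z).
Proof.
rewrite mulrBr -[smp v j * z j](sum_delta j (fun k => smp v j * z k)) /smE.
by rewrite mulr_sumr -sumrB; apply: eq_bigr => k _; rewrite /smdp; ring.
Qed.

Lemma smdPhi_sum v z j : \sum_k smdPhi v j k * z k = smPhi v j * (z j - 2 * smE v z).
Proof.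
rewrite mulrBr -[smPhi v j * z j](sum_delta j (fun k => smPhi v j * z k)) /smE.
by rewrite [2 * _]mulr_sumr mulr_sumr -sumrB; apply: eq_bigr => k _; rewrite /smdPhi /smPhi; ring.
Qed.

Lemma norm_smp_le1 v j : `|smp v j| <= 1.
Proof. by rewrite ger0_norm ?smp_ge0// smp_le1. Qed.

Lemma norm_smPhi_le1 v j : `|smPhi v j| <= 1.
Proof. by rewrite ger0_norm ?smPhi_ge0// smPhi_le1. Qed.

Lemma norm_smdp_le3 v j k : `|smdp v j k| <= 3.
Proof.
have p0 := smp_ge0 v j; have p1 := smp_le1 v j.
have q0 := smp_ge0 v k; have q1 := smp_le1 v k.
have pq0 := mulr_ge0 p0 q0; have pq1 := mulr_ile1 p0 q0 p1 q1.
by rewrite /smdp; case: (j == k); rewrite /= ?mul1r ?mul0r ler_norml; apply/andP; split; lra.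
Qed.

Lemma norm_smdPhi_le3 v j k : `|smdPhi v j k| <= 3.
Proof.
rewrite /smdPhi normrM gtr0_norm ?sm0_gt0//.
apply: (@le_trans _ _ (1 * 3)); last by rewrite mul1r.
apply: ler_pM => //; [exact/ltW/sm0_gt0|exact: sm0_le1|].
have p0 := smp_ge0 v j; have p1 := smp_le1 v j.
have q0 := smp_ge0 v k; have q1 := smp_le1 v k.
have pq0 := mulr_ge0 p0 q0; have pq1 := mulr_ile1 p0 q0 p1 q1.
by case: (j == k); rewrite /= ?mul1r ?mul0r ler_norml; apply/andP; split; lra.
Qed.

Definition smQ v (A : J -> J -> R) : R := \sum_j \sum_k A j k * smdp v j k.

Lemma smQE v A : smQ v A = smE v (fun j => A j j) - smE v (fun j => smE v (A j)).
Proof.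
rewrite /smQ /smE -sumrB; apply: eq_bigr => j _.
rewrite -(sum_delta j (fun k => smp v j * A j k)) mulr_sumr -sumrB.
by apply: eq_bigr => k _; rewrite /smdp; ring.
Qed.

(** With q = 1 - [sm0 v], the diagonal average is at least q (1 - D) and the double average at most
    q^2 (1 + D). The main terms leave q - q^2, which is [smw v]. *)
Lemma smQ_ge v A D : (forall j k, A j k <= 1 + D) -> (forall j, 1 - D <= A j j) ->
  0 <= D -> smw v - 2 * D <= smQ v A.
Proof.
move=> h1 h2 D0; rewrite smQE.
have k1 : (1 - sm0 v) * (1 - D) <= smE v (fun j => A j j).
  by rewrite -smE_cst; exact: smE_le.
have p0 := sm0_gt0 v; have p1 := sm0_le1 v.
have k2 : smE v (fun j => smE v (A j)) <= (1 - sm0 v) * ((1 - sm0 v) * (1 + D)).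
  rewrite -smE_cst; apply: smE_le => j; rewrite -smE_cst; exact: smE_le.
rewrite /smw; set q := 1 - sm0 v in k1 k2 *; have q0 : 0 <= q by rewrite /q; lra.
have q1 : q <= 1 by rewrite /q; lra.
have -> : sm0 v = 1 - q by rewrite /q; ring.
have : D * (q + q * q) <= D * 2 by rewrite ler_wpM2l//; nra.
lra.
Qed.

(* The entropy of the probability vector (sm0 v, smp v) is at most the
   logarithm of the number of its atoms. *)
Lemma entropy_le v : ln (1 + smZ v) - smE v v <= ln (#|J|.+1%:R).
Proof.
set D : R := #|J|.+1%:R; have D0 : 0 < D by rewrite ltr0n.
(* Gibbs' inequality for one atom, against the uniform law on D = |J| + 1 atoms: ln x <= x - 1 at x
   = 1 / (p D). *)
have hp (p : R) : 0 < p -> p * (- ln p - ln D) <= D^-1 - p.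
  move=> p0; have pD : 0 < (p * D)^-1 by rewrite invr_gt0 mulr_gt0.
  have x1 : -1 < (p * D)^-1 - 1 by rewrite ltrBrDr addNr.
  have h := le_ln1Dx x1; rewrite [1 + _]addrC subrK in h.
  rewrite lnV ?posrE ?mulr_gt0// lnM ?posrE// in h.
  have : p * (- (ln p + ln D)) <= p * ((p * D)^-1 - 1) by rewrite ler_pM2l.
  by rewrite mulrBr invfM mulrA mulfV ?gt_eqF// mul1r mulr1 opprD.
have Z0 := smZ1_gt0 v.
have e0 : ln (sm0 v) = - ln (1 + smZ v) by rewrite /sm0 lnV ?posrE.
have ej j : v j = ln (smp v j) + ln (1 + smZ v).
  by rewrite /smp lnM ?posrE ?expR_gt0 ?sm0_gt0// expRK e0; ring.
have s1 : sm0 v * (- ln (sm0 v) - ln D) + \sum_j smp v j * (- ln (smp v j) - ln D) <= 0.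
  apply: (@le_trans _ _ ((D^-1 - sm0 v) + \sum_j (D^-1 - smp v j))).
    by rewrite lerD ?hp ?sm0_gt0// ler_sum// => j _; rewrite hp ?smp_gt0.
  rewrite sumrB smp_sum sumr_const -[_ *+ _]mulr_natl.
  have -> : #|predT : pred J|%:R = D - 1 :> R by rewrite /D -natr1 addrK.
  rewrite le_eqVlt; apply/orP; left; apply/eqP.
  by field; rewrite gt_eqF.
have e2 : smE v v = \sum_j smp v j * (ln (smp v j) + ln (1 + smZ v)).
  by apply: eq_bigr => j _; rewrite -ej.
have e3 : \sum_j smp v j * (- ln (smp v j) - ln D) =
    - smE v v + (1 - sm0 v) * (ln (1 + smZ v) - ln D).
  by rewrite e2 -smp_sum mulr_suml -sumrN -big_split/=; apply: eq_bigr => j _; ring.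
by rewrite e3 e0 in s1; lra.
Qed.

End SoftmaxDerivative.

(** * Gaussian fields: anti-concentration and expected maximum *)

Section GaussMax.
Context d (T : measurableType d) {R : realType} (P : probability T R).
Context dX (TX : measurableType dX) (n : nat) (J : finType).
Variables (X : 'I_n -> T -> TX) (e : 'I_n -> {RV P >-> R}).
Variable A : J -> 'I_n -> R.
Hypothesis eN : forall i, standard_normal (e i).
Hypothesis eI : forall i, indep P (e i) (looE X e i).
Variable y : J -> TX -> R.
Hypothesis my : forall j, measurable_fun setT (y j).
Local Notation G := (gaussG e A).
Local Notation Gam := (gram A).

Definition sumY w j : R := \sum_i y j (X i w).
(** The argument of the soft maximum throughout: kap scales the sum, t the Gaussian field, and b
    holds the thresholds. Setting kap = 0 leaves a purely Gaussian vector. *)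
Definition vv (kap t : R) (b : J -> R) w j : R := kap * sumY w j - b j + t * G w j.

Let u kap (b : J -> R) (x : n.-tuple TX) j := kap * \sum_i y j (tnth x i) - b j.

Let mu kap b k : measurable_fun setT (fun x => u kap b x k).
Proof.
apply: measurable_funB => //; apply: measurable_funM => //; apply: meas_sum => i.
by apply: measurableT_comp => //; exact: measurable_tnth.
Qed.

Let vvE kap t b w : vv kap t b w = fun j => u kap b (dataX X w) j + t * G w j.
Proof.
apply/funext => j; rewrite /vv /u /sumY; congr (_ * _ - _ + _).
by apply: eq_bigr => i _; rewrite tnth_mktuple.
Qed.

Lemma stein_smp kap t b :
  L1 P (fun w => \sum_j G w j * smp (vv kap t b w) j) /\
  Ex P (fun w => \sum_j G w j * smp (vv kap t b w) j) =
  t * Ex P (fun w => smQ (vv kap t b w) Gam).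
Proof.
have h := @stein_vector _ _ _ P _ _ _ _ X e A eN eI smp smdp 6000
  norm_smp_le1 norm_smdp_le3 _ _ _ _ (mu kap b) t.
have [|||h1 h2] := h.
- move=> v z M j hz M0; rewrite smdp_sum; exact: smp_taylor.
- by move=> *; exact: meas_smp.
- move=> *; apply: measurable_funB; apply: measurable_funM => //; exact: meas_smp.
split; first by apply: L1_ext h1 => w; rewrite vvE.
under [X in Ex _ X]funext do rewrite vvE.
by rewrite h2; congr (_ * Ex _ _); apply/funext => w; rewrite vvE.
Qed.

Lemma stein_smPhi kap t b :
  L1 P (fun w => \sum_j G w j * smPhi (vv kap t b w) j) /\
  Ex P (fun w => \sum_j G w j * smPhi (vv kap t b w) j) =
  t * Ex P (fun w => smH (vv kap t b w) Gam).
Proof.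
have h := @stein_vector _ _ _ P _ _ _ _ X e A eN eI smPhi smdPhi 6000
  norm_smPhi_le1 norm_smdPhi_le3 _ _ _ _ (mu kap b) t.
have [|||h1 h2] := h.
- move=> v z M j hz M0; rewrite smdPhi_sum; exact: smPhi_taylor.
- by move=> *; exact: meas_smPhi.
- by move=> *; exact: meas_smdPhi.
split; first by apply: L1_ext h1 => w; rewrite vvE.
under [X in Ex _ X]funext do rewrite vvE.
by rewrite h2; congr (_ * Ex _ _); apply/funext => w; rewrite vvE.
Qed.

Definition Gmax w : R := \big[Num.max/0]_j G w j.

Hypothesis mX : forall i, measurable_fun setT (X i).

Lemma meas_G j : measurable_fun setT (fun w => G w j).
Proof. by apply: meas_sum => i; apply: measurable_funM. Qed.

Lemma meas_sumY j : measurable_fun setT (fun w => sumY w j).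
Proof. by apply: meas_sum => i; exact: measurableT_comp. Qed.

Lemma meas_vv kap t b j : measurable_fun setT (fun w => vv kap t b w j).
Proof.
apply: measurable_funD; last by apply: measurable_funM => //; exact: meas_G.
by apply: measurable_funB => //; apply: measurable_funM => //; exact: meas_sumY.
Qed.

Lemma L1_e i : L1 P (fun w => e i w).
Proof.
apply: (normal_L1_le (eN i) (f := fun x => x) (c := 1)); first exact: measurable_id.
by move=> x; rewrite mul1r norm_le_env.
Qed.

Lemma L1_G j : L1 P (fun w => G w j).
Proof. by apply: L1_sum => i _; apply: L1Z; exact: L1_e. Qed.

Lemma Gmax_ge0 w : 0 <= Gmax w.
Proof. exact: bigmax_ge_id. Qed.

Lemma Gmax_ge w j : G w j <= Gmax w.
Proof. exact: le_bigmax. Qed.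

Lemma L1_Gmax : L1 P Gmax.
Proof.
apply: (L1_le (g := fun w => \sum_j `|G w j|)).
- by apply: meas_bigmax => j; exact: meas_G.
- move=> w; rewrite ger0_norm ?Gmax_ge0//.
  apply: bigmax_le; first exact: sumr_ge0.
  move=> j _; rewrite (bigD1 j)//= -[leLHS]addr0 lerD ?ler_norm//.
  exact: sumr_ge0.
- by apply: L1_sum => j _; apply: L1_norm; exact: L1_G.
Qed.

Lemma L1_smw kap t b : L1 P (fun w => smw (vv kap t b w)).
Proof.
apply: (L1_bnd _ (c := 1)); first by apply: meas_smw; exact: meas_vv.
by move=> w; have /andP[h1 h2] := smw_bounds (vv kap t b w); rewrite ger0_norm.
Qed.

Lemma L1_sm0 kap t b : L1 P (fun w => sm0 (vv kap t b w)).
Proof.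
apply: (L1_bnd _ (c := 1)); first by apply: meas_sm0; exact: meas_vv.
by move=> w; rewrite ger0_norm ?sm0_le1// ltW ?sm0_gt0.
Qed.

Lemma L1_smQ kap t b B : L1 P (fun w => smQ (vv kap t b w) B).
Proof.
apply: L1_sum => j _; apply: L1_sum => k _; apply: L1Z.
apply: (L1_bnd _ (c := 3)); last by move=> w; exact: norm_smdp_le3.
by apply: measurable_funB; apply: measurable_funM => //; apply: meas_smp; exact: meas_vv.
Qed.

Lemma L1_smdPhi kap t b j k : L1 P (fun w => smdPhi (vv kap t b w) j k).
Proof.
apply: (L1_bnd _ (c := 3)); last by move=> w; exact: norm_smdPhi_le3.
by apply: meas_smdPhi; exact: meas_vv.
Qed.

Lemma L1_smH kap t b B : L1 P (fun w => smH (vv kap t b w) B).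
Proof.
by apply: L1_sum => j _; apply: L1_sum => k _; apply: L1Z; exact: L1_smdPhi.
Qed.

Lemma sum_smp_le_Gmax v w : \sum_j G w j * smp v j <= Gmax w.
Proof.
apply: (@le_trans _ _ (smE v (fun=> Gmax w))).
  by apply: ler_sum => j _; rewrite mulrC ler_wpM2l ?smp_ge0// Gmax_ge.
by apply: smE_le_cst => //; exact: Gmax_ge0.
Qed.

(* Nazarov-type anti-concentration, obtained by Gaussian integration by parts:
   for unit variances the correlation matrix has entries at most 1, so the
   quadratic form smQ dominates the logistic density smw. *)
Lemma gauss_anticoncentration (beta D : R) b : 0 < beta ->
  (forall j k, Gam j k <= 1 + D) -> (forall j, 1 - D <= Gam j j) -> 0 <= D ->
  Ex P (fun w => smw (vv 0 beta b w)) <= Ex P Gmax / beta + 2 * D.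
Proof.
move=> b0 h1 h2 D0; have [L e2] := stein_smp 0 beta b.
have k1 : Ex P (fun w => \sum_j G w j * smp (vv 0 beta b w) j) <= Ex P Gmax.
  apply: Ex_le => //; first exact: L1_Gmax.
  by move=> w; exact: sum_smp_le_Gmax.
have k2 : Ex P (fun w => smw (vv 0 beta b w) - 2 * D) <= Ex P (fun w => smQ (vv 0 beta b w) Gam).
  apply: Ex_le => [||w].
  - by apply: L1B; [exact: L1_smw|exact: L1_cst].
  - exact: L1_smQ.
  - exact: smQ_ge.
rewrite ExB ?Ex_cst in k2; [|exact: L1_smw|exact: L1_cst].
rewrite e2 in k1; rewrite -lerBlDr ler_pdivlMr// mulrC.
by apply: le_trans k1; rewrite ler_pM2l.
Qed.

Lemma gram_psd v : 0 <= smE v (fun j => smE v (Gam j)).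
Proof.
have -> : smE v (fun j => smE v (Gam j)) = \sum_i (smE v (A^~ i)) ^+ 2.
  rewrite /smE /gram.
  under eq_bigr => j _.
    under eq_bigr do rewrite mulr_sumr.
    rewrite exchange_big/= mulr_sumr; over.
  rewrite exchange_big/=; apply: eq_bigr => i _.
  rewrite expr2 mulr_suml; apply: eq_bigr => j _.
  by rewrite -mulrA [RHS]mulrCA !mulr_sumr; apply: eq_bigr => k _; ring.
by apply: sumr_ge0 => i _; exact: sqr_ge0.
Qed.

(** lam times the maximum is below the log-sum-exp, which is entropy plus mean energy. The entropy
    is at most ln (|J| + 1). The expected energy is computed by Stein's identity, in which the
    nonnegative quadratic form of [gram] is dropped and only the variances remain. *)
Lemma Ex_Gmax_le (lam s : R) : 0 < lam -> (forall j, Gam j j <= s) -> 0 <= s ->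
  Ex P Gmax <= ln (#|J|.+1%:R) / lam + lam * s.
Proof.
move=> l0 hs s0; have [L e2] := stein_smp 0 lam (fun=> 0).
set v := vv 0 lam (fun=> 0) in L e2.
have k1 : Ex P (fun w => smQ (v w) Gam) <= s.
  apply: Ex_le_cst; first exact: L1_smQ.
  move=> w; rewrite smQE; have := gram_psd (v w).
  by have := smE_le_cst (v w) s0 hs; lra.
have k2 : Ex P Gmax <= Ex P (fun w => lam^-1 * ln (#|J|.+1%:R) + \sum_j G w j * smp (v w) j).
  apply: Ex_le => [||w].
  - exact: L1_Gmax.
  - by apply: L1D => //; exact: L1_cst.
  - have vE j : v w j = lam * G w j by rewrite /v /vv; ring.
    have e3 : smE (v w) (v w) = lam * \sum_j G w j * smp (v w) j.
      by rewrite mulr_sumr; apply: eq_bigr => j _; rewrite vE; ring.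
    have := entropy_le (v w); rewrite e3 => h.
    have hM : lam * Gmax w <= ln (1 + smZ (v w)).
      have Z1 := smZ1_gt0 (v w); have Z0 := smZ_ge0 (v w).
      rewrite -[leLHS]expRK ler_ln ?posrE ?expR_gt0//.
      have : Gmax w = 0 \/ exists j, Gmax w = G w j.
        rewrite /Gmax; elim/big_rec: _ => [|j x _ [->|[k ->]]]; first by left.
          by rewrite /Num.max; case: ifP => _; [left|right; exists j].
        by rewrite /Num.max; case: ifP => _; right; [exists k|exists j].
      move=> [->|[j ->]]; first by rewrite mulr0 expR0; lra.
      rewrite -vE /smZ (bigD1 j)//= addrCA lerDl addr_ge0//.
      by apply: sumr_ge0 => k _; exact: expR_ge0.
    rewrite -(ler_pM2l l0) mulrDr mulrA mulfV ?gt_eqF// mul1r; lra.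
rewrite ExD ?Ex_cst ?e2 in k2 => //; last exact: L1_cst.
apply: le_trans k2 _; rewrite [_^-1 * _]mulrC lerD2l ler_pM2l//.
Qed.

End GaussMax.

(** * Leave-one-out expansion *)

Section LeaveOneOut.
Context d (T : measurableType d) {R : realType} (P : probability T R).
Context dX (TX : measurableType dX) (n : nat) (J : finType).
Variables (X : 'I_n -> T -> TX) (e : 'I_n -> {RV P >-> R}).
Variable A : J -> 'I_n -> R.
Hypothesis mX : forall i, measurable_fun setT (X i).
Variable x0 : TX.
Hypothesis xI : forall i, indep P (X i) (looX X e x0 i).
Variables (y : J -> TX -> R) (Bm : TX -> R).
Hypothesis my : forall j, measurable_fun setT (y j).
Hypothesis Bm0 : forall x, 0 <= Bm x.
Hypothesis yB : forall j x, `|y j x| <= Bm x.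
Variables (Rm : J -> J -> R) (M3 M4 : R).
Hypothesis LB : forall i, L1 P (fun w => Bm (X i w) ^+ 4).
Hypothesis EB : forall i, Ex P (fun w => Bm (X i w) ^+ 4) <= M4.
Hypothesis Ey : forall i j, Ex P (fun w => y j (X i w)) = 0.
Hypothesis Eyy : forall i j k, Ex P (fun w => y j (X i w) * y k (X i w)) = Rm j k.
Hypothesis Ey3 : forall i j, Ex P (fun w => `|y j (X i w)| ^+ 3) <= M3.
Hypothesis Rm1 : forall j k, `|Rm j k| <= 1.

Local Notation vv := (vv X e A y).

Lemma L1_poly i (f : TX -> R) c : measurable_fun setT f ->
  (forall x, `|f x| <= c * (1 + Bm x ^+ 4)) -> L1 P (fun w => f (X i w)).
Proof.
move=> mf h; apply: (L1_le (measurableT_comp mf (mX i)) (fun w => h (X i w))).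
by apply: L1Z; apply: L1D; [exact: L1_cst|exact: LB].
Qed.

Lemma Bm_pow x k : (k <= 4)%N -> Bm x ^+ k <= 1 * (1 + Bm x ^+ 4).
Proof.
move=> k4; rewrite mul1r; have [h|h] := leP (Bm x) 1.
  apply: (@le_trans _ _ 1); first by rewrite exprn_ile1.
  by rewrite lerDl exprn_ge0.
apply: (@le_trans _ _ (Bm x ^+ 4)); last by rewrite lerDr.
by rewrite ler_weXn2l// ltW.
Qed.

Lemma L1_y i j : L1 P (fun w => y j (X i w)).
Proof.
apply: (L1_poly i (c := 1)) => // x; apply: le_trans (yB j x) _.
exact: (Bm_pow x (k := 1)).
Qed.

Lemma L1_yy i j k : L1 P (fun w => y j (X i w) * y k (X i w)).
Proof.
apply: (L1_poly i (f := fun x => y j x * y k x) (c := 1)); first exact: measurable_funM.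
move=> x; rewrite normrM; apply: le_trans (Bm_pow x (k := 2) _) => //.
by rewrite expr2 ler_pM.
Qed.

Lemma L1_y3 i j : L1 P (fun w => `|y j (X i w)| ^+ 3).
Proof.
apply: (L1_poly i (f := fun x => `|y j x| ^+ 3) (c := 1)).
  by apply: measurable_funX; exact: meas_normr.
move=> x; rewrite ger0_norm ?exprn_ge0//; apply: le_trans (Bm_pow x (k := 3) _) => //.
by rewrite lerXn2r// nnegrE.
Qed.

Lemma Ey1 i j : Ex P (fun w => `|y j (X i w)|) <= 1.
Proof.
have L := L1_yy i j j.
apply: (@le_trans _ _ (Ex P (fun w => 1 / 2 + 1 / 2 * (y j (X i w) * y j (X i w))))).
  apply: Ex_le => [||w].
  - by apply: L1_norm; exact: L1_y.
  - by apply: L1D; [exact: L1_cst|exact: L1Z].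
  - have : y j (X i w) * y j (X i w) = `|y j (X i w)| ^+ 2 by rewrite real_normK ?num_real.
    by move=> ->; have := sqr_ge0 (`|y j (X i w)| - 1); lra.
rewrite ExD; [|exact: L1_cst|exact: L1Z].
rewrite Ex_cst ExZ// Eyy.
by have := ler_norm (Rm j j); have := Rm1 j j; lra.
Qed.

Variables (kap t : R) (b : J -> R) (i : 'I_n).

Let vi (V : n.-tuple TX * n.-tuple R) j : R :=
  kap * (\sum_(k | k != i) y j (tnth V.1 k)) - b j + t * \sum_l A j l * tnth V.2 l.

Let mvi j : measurable_fun setT (fun V => vi V j).
Proof.
apply: measurable_funD.
  apply: measurable_funB => //; apply: measurable_funM => //; apply: meas_sum => k.
  apply: measurableT_comp => //.
  exact: measurableT_comp (measurable_tnth _) measurable_fst.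
apply: measurable_funM => //; apply: meas_sum => l; apply: measurable_funM => //.
exact: measurableT_comp (measurable_tnth _) measurable_snd.
Qed.

Definition vloo w : J -> R := vi (looX X e x0 i w).

Lemma vv_loo w : vv kap t b w = fun j => vloo w j + kap * y j (X i w).
Proof.
apply/funext => j; rewrite /vloo /vi /looX /= /vv /sumY (bigD1 i)//= /gaussG.
have -> : \sum_(k < n | k != i) y j (tnth [tuple (if k0 == i then x0 else X k0 w) | k0 < n] k)
   = \sum_(k < n | k != i) y j (X k w).
  by apply: eq_bigr => k /negbTE ki; rewrite tnth_mktuple ki.
have -> : \sum_l A j l * tnth (dataE e w) l = \sum_l A j l * e l w.
  by apply: eq_bigr => l _; rewrite tnth_mktuple.
ring.
Qed.

Lemma meas_vloo j : measurable_fun setT (fun w => vloo w j).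
Proof. by have [_ mV _] := xI i; exact: (measurableT_comp (mvi j) mV). Qed.

Lemma loo_prod (f : TX -> R) (F : (J -> R) -> R) c :
  measurable_fun setT f -> L1 P (fun w => f (X i w)) ->
  (forall v, `|F v| <= c) ->
  (forall d' (T' : measurableType d') (v : T' -> J -> R),
    (forall k, measurable_fun setT (fun w => v w k)) ->
    measurable_fun setT (fun w => F (v w))) ->
  [/\ L1 P (fun w => F (vloo w)), L1 P (fun w => f (X i w) * F (vloo w)) &
  Ex P (fun w => f (X i w) * F (vloo w)) =
    Ex P (fun w => f (X i w)) * Ex P (fun w => F (vloo w))].
Proof.
move=> mf Lf Fc mF.
have mFv : measurable_fun setT (fun w => F (vloo w)) by apply: mF; exact: meas_vloo.
have LfF : L1 P (fun w => f (X i w) * F (vloo w)).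
  apply: L1_le (L1Z c (L1_norm Lf)).
    by apply: measurable_funM => //; exact: measurableT_comp.
  by move=> w; rewrite normrM mulrC ler_wpM2r.
split => //; first exact: (L1_bnd _ (c := c)).
exact: (indep_prod (a := f) (b := fun V => F (vi V)) (xI i) mf (mF _ _ _ mvi) Lf LfF).
Qed.

Definition omega_loo : R := Ex P (fun w => smw (vloo w)).

Lemma norm_smw_le1 (v : J -> R) : `|smw v| <= 1.
Proof. by have /andP[h1 h2] := smw_bounds v; rewrite ger0_norm. Qed.

Lemma L1_smw_loo : L1 P (fun w => smw (vloo w)).
Proof.
apply: (L1_bnd _ (c := 1)); first by apply: meas_smw; exact: meas_vloo.
by move=> w; exact: norm_smw_le1.
Qed.

(** The weights depend on the leave-one-out vector only, so independence replaces each f_j(X_i) by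
    its mean before the sum over j is taken. A moment bound for single coordinates is enough, and
    the remaining weights add up to the window mass. *)
Lemma loo_weighted (f : J -> TX -> R) c :
  (forall j, measurable_fun setT (f j)) -> (forall j, L1 P (fun w => f j (X i w))) ->
  (forall j, Ex P (fun w => f j (X i w)) <= c) ->
  L1 P (fun w => sm0 (vloo w) * smE (vloo w) (f ^~ (X i w))) /\
  Ex P (fun w => sm0 (vloo w) * smE (vloo w) (f ^~ (X i w))) <= c * omega_loo.
Proof.
move=> mf Lf fc.
have hp j := loo_prod (mf j) (Lf j) (fun v => norm_smPhi_le1 v j)
  (fun _ _ _ h => meas_smPhi h j).
have e1 w : sm0 (vloo w) * smE (vloo w) (f ^~ (X i w)) =
    \sum_j f j (X i w) * smPhi (vloo w) j.
  by rewrite /smE mulr_sumr; apply: eq_bigr => j _; rewrite /smPhi; ring.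
have LL : L1 P (fun w => \sum_j f j (X i w) * smPhi (vloo w) j).
  by apply: L1_sum => j _; have [] := hp j.
split; first by apply: L1_ext LL => w.
rewrite [X in Ex _ X](_ : _ = fun w => \sum_j f j (X i w) * smPhi (vloo w) j); last exact/funext.
rewrite Ex_sum; last by move=> j _; have [] := hp j.
have -> : omega_loo = \sum_j Ex P (fun w => smPhi (vloo w) j).
  rewrite -Ex_sum; last by move=> j _; have [] := hp j.
  by congr Ex; apply/funext => w; rewrite /smw -smp_sum mulr_sumr.
rewrite mulr_sumr; apply: ler_sum => j _; have [_ _ ->] := hp j.
by rewrite ler_wpM2r// Ex_ge0// => w; exact: smPhi_ge0.
Qed.

(** The first line is the error of expanding the gradient around the leave-one-out vector; the
    second, with its extra factor kap, comes from moving the Hessian back to the full vector. *)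
Definition Err (o : R) : R :=
  9000 * kap ^+ 2 * (M3 * o) + 5 * `|kap| ^+ 3 * M4 +
  `|kap| * (130 * 1000 * `|kap| * (1 * o) + 6 * `|kap| ^+ 4 * M4).

(** Around the leave-one-out vector the zeroth-order term has mean 0 because the summand is centred,
    and in the first-order term independence replaces y_j y_k by [Rm j k]. The resulting Hessian
    term is then compared with the one at the full vector. *)
Lemma loo_bound :
  L1 P (fun w => \sum_j y j (X i w) * smPhi (vv kap t b w) j) /\
  `|Ex P (fun w => \sum_j y j (X i w) * smPhi (vv kap t b w) j)
     - kap * Ex P (fun w => smH (vv kap t b w) Rm)| <= Err omega_loo.
Proof.
pose Y w j := y j (X i w).
have hphi j := loo_prod (my j) (L1_y i j) (fun v => norm_smPhi_le1 v j)
  (fun _ _ _ h => meas_smPhi h j).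
have hd j k := loo_prod (measurable_funM (my j) (my k)) (L1_yy i j k)
  (fun v => norm_smdPhi_le3 v j k) (fun _ _ _ h => meas_smdPhi h j k).
have mvv j : measurable_fun setT (fun w => vv kap t b w j) by exact: meas_vv.
have LvH : L1 P (fun w => smH (vv kap t b w) Rm).
  apply: L1_sum => j _; apply: L1_sum => k _; apply: L1Z.
  by apply: (L1_bnd _ (c := 3)); [exact: meas_smdPhi|move=> w; exact: norm_smdPhi_le3].
have LT : L1 P (fun w => \sum_j Y w j * smPhi (vv kap t b w) j).
  apply: L1_sum => j _; apply: L1_le (L1_norm (L1_y i j)).
    apply: measurable_funM; last exact: meas_smPhi.
    exact: measurableT_comp.
  by move=> w; rewrite normrM ler_piMr// norm_smPhi_le1.
split=> //.
pose f0 w := \sum_j Y w j * smPhi (vloo w) j.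
pose f1 w := smH (vloo w) (fun j k => Y w j * Y w k).
pose f2 w := smH (vloo w) Rm.
have L0 : L1 P f0 by apply: L1_sum => j _; have [] := hphi j.
have E0 : Ex P f0 = 0.
  rewrite Ex_sum; last by move=> j _; have [] := hphi j.
  by rewrite big1// => j _; have [_ _ ->] := hphi j; rewrite Ey mul0r.
have L1' : L1 P f1 by apply: L1_sum => j _; apply: L1_sum => k _; have [] := hd j k.
have L2 : L1 P f2.
  by apply: L1_sum => j _; apply: L1_sum => k _; apply: L1Z; have [] := hd j k.
have E1 : Ex P f1 = Ex P f2.
  rewrite Ex_sum; last by move=> j _; apply: L1_sum => k _; have [] := hd j k.
  rewrite Ex_sum; last by move=> j _; apply: L1_sum => k _; apply: L1Z; have [] := hd j k.
  apply: eq_bigr => j _; rewrite Ex_sum; last by move=> k _; have [] := hd j k.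
  rewrite Ex_sum; last by move=> k _; apply: L1Z; have [] := hd j k.
  apply: eq_bigr => k _; have [l _ ->] := hd j k.
  by rewrite ExZ// Eyy.
have [La Ea] := loo_weighted (f := fun j x => `|y j x| ^+ 3)
  (fun j => measurable_funX 3 (meas_normr (my j))) (L1_y3 i) (Ey3 i).
have [Lb Eb] := loo_weighted (f := fun j x => `|y j x|)
  (fun j => meas_normr (my j)) (fun j => L1_norm (L1_y i j)) (Ey1 i).
pose r1 w := 9000 * kap ^+ 2 * (sm0 (vloo w) * smE (vloo w) (fun j => `|Y w j| ^+ 3))
  + 5 * `|kap| ^+ 3 * Bm (X i w) ^+ 4.
pose r2 w := 130 * 1000 * `|kap| * (sm0 (vloo w) * smE (vloo w) (fun j => `|Y w j|))
  + 6 * `|kap| ^+ 4 * Bm (X i w) ^+ 4.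
have Lr1 : L1 P r1 by apply: L1D; apply: L1Z => //; exact: LB.
have Lr2 : L1 P r2 by apply: L1D; apply: L1Z => //; exact: LB.
have B1 : `|Ex P (fun w => \sum_j Y w j * smPhi (vv kap t b w) j) - kap * Ex P f2| <= Ex P r1.
  pose Tw w := \sum_j Y w j * smPhi (vv kap t b w) j.
  have -> : Ex P Tw - kap * Ex P f2 = Ex P (fun w => Tw w - f0 w - kap * f1 w).
    by rewrite ExB; [rewrite ExB// ExZ// E0 E1 subr0|exact: L1B|exact: L1Z].
  apply: Ex_norm_le => //; first by apply: L1B; [exact: L1B|exact: L1Z].
  by move=> w; rewrite /Tw vv_loo; apply: smPhi_sum_taylor => [j|]; [exact: yB|exact: Bm0].
have B2 : `|Ex P (fun w => smH (vv kap t b w) Rm) - Ex P f2| <= Ex P r2.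
  rewrite -ExB//; apply: Ex_norm_le => //; first exact: L1B.
  by move=> w; rewrite vv_loo; apply: smH_taylor => [j||//]; [exact: yB|exact: Bm0].
have E3 : Ex P r1 <= 9000 * kap ^+ 2 * (M3 * omega_loo) + 5 * `|kap| ^+ 3 * M4.
  rewrite ExD; [|exact: L1Z|by apply: L1Z; exact: LB].
  rewrite (ExZ _ La) (ExZ _ (LB i)).
  apply: lerD; [apply: (ler_wpM2l _ Ea)|apply: (ler_wpM2l _ (EB i))].
    by apply: mulr_ge0 (sqr_ge0 _); exact: ler0n.
  by apply: mulr_ge0; [exact: ler0n|exact: exprn_ge0].
have E4 : Ex P r2 <= 130 * 1000 * `|kap| * (1 * omega_loo) + 6 * `|kap| ^+ 4 * M4.
  rewrite ExD; [|exact: L1Z|by apply: L1Z; exact: LB].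
  rewrite (ExZ _ Lb) (ExZ _ (LB i)).
  apply: lerD; [apply: (ler_wpM2l _ Eb)|apply: (ler_wpM2l _ (EB i))].
    by apply: mulr_ge0 (normr_ge0 _); apply: mulr_ge0; exact: ler0n.
  by apply: mulr_ge0; [exact: ler0n|exact: exprn_ge0].
set a := Ex P (fun w => smH _ _) in B2 *.
have -> : forall q, q - kap * a = (q - kap * Ex P f2) - kap * (a - Ex P f2).
  by move=> q; ring.
apply: le_trans (ler_normB _ _) _; rewrite normrM /Err.
apply: lerD; first exact: le_trans B1 E3.
by rewrite ler_wpM2l//; exact: le_trans B2 E4.
Qed.

(** If |kap| B <= 1, [smw_stable] applies; otherwise the logistic density is at most 1 <= (|kap|
    B)^4. *)
Lemma omega_loo_le :
  omega_loo <= 64 * Ex P (fun w => smw (vv kap t b w)) + `|kap| ^+ 4 * M4.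
Proof.
have Lw : L1 P (fun w => smw (vv kap t b w)).
  apply: (L1_bnd _ (c := 1)); last by move=> w; exact: norm_smw_le1.
  by apply: meas_smw => j; exact: meas_vv.
apply: (@le_trans _ _ (Ex P (fun w => 64 * smw (vv kap t b w) + `|kap| ^+ 4 * Bm (X i w) ^+ 4))).
  apply: Ex_le; first exact: L1_smw_loo.
    by apply: L1D; apply: L1Z => //; exact: LB.
  move=> w; rewrite vv_loo.
  have /andP[w0 w1] := smw_bounds (vloo w).
  have /andP[w0' _] := smw_bounds (fun j => vloo w j + kap * y j (X i w)).
  have [h|h] := leP (`|kap| * Bm (X i w)) 1.
    rewrite -[leLHS]addr0 lerD ?mulr_ge0 ?exprn_ge0//; apply: smw_stable => j.
    by rewrite normrM (le_trans _ h)// ler_wpM2l.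
  have u1 : 1 <= `|kap| ^+ 4 * Bm (X i w) ^+ 4 by rewrite -exprMn exprn_ege1// ltW.
  apply: (le_trans w1); apply: (le_trans u1); rewrite lerDr; exact: mulr_ge0.
rewrite ExD; [|exact: L1Z|by apply: L1Z; exact: LB].
  rewrite (ExZ _ Lw) (ExZ _ (LB i)).
by rewrite lerD2l ler_wpM2l ?exprn_ge0.
Qed.

End LeaveOneOut.

(** * Interpolation *)

Section RealPaths.
Context {R : realType}.
Implicit Types x h : R.

Lemma lipschitz_derive (f df : R -> R) (M : R) :
  (forall x, is_derive x 1 f (df x)) -> (forall x, `|df x| <= M) ->
  forall a b, `|f b - f a| <= M * `|b - a|.
Proof.
move=> fd dM a b; wlog ab : a b / a <= b => [hw|].
  have [/hw //|/ltW/hw] := leP a b.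
  by rewrite distrC [`|a - b|]distrC.
have [|c _ ->] := MVT_segment ab (fun x _ => fd x).
  apply: continuous_subspaceT => x; apply/differentiable_continuous/derivable1_diffP.
  by case: (fd x).
by rewrite normrM ler_wpM2r.
Qed.

Lemma sin_le_norm x : `|sin x| <= `|x|.
Proof.
have := lipschitz_derive (fun y => is_derive_sin y) (fun y => cos_max y) 0 x.
by rewrite sin0 !subr0 mul1r.
Qed.

Lemma cos_sub1 h : `|cos h - 1| <= h ^+ 2.
Proof.
have -> : cos h = 1 - 2 * sin (h / 2) ^+ 2.
  by rewrite [in LHS](splitr h) cosD -!expr2 cos2sin2; ring.
have -> : 1 - 2 * sin (h / 2) ^+ 2 - 1 = - (2 * sin (h / 2) ^+ 2) by ring.
have k := sqr_le_norm (sin_le_norm (h / 2)).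
rewrite real_normK ?num_real// in k.
have s0 := sqr_ge0 (sin (h / 2)); have := sqr_ge0 h.
rewrite normrN ger0_norm; last by rewrite mulr_ge0.
lra.
Qed.

Lemma sin_sub h : `|sin h - h| <= 2 * h ^+ 2.
Proof.
have h0 := normr_ge0 h.
have hh : h ^+ 2 = `|h| ^+ 2 by rewrite real_normK ?num_real.
have [h1|h1] := leP `|h| 1; last first.
  apply: le_trans (ler_normB _ _) _; have := sin_le_norm h; rewrite hh; nra.
pose f x := sin x - x.
have fd x : is_derive x 1 f (cos x - 1).
  exact: (is_deriveB (is_derive_sin x) (is_derive_id x (1 : R))).
have : `|f h - f 0| <= h ^+ 2.
  wlog : h h0 h1 hh / 0 <= h => [hw|hp].
    have [hp|hn] := leP 0 h; first exact: hw.
    have := hw (- h); rewrite normrN sqrrN => /(_ h0 h1 hh).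
    have -> : f (- h) = - f h by rewrite /f sinN; ring.
    have -> : f 0 = 0 by rewrite /f sin0 subrr.
    by rewrite !subr0 normrN; apply; lra.
  have [|c] := MVT_segment hp (fun x _ => fd x).
    apply: continuous_subspaceT => x; apply/differentiable_continuous/derivable1_diffP.
    by case: (fd x).
  rewrite in_itv/= => /andP[c0 c1 ->]; rewrite subr0 normrM.
  have k := cos_sub1 c.
  have : c ^+ 2 <= h by rewrite expr2; rewrite ger0_norm// in h1; nra.
  by move=> k2; rewrite hh expr2 ler_wpM2r//; rewrite (ger0_norm hp); lra.
have -> : f 0 = 0 by rewrite /f sin0 subrr.
by rewrite subr0 /f; have := sqr_ge0 h; lra.
Qed.

Lemma cos_taylor x h : `|cos (x + h) - cos x + h * sin x| <= 3 * h ^+ 2.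
Proof.
have -> : cos (x + h) - cos x + h * sin x = cos x * (cos h - 1) - sin x * (sin h - h).
  by rewrite cosD; ring.
apply: le_trans (ler_normB _ _) _; rewrite !normrM.
have := ler_pM (normr_ge0 _) (normr_ge0 _) (cos_max x) (cos_sub1 h).
have := ler_pM (normr_ge0 _) (normr_ge0 _) (sin_max x) (sin_sub h); lra.
Qed.

Lemma sin_taylor x h : `|sin (x + h) - sin x - h * cos x| <= 3 * h ^+ 2.
Proof.
have -> : sin (x + h) - sin x - h * cos x = sin x * (cos h - 1) + cos x * (sin h - h).
  by rewrite sinD; ring.
apply: le_trans (ler_normD _ _) _; rewrite !normrM.
have := ler_pM (normr_ge0 _) (normr_ge0 _) (sin_max x) (cos_sub1 h).
have := ler_pM (normr_ge0 _) (normr_ge0 _) (cos_max x) (sin_sub h); lra.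
Qed.

Lemma cos_lip x h : `|cos (x + h) - cos x| <= `|h|.
Proof.
have dM (y : R) : `|- sin y| <= 1 by rewrite normrN sin_max.
have := lipschitz_derive (fun y => is_derive_cos y) dM x (x + h).
by rewrite mul1r addrAC subrr add0r.
Qed.

Lemma sin_lip x h : `|sin (x + h) - sin x| <= `|h|.
Proof.
have := lipschitz_derive (fun y => is_derive_sin y) (fun y => cos_max y) x (x + h).
by rewrite mul1r addrAC subrr add0r.
Qed.

(** A mean value inequality by subdivision: over N equal steps the quadratic remainders add up to C
    L^2 / N, which is made smaller than any eps. The expansion is all that relates D to f. *)
Lemma path_bound (f D : R -> R) (B C a b : R) : 0 <= C -> a <= b ->
  (forall x h, `|f (x + h) - f x - h * D x| <= C * h ^+ 2) ->
  (forall x, a <= x <= b -> `|D x| <= B) -> `|f b - f a| <= B * (b - a).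
Proof.
move=> C0 ab fT DB; set L := b - a.
have L0 : 0 <= L by rewrite /L; lra.
apply/ler_addgt0Pr => eps e0.
pose N := (Num.truncn (C * L ^+ 2 / eps)).+1.
have N0 : 0 < N%:R :> R by rewrite ltr0n.
pose h := L / N%:R.
have h0 : 0 <= h by rewrite divr_ge0// ltW.
have Nh : N%:R * h = L by rewrite /h; field; rewrite gt_eqF.
have step k : (k <= N)%N -> `|f (a + k%:R * h) - f a| <= k%:R * (B * h + C * h ^+ 2).
  elim: k => [|k ih] kN; first by rewrite !mul0r addr0 subrr normr0.
  have {}ih := ih (ltnW kN).
  have -> : a + k.+1%:R * h = a + k%:R * h + h by rewrite -natr1; ring.
  have xab : a <= a + k%:R * h <= b.
    have : k%:R * h <= N%:R * h by rewrite ler_wpM2r// ler_nat ltnW.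
    have : 0 <= k%:R * h by rewrite mulr_ge0.
    by rewrite Nh /L => ? ?; apply/andP; split; lra.
  set x := a + k%:R * h in ih xab *.
  have -> : f (x + h) - f a = (f (x + h) - f x - h * D x) + (h * D x + (f x - f a)) by ring.
  apply: le_trans (ler_normD _ _) _; apply: le_trans (lerD (lexx _) (ler_normD _ _)) _.
  rewrite [X in _ + (X + _)]normrM (ger0_norm h0); have := fT x h.
  have : h * `|D x| <= h * B by rewrite ler_wpM2l// DB.
  by rewrite -natr1; lra.
have := step N (leqnn _); rewrite Nh.
have -> : a + L = b by rewrite /L; ring.
move=> hh; apply: le_trans hh _.
have -> : N%:R * (B * h + C * h ^+ 2) = B * L + C * L ^+ 2 / N%:R.
  by rewrite /h; field; rewrite gt_eqF.
rewrite lerD2l ler_pdivrMr//; have := truncnS_gt (C * L ^+ 2 / eps).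
by rewrite -/N ltr_pdivrMr// => /ltW; rewrite [eps * _]mulrC.
Qed.

End RealPaths.

Section SquareIntegrable.
Context d (T : measurableType d) {R : realType} (P : probability T R).
Implicit Types f g : T -> R.

Definition L2 f := measurable_fun setT f /\ L1 P (fun w => f w ^+ 2).

Lemma L2_L1 f : L2 f -> L1 P f.
Proof.
move=> [mf lf]; apply: (L1_le (g := fun w => 1 + f w ^+ 2)) => //.
  move=> w; rewrite -real_normK ?num_real//.
  by have := sqr_ge0 (`|f w| - 1); have := normr_ge0 (f w); nra.
by apply: L1D => //; exact: L1_cst.
Qed.

Lemma L2D f g : L2 f -> L2 g -> L2 (fun w => f w + g w).
Proof.
move=> [mf lf] [mg lg]; split; first exact: measurable_funD.
apply: (L1_le (g := fun w => 2 * f w ^+ 2 + 2 * g w ^+ 2)).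
- by apply: measurable_funX; exact: measurable_funD.
- by move=> w; rewrite ger0_norm ?sqr_ge0//; have := sqr_ge0 (f w - g w); nra.
- by apply: L1D; exact: L1Z.
Qed.

Lemma L2Z c f : L2 f -> L2 (fun w => c * f w).
Proof.
move=> [mf lf]; split; first exact: measurable_funM.
by apply: L1_ext (L1Z (c ^+ 2) lf) => w; rewrite exprMn.
Qed.

Lemma L2_norm f : L2 f -> L2 (fun w => `|f w|).
Proof.
move=> [mf lf]; split; first exact: meas_normr.
by apply: L1_ext lf => w; rewrite real_normK ?num_real.
Qed.

Lemma L2_sum (I : Type) (r : seq I) (p : pred I) (F : I -> T -> R) :
  (forall i, L2 (F i)) -> L2 (fun w => \sum_(i <- r | p i) F i w).
Proof.
move=> h; split; first by apply: meas_sum => i; have [] := h i.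
elim: r => [|i r ih].
  by apply: L1_ext (L1_cst P 0) => w; rewrite big_nil expr0n.
have [pi|pi] := boolP (p i).
  have [_ l] : L2 (fun w => F i w + \sum_(j <- r | p j) F j w).
    by apply: L2D => //; split=> //; apply: meas_sum => j; have [] := h j.
  by apply: L1_ext l => w; rewrite big_cons pi.
by apply: L1_ext ih => w; rewrite big_cons (negbTE pi).
Qed.

End SquareIntegrable.

(** * Derivative of the smoothed probability along the path *)

Section GaussianApproximation.
Context d (T : measurableType d) {R : realType} (P : probability T R).
Context dX (TX : measurableType dX) (n : nat) (J : finType).
Variables (X : 'I_n -> T -> TX) (e : 'I_n -> {RV P >-> R}).
Variable A : J -> 'I_n -> R.
Hypothesis n0 : (0 < n)%N.
Hypothesis eN : forall i, standard_normal (e i).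
Hypothesis eI : forall i, indep P (e i) (looE X e i).
Hypothesis mX : forall i, measurable_fun setT (X i).
Variable x0 : TX.
Hypothesis xI : forall i, indep P (X i) (looX X e x0 i).
Variables (y : J -> TX -> R) (Bm : TX -> R).
Hypothesis my : forall j, measurable_fun setT (y j).
Hypothesis Bm0 : forall x, 0 <= Bm x.
Hypothesis yB : forall j x, `|y j x| <= Bm x.
Variables (Rm : J -> J -> R) (M3 M4 : R).
Hypothesis LB : forall i, L1 P (fun w => Bm (X i w) ^+ 4).
Hypothesis EB : forall i, Ex P (fun w => Bm (X i w) ^+ 4) <= M4.
Hypothesis Ey : forall i j, Ex P (fun w => y j (X i w)) = 0.
Hypothesis Eyy : forall i j k, Ex P (fun w => y j (X i w) * y k (X i w)) = Rm j k.
Hypothesis Ey3 : forall i j, Ex P (fun w => `|y j (X i w)| ^+ 3) <= M3.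
Hypothesis Rm1 : forall j k, `|Rm j k| <= 1.
Hypothesis Rd1 : forall j, Rm j j = 1.
Hypothesis M31 : 1 <= M3.

Local Notation vv := (vv X e A y).
Local Notation sY := (sumY X y).
Local Notation G := (gaussG e A).

Variables (D beta : R) (b : J -> R).
Hypothesis D0 : 0 <= D.
Hypothesis GD : forall j k, `|gram A j k - Rm j k| <= D.
Hypothesis b0 : 0 < beta.

Let rn : R := (Num.sqrt n%:R)^-1.

Let nR : 0 < n%:R :> R. Proof. by rewrite ltr0n. Qed.
Let rn0 : 0 < rn. Proof. by rewrite invr_gt0 sqrtr_gt0. Qed.
Let rn2 : rn ^+ 2 * n%:R = 1.
Proof. by rewrite exprVn sqr_sqrtr ?ltW// mulVf// gt_eqF. Qed.
Let rn1 : rn <= 1.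
Proof.
rewrite /rn invf_le1 ?sqrtr_gt0// -[leLHS](sqrtr1 R) ler_sqrt//.
by rewrite ler1n.
Qed.

(** At th = 0 this is the normalized sum, at th = pi / 2 the Gaussian field, and cos^2 + sin^2 = 1
    keeps the covariance along the path, up to the mismatch D. The variable tau shifts all
    thresholds at once; window masses are increments in tau. *)
Definition vt (th tau : R) : T -> J -> R :=
  vv (beta * cos th * rn) (beta * sin th) (fun j => beta * (b j + tau)).
Definition phi th tau : R := Ex P (fun w => sm0 (vt th tau w)).
Let dv th w j : R := beta * (- sin th * rn * sY w j + cos th * G w j).
Definition Dphi th tau : R := - Ex P (fun w => \sum_j dv th w j * smPhi (vt th tau w) j).

Let mvt th tau j : measurable_fun setT (fun w => vt th tau w j).
Proof. exact: meas_vv. Qed.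

Let Nm w : R := \sum_j (`|sY w j| + `|G w j|).

Let L2y i j : L2 P (fun w => y j (X i w)).
Proof.
split; first exact: measurableT_comp.
apply: L1_ext (L1_yy mX my Bm0 yB LB i j j) => w; exact: expr2.
Qed.

Let L2e i : L2 P (fun w => e i w).
Proof.
split; first exact: measurable_funPT.
apply: (normal_L1_le (eN i) (f := fun x => x ^+ 2) (c := 1)).
  exact: measurable_funX.
by move=> x; rewrite mul1r ger0_norm ?sqr_ge0// sqr_le_env.
Qed.

Let L2S j : L2 P (fun w => sY w j).
Proof. by apply: L2_sum => i; exact: L2y. Qed.

Let L2G j : L2 P (fun w => G w j).
Proof. by apply: L2_sum => i; apply: L2Z; exact: L2e. Qed.

Let L2N : L2 P Nm.
Proof. by apply: L2_sum => j; apply: L2D; apply: L2_norm; [exact: L2S|exact: L2G]. Qed.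

Let Nm_ge w j : `|sY w j| + `|G w j| <= Nm w.
Proof.
by rewrite /Nm (bigD1 j)//= lerDl; apply: sumr_ge0 => k _; rewrite addr_ge0.
Qed.

Let Nm0 w : 0 <= Nm w.
Proof. by apply: sumr_ge0 => k _; rewrite addr_ge0. Qed.

Let LSPhi j th tau : L1 P (fun w => sY w j * smPhi (vt th tau w) j).
Proof.
apply: L1_le (L1_norm (L2_L1 (L2S j))).
  by apply: measurable_funM; [have [] := L2S j|exact: meas_smPhi].
by move=> w; rewrite normrM ler_piMr// norm_smPhi_le1.
Qed.

Let LGPhi j th tau : L1 P (fun w => G w j * smPhi (vt th tau w) j).
Proof.
apply: L1_le (L1_norm (L2_L1 (L2G j))).
  by apply: measurable_funM; [have [] := L2G j|exact: meas_smPhi].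
by move=> w; rewrite normrM ler_piMr// norm_smPhi_le1.
Qed.

Let dvE th tau w : \sum_j dv th w j * smPhi (vt th tau w) j =
  - (beta * sin th * rn) * (\sum_j sY w j * smPhi (vt th tau w) j) +
  beta * cos th * (\sum_j G w j * smPhi (vt th tau w) j).
Proof.
by rewrite !mulr_sumr -big_split/=; apply: eq_bigr => j _; rewrite /dv; ring.
Qed.

Let LSs th tau : L1 P (fun w => \sum_j sY w j * smPhi (vt th tau w) j).
Proof. by apply: L1_sum => j _; exact: LSPhi. Qed.

Let LGs th tau : L1 P (fun w => \sum_j G w j * smPhi (vt th tau w) j).
Proof. by apply: L1_sum => j _; exact: LGPhi. Qed.

Let LdvPhi th tau : L1 P (fun w => \sum_j dv th w j * smPhi (vt th tau w) j).
Proof.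
apply: L1_ext (L1D (L1Z (- (beta * sin th * rn)) (LSs th tau))
  (L1Z (beta * cos th) (LGs th tau))) => w.
exact/esym/dvE.
Qed.

Let Lsm0 th tau : L1 P (fun w => sm0 (vt th tau w)).
Proof. exact: L1_sm0. Qed.

(** The constant comes from the first and second moments of [Nm] and may be large; it is uniform in
    th and tau and disappears in [path_bound]. *)
Lemma phi_taylor : exists2 C, 0 <= C & forall tau th h,
  `|phi (th + h) tau - phi th tau - h * Dphi th tau| <= C * h ^+ 2.
Proof.
pose q w := 3000 * beta ^+ 2 * Nm w ^+ 2 + 3 * beta * Nm w.
have k3 : 0 <= 3000 * beta ^+ 2 by apply: mulr_ge0 (sqr_ge0 _); exact: ler0n.
have Lq : L1 P q.
  by apply: L1D; apply: L1Z; [have [] := L2N|exact: L2_L1].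
exists (Ex P q).
  apply: Ex_ge0 => w; apply: addr_ge0; apply: mulr_ge0 => //; first exact: sqr_ge0.
  by apply: mulr_ge0 => //; exact: ltW.
move=> tau th h.
have -> : phi (th + h) tau - phi th tau - h * Dphi th tau =
  Ex P (fun w => sm0 (vt (th + h) tau w) - sm0 (vt th tau w) +
    h * \sum_j dv th w j * smPhi (vt th tau w) j).
  by rewrite ExD; [rewrite ExB// ExZ// mulrN opprK|exact: L1B|exact: L1Z].
rewrite mulrC -ExZ//; apply: Ex_norm_le; [|exact: L1Z|].
  by apply: L1D; [exact: L1B|exact: L1Z].
move=> w.
pose z j := vt (th + h) tau w j - vt th tau w j.
have ez : vt (th + h) tau w = fun j => vt th tau w j + z j.
  by apply/funext => j; rewrite /z; ring.
have zE j : z j = beta * ((cos (th + h) - cos th) * rn * sY w j + (sin (th + h) - sin th) * G w j).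
  by rewrite /z /vt /vv; ring.
have hN := mulr_ge0 (normr_ge0 h) (Nm0 w).
have rS j : `|rn * sY w j| <= `|sY w j|.
  by rewrite normrM gtr0_norm// ler_piMl.
have z1 j : `|z j| <= beta * (`|h| * Nm w).
  rewrite zE normrM gtr0_norm// ler_pM2l//; apply: le_trans (ler_normD _ _) _.
  rewrite -mulrA [`|_ * (rn * _)|]normrM [`|_ * G w j|]normrM.
  have k1 := ler_pM (normr_ge0 _) (normr_ge0 _) (cos_lip th h) (rS j).
  have k2 := ler_wpM2r (normr_ge0 (G w j)) (sin_lip th h).
  apply: le_trans (lerD k1 k2) _; rewrite -mulrDr ler_wpM2l//.
have z2 j : `|z j - h * dv th w j| <= 3 * beta * Nm w * h ^+ 2.
  have -> : z j - h * dv th w j = beta * ((cos (th + h) - cos th + h * sin th) * (rn * sY w j) +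
     (sin (th + h) - sin th - h * cos th) * G w j) by rewrite zE /dv; ring.
  rewrite normrM gtr0_norm// (_ : 3 * beta * Nm w * h ^+ 2 = beta * (3 * h ^+ 2 * Nm w)); last by ring.
  rewrite ler_pM2l//; apply: le_trans (ler_normD _ _) _; rewrite normrM [`|_ * G w j|]normrM.
  have k1 := ler_pM (normr_ge0 _) (normr_ge0 _) (cos_taylor th h) (rS j).
  have k2 := ler_wpM2r (normr_ge0 (G w j)) (sin_taylor th h).
  apply: le_trans (lerD k1 k2) _; rewrite -mulrDr ler_wpM2l//.
  by apply: mulr_ge0 => //; exact: sqr_ge0.
have S := sm0_taylor (vt th tau w) z1 (mulr_ge0 (ltW b0) hN).
rewrite -ez in S.
have es : sm0 (vt th tau w) * smE (vt th tau w) z = \sum_j z j * smPhi (vt th tau w) j.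
  by rewrite /smE mulr_sumr; apply: eq_bigr => j _; rewrite /smPhi; ring.
have S2 : `|\sum_j (z j - h * dv th w j) * smPhi (vt th tau w) j| <= 3 * beta * Nm w * h ^+ 2.
  apply: le_trans (ler_norm_sum _ _ _) _.
  apply: (@le_trans _ _ (\sum_j 3 * beta * Nm w * h ^+ 2 * smPhi (vt th tau w) j)).
    by apply: ler_sum => j _; rewrite normrM (ger0_norm (smPhi_ge0 _ _)) ler_wpM2r ?smPhi_ge0.
  rewrite -mulr_sumr ler_piMr//.
    apply: mulr_ge0 (sqr_ge0 _); apply: mulr_ge0 (Nm0 w); apply: mulr_ge0 => //; exact: ltW.
  rewrite /smPhi -mulr_sumr smp_sum -/(smw _); by have /andP[] := smw_bounds (vt th tau w).
set a := sm0 (vt (th + h) tau w) in S *; set c := sm0 (vt th tau w) in S *.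
have -> : a - c + h * \sum_j dv th w j * smPhi (vt th tau w) j =
  (a - c + c * smE (vt th tau w) z) - \sum_j (z j - h * dv th w j) * smPhi (vt th tau w) j.
  have -> : \sum_j (z j - h * dv th w j) * smPhi (vt th tau w) j =
      \sum_j z j * smPhi (vt th tau w) j - h * \sum_j dv th w j * smPhi (vt th tau w) j.
    by rewrite mulr_sumr -sumrB; apply: eq_bigr => j _; ring.
  by rewrite es; ring.
apply: le_trans (ler_normB _ _) _; apply: le_trans (lerD S S2) _.
have hh : `|h| ^+ 2 = h ^+ 2 by rewrite real_normK ?num_real.
rewrite /q !exprMn hh le_eqVlt; apply/orP; left; apply/eqP; ring.
Qed.

(** A round number above 64 * (9000 + 130000), where 64 is the stability factor of the window mass
    and the other numbers are those of [Err]. *)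
Definition cK : R := 1000 * 1000 * 10.
(** The window mass is multiplied by the covariance mismatch and by the third-order error beta^3 M3
    / sqrt n; [K2] collects the contribution of large increments. *)
Definition K1 : R := 3 * beta ^+ 2 * D + cK * (beta ^+ 3 * rn * M3).
Definition K2 : R := cK * (beta ^+ 4 * M4 / n%:R).

Hypothesis kap1 : beta * rn <= 1.
Hypothesis kapM3 : (beta * rn) ^+ 3 * M3 <= 1.

Let M40 : 0 <= M4.
Proof.
apply: le_trans (EB (Ordinal n0)); apply: Ex_ge0 => w; exact: exprn_ge0.
Qed.

Let Err_le k o W : `|k| <= beta * rn -> 0 <= W ->
  0 <= o -> o <= 64 * W + `|k| ^+ 4 * M4 ->
  Err M3 M4 k o <= cK * ((beta * rn) ^+ 2 * M3 * W + (beta * rn) ^+ 3 * M4).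
Proof.
move=> hk W0 o0 ho; rewrite /Err.
have kap1' := kap1; have kapM3' := kapM3.
set k0 := beta * rn in hk kap1' kapM3' *.
have ka := normr_ge0 k; have -> : k ^+ 2 = `|k| ^+ 2 by rewrite real_normK ?num_real.
set kk := `|k| in hk ho ka *.
have k00 : 0 <= k0 by lra.
have m30 : 0 <= M3 by have := M31; lra.
have p2 : kk ^+ 2 <= k0 ^+ 2 by rewrite lerXn2r ?nnegrE.
have p3 : kk ^+ 3 <= k0 ^+ 3 by rewrite lerXn2r ?nnegrE.
have p4 : kk ^+ 4 <= k0 ^+ 4 by rewrite lerXn2r ?nnegrE.
have p5 : kk * kk ^+ 4 <= k0 ^+ 3.
  apply: (@le_trans _ _ (kk ^+ 3)) => //; rewrite (_ : kk * kk ^+ 4 = kk ^+ 3 * kk ^+ 2); last by ring.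
  by rewrite ler_piMr ?exprn_ge0// exprn_ile1// (le_trans hk).
have ho' : o <= 64 * W + k0 ^+ 4 * M4.
  by apply: le_trans ho _; rewrite lerD2l ler_wpM2r.
have q1 : kk ^+ 2 * (M3 * o) <= k0 ^+ 2 * (M3 * (64 * W + k0 ^+ 4 * M4)).
  apply: (ler_pM (sqr_ge0 _) (mulr_ge0 m30 o0) p2); exact: ler_wpM2l.
have q2 : kk * (kk * o) <= kk ^+ 2 * (M3 * o).
  rewrite mulrA -expr2 ler_wpM2l ?sqr_ge0// ler_peMl//.
have q3 : k0 ^+ 2 * (M3 * (k0 ^+ 4 * M4)) <= k0 ^+ 3 * M4.
  rewrite (_ : _ * _ = (k0 ^+ 3 * M3) * (k0 ^+ 3 * M4)); last by ring.
  by rewrite ler_piMl// mulr_ge0// exprn_ge0.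
have q4 : kk ^+ 3 * M4 <= k0 ^+ 3 * M4 by rewrite ler_wpM2r.
have q5 : kk * kk ^+ 4 * M4 <= k0 ^+ 3 * M4 by rewrite ler_wpM2r.
have q6 : 0 <= k0 ^+ 2 * (M3 * W) by apply: mulr_ge0 (sqr_ge0 _) _; exact: mulr_ge0.
have q7 : 0 <= k0 ^+ 3 * M4 by rewrite mulr_ge0 ?exprn_ge0.
have -> : 9000 * kk ^+ 2 * (M3 * o) + 5 * kk ^+ 3 * M4 +
   kk * (130 * 1000 * kk * (1 * o) + 6 * kk ^+ 4 * M4) =
   9000 * (kk ^+ 2 * (M3 * o)) + 5 * (kk ^+ 3 * M4) +
   130 * 1000 * (kk * (kk * o)) + 6 * (kk * kk ^+ 4 * M4) by ring.
have -> : k0 ^+ 2 * M3 * W = k0 ^+ 2 * (M3 * W) by ring.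
have q8 : k0 ^+ 2 * (M3 * (64 * W + k0 ^+ 4 * M4)) =
  64 * (k0 ^+ 2 * (M3 * W)) + k0 ^+ 2 * (M3 * (k0 ^+ 4 * M4)) by ring.
rewrite q8 in q1.
move: q1 q2 q3 q4 q5 q6 q7.
move: (kk ^+ 2 * (M3 * o)) (kk * (kk * o)) (kk ^+ 3 * M4) (kk * kk ^+ 4 * M4)
  (k0 ^+ 2 * (M3 * (k0 ^+ 4 * M4))) (k0 ^+ 2 * (M3 * W)) (k0 ^+ 3 * M4).
move=> a1 a2 a3 a4 a5 a6 a7 *; rewrite /cK; lra.
Qed.

Definition W th tau : R := Ex P (fun w => smw (vt th tau w)).

Let W0 th tau : 0 <= W th tau.
Proof. by apply: Ex_ge0 => w; have /andP[] := smw_bounds (vt th tau w). Qed.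

(** With n rn^2 = 1 the sum contributes beta^2 sin th cos th times the Hessian term of [Rm], and the
    Gaussian field the same multiple of that of [gram] with the opposite sign. What is left is the
    covariance mismatch, at most 3 D times the window mass, and n leave-one-out errors. *)
Lemma Dphi_bound th tau : `|Dphi th tau| <= K1 * W th tau + K2.
Proof.
set kap := beta * cos th * rn; set t := beta * sin th.
set H := fun B => Ex P (fun w => smH (vt th tau w) B).
have hk : `|kap| <= beta * rn.
  rewrite /kap normrM normrM (gtr0_norm b0) (gtr0_norm rn0) ler_pM2r//.
  by apply: ler_piMr; [exact: ltW|exact: cos_max].
set E0 := cK * ((beta * rn) ^+ 2 * M3 * W th tau + (beta * rn) ^+ 3 * M4).
have hi i : L1 P (fun w => \sum_j y j (X i w) * smPhi (vt th tau w) j) /\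
   `|Ex P (fun w => \sum_j y j (X i w) * smPhi (vt th tau w) j) - kap * H Rm| <= E0.
  have [l1 l2] := loo_bound A mX xI my Bm0 yB LB EB Ey Eyy Ey3 Rm1 kap t
    (fun j => beta * (b j + tau)) i.
  split=> //; apply: le_trans l2 _; apply: Err_le => //.
  - by apply: Ex_ge0 => w; have /andP[] := smw_bounds (vloo X e A x0 y kap t (fun j => beta * (b j + tau)) i w).
  - exact: (omega_loo_le A mX xI my Bm0 yB LB EB).
have eS w : \sum_j sY w j * smPhi (vt th tau w) j = \sum_i \sum_j y j (X i w) * smPhi (vt th tau w) j.
  rewrite exchange_big/=; apply: eq_bigr => j _; by rewrite /sumY mulr_suml.
have LS : L1 P (fun w => \sum_j sY w j * smPhi (vt th tau w) j).
  exact: LSs.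
have LG : L1 P (fun w => \sum_j G w j * smPhi (vt th tau w) j).
  exact: LGs.
have hS : `|Ex P (fun w => \sum_j sY w j * smPhi (vt th tau w) j) - n%:R * (kap * H Rm)| <= n%:R * E0.
  rewrite [X in Ex _ X](_ : _ = fun w => \sum_i \sum_j y j (X i w) * smPhi (vt th tau w) j); last exact/funext.
  rewrite Ex_sum; last by move=> i _; have [] := hi i.
  have sc (q : R) : n%:R * q = \sum_(i < n) q by rewrite sumr_const card_ord mulr_natl.
  rewrite !sc -sumrB; apply: le_trans (ler_norm_sum _ _ _) _.
  by apply: ler_sum => i _; have [] := hi i.
have [_ hG] := stein_smPhi A eN eI my kap t (fun j => beta * (b j + tau)).
rewrite -/(vt th tau) -/(H (gram A)) in hG.
have eD : Dphi th tau = beta * sin th * rn * Ex P (fun w => \sum_j sY w j * smPhi (vt th tau w) j)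
   - beta * cos th * (t * H (gram A)).
  rewrite /Dphi -hG.
  rewrite [X in Ex _ X](_ : _ = fun w => - (beta * sin th * rn) * (\sum_j sY w j * smPhi (vt th tau w) j) +
    beta * cos th * (\sum_j G w j * smPhi (vt th tau w) j)); last exact/funext/dvE.
  by rewrite ExD ?ExZ//; [ring|exact: L1Z|exact: L1Z].
have hH : `|H (gram A) - H Rm| <= 3 * D * W th tau.
  rewrite /H -ExB; [|exact: L1_smH|exact: L1_smH].
  rewrite -ExZ; last exact: L1_smw.
  apply: Ex_norm_le.
  - by apply: L1B; exact: L1_smH.
  - by apply: L1Z; exact: L1_smw.
  - move=> w; rewrite (_ : _ - _ = smH (vt th tau w) (fun j k => gram A j k - Rm j k)).
      exact: smH_bound.
    rewrite /smH -sumrB; apply: eq_bigr => j _; rewrite -sumrB; apply: eq_bigr => k _; ring.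
set ES := Ex P (fun w => \sum_j sY w j * smPhi (vt th tau w) j) in hS eD.
have -> : Dphi th tau = beta * sin th * rn * (ES - n%:R * (kap * H Rm))
   - beta ^+ 2 * sin th * cos th * (H (gram A) - H Rm).
  rewrite eD /kap /t.
  have -> : beta * sin th * rn * (ES - n%:R * (beta * cos th * rn * H Rm)) =
     beta * sin th * rn * ES - beta ^+ 2 * sin th * cos th * (rn ^+ 2 * n%:R) * H Rm by ring.
  by rewrite rn2; ring.
apply: le_trans (ler_normB _ _) _.
have s1 := sin_max th; have c1 := cos_max th.
have T1 : `|beta * sin th * rn * (ES - n%:R * (kap * H Rm))| <= beta * rn * (n%:R * E0).
  rewrite normrM; apply: ler_pM => //.
  rewrite !normrM (gtr0_norm b0) (gtr0_norm rn0) ler_pM2r//.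
  by apply: ler_piMr => //; exact: ltW.
have T2 : `|beta ^+ 2 * sin th * cos th * (H (gram A) - H Rm)| <= beta ^+ 2 * (3 * D * W th tau).
  rewrite normrM; apply: ler_pM => //.
  rewrite -mulrA normrM ger0_norm ?sqr_ge0// ler_piMr ?sqr_ge0//.
  by rewrite normrM; exact: mulr_ile1.
apply: le_trans (lerD T1 T2) _.
rewrite /E0 /K1 /K2 le_eqVlt; apply/orP; left; apply/eqP.
have -> : beta * rn * (n%:R * (cK * ((beta * rn) ^+ 2 * M3 * W th tau + (beta * rn) ^+ 3 * M4))) =
  cK * (beta ^+ 3 * rn * M3 * W th tau + beta ^+ 4 * rn ^+ 2 * M4) * (rn ^+ 2 * n%:R) by ring.
have -> : n%:R^-1 = rn ^+ 2 by rewrite /rn exprVn sqr_sqrtr ?ltW.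
rewrite rn2; ring.
Qed.

End GaussianApproximation.

(* If the increments of f over a path are controlled by the window masses w,
   which are themselves increments of f in the threshold, then the distance
   between the endpoints is bounded by a fraction of its own supremum. *)
Section SelfBounding.
Context {R : realType}.
Variables (f w D : R -> R -> R) (r K1 K2 C a0 : R) (m : nat).
Hypothesis r0 : 0 < r.
Hypothesis m0 : (0 < m)%N.
Hypothesis fw : forall th tau, w th tau <= 2 * (f th (tau + r) - f th tau) <= 6 * w th tau.
Hypothesis fmono : forall th tau tau', tau <= tau' -> f th tau <= f th tau'.
Hypothesis f01 : forall th tau, 0 <= f th tau <= 1.
Hypothesis C0 : 0 <= C.
Hypothesis fT : forall tau th h, `|f (th + h) tau - f th tau - h * D th tau| <= C * h ^+ 2.
Hypothesis fD : forall th tau, `|D th tau| <= K1 * w th tau + K2.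
Variable th1 : R.
Hypothesis th12 : 0 <= th1 <= 2.
Hypothesis anti : forall tau, w th1 tau <= a0.
Hypothesis a00 : 0 <= a0.
Hypothesis K10 : 0 <= K1.
Hypothesis K20 : 0 <= K2.
Hypothesis K1m : 16 * K1 <= m%:R.

Definition gridavg (g : R -> R) tau : R := m%:R^-1 * \sum_(k < m) g (tau + k%:R * r).

Let mR : 0 < m%:R :> R. Proof. by rewrite ltr0n. Qed.

Let sc (c : R) : c * m%:R = \sum_(k < m) c.
Proof. by rewrite sumr_const card_ord mulr_natr. Qed.

Lemma gridavg_ge g tau c : (forall k : 'I_m, c <= g (tau + k%:R * r)) -> c <= gridavg g tau.
Proof.
move=> h; rewrite /gridavg mulrC ler_pdivlMr// sc.
exact: ler_sum.
Qed.

Lemma gridavg_le g tau c : (forall k : 'I_m, g (tau + k%:R * r) <= c) -> gridavg g tau <= c.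
Proof.
move=> h; rewrite /gridavg mulrC ler_pdivrMr// sc.
exact: ler_sum.
Qed.

Let telescope_f th tau N : \sum_(k < N) (f th (tau + k%:R * r + r) - f th (tau + k%:R * r)) =
  f th (tau + N%:R * r) - f th tau.
Proof.
elim: N => [|N ih]; first by rewrite big_ord0 mul0r addr0 subrr.
rewrite big_ord_recr/= ih -natr1 (_ : tau + (N%:R + 1) * r = tau + N%:R * r + r); last by ring.
ring.
Qed.

(** The windows of one grid telescope to a single increment of f over m steps. By monotonicity this
    increment lies below that of the grid averages between tau - m r and tau + m r, so it is
    controlled by the averaged quantity itself. *)
Lemma window_sum th tau :
  \sum_(k < m) w th (tau + k%:R * r) <=
  2 * (gridavg (f th) (tau + m%:R * r) - gridavg (f th) (tau - m%:R * r)).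
Proof.
apply: (@le_trans _ _ (2 * (f th (tau + m%:R * r) - f th tau))).
  rewrite -telescope_f mulr_sumr; apply: ler_sum => k _.
  by have /andP[] := fw th (tau + k%:R * r).
rewrite ler_pM2l// lerB//.
  apply: gridavg_ge => k; apply: fmono; rewrite lerDl mulr_ge0// ltW//.
apply: gridavg_le => k; apply: fmono.
have : k%:R * r <= m%:R * r by rewrite ler_pM2r// ler_nat ltnW.
lra.
Qed.

Lemma gridavg_anti tau N : gridavg (f th1) (tau + N%:R * r) - gridavg (f th1) tau <= 3 * N%:R * a0.
Proof.
rewrite /gridavg -mulrBr -sumrB mulrC ler_pdivrMr// sc.
apply: ler_sum => k _.
rewrite (_ : tau + N%:R * r + k%:R * r = tau + k%:R * r + N%:R * r); last by ring.
rewrite -telescope_f (_ : 3 * N%:R * a0 = \sum_(l < N) 3 * a0); last first.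
  by rewrite sumr_const card_ord -mulr_natr; ring.
apply: ler_sum => l _; have /andP[_] := fw th1 (tau + k%:R * r + l%:R * r).
by have := anti (tau + k%:R * r + l%:R * r); lra.
Qed.

Let F th tau := gridavg (f th) tau.
Let DF th tau := m%:R^-1 * \sum_(k < m) D th (tau + k%:R * r).

Let FT tau th h : `|F (th + h) tau - F th tau - h * DF th tau| <= C * h ^+ 2.
Proof.
have -> : F (th + h) tau - F th tau - h * DF th tau = m%:R^-1 * \sum_(k < m)
   (f (th + h) (tau + k%:R * r) - f th (tau + k%:R * r) - h * D th (tau + k%:R * r)).
  by rewrite /F /gridavg /DF sumrB sumrB -mulr_sumr; ring.
rewrite normrM gtr0_norm ?invr_gt0// mulrC ler_pdivrMr//.
apply: le_trans (ler_norm_sum _ _ _) _.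
rewrite sc; exact: ler_sum.
Qed.

(** Replacing th by th1 in the bound of [window_sum] costs 2 (2 rho), and at th1 anti-concentration
    bounds the increment over 2 m steps by 6 m a0. Multiplication by K1 <= m / 16 and division by m
    return rho with the factor 1/4. *)
Let DF_bound rho th tau :
  (forall tau, `|F th tau - F th1 tau| <= rho) ->
  `|DF th tau| <= rho / 4 + 3 / 4 * m%:R * a0 + K2.
Proof.
move=> h.
have w1 : \sum_(k < m) w th (tau + k%:R * r) <= 4 * rho + 12 * m%:R * a0.
  apply: le_trans (window_sum th tau) _.
  have k1 := h (tau + m%:R * r); have k2 := h (tau - m%:R * r).
  have k3 := gridavg_anti (tau - m%:R * r) (m + m).
  rewrite natrD (_ : tau - m%:R * r + (m%:R + m%:R) * r = tau + m%:R * r) in k3; last by ring.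
  rewrite -!/(F _ _) in k3 *.
  by move: k1 k2; rewrite !ler_norml => /andP[? ?] /andP[? ?]; lra.
rewrite /DF normrM gtr0_norm ?invr_gt0// mulrC ler_pdivrMr//.
apply: le_trans (ler_norm_sum _ _ _) _.
apply: (@le_trans _ _ (\sum_(k < m) (K1 * w th (tau + k%:R * r) + K2))).
  by apply: ler_sum.
rewrite big_split/= -mulr_sumr sumr_const card_ord -mulr_natr.
have k4 : K1 * \sum_(k < m) w th (tau + k%:R * r) <= K1 * (4 * rho + 12 * m%:R * a0).
  by rewrite ler_wpM2l.
have rho0 : 0 <= rho := le_trans (normr_ge0 _) (h 0).
have k5 : K1 * (4 * rho + 12 * m%:R * a0) <= (m%:R / 16) * (4 * rho + 12 * m%:R * a0).
  apply: ler_wpM2r; last by have := K1m; lra.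
  by rewrite addr_ge0 ?mulr_ge0// ltW.
apply: le_trans (lerD (le_trans k4 k5) (lexx _)) _.
by rewrite le_eqVlt; apply/orP; left; apply/eqP; field.
Qed.

Let E := 3 / 2 * m%:R * a0 + 2 * K2.

Let self_bound rho :
  (forall th tau, 0 <= th <= th1 -> `|F th tau - F th1 tau| <= rho) ->
  (forall th tau, 0 <= th <= th1 -> `|F th tau - F th1 tau| <= rho / 2 + E).
Proof.
move=> h th tau /andP[t0 t1].
have rho0 : 0 <= rho.
  by apply: le_trans (normr_ge0 _) (h th tau _); rewrite t0.
have /andP[th10 th11] := th12.
have Bx x : th <= x <= th1 -> `|DF x tau| <= rho / 4 + 3 / 4 * m%:R * a0 + K2.
  move=> /andP[x0 x1]; apply: DF_bound => tau'; apply: h.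
  by rewrite x1 (le_trans t0 x0).
rewrite distrC; have k := path_bound C0 t1 (FT tau) Bx.
apply: le_trans k _.
have B0 : 0 <= rho / 4 + 3 / 4 * m%:R * a0 + K2.
  have q0 : 0 <= m%:R * a0 by rewrite mulr_ge0// ltW.
  by have := K20; rewrite -mulrA; lra.
apply: (@le_trans _ _ ((rho / 4 + 3 / 4 * m%:R * a0 + K2) * 2)).
  by rewrite ler_wpM2l//; lra.
by rewrite le_eqVlt; apply/orP; left; apply/eqP; rewrite /E; field.
Qed.

(** The path has length at most 2, so the factor 1/4 becomes 1/2 in [self_bound]. Iterating the
    implication from rho to rho / 2 + E, starting at the trivial bound 1, gives 2 E in the limit
    without forming a supremum. *)
Lemma self_bounding tau :
  `|gridavg (f 0) tau - gridavg (f th1) tau| <= 3 * m%:R * a0 + 4 * K2.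
Proof.
have F01 th tau' : 0 <= F th tau' <= 1.
  apply/andP; split; [apply: gridavg_ge|apply: gridavg_le] => k; by have /andP[] := f01 th (tau' + k%:R * r).
have E0 : 0 <= E.
  have q0 : 0 <= m%:R * a0 by rewrite mulr_ge0// ltW.
  by have := K20; rewrite /E -mulrA; lra.
have it N : forall th tau, 0 <= th <= th1 -> `|F th tau - F th1 tau| <= 2^-1 ^+ N + 2 * E.
  elim: N => [|N ih] th tau' ht.
    have /andP[? ?] := F01 th tau'; have /andP[? ?] := F01 th1 tau'.
    by rewrite expr0 ler_norml; apply/andP; split; lra.
  have := self_bound ih tau' ht; rewrite exprS.
  by move=> hh; apply: le_trans hh _; lra.
have -> : 3 * m%:R * a0 + 4 * K2 = 2 * E by rewrite /E; field.
have /andP[t0 _] := th12.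
apply/ler_addgt0Pr => eps e0.
pose N := (Num.truncn (eps^-1)).+1.
have := it N 0 tau; rewrite lexx t0 => /(_ isT) hh; apply: le_trans hh _.
rewrite addrC lerD2l exprVn invf_ple ?posrE ?exprn_gt0//.
apply: ltW; apply: lt_le_trans (truncnS_gt _) _; rewrite -natrX ler_nat.
exact/ltnW/ltn_expl.
Qed.

End SelfBounding.

Lemma cK_ge0 (R : realType) : 0 <= cK :> R.
Proof. exact: (mulr_ge0 (mulr_ge0 (ler0n _ _) (ler0n _ _)) (ler0n _ _)). Qed.

Lemma comparison_chain (R : realType) (pu pv ex g1 g2 g3 q k : R) :
  g1 <= pv + ex -> pu - ex <= g2 -> - (3 * q + 4 * k) <= g1 - g3 -> g2 - g3 <= 18 * q ->
  pu - (21 * q + 4 * k + 2 * ex) <= pv.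
Proof. lra. Qed.

(** * Comparison of the orthant probabilities of the sum and of the Gaussian field *)

Section GaussianComparison.
Context d (T : measurableType d) {R : realType} (P : probability T R).
Context dX (TX : measurableType dX) (n : nat) (J : finType).
Variables (X : 'I_n -> T -> TX) (e : 'I_n -> {RV P >-> R}).
Variable A : J -> 'I_n -> R.
Hypothesis n0 : (0 < n)%N.
Hypothesis eN : forall i, standard_normal (e i).
Hypothesis eI : forall i, indep P (e i) (looE X e i).
Hypothesis mX : forall i, measurable_fun setT (X i).
Variable x0 : TX.
Hypothesis xI : forall i, indep P (X i) (looX X e x0 i).
Variables (y : J -> TX -> R) (Bm : TX -> R).
Hypothesis my : forall j, measurable_fun setT (y j).
Hypothesis Bm0 : forall x, 0 <= Bm x.
Hypothesis yB : forall j x, `|y j x| <= Bm x.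
Variables (Rm : J -> J -> R) (M3 M4 : R).
Hypothesis LB : forall i, L1 P (fun w => Bm (X i w) ^+ 4).
Hypothesis EB : forall i, Ex P (fun w => Bm (X i w) ^+ 4) <= M4.
Hypothesis Ey : forall i j, Ex P (fun w => y j (X i w)) = 0.
Hypothesis Eyy : forall i j k, Ex P (fun w => y j (X i w) * y k (X i w)) = Rm j k.
Hypothesis Ey3 : forall i j, Ex P (fun w => `|y j (X i w)| ^+ 3) <= M3.
Hypothesis Rm1 : forall j k, `|Rm j k| <= 1.
Hypothesis Rd1 : forall j, Rm j j = 1.
Hypothesis M31 : 1 <= M3.
Variables (D beta : R) (b : J -> R).
Hypothesis D0 : 0 <= D.
Hypothesis GD : forall j k, `|gram A j k - Rm j k| <= D.
Hypothesis b0 : 0 < beta.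
Hypothesis kap1 : beta * (Num.sqrt n%:R)^-1 <= 1.
Hypothesis kapM3 : (beta * (Num.sqrt n%:R)^-1) ^+ 3 * M3 <= 1.
Variable m : nat.
Hypothesis m0 : (0 < m)%N.
Hypothesis mJ : #|J|%:R <= expR (2 * m%:R) :> R.
Local Notation K1 := (K1 n M3 D beta).
Local Notation K2 := (K2 n M4 beta).
Hypothesis mK1 : 16 * K1 <= m%:R.

Let a0 : R := Ex P (Gmax e A) / beta + 2 * D.
Let rn : R := (Num.sqrt n%:R)^-1.

Local Notation vt := (vt X e A y beta b).
Local Notation phi := (phi X e A y beta b).
Local Notation W := (W X e A y beta b).
Local Notation Dphi := (Dphi X e A y beta b).

Let vt_shift th tau w j : vt th (tau + beta^-1) w j = vt th tau w j - 1.
Proof.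
have bb : beta * beta^-1 = 1 by rewrite mulfV// gt_eqF.
by rewrite /vt /vv addrA mulrDr bb; ring.
Qed.

Let Lphi th tau : L1 P (fun w => sm0 (vt th tau w)).
Proof. exact: L1_sm0. Qed.

Let fw th tau : W th tau <= 2 * (phi th (tau + beta^-1) - phi th tau) <= 6 * W th tau.
Proof.
have LW : L1 P (fun w => smw (vt th tau w)) by exact: L1_smw.
have e1 : 2 * (phi th (tau + beta^-1) - phi th tau) =
    Ex P (fun w => 2 * (sm0 (vt th (tau + beta^-1) w) - sm0 (vt th tau w))).
  by rewrite ExZ; [rewrite ExB|exact: L1B].
have hw w : smw (vt th tau w) <= 2 * (sm0 (vt th (tau + beta^-1) w) - sm0 (vt th tau w)) <=
   6 * smw (vt th tau w).
  rewrite (_ : vt th (tau + beta^-1) w = fun j => vt th tau w j - 1); last first.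
    by apply/funext => j; exact: vt_shift.
  exact: smw_shift.
rewrite e1 /W; apply/andP; split.
  by apply: (Ex_le LW) => [|w]; [apply: L1Z; exact: L1B|have /andP[] := hw w].
rewrite -ExZ//; apply: Ex_le => [||w]; last by have /andP[] := hw w.
- by apply: L1Z; exact: L1B.
- exact: L1Z.
Qed.

Let fmono th tau tau' : tau <= tau' -> phi th tau <= phi th tau'.
Proof.
move=> h; apply: Ex_le => // w; apply: sm0_mono => j.
by rewrite /vt /vv lerD2r lerD2l lerN2 ler_pM2l// lerD2l.
Qed.

Let f01 th tau : 0 <= phi th tau <= 1.
Proof.
apply/andP; split; first by apply: Ex_ge0 => w; exact/ltW/sm0_gt0.
by apply: Ex_le_cst => // w; exact: sm0_le1.
Qed.

Let M40 (i : 'I_n) : 0 <= M4.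
Proof. by apply: le_trans (EB i); apply: Ex_ge0 => w; rewrite exprn_ge0. Qed.

Let beta_ge0 : 0 <= beta := ltW b0.

Let M30 : 0 <= M3 := le_trans ler01 M31.

Let K10 : 0 <= K1.
Proof.
have h1 : 0 <= beta ^+ 3 * rn * M3.
  apply: mulr_ge0 => //; apply: mulr_ge0; first exact: exprn_ge0.
  by rewrite invr_ge0.
apply: addr_ge0; last exact: mulr_ge0 (cK_ge0 R) h1.
by apply: mulr_ge0 => //; apply: mulr_ge0 => //; exact: exprn_ge0.
Qed.

Let K20 : 0 <= K2.
Proof.
apply: mulr_ge0 (cK_ge0 R) _; apply: mulr_ge0; last by rewrite invr_ge0.
by apply: mulr_ge0 (M40 (Ordinal n0)); exact: exprn_ge0.
Qed.

Let Gm0 : 0 <= Ex P (Gmax e A).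
Proof.
by apply: Ex_ge0 => w; exact: bigmax_ge_id.
Qed.

Let a00 : 0 <= a0.
Proof. by rewrite /a0 addr_ge0 ?divr_ge0 ?mulr_ge0// ltW. Qed.

Let anti tau : W (pi / 2) tau <= a0.
Proof.
rewrite /W; have -> : vt (pi / 2) tau = vv X e A y 0 beta (fun j => beta * (b j + tau)).
  by rewrite /vt cos_pihalf sin_pihalf mulr0 mul0r mulr1.
apply: gauss_anticoncentration => //.
- move=> j k; have := GD j k; have := Rm1 j k.
  by rewrite !ler_norml => /andP[? ?] /andP[? ?]; lra.
- by move=> j; have := GD j j; rewrite Rd1 ler_norml => /andP[? ?]; lra.
Qed.

Lemma smooth_comparison tau :
  `|gridavg beta^-1 m (phi 0) tau - gridavg beta^-1 m (phi (pi / 2)) tau| <=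
  3 * m%:R * a0 + 4 * K2.
Proof.
have [C C0 hC] := phi_taylor A n0 eN mX my Bm0 yB LB b b0.
have D1 th tau1 : `|Dphi th tau1| <= K1 * W th tau1 + K2.
  by apply: (Dphi_bound n0 eN eI mX xI my Bm0 yB LB EB Ey Eyy Ey3 Rm1).
have bi : 0 < beta^-1 by rewrite invr_gt0.
have hp : 0 <= (pi : R) / 2 <= 2 by rewrite (ltW (pihalf_lt2 R)) andbT divr_ge0// pi_ge0.
exact: (self_bounding bi m0 fw fmono f01 C0 hC D1 hp anti a00 K10 K20 mK1).
Qed.

Lemma measurable_forall_le (I : finType) (f : I -> T -> R) (c : I -> R) :
  (forall i, measurable_fun setT (f i)) -> measurable [set w | forall i, f i w <= c i].
Proof.
move=> mf; rewrite (_ : [set w | _] = \bigcap_(i in [set: I]) [set w | f i w <= c i]).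
  by apply: fin_bigcap_measurable => // i _; exact: meas_le.
by apply/seteqP; split => w /= h i; [move=> _|]; exact: h.
Qed.

Let V := [set w | forall j, rn * sumY X y w j <= b j - m%:R / beta].
Let U := [set w | forall j, gaussG e A w j <= b j].

Let mV : measurable V.
Proof.
apply: measurable_forall_le => j; apply: measurable_funM => //; exact: meas_sumY.
Qed.

Let mU : measurable U.
Proof. by apply: measurable_forall_le => j; exact: meas_G. Qed.

(** Outside V some coordinate of the sum exceeds b_j - m / beta, so its argument in the soft maximum
    is at least m when tau <= - 2 m / beta, and [sm0] is at most exp(-m). *)
Let upper tau : tau <= - (2 * m%:R / beta) -> phi 0 tau <= Pr P V + expR (- m%:R).
Proof.
move=> ht; rewrite -lerBlDr.
have -> : phi 0 tau - expR (- m%:R) = Ex P (fun w => sm0 (vt 0 tau w) - expR (- m%:R)).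
  by rewrite ExB ?Ex_cst//; exact: L1_cst.
apply: Pr_Ex_ge => //; first by apply: L1B => //; exact: L1_cst.
move=> w; rewrite indicE; have [/set_mem hV|/negP hV] := boolP (w \in V).
  by have := sm0_le1 (vt 0 tau w); have := expR_gt0 (- m%:R : R); rewrite mulr1n; lra.
rewrite mulr0n subr_le0.
have /existsNP[j /negP] : ~ V w by move=> h; apply: hV; exact: mem_set.
rewrite -ltNge => hj.
have hv : m%:R <= vt 0 tau w j.
  rewrite /vt /vv cos0 sin0 mulr0 mul0r addr0 mulr1 -/rn -mulrA -mulrBr.
  rewrite -ler_pdivrMl//; apply: le_trans (_ : b j - m%:R / beta - (b j + tau) <= _).
    by move: ht; rewrite -mulrA mulrC; lra.
  by rewrite lerB// ltW.
rewrite expRN /sm0 lef_pV2 ?posrE ?expR_gt0 ?smZ1_gt0//.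
apply: (@le_trans _ _ (expR (vt 0 tau w j))); first by rewrite ler_expR.
rewrite /smZ (bigD1 j)//= addrCA lerDl addr_ge0// sumr_ge0// => k _; exact: expR_ge0.
Qed.

(** On U all arguments are at most -3 m, hence [smZ] is at most |J| exp(-3 m) <= exp(-m). *)
Let lower tau : 3 * m%:R / beta <= tau -> Pr P U - expR (- m%:R) <= phi (pi / 2) tau.
Proof.
move=> ht; rewrite lerBlDr.
have -> : phi (pi / 2) tau + expR (- m%:R) = Ex P (fun w => sm0 (vt (pi / 2) tau w) + expR (- m%:R)).
  by rewrite ExD ?Ex_cst//; exact: L1_cst.
apply: Pr_Ex_le => //; first by apply: L1D => //; exact: L1_cst.
move=> w; rewrite indicE; have [/set_mem hU|hU] := boolP (w \in U); last first.
  by rewrite mulr0n addr_ge0 ?expR_ge0// ltW ?sm0_gt0.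
rewrite mulr1n.
have hv j : vt (pi / 2) tau w j <= - (3 * m%:R).
  rewrite /vt /vv cos_pihalf sin_pihalf mulr0 !mul0r mulr1 sub0r.
  have h1 : beta * gaussG e A w j <= beta * b j by rewrite ler_pM2l.
  have h2 : 3 * m%:R <= beta * tau by rewrite [beta * _]mulrC -ler_pdivrMr.
  by rewrite mulrDr; lra.
have hZ : smZ (vt (pi / 2) tau w) <= expR (- m%:R).
  apply: (@le_trans _ _ (\sum_(j : J) expR (- (3 * m%:R)))).
    by apply: ler_sum => j _; rewrite ler_expR.
  rewrite sumr_const -[leLHS]mulr_natl.
  apply: (@le_trans _ _ (expR (2 * m%:R) * expR (- (3 * m%:R)))).
    by rewrite ler_wpM2r// expR_ge0.
  by rewrite -expRD ler_expR; lra.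
have := smZ_ge0 (vt (pi / 2) tau w); rewrite /sm0; set z := smZ _ in hZ * => z0.
apply: le_trans (_ : (1 + z)^-1 + z <= _); last by rewrite lerD2l.
have z1 : 0 < 1 + z by lra.
rewrite -(ler_pM2r z1) mul1r mulrDl mulVf ?gt_eqF//; nra.
Qed.

(** The grid starting at - 3 m / beta stays below - 2 m / beta, as [upper] demands, and the one
    starting 6 m steps higher stays above 3 m / beta, as [lower] demands. Moving the Gaussian
    average over these 6 m steps costs 18 m a0, and the comparison along the path 3 m a0; together
    21 m a0. *)
Theorem gaussian_comparison :
  Pr P U - (21 * m%:R * (Ex P (Gmax e A) / beta + 2 * D) + 4 * K2 + 2 * expR (- m%:R)) <=
  Pr P V.
Proof.
rewrite -/a0.
set t := - (3 * m%:R / beta).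
have q1 : gridavg beta^-1 m (phi 0) t <= Pr P V + expR (- m%:R).
  apply: gridavg_le => // k; apply: upper.
  have : k%:R * beta^-1 <= m%:R * beta^-1 by rewrite ler_pM2r ?invr_gt0// ler_nat ltnW.
  by rewrite /t -!mulrA; lra.
have q2 : Pr P U - expR (- m%:R) <= gridavg beta^-1 m (phi (pi / 2)) (t + (6 * m)%:R * beta^-1).
  apply: gridavg_ge => // k; apply: lower.
  have : 0 <= k%:R * beta^-1 by rewrite mulr_ge0// invr_ge0 ltW.
  by rewrite /t natrM -!mulrA; lra.
have q3 := smooth_comparison t.
have q4 : gridavg beta^-1 m (phi (pi / 2)) (t + (6 * m)%:R * beta^-1) -
  gridavg beta^-1 m (phi (pi / 2)) t <= 3 * (6 * m)%:R * a0.
  apply: (gridavg_anti (w := W)) => //.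
rewrite natrM (_ : 3 * (6 * m%:R) * a0 = 18 * (m%:R * a0)) in q4; last by ring.
rewrite natrM in q2; move: q3; rewrite ler_norml => /andP[q3 _].
rewrite -[3 * m%:R * a0]mulrA in q3; rewrite -[21 * m%:R * a0]mulrA.
exact: comparison_chain q1 q2 q3 q4.
Qed.

End GaussianComparison.

(** * Independence of the data and the multipliers *)

Section LeaveOneOutIndependence.
Context d (T : measurableType d) {R : realType} (P : probability T R).
Context d1 (T1 : measurableType d1) d2 (T2 : measurableType d2) (n : nat).

Definition rect (B : 'I_n -> set T1) (C : 'I_n -> set T2) : set (n.-tuple T1 * n.-tuple T2) :=
  [set x | (forall k, B k (tnth x.1 k)) /\ (forall k, C k (tnth x.2 k))].

(** A generating family closed under intersection, on which the law of sample and multipliers is a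
    finite product; [indep_dynkin] reduces the leave-one-out independence to it. *)
Definition rects : set (set (n.-tuple T1 * n.-tuple T2)) :=
  [set S | exists B C, [/\ forall k, measurable (B k), forall k, measurable (C k) & S = rect B C]].

Lemma rects_setI : setI_closed rects.
Proof.
move=> _ _ [B [C [mB mC ->]]] [B' [C' [mB' mC' ->]]].
exists (fun k => B k `&` B' k), (fun k => C k `&` C' k); split.
- by move=> k; exact: measurableI.
- by move=> k; exact: measurableI.
apply/seteqP; split => x /=.
  by move=> [[h1 h2] [h3 h4]]; split => k; split.
by move=> [h1 h2]; split; split => k; have [] := h1 k; have [] := h2 k.
Qed.

Lemma rects_setT : rects setT.
Proof.
exists (fun=> setT), (fun=> setT); split => //.
by apply/seteqP; split => x.
Qed.

Lemma measurable_rect B C : (forall k, measurable (B k)) -> (forall k, measurable (C k)) ->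
  measurable (rect B C).
Proof.
move=> mB mC; rewrite (_ : rect B C =
   (\bigcap_(k in [set: 'I_n]) [set x | B k (tnth x.1 k)]) `&`
   (\bigcap_(k in [set: 'I_n]) [set x | C k (tnth x.2 k)])).
  apply: measurableI; apply: fin_bigcap_measurable => // k _.
    have m : measurable_fun setT (fun x : n.-tuple T1 * n.-tuple T2 => tnth x.1 k).
      by apply: (measurableT_comp (measurable_tnth k)); exact: measurable_fst.
    by rewrite -[X in measurable X]setTI; exact: m.
  have m : measurable_fun setT (fun x : n.-tuple T1 * n.-tuple T2 => tnth x.2 k).
    by apply: (measurableT_comp (measurable_tnth k)); exact: measurable_snd.
  by rewrite -[X in measurable X]setTI; exact: m.
apply/seteqP; split => x /=.
  by move=> [h1 h2]; split => k _.
by move=> [h1 h2]; split => k; [exact: h1|exact: h2].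
Qed.

Lemma rects_generate : measurable `<=` <<s rects >>.
Proof.
have mid : measurable_fun setT
    (fun x : g_sigma_algebraType rects => (x.1 : n.-tuple T1, x.2 : n.-tuple T2)).
  apply: measurable_fun_pair; apply/measurable_fun_tnthP => k.
  - move=> _ B mB; rewrite setTI.
    apply: sub_sigma_algebra; exists (fun j => if j == k then B else setT), (fun=> setT).
    split => //; first by move=> j; case: ifP.
    apply/seteqP; split => x /=.
      by move=> h; split => // j; case: eqP => // ->.
    by move=> [/(_ k)]; rewrite eqxx.
  - move=> _ B mB; rewrite setTI.
    apply: sub_sigma_algebra; exists (fun=> setT), (fun j => if j == k then B else setT).
    split => //; first by move=> j; case: ifP.
    apply/seteqP; split => x /=.
      by move=> h; split => // j; case: eqP => // ->.
    by move=> [_ /(_ k)]; rewrite eqxx.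
move=> S mS; have := mid measurableT S mS; rewrite setTI.
by rewrite (_ : _ @^-1` S = S)//; apply/seteqP; split => -[].
Qed.

End LeaveOneOutIndependence.

Section DataIndependence.
Context d (T : measurableType d) {R : realType} (P : probability T R).
Context d1 (T1 : measurableType d1) (n : nat).
Variables (X : 'I_n -> {RV P >-> T1}) (e : 'I_n -> {RV P >-> R}).
Hypothesis XI : mutually_independent X.
Hypothesis EI : mutually_independent e.
Hypothesis XE : independent_families X e.

Lemma prob_rect B C : (forall k, measurable (B k)) -> (forall k, measurable (C k)) ->
  P [set w | (forall k, B k (X k w)) /\ (forall k, C k (e k w))] =
  ((\prod_(k < n) P (X k @^-1` B k)) * \prod_(k < n) P (e k @^-1` C k))%E.
Proof.
move=> mB mC; rewrite -XI// -EI//.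
have mb d' (T' : measurableType d') (D : 'I_n -> set T') : (forall k, measurable (D k)) ->
    measurable [set x : n.-tuple T' | forall k, D k (tnth x k)].
  move=> mD; rewrite (_ : [set x | _] = \bigcap_(k in [set: 'I_n]) ((@tnth n T')^~ k @^-1` D k)).
    apply: fin_bigcap_measurable => // k _; rewrite -[X in measurable X]setTI.
    exact: measurable_tnth.
  by apply/seteqP; split => x h k; [move=> _|]; exact: h.
have := XE (mb _ _ _ mB) (mb _ _ _ mC) => /=.
rewrite (_ : [set w | _] = [set w | (forall k, B k (X k w)) /\ (forall k, C k (e k w))]); last first.
  apply/seteqP; split => w /=.
    by move=> [h1 h2]; split => k; [have := h1 k|have := h2 k]; rewrite tnth_mktuple.
  by move=> [h1 h2]; split => k; rewrite tnth_mktuple.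
move=> ->; congr (P _ * P _)%E; apply/seteqP; split => w /= h k; first by move=> _; have := h k; rewrite tnth_mktuple.
- by rewrite tnth_mktuple; exact: h.
- by move=> _; have := h k; rewrite tnth_mktuple.
- by rewrite tnth_mktuple; exact: h.
Qed.

Lemma meas_looX x0 i : measurable_fun setT (looX X e x0 i).
Proof.
apply: measurable_fun_pair; apply/measurable_fun_tnthP => k.
  rewrite (_ : _ \o _ = fun w => if k == i then x0 else X k w); last first.
    by apply/funext => w /=; rewrite tnth_mktuple.
  by case: eqP => _; [exact: measurable_cst|exact: measurable_funPT].
rewrite (_ : _ \o _ = e k); last by apply/funext => w /=; rewrite tnth_mktuple.
exact: measurable_funPT.
Qed.

Lemma meas_looE i : measurable_fun setT (looE X e i).
Proof.
apply: measurable_fun_pair; apply/measurable_fun_tnthP => k.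
  rewrite (_ : _ \o _ = X k); last by apply/funext => w /=; rewrite tnth_mktuple.
  exact: measurable_funPT.
rewrite (_ : _ \o _ = fun w => if k == i then 0 else e k w); last first.
  by apply/funext => w /=; rewrite tnth_mktuple.
by case: eqP => _; [exact: measurable_cst|exact: measurable_funPT].
Qed.

Lemma indep_looX x0 i : indep P (X i) (looX X e x0 i).
Proof.
apply: (indep_dynkin (G := @rects _ T1 _ R n)).
- exact: rects_setI.
- exact: rects_setT.
- exact: measurable_funPT.
- exact: meas_looX.
- exact: rects_generate.
- by move=> _ [B [C [mB mC ->]]]; exact: measurable_rect.
move=> A _ mA [B [C [mB mC ->]]].
pose B1 S k := if k == i then S else B k.
have mB1 S : measurable S -> forall k, measurable (B1 S k).
  by move=> mS k; rewrite /B1; case: ifP.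
have prodB1 S : measurable S -> (\prod_(k < n) P (X k @^-1` B1 S k) =
    P (X i @^-1` S) * \prod_(k < n | k != i) P (X k @^-1` B k))%E.
  move=> mS; rewrite (bigD1 i)//= /B1 eqxx; congr (_ * _)%E.
  by apply: eq_bigr => k /negPf ->.
(* The i-th slot always holds [x0], so the condition on it is either always satisfied or makes the
   event empty. *)
have [bx|bx] := pselect (B i x0); last first.
  have e0 : looX X e x0 i @^-1` rect B C = set0.
    apply/seteqP; split => // w [/(_ i)]; rewrite tnth_mktuple eqxx => h _.
    exact: bx.
  by rewrite e0 setI0 measure0 mule0.
have e1 S : X i @^-1` S `&` looX X e x0 i @^-1` rect B C =
    [set w | (forall k, B1 S k (X k w)) /\ (forall k, C k (e k w))].
  apply/seteqP; split => w /=.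
    move=> [h1 [h2 h3]]; split => k.
      by have := h2 k; rewrite tnth_mktuple /B1; case: eqP => // ->.
    by have := h3 k; rewrite tnth_mktuple.
  move=> [h1 h2]; split; first by have := h1 i; rewrite /B1 eqxx.
  split => k; rewrite tnth_mktuple; last exact: h2.
  by have := h1 k; rewrite /B1; case: eqP => // ->.
(* The probability of the leave-one-out event alone is the same computation with S = [setT]. *)
rewrite e1 (prob_rect (mB1 _ mA) mC) -[looX _ _ _ _ @^-1` _]setTI -(preimage_setT (X i)) e1.
rewrite (prob_rect (mB1 _ measurableT) mC) !prodB1//.
by rewrite preimage_setT [P setT]probability_setT mul1e muleA.
Qed.

Lemma indep_looE i : indep P (e i) (looE X e i).
Proof.
apply: (indep_dynkin (G := @rects _ T1 _ R n)).
- exact: rects_setI.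
- exact: rects_setT.
- exact: measurable_funPT.
- exact: meas_looE.
- exact: rects_generate.
- by move=> _ [B [C [mB mC ->]]]; exact: measurable_rect.
move=> A _ mA [B [C [mB mC ->]]].
pose C1 S k := if k == i then S else C k.
have mC1 S : measurable S -> forall k, measurable (C1 S k).
  by move=> mS k; rewrite /C1; case: ifP.
have prodC1 S : measurable S -> (\prod_(k < n) P (e k @^-1` C1 S k) =
    P (e i @^-1` S) * \prod_(k < n | k != i) P (e k @^-1` C k))%E.
  move=> mS; rewrite (bigD1 i)//= /C1 eqxx; congr (_ * _)%E.
  by apply: eq_bigr => k /negPf ->.
have [bx|bx] := pselect (C i 0); last first.
  have e0 : looE X e i @^-1` rect B C = set0.
    apply/seteqP; split => // w [_ /(_ i)]; rewrite tnth_mktuple eqxx => h.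
    exact: bx.
  by rewrite e0 setI0 measure0 mule0.
have e1 S : e i @^-1` S `&` looE X e i @^-1` rect B C =
    [set w | (forall k, B k (X k w)) /\ (forall k, C1 S k (e k w))].
  apply/seteqP; split => w /=.
    move=> [h1 [h2 h3]]; split => k.
      by have := h2 k; rewrite tnth_mktuple.
    by have := h3 k; rewrite tnth_mktuple /C1; case: eqP => // ->.
  move=> [h1 h2]; split; first by have := h2 i; rewrite /C1 eqxx.
  split => k; rewrite tnth_mktuple; first exact: h1.
  by have := h2 k; rewrite /C1; case: eqP => // ->.
rewrite e1 (prob_rect mB (mC1 _ mA)) -[looE _ _ _ @^-1` _]setTI -(preimage_setT (e i)) e1.
rewrite (prob_rect mB (mC1 _ measurableT)) !prodC1//.
by rewrite preimage_setT [P setT]probability_setT mul1e muleCA.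
Qed.

End DataIndependence.

(** * Maximal inequality *)

Section MaximalInequality.
Context {R : realType} {J : finType}.
Implicit Types v z : J -> R.

Lemma smD_add v z : 1 + smZ (fun j => v j + z j) = (1 + smZ v) * smD v z.
Proof.
have := sm0_add v z; rewrite /sm0 => /(congr1 GRing.inv).
by rewrite invf_div !invrK mulrC.
Qed.

(** For b <= 1 this is ln (1 + t) <= t and the quadratic bound on exp. For b > 1 the left side is at
    most b and the average at least -b, and 2 b <= 4 b^2. *)
Lemma ln_smD_le v z b : (forall j, `|z j| <= b) -> 0 <= b ->
  ln (smD v z) <= smE v z + 4 * b ^+ 2.
Proof.
move=> hz b0; have D0 := smD_gt0 v z.
have ub t : smD v z <= expR t -> ln (smD v z) <= t.
  by move=> h; rewrite -[leRHS]expRK ler_ln ?posrE ?expR_gt0.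
have [b1|b1] := lerP b 1.
  apply: ub; apply: le_trans (expR_ge1Dx _).
  rewrite /smD lerD2l; apply: (@le_trans _ _ (smE v (fun j => z j + 4 * b ^+ 2))).
    apply: smE_le => j; have zj := hz j.
    have /expR_taylor2/andP[_] : `|z j| <= 1 by exact: le_trans b1.
    have : z j ^+ 2 <= b ^+ 2 by exact: sqr_le_norm.
    by lra.
  by rewrite smED lerD2l; apply: smE_le_cst => //; rewrite mulr_ge0// sqr_ge0.
have h1 : - b <= smE v z.
  by move: (le_trans (smE_norm v z) (smE_le_cst v b0 (f := fun j => `|z j|) hz)); rewrite ler_norml => /andP[].
have h2 : ln (smD v z) <= b.
  apply: ub; rewrite smDE.
  have -> : expR b = sm0 v * expR b + (1 - sm0 v) * expR b by ring.
  rewrite -smE_cst; apply: lerD.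
    by apply: ler_peMr; [exact/ltW/sm0_gt0|rewrite -expR0 ler_expR].
  by apply: smE_le => j; rewrite ler_expR; exact: le_trans (ler_norm _) (hz j).
by nra.
Qed.

(** Log-sum-exp with the extra atom 0; it dominates all coordinates and 0, and serves as the
    potential of the maximal inequality. *)
Definition lse v : R := ln (1 + smZ v).

Lemma lse_add v z b : (forall j, `|z j| <= b) -> 0 <= b ->
  lse (fun j => v j + z j) <= lse v + smE v z + 4 * b ^+ 2.
Proof.
move=> hz b0; rewrite /lse smD_add lnM ?posrE ?smZ1_gt0 ?smD_gt0//.
by rewrite -addrA lerD2l ln_smD_le.
Qed.

Lemma lse_ge0 v : 0 <= lse v.
Proof. by rewrite ln_ge0// lerDl smZ_ge0. Qed.

Lemma lse_ge v j : v j <= lse v.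
Proof.
rewrite -[leLHS]expRK /lse ler_ln ?posrE ?expR_gt0 ?smZ1_gt0//.
by rewrite /smZ (bigD1 j)//= addrCA lerDl addr_ge0// sumr_ge0// => k _; exact: expR_ge0.
Qed.

Lemma lse0 : lse (fun=> 0 : R) = ln (#|J|.+1%:R).
Proof.
by rewrite /lse /smZ (eq_bigr (fun=> 1)) ?sumr_const ?natr1 1?addrC ?natr1// => j _; rewrite expR0.
Qed.

Context d (T : measurableType d) (P : probability T R).
Context d1 (T1 : measurableType d1) (n : nat).
Variables (X : 'I_n -> T -> T1) (e : 'I_n -> {RV P >-> R}) (x0 : T1).
Hypothesis mX : forall i, measurable_fun setT (X i).
Hypothesis xI : forall i, indep P (X i) (looX X e x0 i).
Variables (f : J -> T1 -> R) (B : T1 -> R) (s : R).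
Hypothesis mf : forall j, measurable_fun setT (f j).
Hypothesis fB : forall j x, `|f j x| <= B x.
Hypothesis B0 : forall x, 0 <= B x.
Hypothesis LB : forall i, L1 P (fun w => B (X i w) ^+ 2).
Hypothesis EB : forall i, Ex P (fun w => B (X i w) ^+ 2) <= s.
Hypothesis Ef : forall i j, Ex P (fun w => f j (X i w)) = 0.

Let Lf i j : L1 P (fun w => f j (X i w)).
Proof.
apply: (L1_le (g := fun w => 1 + B (X i w) ^+ 2)).
- exact: measurableT_comp.
- move=> w; apply: le_trans (fB j (X i w)) _.
  by have := sqr_ge0 (B (X i w) - 1); have := B0 (X i w); nra.
- by apply: L1D => //; exact: L1_cst.
Qed.

Variable lam : R.
Hypothesis lam0 : 0 < lam.

Let S (k : nat) w j : R := lam * \sum_(i < n | (i < k)%N) f j (X i w).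

Let LS k j : L1 P (fun w => S k w j).
Proof. by apply: L1Z; apply: L1_sum => i _. Qed.

Let L_lse k : L1 P (fun w => lse (S k w)).
Proof.
apply: (L1_le (g := fun w => ln (#|J|.+1%:R) + \sum_j `|S k w j|)).
- rewrite /lse; apply: measurableT_comp; first exact: measurable_ln.
  apply: measurable_funD => //; apply: meas_sum => j; apply: measurableT_comp; first exact: measurable_expR.
  exact: L1_meas (LS k j).
- move=> w; rewrite ger0_norm ?lse_ge0//.
  set b := \sum_j _; have b0 : 0 <= b by apply: sumr_ge0.
  rewrite -lse0 -[X in _ + X]expRK /lse -lnM ?posrE ?smZ1_gt0 ?expR_gt0//.
  rewrite ler_ln ?posrE ?smZ1_gt0 ?mulr_gt0 ?smZ1_gt0 ?expR_gt0//.
  rewrite mulrDl mul1r; apply: lerD; first by rewrite -expR0 ler_expR.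
  rewrite /smZ mulr_suml; apply: ler_sum => j _; rewrite expR0 mul1r ler_expR.
  apply: le_trans (ler_norm _) _; rewrite /b (bigD1 j)//= lerDl.
  by apply: sumr_ge0.
- by apply: L1D; [exact: L1_cst|apply: L1_sum => j _; exact: L1_norm].
Qed.

(** Adding one summand raises the potential by its Gibbs average plus a quadratic term. The weights
    involve earlier summands only, so the average has mean zero, and the second moment of the
    envelope controls the rest. *)
Let step (k : 'I_n) : Ex P (fun w => lse (S k.+1 w)) <=
  Ex P (fun w => lse (S k w)) + 4 * (lam ^+ 2 * s).
Proof.
have Lp j : L1 P (fun w => f j (X k w) * smp (S k w) j).
  apply: L1_le (L1_norm (Lf k j)).
    apply: measurable_funM; first exact: L1_meas (Lf k j).
    by apply: (meas_smp (v := S k)) => i; exact: L1_meas (LS k i).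
  by move=> w; rewrite normrM ler_piMr// ger0_norm ?smp_ge0// smp_le1.
have Ep j : Ex P (fun w => f j (X k w) * smp (S k w) j) = 0.
  (* Only indices below k enter [S k], so it is a function of the sample with the k-th entry
     overwritten. *)
  pose v (x : n.-tuple T1 * n.-tuple R) j := lam * \sum_(i < n | (i < k)%N) f j (tnth x.1 i).
  have ev w : S k w = v (looX X e x0 k w).
    apply/funext => j'; rewrite /S /v; congr (_ * _); apply: eq_bigr => i ik.
    by rewrite tnth_mktuple ifN// -val_eqE/= ltn_eqF.
  have e1 : (fun w => f j (X k w) * smp (S k w) j) =
      fun w => f j (X k w) * smp (v (looX X e x0 k w)) j.
    by apply/funext => w; rewrite ev.
  rewrite e1 (indep_prod (b := fun x => smp (v x) j) (xI k))//.
  - by rewrite [X in X * _](Ef k j) mul0r.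
  - apply: (meas_smp (v := v)) => i; apply: measurable_funM => //; apply: meas_sum => i'.
    apply: measurableT_comp => //.
    by apply: (measurableT_comp (measurable_tnth i')); exact: measurable_fst.
  - exact: Lf.
  - by have := Lp j; rewrite e1.
have LE : L1 P (fun w => \sum_j lam * (f j (X k w) * smp (S k w) j)).
  by apply: L1_sum => j _; exact: L1Z.
apply: (@le_trans _ _ (Ex P (fun w => lse (S k w) + (\sum_j lam * (f j (X k w) * smp (S k w) j))
    + 4 * lam ^+ 2 * B (X k w) ^+ 2))).
  apply: Ex_le => [//||w]; first by apply: L1D; [exact: L1D|exact: L1Z].
  have -> : S k.+1 w = fun j => S k w j + lam * f j (X k w).
    apply/funext => j; rewrite /S -mulrDr; congr (_ * _).
    rewrite (bigD1 k)//= addrC; congr (_ + _); apply: eq_bigl => i.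
    by rewrite ltnS ltn_neqAle andbC.
  have := @lse_add (S k w) (fun j => lam * f j (X k w)) (lam * B (X k w)).
  move=> /(_ _ _)/le_trans; apply.
  - by move=> j; rewrite normrM gtr0_norm// ler_pM2l.
  - by rewrite mulr_ge0// ltW.
  rewrite exprMn mulrA lerD2r lerD2l /smE le_eqVlt; apply/orP; left; apply/eqP.
  by apply: eq_bigr => j _; ring.
rewrite ExD; [|exact: L1D|exact: L1Z]; rewrite ExD// Ex_sum; last by move=> j _; exact: L1Z.
rewrite big1 ?addr0; last by move=> j _; rewrite ExZ// Ep mulr0.
by rewrite lerD2l ExZ// -mulrA ler_pM2l// ler_pM2l// exprn_gt0.
Qed.

(** The potential starts at ln (|J| + 1) and gains at most 4 lam^2 s in each of n steps; division by
    lam gives the bound for the maximum. *)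
Lemma Ex_bigmax_sum_le :
  Ex P (fun w => \big[Num.max/0]_j \sum_i f j (X i w)) <=
  ln (#|J|.+1%:R) / lam + 4 * lam * (n%:R * s).
Proof.
have h k : (k <= n)%N -> Ex P (fun w => lse (S k w)) <=
    ln (#|J|.+1%:R) + k%:R * (4 * (lam ^+ 2 * s)).
  elim: k => [_|k ih kn].
    rewrite mul0r addr0 -lse0 le_eqVlt; apply/orP; left; apply/eqP.
    rewrite -[RHS](Ex_cst P); congr (Ex P); apply/funext => w; congr lse; apply/funext => j.
    by rewrite /S big_pred0 ?mulr0.
  have := step (Ordinal kn); have := ih (ltnW kn) => /= h1 h2.
  apply: le_trans h2 _; apply: le_trans (lerD h1 (lexx _)) _.
  by rewrite -[k.+1%:R]natr1 [(k%:R + 1) * _]mulrDl mul1r addrA.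
have Lm : L1 P (fun w => \big[Num.max/0]_j \sum_i f j (X i w)).
  apply: (L1_le (g := fun w => \sum_j `|\sum_i f j (X i w)|)).
  - by apply: meas_bigmax => j; apply: meas_sum => i; exact: L1_meas (Lf i j).
  - move=> w; rewrite ger0_norm ?bigmax_ge_id//.
    apply/bigmax_leP; split => [|j _]; first exact: sumr_ge0.
    apply: le_trans (ler_norm _) _; rewrite (bigD1 j)//= lerDl; exact: sumr_ge0.
  - by apply: L1_sum => j _; apply: L1_norm; apply: L1_sum => i _.
have h1 : Ex P (fun w => \big[Num.max/0]_j \sum_i f j (X i w)) <= Ex P (fun w => lam^-1 * lse (S n w)).
  apply: Ex_le => [//||w]; first exact: L1Z.
  apply/bigmax_leP; split => [|j _]; first by rewrite mulr_ge0 ?lse_ge0// invr_ge0 ltW.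
  rewrite ler_pdivlMl//; apply: le_trans (lse_ge (S n w) j).
  by rewrite /S le_eqVlt; apply/orP; left; apply/eqP; congr (_ * _); apply: eq_bigl => i; rewrite ltn_ord.
apply: le_trans h1 _; rewrite ExZ// ler_pdivrMl//.
apply: le_trans (h n (leqnn n)) _.
rewrite le_eqVlt; apply/orP; left; apply/eqP; field.
by rewrite gt_eqF.
Qed.

End MaximalInequality.

(** * Spectral norm and thresholding *)

Section SpectralNorm.
Context {R : realType}.

(** Cauchy-Schwarz from Lagrange's identity. *)
Lemma cauchy_sum (I : finType) (a b : I -> R) :
  (\sum_i a i * b i) ^+ 2 <= (\sum_i a i ^+ 2) * (\sum_i b i ^+ 2).
Proof.
have h : 0 <= \sum_i \sum_j (a i * b j - a j * b i) ^+ 2.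
  by apply: sumr_ge0 => i _; apply: sumr_ge0 => j _; exact: sqr_ge0.
have e : \sum_i \sum_j (a i * b j - a j * b i) ^+ 2 =
   2 * ((\sum_i a i ^+ 2) * (\sum_i b i ^+ 2)) - 2 * (\sum_i a i * b i) ^+ 2.
  have e1 : \sum_i \sum_j (a i ^+ 2 * b j ^+ 2) = (\sum_i a i ^+ 2) * (\sum_i b i ^+ 2).
    by rewrite mulr_suml; apply: eq_bigr => i _; rewrite mulr_sumr.
  have e2 : \sum_i \sum_j (a j ^+ 2 * b i ^+ 2) = (\sum_i a i ^+ 2) * (\sum_i b i ^+ 2).
    by rewrite exchange_big/= e1.
  have e3 : \sum_i \sum_j ((a i * b i) * (a j * b j)) = (\sum_i a i * b i) ^+ 2.
    by rewrite expr2 mulr_suml; apply: eq_bigr => i _; rewrite mulr_sumr.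
  transitivity (\sum_i \sum_j (a i ^+ 2 * b j ^+ 2) + \sum_i \sum_j (a j ^+ 2 * b i ^+ 2)
     - 2 * \sum_i \sum_j ((a i * b i) * (a j * b j))); last by rewrite e1 e2 e3; ring.
  rewrite mulr_sumr -big_split -sumrB/=; apply: eq_bigr => i _.
  rewrite mulr_sumr -big_split -sumrB/=; apply: eq_bigr => j _; ring.
by rewrite e in h; lra.
Qed.

Lemma sum_sqr_ge0 (I : finType) (v : I -> R) : 0 <= \sum_i v i ^+ 2.
Proof. by apply: sumr_ge0 => i _; exact: sqr_ge0. Qed.

Context {p : nat}.
Implicit Types (A : 'M[R]_p) (v : 'I_p -> R).

Lemma frob_norm_col v : frob_norm (\col_k v k) = Num.sqrt (\sum_k v k ^+ 2).
Proof.
by congr Num.sqrt; apply: eq_bigr => i _; rewrite big_ord1 mxE.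
Qed.

Lemma frob_norm_mulmx_col A v :
  frob_norm (A *m \col_k v k) = Num.sqrt (\sum_i (\sum_k A i k * v k) ^+ 2).
Proof.
congr Num.sqrt; apply: eq_bigr => i _; rewrite big_ord1 mxE; congr (_ ^+ 2).
by apply: eq_bigr => k _; rewrite mxE.
Qed.

Lemma mulmx_sqr_le A v :
  \sum_i (\sum_k A i k * v k) ^+ 2 <= (\sum_i \sum_k A i k ^+ 2) * \sum_k v k ^+ 2.
Proof.
by rewrite mulr_suml; apply: ler_sum => i _; exact: cauchy_sum.
Qed.

(** The supremum is a genuine one: the zero vector gives a point of the set and the Frobenius norm
    an upper bound. Scaling to unit vectors then yields the quadratic form inequality. *)
Lemma spectral_norm_leP A c : 0 <= c ->
  spectral_norm A <= c <->
  (forall v, \sum_i (\sum_k A i k * v k) ^+ 2 <= c ^+ 2 * \sum_k v k ^+ 2).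
Proof.
move=> c0; have colE (v : 'cV[R]_p) : v = \col_k v k 0.
  by apply/colP => k; rewrite mxE.
split=> [hA v|hA]; last first.
  apply: ge_sup.
    exists (frob_norm (A *m (0 : 'cV[R]_p))), (0 : 'cV[R]_p) => //=.
    rewrite (_ : 0 = \col_k (fun=> 0 : R) k); last by apply/colP => k; rewrite !mxE.
    by rewrite frob_norm_col big1 ?sqrtr0// => k _; rewrite expr0n.
  move=> _ [v /= hv <-]; rewrite (colE v) frob_norm_mulmx_col.
  rewrite (colE v) frob_norm_col in hv.
  rewrite -(ger0_norm c0) -sqrtr_sqr ler_wsqrtr//.
  apply: le_trans (hA _) _; rewrite -[leRHS]mulr1 ler_wpM2l ?sqr_ge0//.
  by move: hv; rewrite -[X in _ <= X]sqrtr1 ler_sqrt ?ltr01.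
have [e|s0] := eqVneq (\sum_k v k ^+ 2) 0.
  by apply: le_trans (mulmx_sqr_le A v) _; rewrite e !mulr0.
have {}s0 : 0 < \sum_k v k ^+ 2 by rewrite lt_def s0 sum_sqr_ge0.
set s := Num.sqrt (\sum_k v k ^+ 2).
have sp : 0 < s by rewrite sqrtr_gt0.
have s2 : s ^+ 2 = \sum_k v k ^+ 2 by rewrite sqr_sqrtr// ltW.
pose u k := v k / s.
have u1 : \sum_k u k ^+ 2 = 1.
  rewrite -(@divff _ (s ^+ 2)) ?sqrf_eq0 ?gt_eqF//.
  rewrite [X in X / _]s2 mulr_suml; apply: eq_bigr => k _.
  by rewrite /u exprMn exprVn.
have hu : frob_norm (A *m \col_k u k) <= c.
  apply: le_trans hA; apply: ub_le_sup.
    exists (Num.sqrt (\sum_i \sum_k A i k ^+ 2)) => _ [z /= hz <-].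
    rewrite (colE z) frob_norm_mulmx_col; rewrite (colE z) frob_norm_col in hz.
    rewrite ler_wsqrtr//; apply: le_trans (mulmx_sqr_le A _) _.
    rewrite -[leRHS]mulr1 ler_wpM2l//.
      by apply: sumr_ge0 => i _; exact: sum_sqr_ge0.
    by move: hz; rewrite -[X in _ <= X]sqrtr1 ler_sqrt ?ltr01.
  by exists (\col_k u k) => //=; rewrite frob_norm_col u1 sqrtr1.
rewrite frob_norm_mulmx_col -(ger0_norm c0) -sqrtr_sqr ler_sqrt ?sqr_ge0// in hu.
have -> : \sum_i (\sum_k A i k * v k) ^+ 2 = (\sum_i (\sum_k A i k * u k) ^+ 2) * s ^+ 2.
  rewrite mulr_suml; apply: eq_bigr => i _; rewrite -exprMn mulr_suml; congr (_ ^+ 2).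
  by apply: eq_bigr => k _; rewrite /u -mulrA divfK ?gt_eqF.
by rewrite -s2; apply: ler_wpM2r; [exact: sqr_ge0|].
Qed.

(* Rational vectors suffice, which makes the spectral norm measurable. *)
Lemma spectral_norm_le_rat A c : 0 <= c ->
  spectral_norm A <= c <->
  (forall v : {ffun 'I_p -> rat}, \sum_i (\sum_k A i k * ratr (v k)) ^+ 2 <=
    c ^+ 2 * \sum_k ratr (v k) ^+ 2).
Proof.
move=> c0; rewrite (spectral_norm_leP _ c0); split=> h v; first exact: h.
pose M k l := (if k == l then c ^+ 2 else 0) - \sum_i A i k * A i l.
pose f (v : 'I_p -> R) := \sum_k \sum_l M k l * (v k * v l).
have fE (u : 'I_p -> R) : f u = c ^+ 2 * (\sum_k u k ^+ 2) - \sum_i (\sum_k A i k * u k) ^+ 2.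
  have e1 : \sum_i (\sum_k A i k * u k) ^+ 2 = \sum_k \sum_l (\sum_i A i k * A i l) * (u k * u l).
    transitivity (\sum_i \sum_k \sum_l A i k * A i l * (u k * u l)).
      apply: eq_bigr => i _; rewrite expr2 mulr_suml; apply: eq_bigr => k _.
      by rewrite mulr_sumr; apply: eq_bigr => l _; ring.
    rewrite exchange_big/=; apply: eq_bigr => k _; rewrite exchange_big/=.
    by apply: eq_bigr => l _; rewrite mulr_suml.
  rewrite e1 mulr_sumr -sumrB; apply: eq_bigr => k _.
  have -> : c ^+ 2 * u k ^+ 2 = \sum_l (if k == l then c ^+ 2 else 0) * (u k * u l).
    rewrite (bigD1 k)//= eqxx big1 ?addr0 ?expr2// => l lk.
    by rewrite eq_sym (negPf lk) mul0r.
  by rewrite -sumrB; apply: eq_bigr => l _; rewrite /M mulrBl.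
suff : 0 <= f v by rewrite fE subr_ge0.
(* A local Lipschitz constant: moving each coordinate by at most t <= 1 changes the quadratic form f
   by at most t C. *)
pose C := \sum_k \sum_l `|M k l| * (`|v k| + `|v l| + 1).
have C0 : 0 <= C.
  by apply: sumr_ge0 => k _; apply: sumr_ge0 => l _; rewrite mulr_ge0// !addr_ge0.
have key t : 0 < t -> t <= 1 -> - (t * C) <= f v.
  move=> t0 t1.
  have hq k : exists q : rat, `|ratr q - v k| <= t.
    have [|q] := @rat_in_itvoo R (v k) (v k + t); first by rewrite ltrDl.
    rewrite in_itv/= => /andP[q1 q2]; exists q; rewrite ler_norml; apply/andP; split; lra.
  have [q hqs] := choice hq.
  pose u := finfun q.
  have : 0 <= f (fun k => ratr (u k)) by rewrite fE subr_ge0; exact: h.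
  have : `|f (fun k => ratr (u k)) - f v| <= t * C.
    rewrite /f -sumrB; apply: le_trans (ler_norm_sum _ _ _) _.
    rewrite /C mulr_sumr; apply: ler_sum => k _; rewrite -sumrB.
    apply: le_trans (ler_norm_sum _ _ _) _; rewrite mulr_sumr; apply: ler_sum => l _.
    rewrite -mulrBr normrM [leRHS]mulrCA. apply: ler_wpM2l => //.
    have := hqs k; have := hqs l; rewrite !ffunE.
    set a := ratr (q k); set b := ratr (q l) => hb ha.
    have -> : a * b - v k * v l = v k * (b - v l) + (a - v k) * v l + (a - v k) * (b - v l) by ring.
    apply: le_trans (ler_normD _ _) _; apply: le_trans (lerD (ler_normD _ _) (lexx _)) _.
    rewrite !normrM.
    have h1 : `|v k| * `|b - v l| <= `|v k| * t by rewrite ler_wpM2l.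
    have h2 : `|a - v k| * `|v l| <= t * `|v l| by rewrite ler_wpM2r.
    have h3 : `|a - v k| * `|b - v l| <= t * 1.
      by apply: ler_pM => //; exact: le_trans hb t1.
    by apply: le_trans (lerD (lerD h1 h2) h3) _; lra.
  by rewrite ler_norml => /andP[h1 h2] h3; lra.
rewrite leNgt; apply/negP => fv.
have C1 : 0 < C + 1 by lra.
have F1 : 0 < 1 - f v by lra.
pose t := Num.min 1 (- f v / (2 * (C + 1))).
have t0 : 0 < t by rewrite lt_min ltr01 divr_gt0 ?mulr_gt0// oppr_gt0.
have t1 : t <= 1 by rewrite ge_min lexx.
have t2 : t * (2 * (C + 1)) <= - f v by rewrite -ler_pdivlMr ?mulr_gt0// ge_min lexx orbT.
have := key t t0 t1.
have : 0 <= t * C by rewrite mulr_ge0// ltW.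
by move: t2; rewrite !mulrDr => t2 t3 t4; lra.
Qed.

(* Schur's test. *)
Lemma spectral_norm_le_rowsum A c : 0 <= c -> (forall i k, A i k = A k i) ->
  (forall i, \sum_k `|A i k| <= c) -> spectral_norm A <= c.
Proof.
move=> c0 As hA; apply/spectral_norm_leP => // v.
apply: (@le_trans _ _ (\sum_i c * \sum_k `|A i k| * v k ^+ 2)).
  apply: ler_sum => i _.
  (* Splitting |A i k| into two square roots makes the row sum one factor of Cauchy-Schwarz. *)
  have := cauchy_sum (fun k => Num.sqrt `|A i k|) (fun k => Num.sqrt `|A i k| * `|v k|).
  have -> : \sum_k Num.sqrt `|A i k| * (Num.sqrt `|A i k| * `|v k|) = \sum_k `|A i k * v k|.
    by apply: eq_bigr => k _; rewrite mulrA -expr2 sqr_sqrtr// normrM.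
  have -> : \sum_k Num.sqrt `|A i k| ^+ 2 = \sum_k `|A i k|.
    by apply: eq_bigr => k _; rewrite sqr_sqrtr.
  have -> : \sum_k (Num.sqrt `|A i k| * `|v k|) ^+ 2 = \sum_k `|A i k| * v k ^+ 2.
    by apply: eq_bigr => k _; rewrite exprMn sqr_sqrtr// real_normK ?num_real.
  move=> h; apply: (@le_trans _ _ ((\sum_k `|A i k * v k|) ^+ 2)).
    rewrite -[leLHS]real_normK ?num_real// lerXn2r ?nnegrE ?sumr_ge0//.
    exact: ler_norm_sum.
  apply: le_trans h _; apply: ler_wpM2r => //.
  by apply: sumr_ge0 => k _; rewrite mulr_ge0// sqr_ge0.
rewrite -mulr_sumr exchange_big/= expr2 -mulrA; apply: ler_wpM2l => //.
rewrite mulr_sumr; apply: ler_sum => k _; rewrite -mulr_suml ler_wpM2r ?sqr_ge0//.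
by apply: le_trans (hA k); apply: ler_sum => i _; rewrite As.
Qed.

End SpectralNorm.

(** * Deterministic thresholding bounds under an entrywise error bound *)

Section Thresholding.
Context {R : realType}.
Variables (r beta a : R).
Hypothesis r01 : 0 <= r < 1.
Hypothesis b01 : 0 < beta < 1.
Hypothesis a0 : 0 <= a.

Let g : R := (beta / (1 - beta)) `^ r.

Let b0 : 0 < beta. Proof. by case/andP: b01. Qed.
Let b1 : 0 < 1 - beta. Proof. by case/andP: b01 => _; rewrite subr_gt0. Qed.
Let r0 : 0 <= r. Proof. by case/andP: r01. Qed.
Let r1 : r < 1. Proof. by case/andP: r01. Qed.

Lemma abs_pow_ge0 (s : R) : 0 <= abs_pow s r.
Proof. by rewrite /abs_pow; case: ifP => // _; exact: powR_ge0. Qed.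

(** An entry that passes the threshold satisfies |sg| > a / beta - a = a (1 - beta) / beta, so a^r
    is at most |sg|^r times g. *)
Let large_sigma s sg : `|s - sg| <= a -> beta^-1 * a < `|s| -> 0 < a ->
  a `^ r <= abs_pow sg r * g.
Proof.
move=> hs ht ap.
have sp : a * (1 - beta) / beta < `|sg|.
  have -> : a * (1 - beta) / beta = beta^-1 * a - a by field; rewrite gt_eqF.
  have : `|s| <= `|s - sg| + `|sg| by rewrite -[X in `|X| <= _](subrK sg s) ler_normD.
  lra.
have sg0 : 0 < `|sg| by apply: lt_trans sp; rewrite divr_gt0 ?mulr_gt0.
rewrite /abs_pow ifF; last by apply/negbTE; rewrite -normr_gt0.
have q0 : 0 <= beta / (1 - beta) by rewrite divr_ge0 ?(ltW b0) ?(ltW b1).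
have h : a <= `|sg| * (beta / (1 - beta)).
  by rewrite -ler_pdivrMr ?divr_gt0// invf_div mulrA ltW.
by rewrite /g -powRM// ge0_ler_powR// ?nnegrE// mulr_ge0.
Qed.

Let powR_split x q : 0 < x -> x `^ q = x `^ (q - r) * x `^ r.
Proof.
move=> xp; rewrite -powRD; first by congr (_ `^ _); ring.
by apply/implyP => _; rewrite gt_eqF.
Qed.

(* q = 1 gives the spectral norm bound, q = 2 the Frobenius one. *)
Lemma threshold_entry (q : nat) s sg : (0 < q)%N -> `|s - sg| <= a ->
  `|(if beta^-1 * a < `|s| then s else 0) - sg| ^+ q <=
  abs_pow sg r * (((1 + beta) ^+ q / beta `^ (q%:R - r) + g) * a `^ (q%:R - r)).
Proof.
move=> q0 hs.
have q1 : 1 <= q%:R :> R by rewrite ler1n.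
have qr : 0 < q%:R - r by have := r1; lra.
have gg : 0 <= g := powR_ge0 _ _.
have bb : 0 <= (1 + beta) ^+ q / beta `^ (q%:R - r).
  by rewrite divr_ge0 ?powR_ge0// exprn_ge0// addr_ge0// ltW.
have aq : 0 <= a `^ (q%:R - r) := powR_ge0 _ _.
have ag := abs_pow_ge0 sg.
case: ifPn => [ht|ht].
  (* The entry is kept: the error is at most a, and [large_sigma] trades the factor a^r for
     [abs_pow sg r]. *)
  apply: (@le_trans _ _ (a ^+ q)); first by rewrite lerXn2r// nnegrE.
  have [e|ap] := eqVneq a 0.
    by rewrite e expr0n gtn_eqF//= !mulr_ge0 ?addr_ge0 ?powR_ge0.
  have {}ap : 0 < a by rewrite lt_def ap.
  rewrite -[a ^+ q]powR_mulrn// (@powR_split a)//.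
  apply: (@le_trans _ _ ((abs_pow sg r * g) * a `^ (q%:R - r))).
    by rewrite [leLHS]mulrC ler_wpM2r// (large_sigma hs).
  rewrite -mulrA; apply: ler_wpM2l => //; apply: ler_wpM2r => //.
  by rewrite lerDr.
(* The entry is set to zero: the error is |sg| <= |s| + a <= (1 + beta) a / beta, and |sg|^r is
   split off. *)
rewrite sub0r normrN.
have hsg : `|sg| <= (1 + beta) / beta * a.
  rewrite -leNgt in ht.
  have : `|sg| <= `|s - sg| + `|s| by rewrite -[X in `|X| <= _](subKr s sg) (le_trans (ler_normB _ _))// addrC.
  have -> : (1 + beta) / beta * a = beta^-1 * a + a by field; rewrite gt_eqF.
  lra.
have [e|sp] := eqVneq sg 0.
  by rewrite e normr0 expr0n gtn_eqF//= !mulr_ge0 ?addr_ge0 ?abs_pow_ge0.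
rewrite /abs_pow (negPf sp) -[`|sg| ^+ q]powR_mulrn// (@powR_split `|sg|) ?normr_gt0//.
rewrite [leLHS]mulrC ler_wpM2l ?powR_ge0//.
apply: (@le_trans _ _ (((1 + beta) / beta * a) `^ (q%:R - r))).
  apply: ge0_ler_powR; rewrite ?nnegrE ?(ltW qr)//.
  by rewrite mulr_ge0// divr_ge0 ?(ltW b0)// addr_ge0// ltW.
have b2 : 0 <= 1 + beta by rewrite addr_ge0// ltW.
rewrite powRM ?divr_ge0 ?(ltW b0)// ler_wpM2r// powRM ?invr_ge0 ?(ltW b0)//.
rewrite -[X in _ * X `^ _]powR_inv1 ?(ltW b0)// -powRrM mulN1r powRN.
apply: (@le_trans _ _ ((1 + beta) ^+ q / beta `^ (q%:R - r))); last by rewrite lerDl.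
rewrite ler_wpM2r ?invr_ge0 ?powR_ge0// -powR_mulrn// ler_powR//.
  by rewrite lerDl ltW.
by rewrite lerBlDr lerDl.
Qed.

Variables (p : nat) (S Sg : 'M[R]_p) (zeta : R).
Hypothesis hS : forall m k, `|S m k - Sg m k| <= a.
Hypothesis SS : forall m k, S m k = S k m.
Hypothesis sparse : sparse_class r zeta Sg.

Let Sgs m k : Sg m k = Sg k m.
Proof. by case: sparse => -[st _] _; rewrite -[in RHS]st mxE. Qed.

Let rows m : \sum_k abs_pow (Sg m k) r <= zeta.
Proof.
by case: sparse => _; apply: le_trans; apply: (le_bigmax _ (fun m => \sum_k abs_pow (Sg m k) r)).
Qed.

Let z0 : (0 < p)%N -> 0 <= zeta.
Proof.
move=> p0; apply: le_trans (rows (Ordinal p0)); apply: sumr_ge0 => k _; exact: abs_pow_ge0.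
Qed.

Let E := threshold (beta^-1 * a) S - Sg.

Lemma threshold_rowsum (q : nat) m : (0 < q)%N -> \sum_k `|E m k| ^+ q <=
  ((1 + beta) ^+ q / beta `^ (q%:R - r) + g) * zeta * a `^ (q%:R - r).
Proof.
move=> q0; apply: le_trans (_ : _ <= \sum_k abs_pow (Sg m k) r *
   (((1 + beta) ^+ q / beta `^ (q%:R - r) + g) * a `^ (q%:R - r))) _.
  by apply: ler_sum => k _; rewrite /E !mxE; exact: threshold_entry.
rewrite -mulr_suml [leRHS](_ : _ = zeta *
  (((1 + beta) ^+ q / beta `^ (q%:R - r) + g) * a `^ (q%:R - r))); last by ring.
apply: ler_wpM2r => //; apply: mulr_ge0; last exact: powR_ge0.
apply: addr_ge0; last exact: powR_ge0.
by rewrite divr_ge0 ?powR_ge0// exprn_ge0// addr_ge0// ltW.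
Qed.

(** Since E is symmetric, Schur's test turns row sums into the spectral bound. The entrywise
    estimate has the constants 1 + beta and (1 + beta)^2, which lie below 3 + 2 beta and 2 (4 + 3
    beta^2). *)
Lemma threshold_bounds : (0 < p)%N ->
  spectral_norm E <= ((3 + 2 * beta) / beta `^ (1 - r) + g) * zeta * a `^ (1 - r) /\
  p%:R^-1 * frob_norm E ^+ 2 <=
    2 * ((4 + 3 * beta ^+ 2) / beta `^ (2 - r) + 2 * g) * zeta * a `^ (2 - r).
Proof.
move=> p0; have zz := z0 p0.
have gg : 0 <= g := powR_ge0 _ _.
have pos q : 0 < beta `^ q by exact: powR_gt0.
split.
  apply: spectral_norm_le_rowsum.
  - rewrite !mulr_ge0 ?powR_ge0// addr_ge0// divr_ge0 ?powR_ge0//.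
    by rewrite addr_ge0// mulr_ge0// ltW.
  - by move=> i k; rewrite /E !mxE SS Sgs.
  move=> m; have := threshold_rowsum m (isT : (0 < 1)%N).
  rewrite (eq_bigr (fun k => `|E m k|)) => [h|k _]; last exact: expr1.
  apply: le_trans h _; rewrite expr1.
  rewrite ler_wpM2r ?powR_ge0// ler_wpM2r// lerD2r ler_pM2r ?invr_gt0//.
  by have := b0; lra.
rewrite ler_pdivrMl ?ltr0n// /frob_norm sqr_sqrtr; last first.
  by apply: sumr_ge0 => i _; exact: sum_sqr_ge0.
apply: le_trans (_ : _ <= \sum_(i < p) (((1 + beta) ^+ 2 / beta `^ (2 - r) + g) * zeta * a `^ (2 - r))) _.
  apply: ler_sum => m _; have := threshold_rowsum m (isT : (0 < 2)%N).
  by rewrite (eq_bigr (fun k => E m k ^+ 2)) => // k _; rewrite real_normK ?num_real.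
rewrite sumr_const card_ord -[leLHS]mulr_natl; apply: ler_wpM2l => //.
rewrite ler_wpM2r ?powR_ge0// ler_wpM2r// mulrDr; apply: lerD; last by lra.
rewrite mulrA ler_pM2r ?invr_gt0//; have := sqr_ge0 (beta - 1); have := sqr_ge0 beta; nra.
Qed.

End Thresholding.

(** * Bootstrap covariance *)

Section BootstrapAlgebra.
Context {R : realType} (n p : nat).
Hypothesis n4 : (4 <= n)%N.
Variable x : 'I_n -> 'cV[R]_p.
Implicit Types (m k : 'I_p) (i : 'I_n) (f g : 'I_n -> R).

Definition avg (f : 'I_n -> R) : R := n%:R^-1 * \sum_i f i.

Let nR : 4 <= n%:R :> R. Proof. by rewrite (ler_nat R 4). Qed.
Let n0 : n%:R != 0 :> R. Proof. by rewrite pnatr_eq0 -lt0n (leq_trans _ n4). Qed.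
Let n1E : n.-1%:R = n%:R - 1 :> R.
Proof. by rewrite -subn1 natrB// (leq_trans _ n4). Qed.
Let n10 : n%:R - 1 != 0 :> R. Proof. by apply/eqP; have := nR; lra. Qed.

Lemma avgD f g : avg (fun i => f i + g i) = avg f + avg g.
Proof. by rewrite /avg big_split mulrDr. Qed.
Lemma avgZ c f : avg (fun i => c * f i) = c * avg f.
Proof. by rewrite /avg -mulr_sumr mulrCA. Qed.
Lemma avgB f g : avg (fun i => f i - g i) = avg f - avg g.
Proof. by rewrite /avg sumrB mulrBr. Qed.
Lemma avg_cst c : avg (fun=> c) = c.
Proof. by rewrite /avg sumr_const card_ord -[c *+ _]mulr_natl mulrA mulVf// mul1r. Qed.
Lemma avg_le f g : (forall i, f i <= g i) -> avg f <= avg g.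
Proof. by move=> h; rewrite /avg ler_wpM2l ?invr_ge0//; exact: ler_sum. Qed.
Lemma avg_ge0 f : (forall i, 0 <= f i) -> 0 <= avg f.
Proof. by move=> h; rewrite /avg mulr_ge0 ?invr_ge0// sumr_ge0. Qed.
Lemma avg_norm f : `|avg f| <= avg (fun i => `|f i|).
Proof.
rewrite /avg normrM ger0_norm ?invr_ge0// ler_wpM2l ?invr_ge0//.
exact: ler_norm_sum.
Qed.
Lemma sum_avg f : \sum_i f i = n%:R * avg f.
Proof. by rewrite /avg mulrA mulfV// mul1r. Qed.

Let xb m := sample_mean x m 0.
Let S := sample_cov x.
Definition raw m k : R := avg (fun i => x i m 0 * x i k 0).
Definition cprod i m k : R := (x i m 0 - xb m) * (x i k 0 - xb k).
(* The multiplier of e_i in 2 sqrt n T_n^sharp: the average of h(x_i, x_j) over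
   j <> i is a combination of (x_i - xbar)(x_i - xbar)^T and the sample covariance. *)
Definition bootB i m k : R := n%:R / (n%:R - 1) * cprod i m k - S m k.

Lemma sample_meanE m : xb m = avg (fun i => x i m 0).
Proof. by rewrite /xb /sample_mean /avg !mxE summxE. Qed.

Lemma avg_cprod m k : avg (fun i => cprod i m k) = raw m k - xb m * xb k.
Proof.
rewrite /cprod (_ : (fun i => _) = fun i => (x i m 0 * x i k 0 - xb m * x i k 0) -
   (xb k * x i m 0 - xb m * xb k)); last by apply/funext => i; ring.
rewrite !avgB !avgZ avg_cst -!sample_meanE /raw; ring.
Qed.

Lemma sample_covE m k : S m k = n%:R / (n%:R - 1) * (raw m k - xb m * xb k).
Proof.
rewrite -avg_cprod /S /sample_cov mxE summxE n1E /avg.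
rewrite (eq_bigr (fun i => cprod i m k)); last first.
  by move=> i _; rewrite mxE big_ord1 /cprod /xb !mxE.
by field; rewrite n0 n10.
Qed.

Lemma sample_cov_sym m k : S m k = S k m.
Proof.
by rewrite !sample_covE mulrC [xb m * _]mulrC mulrC /raw; congr (_ * (avg _ - _)); apply/funext => i; rewrite mulrC.
Qed.

Lemma boot_summand i m k :
  2 * (n.-1%:R^-1 * (\sum_(j < n | j != i) cov_kernel (x i) (x j)) m k - S m k) =
  bootB i m k.
Proof.
have e1 : (\sum_(j < n | j != i) cov_kernel (x i) (x j)) m k =
    \sum_j 2^-1 * ((x i m 0 - x j m 0) * (x i k 0 - x j k 0)).
  rewrite summxE [RHS](bigD1 i)//= subrr mul0r mulr0 add0r; apply: eq_bigr => j _.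
  by rewrite /cov_kernel !mxE big_ord1 !mxE.
rewrite e1 n1E sum_avg.
have -> : avg (fun j => 2^-1 * ((x i m 0 - x j m 0) * (x i k 0 - x j k 0))) =
    2^-1 * (x i m 0 * x i k 0 - xb m * x i k 0 - xb k * x i m 0 + raw m k).
  rewrite avgZ (_ : (fun i0 => _) = fun j => (x i m 0 * x i k 0 - x i k 0 * x j m 0) -
   (x i m 0 * x j k 0 - x j m 0 * x j k 0)); last by apply/funext => j; ring.
  by rewrite !avgB !avgZ avg_cst -!sample_meanE /raw; congr (_ * _); ring.
by rewrite /bootB sample_covE /cprod; field.
Qed.

Lemma boot_TE e m k : 2 * (Num.sqrt n%:R)^-1 * `|boot_T x e m k| =
  `|n%:R^-1 * \sum_i bootB i m k * e i|.
Proof.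
have s0 : 0 < Num.sqrt n%:R :> R by rewrite sqrtr_gt0; have := nR; lra.
have -> : boot_T x e m k = (Num.sqrt n%:R)^-1 * (2^-1 * \sum_i bootB i m k * e i).
  rewrite /boot_T mxE summxE; congr (_ * _); rewrite mulr_sumr; apply: eq_bigr => i _.
  rewrite -boot_summand !mxE -/S; by field; rewrite n1E.
rewrite -[2 * _]ger0_norm; last by rewrite mulr_ge0// invr_ge0 ltW.
rewrite -normrM; congr `|_|.
have -> : n%:R^-1 = (Num.sqrt n%:R)^-1 * (Num.sqrt n%:R)^-1 :> R.
  by rewrite -invfM -expr2 sqr_sqrtr//; have := nR; lra.
by field; rewrite gt_eqF.
Qed.

Lemma boot_TbarE e : boot_Tbar x e = 
  \big[Num.max/0]_(m < p) \big[Num.max/0]_(k < p) `|n%:R^-1 * \sum_i bootB i m k * e i|.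
Proof.
have c0 : 0 <= 2 * (Num.sqrt n%:R)^-1 :> R by rewrite mulr_ge0// invr_ge0.
rewrite /boot_Tbar.
have mx (F : 'I_p -> R) : 2 * (Num.sqrt n%:R)^-1 * \big[Num.max/0]_(k < p) F k =
    \big[Num.max/0]_(k < p) (2 * (Num.sqrt n%:R)^-1 * F k).
  by elim/big_rec2 : _ => [|i y1 y2 _ <-]; [rewrite mulr0|rewrite maxr_pMr].
rewrite mx; apply: eq_bigr => m _; rewrite mx; apply: eq_bigr => k _.
exact: boot_TE.
Qed.

Lemma boot_Tbar_le e t : (0 < p)%N ->
  boot_Tbar x e <= t <-> forall m k, `|n%:R^-1 * \sum_i bootB i m k * e i| <= t.
Proof.
move=> p0; rewrite boot_TbarE; split => [h m k|h].
  apply: le_trans h; apply: le_trans (le_bigmax _ _ m).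
  exact: (le_bigmax _ (fun k => `|n%:R^-1 * \sum_i bootB i m k * e i|) k).
(* The maxima start at 0; as p > 0 there is an entry, and it forces t >= 0. *)
have t0 : 0 <= t := le_trans (normr_ge0 _) (h (Ordinal p0) (Ordinal p0)).
apply/bigmax_leP; split => // m _; apply/bigmax_leP; split => // k _; exact: h.
Qed.

(** * Deterministic estimates on good data *)

Section GoodData.
Variables (Sg : 'M[R]_p) (z : 'I_n -> R) (nu kap rho c1 : R).
Hypothesis nu0 : 0 < nu.
Hypothesis k0 : 0 < kap.
Hypothesis k1 : kap <= 1.
Hypothesis rho0 : 0 < rho.
Hypothesis rhok : rho <= kap.
Hypothesis c10 : 0 <= c1.
Hypothesis c1nu : 1 <= c1 * nu ^+ 2.
Hypothesis hz : forall i k, `|x i k 0| <= z i.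
Hypothesis hz2 : avg (fun i => z i ^+ 2) <= 2 * (nu ^+ 2 / kap ^+ 2).
Hypothesis hz4 : avg (fun i => z i ^+ 4) <= 2 * (nu ^+ 4 / kap ^+ 4).
Hypothesis hxb : forall k, nu * `|xb k| <= rho.
Hypothesis hraw : forall m k, `|raw m k - Sg m k| <= rho.
Hypothesis hSg : forall m k, `|Sg m k| <= 2 * nu ^+ 2.
Hypothesis hn : nu ^+ 4 <= n%:R * (rho ^+ 2 * kap ^+ 4).

Let Q i m k := x i m 0 * x i k 0 - Sg m k.
Let Rr i m k := bootB i m k - Q i m k.
Let u := rho / nu.

Let u0 : 0 <= u. Proof. by rewrite divr_ge0// ltW. Qed.

Let xbu k : `|xb k| <= u.
Proof. by rewrite ler_pdivlMr// mulrC. Qed.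

Let rho1 : rho <= 1 := le_trans rhok k1.

Let u2 : u ^+ 2 <= c1 * rho ^+ 2.
Proof.
rewrite /u expr_div_n ler_pdivrMr ?exprn_gt0// mulrAC.
have : 0 <= rho ^+ 2 by rewrite sqr_ge0.
by move=> h; rewrite -[leLHS]mul1r ler_wpM2r.
Qed.

Let u4 : u ^+ 4 <= c1 ^+ 2 * rho ^+ 2.
Proof.
rewrite (_ : 4 = 2 * 2)%N// exprM; apply: (@le_trans _ _ ((c1 * rho ^+ 2) ^+ 2)).
  by rewrite lerXn2r// nnegrE ?sqr_ge0// mulr_ge0// sqr_ge0.
rewrite exprMn ler_wpM2l ?sqr_ge0// -[leRHS]mulr1 expr2 ler_wpM2l ?sqr_ge0//.
by rewrite expr_le1// ltW.
Qed.

Let nu2n : nu ^+ 2 / n%:R <= rho.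
Proof.
have h : (nu ^+ 2 / n%:R) ^+ 2 <= rho ^+ 2.
  rewrite expr_div_n -exprM (_ : 2 * 2 = 4)%N// ler_pdivrMr; last first.
    by rewrite exprn_gt0//; have := nR; lra.
  apply: le_trans hn _; rewrite mulrC -mulrA; apply: ler_wpM2l; first exact: sqr_ge0.
  have k4 : kap ^+ 4 <= 1 by rewrite expr_le1// ltW.
  rewrite expr2; apply: ler_wpM2r; first by have := nR; lra.
  by have := nR; lra.
by rewrite -ler_sqr ?nnegrE// ?divr_ge0 ?sqr_ge0 ?(ltW rho0).
Qed.

(** The difference is raw / (n - 1) minus n / (n - 1) times the product of the means; both 1 / (n -
    1) <= 2 / n and n / (n - 1) <= 2 hold for n >= 4. *)
Lemma sample_cov_raw m k :
  `|S m k - raw m k| <= 2 * ((2 * nu ^+ 2 + rho) / n%:R) + 2 * (`|xb m| * `|xb k|).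
Proof.
have -> : S m k - raw m k = (n%:R - 1)^-1 * raw m k - (n%:R / (n%:R - 1)) * (xb m * xb k).
  by rewrite sample_covE; field.
have n1 : 0 < n%:R - 1 :> R by have := nR; lra.
have nn : 0 < n%:R :> R by have := nR; lra.
apply: le_trans (ler_normB _ _) _; apply: lerD.
  rewrite normrM gtr0_norm ?invr_gt0//.
  have h1 : `|raw m k| <= 2 * nu ^+ 2 + rho.
    rewrite -[raw m k](subrK (Sg m k)); apply: le_trans (ler_normD _ _) _.
    by rewrite addrC lerD.
  have h2 : (n%:R - 1)^-1 <= 2 / n%:R :> R.
    by rewrite ler_pdivlMr// mulrC ler_pdivrMr//; have := nR; lra.
  rewrite mulrA [2 * _ / _]mulrAC; apply: ler_pM => //; by rewrite invr_ge0 ltW.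
rewrite normrM ger0_norm; last by rewrite divr_ge0 ?ltW.
rewrite normrM; apply: ler_wpM2r; first by rewrite mulr_ge0.
by rewrite ler_pdivrMr//; have := nR; lra.
Qed.

Let S_close m k : `|S m k - Sg m k| <= (7 + 2 * c1) * rho.
Proof.
rewrite -[S m k](subrK (raw m k)) -addrA; apply: le_trans (ler_normD _ _) _.
have h1 := sample_cov_raw m k; have h2 := hraw m k.
have h3 : `|xb m| * `|xb k| <= c1 * rho.
  apply: (@le_trans _ _ (u ^+ 2)); first by rewrite expr2 ler_pM.
  apply: le_trans u2 _; rewrite expr2 mulrA -[leRHS]mulr1.
  by rewrite ler_wpM2l// mulr_ge0// ltW.
have h4 : (2 * nu ^+ 2 + rho) / n%:R <= 3 * rho.
  rewrite mulrDl -mulrA; have h5 : rho / n%:R <= rho.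
    by rewrite ler_pdivrMr ?ler_peMr ?(ltW rho0)//; have := nR; lra.
  by have := nu2n; lra.
by lra.
Qed.

(** The factor 3 is the price of splitting a square of three terms; the rest collects the bounds
    [q1] to [q5] of the next lemma. *)
Definition cR : R := 3 * (32 + 10 * c1 ^+ 2 + (7 + 2 * c1) ^+ 2).

Let cprod_le i m k : cprod i m k ^+ 2 <= 8 * (z i ^+ 4 + u ^+ 4).
Proof.
have z0 : 0 <= z i := le_trans (normr_ge0 _) (hz i m).
have h l : `|x i l 0 - xb l| <= z i + u.
  by apply: le_trans (ler_normB _ _) _; rewrite lerD.
have : `|cprod i m k| <= (z i + u) ^+ 2 by rewrite /cprod normrM expr2 ler_pM.
have zu : 0 <= z i + u by rewrite addr_ge0.
move=> h1; apply: (@le_trans _ _ (((z i + u) ^+ 2) ^+ 2)).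
  by rewrite -[leLHS]real_normK ?num_real// lerXn2r// nnegrE ?sqr_ge0.
have h2 : (z i + u) ^+ 2 <= 2 * (z i ^+ 2 + u ^+ 2) by have := sqr_ge0 (z i - u); nra.
have h3 : ((z i + u) ^+ 2) ^+ 2 <= (2 * (z i ^+ 2 + u ^+ 2)) ^+ 2.
  by rewrite lerXn2r ?nnegrE ?sqr_ge0// mulr_ge0// addr_ge0// sqr_ge0.
apply: le_trans h3 _; rewrite (_ : z i ^+ 4 = (z i ^+ 2) ^+ 2); last by rewrite -exprM.
rewrite (_ : u ^+ 4 = (u ^+ 2) ^+ 2); last by rewrite -exprM.
by have := sqr_ge0 (z i ^+ 2 - u ^+ 2); nra.
Qed.

Let cross_le i m k : (cprod i m k - x i m 0 * x i k 0) ^+ 2 <= 8 * u ^+ 2 * z i ^+ 2 + 2 * u ^+ 4.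
Proof.
have z0 : 0 <= z i := le_trans (normr_ge0 _) (hz i m).
have -> : cprod i m k - x i m 0 * x i k 0 = xb m * xb k - x i m 0 * xb k - xb m * x i k 0.
  by rewrite /cprod; ring.
have h : `|xb m * xb k - x i m 0 * xb k - xb m * x i k 0| <= u ^+ 2 + 2 * z i * u.
  apply: le_trans (ler_normB _ _) _; apply: le_trans (lerD (ler_normB _ _) (lexx _)) _.
  rewrite !normrM.
  have h1 : `|xb m| * `|xb k| <= u * u by rewrite ler_pM.
  have h2 : `|x i m 0| * `|xb k| <= z i * u by rewrite ler_pM.
  have h3 : `|xb m| * `|x i k 0| <= u * z i by rewrite ler_pM.
  by apply: le_trans (lerD (lerD h1 h2) h3) _; rewrite expr2; lra.
have zu : 0 <= z i * u by rewrite mulr_ge0.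
apply: (@le_trans _ _ ((u ^+ 2 + 2 * z i * u) ^+ 2)).
  rewrite -[leLHS]real_normK ?num_real// lerXn2r// nnegrE.
  by rewrite addr_ge0 ?sqr_ge0// -mulrA mulr_ge0.
have -> : 8 * u ^+ 2 * z i ^+ 2 = 8 * (z i * u) ^+ 2 by ring.
have -> : u ^+ 4 = (u ^+ 2) ^+ 2 by rewrite -exprM.
by have := sqr_ge0 (u ^+ 2 - 2 * (z i * u)); nra.
Qed.

(** The residual has three sources: the factor n / (n - 1) instead of 1, the centring by sample
    means in place of 0, and the sample covariance in place of [Sg]. Each has a mean square of order
    rho^2 / kap^2. *)
Lemma boot_residual m k : avg (fun i => Rr i m k ^+ 2) <= cR * (rho ^+ 2 / kap ^+ 2).
Proof.
have nn : 0 < n%:R :> R by have := nR; lra.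
set g := (n%:R - 1 : R)^-1.
have RE i : Rr i m k = g * cprod i m k + (cprod i m k - x i m 0 * x i k 0) - (S m k - Sg m k).
  by rewrite /Rr /bootB /Q /g; field.
have g2 : g ^+ 2 <= n%:R^-1.
  rewrite /g exprVn lef_pV2 ?posrE ?exprn_gt0//; last by have := nR; lra.
  by have := nR; nra.
have pt i : Rr i m k ^+ 2 <= 3 * ((8 * n%:R^-1) * z i ^+ 4 + 8 * n%:R^-1 * u ^+ 4) +
    3 * ((8 * u ^+ 2) * z i ^+ 2 + 2 * u ^+ 4) + 3 * ((7 + 2 * c1) * rho) ^+ 2.
  have h1 : (g * cprod i m k) ^+ 2 <= n%:R^-1 * (8 * (z i ^+ 4 + u ^+ 4)).
    by rewrite exprMn ler_pM// ?sqr_ge0.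
  have h2 := cross_le i m k.
  have h3 : (S m k - Sg m k) ^+ 2 <= ((7 + 2 * c1) * rho) ^+ 2.
    rewrite -[leLHS]real_normK ?num_real// lerXn2r// nnegrE//.
    by rewrite mulr_ge0 ?(ltW rho0)// addr_ge0// mulr_ge0.
  rewrite RE; set a := g * _ in h1 *; set b := (X in X ^+ 2 <= _) in h2 *.
  set c := S m k - _ in h3 *.
  have : (a + b - c) ^+ 2 <= 3 * a ^+ 2 + 3 * b ^+ 2 + 3 * c ^+ 2.
    have := sqr_ge0 (a - b); have := sqr_ge0 (a + c); have := sqr_ge0 (b + c); nra.
  by move=> h4; apply: le_trans h4 _; rewrite -!mulrA in h1 h2 *; lra.
have [v vE] : {v | v = u ^+ 4} by exists (u ^+ 4).
rewrite -vE in pt; apply: le_trans (avg_le pt) _.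
rewrite !avgD avg_cst !avgZ !avgD !avgZ !avg_cst.
have ik : 1 <= kap ^- 2 by rewrite invf_ge1 ?exprn_gt0// expr_le1// ltW.
have r2 : 0 <= rho ^+ 2 by rewrite sqr_ge0.
have rr : rho ^+ 2 <= rho ^+ 2 / kap ^+ 2 by rewrite ler_peMr.
have c2 : 0 <= c1 ^+ 2 by rewrite sqr_ge0.
have q1 : n%:R^-1 * avg (fun i => z i ^+ 4) <= 2 * (rho ^+ 2 / kap ^+ 2).
  apply: (@le_trans _ _ (2 * rho ^+ 2)); last by rewrite ler_pM2l.
  rewrite ler_pdivrMl//; apply: le_trans hz4 _; rewrite [leRHS]mulrCA ler_pM2l//.
  by rewrite ler_pdivrMr ?exprn_gt0// -mulrA.
have q2 : n%:R^-1 * u ^+ 4 <= c1 ^+ 2 * (rho ^+ 2 / kap ^+ 2).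
  apply: (@le_trans _ _ (u ^+ 4)).
    rewrite ler_piMl ?exprn_ge0// invf_le1//; by have := nR; lra.
  by apply: le_trans u4 _; rewrite ler_wpM2l.
have q3 : u ^+ 2 * avg (fun i => z i ^+ 2) <= 2 * (rho ^+ 2 / kap ^+ 2).
  apply: (@le_trans _ _ (u ^+ 2 * (2 * (nu ^+ 2 / kap ^+ 2)))); first by rewrite ler_wpM2l ?sqr_ge0.
  by rewrite /u le_eqVlt; apply/orP; left; apply/eqP; field; rewrite !gt_eqF.
have q4 : u ^+ 4 <= c1 ^+ 2 * (rho ^+ 2 / kap ^+ 2).
  by apply: le_trans u4 _; rewrite ler_wpM2l.
have q5 : ((7 + 2 * c1) * rho) ^+ 2 <= (7 + 2 * c1) ^+ 2 * (rho ^+ 2 / kap ^+ 2).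
  by rewrite exprMn ler_wpM2l ?sqr_ge0.
rewrite /cR; set w := rho ^+ 2 / kap ^+ 2 in q1 q2 q3 q4 q5 *.
have w0 : 0 <= w by apply: le_trans rr.
have q6 : 0 <= c1 ^+ 2 * w by rewrite mulr_ge0.
rewrite {}vE; set A4 := avg _ in q1 *; set A2 := avg _ in q3 *.
rewrite [leLHS](_ : _ = 24 * (n%:R^-1 * A4) + 24 * (n%:R^-1 * u ^+ 4) + 24 * (u ^+ 2 * A2) +
  6 * u ^+ 4 + 3 * ((7 + 2 * c1) * rho) ^+ 2); last by ring.
rewrite [leRHS](_ : _ = 24 * (2 * w) + 24 * (c1 ^+ 2 * w) + 24 * (2 * w) + 6 * (c1 ^+ 2 * w) +
  3 * ((7 + 2 * c1) ^+ 2 * w)); last by ring.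
by apply: lerD; [apply: lerD; [apply: lerD; [apply: lerD|]|]|]; rewrite ler_pM2l.
Qed.

Variables (Gam : 'I_p * 'I_p -> 'I_p * 'I_p -> R) (s0 : R).
Hypothesis hGam : forall a b,
  `|avg (fun i => Q i a.1 a.2 * Q i b.1 b.2) - Gam a b| <= rho.
Hypothesis s00 : 0 < s0.
Hypothesis Gam0 : forall a, s0 <= Gam a a.

Definition cD : R := 1 + 2 * (1 + cR) / s0.

(** With bootB = Q + R the error consists of cross terms and a square of R. After standardization Q
    has bounded mean square and R mean square of order t^2, t = rho / kap, so weighting by t and 1 /
    t in the arithmetic-geometric mean inequality makes all terms of order t. *)
Lemma boot_gram a b :
  `|avg (fun i => bootB i a.1 a.2 * bootB i b.1 b.2) - Gam a b| <=
  cD * (rho / kap) * (Num.sqrt (Gam a a) * Num.sqrt (Gam b b)).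
Proof.
set sa := Num.sqrt (Gam a a); set sb := Num.sqrt (Gam b b).
have Ga a' : 0 < Gam a' a' := lt_le_trans s00 (Gam0 a').
have sa0 : 0 < sa by rewrite sqrtr_gt0.
have sb0 : 0 < sb by rewrite sqrtr_gt0.
have t0 : 0 < rho / kap by rewrite divr_gt0.
set t := rho / kap in t0 *.
have t1 : t <= 1 by rewrite ler_pdivrMr// mul1r.
have rt : rho <= t by rewrite ler_pdivlMr// ler_piMr// ltW.
have ab_s0 : s0 <= sa * sb.
  have q : Num.sqrt s0 <= sa by rewrite ler_wsqrtr.
  have q' : Num.sqrt s0 <= sb by rewrite ler_wsqrtr.
  by rewrite -[leLHS](sqr_sqrtr (ltW s00)) expr2; apply: ler_pM; rewrite ?sqrtr_ge0.
have sab : 0 < sa * sb by rewrite mulr_gt0.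
pose q (c : 'I_p * 'I_p) i := Q i c.1 c.2 / Num.sqrt (Gam c c).
pose r (c : 'I_p * 'I_p) i := Rr i c.1 c.2 / Num.sqrt (Gam c c).
have q2 c : avg (fun i => q c i ^+ 2) <= 1 + rho / s0.
  have -> : (fun i => q c i ^+ 2) = fun i => (Gam c c)^-1 * (Q i c.1 c.2 * Q i c.1 c.2).
    by apply/funext => i; rewrite /q expr_div_n sqr_sqrtr ?ltW// mulrC expr2.
  rewrite avgZ mulrC ler_pdivrMr// mulrDl mul1r.
  have : avg (fun i => Q i c.1 c.2 * Q i c.1 c.2) <= Gam c c + rho.
    by have := hGam c c; rewrite ler_norml => /andP[_]; rewrite lerBlDl.
  move=> h; apply: le_trans h _; rewrite lerD2l mulrAC ler_pdivlMr//.
  by rewrite ler_wpM2l// ltW.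
have r2 c : avg (fun i => r c i ^+ 2) <= cR * t ^+ 2 / s0.
  have -> : (fun i => r c i ^+ 2) = fun i => (Gam c c)^-1 * (Rr i c.1 c.2 ^+ 2).
    by apply/funext => i; rewrite /r expr_div_n sqr_sqrtr ?ltW// mulrC.
  rewrite avgZ [leRHS]mulrC; apply: ler_pM.
  - by rewrite invr_ge0 ltW.
  - by apply: avg_ge0 => i; exact: sqr_ge0.
  - by rewrite lef_pV2 ?posrE.
  - by rewrite /t expr_div_n; exact: boot_residual.
have cR0 : 0 <= cR.
  by rewrite /cR mulr_ge0// !addr_ge0 ?sqr_ge0// mulr_ge0// sqr_ge0.
have pt i : `|bootB i a.1 a.2 * bootB i b.1 b.2 - Q i a.1 a.2 * Q i b.1 b.2| <=
   sa * sb * (2^-1 * t * (q a i ^+ 2 + q b i ^+ 2) + (2^-1 * t^-1 + 2^-1) * (r a i ^+ 2 + r b i ^+ 2)).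
  have -> : bootB i a.1 a.2 * bootB i b.1 b.2 - Q i a.1 a.2 * Q i b.1 b.2 =
     sa * sb * (q a i * r b i + r a i * q b i + r a i * r b i).
    rewrite /q /r -/sa -/sb (_ : bootB i a.1 a.2 = Q i a.1 a.2 + Rr i a.1 a.2); last by rewrite /Rr; ring.
    rewrite (_ : bootB i b.1 b.2 = Q i b.1 b.2 + Rr i b.1 b.2); last by rewrite /Rr; ring.
    by field; rewrite !gt_eqF.
  rewrite normrM gtr0_norm// ler_pM2l//.
  have am (x1 x2 s : R) : 0 < s -> `|x1 * x2| <= 2^-1 * s * x1 ^+ 2 + 2^-1 * s^-1 * x2 ^+ 2.
    move=> sp; have -> : 2^-1 * s * x1 ^+ 2 + 2^-1 * s^-1 * x2 ^+ 2 =
       `|x1 * x2| + 2^-1 * s^-1 * (s * `|x1| - `|x2|) ^+ 2.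
      rewrite normrM -[x1 ^+ 2]real_normK ?num_real// -[x2 ^+ 2]real_normK ?num_real//.
      by field; rewrite gt_eqF.
    rewrite lerDl; apply: mulr_ge0; last exact: sqr_ge0.
    by rewrite mulr_ge0// invr_ge0 ltW.
  apply: le_trans (ler_normD _ _) _; apply: le_trans (lerD (ler_normD _ _) (lexx _)) _.
  have h1 := am (q a i) (r b i) t t0.
  have h2 := am (q b i) (r a i) t t0.
  have h3 := am (r a i) (r b i) 1 ltr01.
  rewrite [r a i * q b i]mulrC; apply: le_trans (lerD (lerD h1 h2) h3) _.
  by rewrite le_eqVlt; apply/orP; left; apply/eqP; field; rewrite gt_eqF.
have d1 : `|avg (fun i => bootB i a.1 a.2 * bootB i b.1 b.2) - avg (fun i => Q i a.1 a.2 * Q i b.1 b.2)| <=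
   sa * sb * (t * (1 + rho / s0) + (t^-1 + 1) * (cR * t ^+ 2 / s0)).
  rewrite -avgB; apply: le_trans (avg_norm _) _; apply: le_trans (avg_le pt) _.
  rewrite avgZ ler_pM2l// avgD !avgZ !avgD; apply: lerD.
    have -> : t * (1 + rho / s0) = 2^-1 * t * ((1 + rho / s0) + (1 + rho / s0)) by field; rewrite gt_eqF.
    by rewrite ler_wpM2l ?lerD// mulr_ge0// ltW.
  have -> : (t^-1 + 1) * (cR * t ^+ 2 / s0) =
    (2^-1 * t^-1 + 2^-1) * (cR * t ^+ 2 / s0 + cR * t ^+ 2 / s0) by field; rewrite !gt_eqF.
  by rewrite ler_wpM2l ?lerD// addr_ge0// mulr_ge0// invr_ge0 ltW.
rewrite -[_ - Gam a b](subrKA (avg (fun i => Q i a.1 a.2 * Q i b.1 b.2))).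
apply: le_trans (ler_normD _ _) _; apply: le_trans (lerD d1 (hGam a b)) _.
have e3 : rho <= sa * sb * (t / s0).
  apply: le_trans rt _; rewrite mulrA ler_pdivlMr// mulrC ler_pM2r//.
apply: le_trans (lerD (lexx _) e3) _; rewrite -mulrDr mulrC ler_pM2r//.
have -> : (t^-1 + 1) * (cR * t ^+ 2 / s0) = (cR / s0) * (t + t ^+ 2) by field; rewrite !gt_eqF.
have t2 : t ^+ 2 <= t by rewrite expr2 ler_piMr// ltW.
have cs : 0 <= cR / s0 by rewrite divr_ge0// ltW.
have e4 : (cR / s0) * (t + t ^+ 2) <= (cR / s0) * (2 * t) by rewrite ler_wpM2l//; lra.
have e5 : t * (rho / s0) <= t * s0^-1.
  by rewrite ler_pM2l// ler_pdivrMr// mulVf ?gt_eqF.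
rewrite /cD mulrDr mulr1.
have -> : (1 + 2 * (1 + cR) / s0) * t = t + 2 * (t * s0^-1) + cR / s0 * (2 * t) by field; rewrite gt_eqF.
by lra.
Qed.

End GoodData.

End BootstrapAlgebra.

(** * Moments and typical data *)

Section Transfer.
Context d (T : measurableType d) {R : realType} (P : probability T R).

Lemma L1_lty (f : T -> R) : measurable_fun setT f -> (forall w, 0 <= f w) ->
  (\int[P]_w (f w)%:E < +oo)%E -> L1 P f.
Proof.
move=> mf f0 h; apply/integrableP; split; first exact/measurable_EFinP.
apply: le_lt_trans h; rewrite le_eqVlt; apply/orP; left; apply/eqP.
by apply: eq_integral => w _ /=; rewrite ger0_norm.
Qed.

Lemma LqNorm_moment (q : nat) (f : T -> R) (c : R) : (0 < q)%N -> measurable_fun setT f -> 0 <= c ->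
  (LqNorm P q%:R f <= c%:E)%E ->
  L1 P (fun w => `|f w| ^+ q) /\ Ex P (fun w => `|f w| ^+ q) <= c ^+ q.
Proof.
move=> q0 mf c0 h; have qn : q%:R != 0 :> R by rewrite pnatr_eq0 -lt0n.
have e : (\int[P]_w (`|f w| ^+ q)%:E)%E = (LqNorm P q%:R f `^ q%:R)%E.
  rewrite /LqNorm poweR_Lnorm//; apply: eq_integral => w _ /=.
  by rewrite ?poweR_EFin powR_mulrn.
have le : (\int[P]_w (`|f w| ^+ q)%:E <= (c ^+ q)%:E)%E.
  rewrite e -powR_mulrn// -poweR_EFin; apply: gt0_ler_poweR => //.
  - by rewrite in_itv/= leey andbT; exact: Lnorm_ge0.
  - by rewrite in_itv/= leey andbT lee_fin.
have L : L1 P (fun w => `|f w| ^+ q).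
  apply: L1_lty => [|w|]; last exact: le_lt_trans le (ltry _).
    by apply: measurable_funX; exact: meas_normr.
  exact: exprn_ge0.
by split => //; rewrite -lee_fin -L1_EFin.
Qed.

Lemma LqNormE (q : nat) (f : T -> R) : (0 < q)%N -> L1 P (fun w => `|f w| ^+ q) ->
  LqNorm P q%:R f = ((Ex P (fun w => `|f w| ^+ q)) `^ q%:R^-1)%:E.
Proof.
move=> q0 L; rewrite /LqNorm unlock -poweR_EFin -L1_EFin//; congr (_ `^ _)%E.
by apply: eq_integral => w _ /=; rewrite ?poweR_EFin powR_mulrn.
Qed.

Context d' (T' : measurableType d').

Lemma identical_law (U V : {RV P >-> T'}) (f : T' -> R) :
  (forall B, measurable B -> distribution P U B = distribution P V B) ->
  measurable_fun setT f -> L1 P (f \o U) ->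
  L1 P (f \o V) /\ Ex P (f \o V) = Ex P (f \o U).
Proof.
move=> UV mf LU.
have mn : measurable_fun setT (fun y => (`|f y|)%:E) by apply/measurable_EFinP; exact: meas_normr.
have LV : L1 P (f \o V).
  apply/integrableP; split; first exact/measurable_EFinP/measurableT_comp.
  have -> : (\int[P]_w `|(EFin \o (f \o V)) w| = \int[P]_w `|(EFin \o (f \o U)) w|)%E.
    have e (W : {RV P >-> T'}) : (\int[P]_w `|(EFin \o (f \o W)) w| =
        \int[distribution P W]_y (`|f y|)%:E)%E.
      by rewrite ge0_integral_distribution// => y; rewrite lee_fin.
    by rewrite !e; apply: eq_measure_integral => B mB _; exact/esym/UV.
  by have /integrableP[] := LU.
split=> //; rewrite /Ex; congr fine.
have e (W : {RV P >-> T'}) : L1 P (f \o W) ->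
    (\int[P]_w ((f \o W) w)%:E = \int[distribution P W]_y (f y)%:E)%E.
  by move=> LW; rewrite integral_distribution//; exact/measurable_EFinP.
by rewrite !e//; apply: eq_measure_integral => B mB _; exact/esym/UV.
Qed.

Lemma covariance_centered (f g : T -> R) (c : R) :
  ('E_P[f] = 0)%E -> ('E_P[g] = 0)%E -> covariance P f g = c%:E ->
  Ex P (fun w => f w * g w) = c.
Proof.
move=> f0 g0; rewrite unlock f0 g0/= unlock => h; rewrite /Ex.
rewrite (_ : (\int[P]_w (f w * g w)%:E)%E = c%:E)// -h; apply: eq_integral => w _.
by rewrite ?fctE /= ?subr0.
Qed.

Lemma Ex_expectation (f : T -> R) : L1 P f -> ('E_P[f] = (Ex P f)%:E)%E.
Proof. by move=> L; rewrite unlock L1_EFin. Qed.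

End Transfer.

Section MaximalAverage.
Context d (T : measurableType d) {R : realType} (P : probability T R).
Context d1 (T1 : measurableType d1) (n : nat).
Variables (X : 'I_n -> T -> T1) (e : 'I_n -> {RV P >-> R}) (x0 : T1).
Hypothesis n0 : (0 < n)%N.
Hypothesis mX : forall i, measurable_fun setT (X i).
Hypothesis xI : forall i, indep P (X i) (looX X e x0 i).
Variables (I : finType) (g : I -> T1 -> R) (B : T1 -> R) (s : R).
Hypothesis mg : forall j, measurable_fun setT (g j).
Hypothesis gB : forall j x, `|g j x| <= B x.
Hypothesis B0 : forall x, 0 <= B x.
Hypothesis LB : forall i, L1 P (fun w => B (X i w) ^+ 2).
Hypothesis EB : forall i, Ex P (fun w => B (X i w) ^+ 2) <= s.
Hypothesis Eg : forall i j, Ex P (fun w => g j (X i w)) = 0.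
Hypothesis s0 : 0 < s.
Variable l : R.
Hypothesis l0 : 0 < l.
Hypothesis ll : ln ((2 * #|I|).+1%:R) <= l.

Definition max_avg w : R := \big[Num.max/0]_j `|avg (fun i => g j (X i w))|.

Lemma L1_max_avg : L1 P max_avg.
Proof.
have Lg i j : L1 P (fun w => g j (X i w)).
  apply: (L1_le (g := fun w => 1 + B (X i w) ^+ 2)).
  - exact: measurableT_comp.
  - move=> w; apply: le_trans (gB j (X i w)) _.
    by have := sqr_ge0 (B (X i w) - 1); have := B0 (X i w); nra.
  - by apply: L1D => //; exact: L1_cst.
have La j : L1 P (fun w => `|avg (fun i => g j (X i w))|).
  by apply: L1_norm; apply: L1Z; apply: L1_sum => i _.
apply: (L1_le (g := fun w => \sum_j `|avg (fun i => g j (X i w))|)).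
- by apply: meas_bigmax => j; exact: L1_meas (La j).
- move=> w; rewrite ger0_norm ?bigmax_ge_id//; apply/bigmax_leP; split => [|j _].
    exact: sumr_ge0.
  by rewrite (bigD1 j)//= lerDl; exact: sumr_ge0.
- by apply: L1_sum.
Qed.

(** Adding a sign to the index turns absolute values into a one-sided maximum over 2 |I| families.
    The choice of [lam] makes the entropy term equal to lam n s, and 5 = 1 + 4. *)
Lemma Ex_max_avg_le : Ex P max_avg <= 5 * Num.sqrt (l * s / n%:R).
Proof.
have nR : 0 < n%:R :> R by rewrite ltr0n.
pose f (j : I * bool) x := (-1) ^+ j.2 * g j.1 x.
have mf j : measurable_fun setT (f j) by apply: measurable_funM.
have fB j x : `|f j x| <= B x by rewrite normrM normrX normrN1 expr1n mul1r.
have Ef i j : Ex P (fun w => f j (X i w)) = 0.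
  rewrite /f ExZ ?Eg ?mulr0//.
  apply: (L1_le (g := fun w => 1 + B (X i w) ^+ 2)).
  - exact: measurableT_comp.
  - move=> w; apply: le_trans (gB j.1 (X i w)) _.
    by have := sqr_ge0 (B (X i w) - 1); have := B0 (X i w); nra.
  - by apply: L1D => //; exact: L1_cst.
pose lam := Num.sqrt (l / (n%:R * s)).
have lam0 : 0 < lam by rewrite sqrtr_gt0 divr_gt0// mulr_gt0.
have h := Ex_bigmax_sum_le mX xI mf fB B0 LB EB Ef lam0.
have hm w : max_avg w = n%:R^-1 * \big[Num.max/0]_j \sum_i f j (X i w).
  apply/eqP; rewrite eq_le; apply/andP; split.
    apply/bigmax_leP; split => [|j _]; first by rewrite mulr_ge0 ?invr_ge0// bigmax_ge_id.
    rewrite /avg normrM ger0_norm ?invr_ge0// ler_pM2l ?invr_gt0//.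
    rewrite ler_norml lerNl; apply/andP; split.
      apply: le_trans (le_bigmax _ _ (j, true)); rewrite /f/= expr1 -mulr_sumr mulN1r//.
    by apply: le_trans (le_bigmax _ _ (j, false)); rewrite /f/= expr0 -mulr_sumr mul1r.
  rewrite ler_pdivrMl//; apply/bigmax_leP; split => [|j _].
    by rewrite mulr_ge0// bigmax_ge_id.
  apply: (@le_trans _ _ (n%:R * `|avg (fun i => g j.1 (X i w))|)); last first.
    by rewrite ler_pM2l//; exact: (le_bigmax _ (fun j => `|avg (fun i => g j (X i w))|)).
  rewrite /avg normrM ger0_norm ?invr_ge0// mulrA mulfV ?gt_eqF// mul1r.
  apply: le_trans (ler_norm _) _; rewrite /f -mulr_sumr normrM normrX normrN1 expr1n mul1r//.
have -> : Ex P max_avg = n%:R^-1 * Ex P (fun w => \big[Num.max/0]_j \sum_i f j (X i w)).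
  have e1 : (fun w => \big[Num.max/0]_j \sum_i f j (X i w)) = fun w => n%:R * max_avg w.
    by apply/funext => w; rewrite hm mulrA mulfV ?mul1r// gt_eqF.
  by rewrite e1 ExZ ?mulrA ?mulVf ?mul1r ?gt_eqF//; exact: L1_max_avg.
rewrite ler_pdivrMl//; apply: le_trans h _.
have hl : ln (#|{: I * bool}|.+1%:R) <= l by rewrite card_prod card_bool mulnC.
apply: (@le_trans _ _ (l / lam + 4 * lam * (n%:R * s))).
  by rewrite lerD2r ler_pM2r ?invr_gt0.
have lam2 : lam ^+ 2 = l / (n%:R * s) by rewrite sqr_sqrtr// ltW// divr_gt0// mulr_gt0.
have -> : Num.sqrt (l * s / n%:R) = lam * s.
  have q : 0 <= lam * s by rewrite mulr_ge0 ?ltW.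
  rewrite -[RHS](ger0_norm q) -sqrtr_sqr exprMn lam2; congr Num.sqrt.
  by field; rewrite !gt_eqF.
have -> : l / lam = lam * (n%:R * s).
  have ns : n%:R * s != 0 by rewrite gt_eqF// mulr_gt0.
  have -> : l = lam ^+ 2 * (n%:R * s) by rewrite lam2 divfK.
  by field; rewrite gt_eqF.
by rewrite le_eqVlt; apply/orP; left; apply/eqP; ring.
Qed.

Lemma Pr_max_avg eps : 0 < eps ->
  Pr P [set w | 5 * Num.sqrt (l * s / n%:R) / eps < max_avg w] <= eps.
Proof.
move=> e0; have q0 : 0 < 5 * Num.sqrt (l * s / n%:R).
  by rewrite mulr_gt0// sqrtr_gt0 divr_gt0 ?mulr_gt0// ltr0n.
apply: le_trans (Pr_markov L1_max_avg _ _) _.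
- by move=> w; exact: bigmax_ge_id.
- by rewrite divr_gt0.
rewrite ler_pdivrMr ?divr_gt0// mulrCA divff ?gt_eqF// mulr1.
exact: Ex_max_avg_le.
Qed.

End MaximalAverage.

(** * Moments of products of coordinates, and the set of good data *)

Section Moments.
Context d (T : measurableType d) {R : realType} (P : probability T R).
Context (n p : nat).
Variables (X : 'I_n -> {RV P >-> p.-tuple R}) (e : 'I_n -> {RV P >-> R}).
Variables (Sigma : 'M[R]_p) (nu C1 s6 : R).
Hypothesis n0 : (0 < n)%N.
Hypothesis p0 : (0 < p)%N.
Hypothesis nu0 : 0 < nu.
Hypothesis C10 : 0 < C1.
Hypothesis s60 : 0 < s6.

Implicit Types (x : p.-tuple R) (a b : 'I_p * 'I_p) (i : 'I_n).

Definition tmax x : R := \big[Num.max/0]_(k < p) `|tnth x k|.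
Definition tQ a x : R := tnth x a.1 * tnth x a.2 - Sigma a.1 a.2.
(** A common envelope of all [tQ]: the entries of [Sigma] are at most the second moment of [tmax],
    hence at most 2 nu^2. *)
Definition tenv x : R := tmax x ^+ 2 + 2 * nu ^+ 2.

Hypothesis H8 : forall i, L1 P (fun w => tmax (X i w) ^+ 8).
Hypothesis E8 : forall i, Ex P (fun w => tmax (X i w) ^+ 8) <= nu ^+ 8.
Hypothesis H6 : forall i k, L1 P (fun w => `|tnth (X i w) k| ^+ 6).
Hypothesis E6 : forall i k, Ex P (fun w => `|tnth (X i w) k| ^+ 6) <= s6 ^+ 6.
Hypothesis Hc : forall i k, Ex P (fun w => tnth (X i w) k) = 0.
Hypothesis Hs : forall i m k, Ex P (fun w => tnth (X i w) m * tnth (X i w) k) = Sigma m k.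
Hypothesis Hv : forall i a, 4 * C1 <= Ex P (fun w => tQ a (X i w) ^+ 2).
Hypothesis Hid : forall i j (f : p.-tuple R -> R), measurable_fun setT f ->
  L1 P (fun w => f (X i w)) -> Ex P (fun w => f (X j w)) = Ex P (fun w => f (X i w)).
Hypothesis xI : forall x0 i, indep P (X i) (looX X e x0 i).

Lemma pow_le1 (t : R) (k : nat) : 0 <= t -> (k <= 8)%N -> t ^+ k <= 1 + t ^+ 8.
Proof.
move=> t0 k8; have [t1|t1] := lerP t 1.
  by apply: (@le_trans _ _ 1); [exact: exprn_ile1|rewrite lerDl exprn_ge0].
by apply: (@le_trans _ _ (t ^+ 8)); [rewrite ler_weXn2l// ltW|rewrite lerDr].
Qed.

(** Bounds lower moments by the eighth one; applied with s = nu it replaces Lyapunov's inequality at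
    the cost of a factor 2. *)
Lemma pow_le_scaled (t s : R) (k : nat) : 0 <= t -> 0 < s -> (k <= 8)%N ->
  t ^+ k <= s ^+ k + s ^+ k * s ^- 8 * t ^+ 8.
Proof.
move=> t0 s0 k8.
have := pow_le1 (divr_ge0 t0 (ltW s0)) k8.
rewrite !expr_div_n ler_pdivrMr ?exprn_gt0// => h; apply: le_trans h _.
by rewrite mulrDl mul1r lerD2l le_eqVlt; apply/orP; left; apply/eqP; ring.
Qed.

Lemma tmax_ge0 x : 0 <= tmax x.
Proof. exact: bigmax_ge_id. Qed.

Lemma tnth_le_tmax x k : `|tnth x k| <= tmax x.
Proof. exact: (le_bigmax _ (fun k => `|tnth x k|)). Qed.

Lemma meas_co k : measurable_fun setT (fun x => tnth x k).
Proof. exact: measurable_tnth. Qed.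

Lemma meas_tmax : measurable_fun setT tmax.
Proof. by apply: meas_bigmax => k; apply: meas_normr; exact: meas_co. Qed.

Lemma meas_tQ a : measurable_fun setT (tQ a).
Proof.
by apply: measurable_funB => //; apply: measurable_funM; exact: meas_co.
Qed.

Lemma meas_tenv : measurable_fun setT tenv.
Proof. by apply: measurable_funD => //; apply: measurable_funX; exact: meas_tmax. Qed.

Lemma meas_comp_data i (f : p.-tuple R -> R) :
  measurable_fun setT f -> measurable_fun setT (fun w => f (X i w)).
Proof. by move=> mf; apply: measurableT_comp. Qed.

Lemma L1_tmax i (f : p.-tuple R -> R) c1 c2 : measurable_fun setT f ->
  (forall x, `|f x| <= c1 + c2 * tmax x ^+ 8) -> L1 P (fun w => f (X i w)).
Proof.
move=> mf h; apply: (L1_le (meas_comp_data i mf) (fun w => h (X i w))).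
by apply: L1D; [exact: L1_cst|exact: L1Z].
Qed.

Lemma Ex_tmax i (f : p.-tuple R -> R) c1 c2 : measurable_fun setT f -> 0 <= c2 ->
  (forall x, `|f x| <= c1 + c2 * tmax x ^+ 8) ->
  Ex P (fun w => f (X i w)) <= c1 + c2 * nu ^+ 8.
Proof.
move=> mf c20 h; apply: (@le_trans _ _ (Ex P (fun w => c1 + c2 * tmax (X i w) ^+ 8))).
  apply: Ex_le; first exact: (L1_tmax i mf h).
    by apply: L1D; [exact: L1_cst|exact: L1Z].
  by move=> w; apply: le_trans (ler_norm _) (h _).
rewrite ExD; [|exact: L1_cst|exact: L1Z]; rewrite Ex_cst ExZ// lerD2l.
by rewrite ler_wpM2l.
Qed.

Lemma tmax_pow_le k x : (k <= 8)%N -> tmax x ^+ k <= nu ^+ k + nu ^+ k * nu ^- 8 * tmax x ^+ 8.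
Proof. by move=> k8; apply: pow_le_scaled => //; exact: tmax_ge0. Qed.

Lemma Ex_tmax_pow i k : (k <= 8)%N ->
  L1 P (fun w => tmax (X i w) ^+ k) /\ Ex P (fun w => tmax (X i w) ^+ k) <= 2 * nu ^+ k.
Proof.
move=> k8; have mf : measurable_fun setT (fun x => tmax x ^+ k).
  by apply: measurable_funX; exact: meas_tmax.
have h x : `|tmax x ^+ k| <= nu ^+ k + nu ^+ k * nu ^- 8 * tmax x ^+ 8.
  by rewrite ger0_norm ?exprn_ge0 ?tmax_ge0// tmax_pow_le.
split; first exact: (L1_tmax i mf h).
apply: le_trans (Ex_tmax i mf _ h) _.
  by rewrite divr_ge0 ?exprn_ge0 ?ltW.
by rewrite divfK ?expf_neq0 ?gt_eqF// mulr_natl mulr2n.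
Qed.

Lemma prod_le_tmax x m k : `|tnth x m * tnth x k| <= tmax x ^+ 2.
Proof. by rewrite normrM expr2 ler_pM// tnth_le_tmax. Qed.

Lemma L1_prod i m k : L1 P (fun w => tnth (X i w) m * tnth (X i w) k).
Proof.
apply: (L1_tmax (f := fun x => tnth x m * tnth x k) (c1 := 1) (c2 := 1) i).
  by apply: measurable_funM; exact: meas_co.
move=> x; apply: le_trans (prod_le_tmax x m k) _.
by rewrite mul1r pow_le1// tmax_ge0.
Qed.

Let i0 : 'I_n := Ordinal n0.

Lemma Sigma_le m k : `|Sigma m k| <= 2 * nu ^+ 2.
Proof.
rewrite -(Hs i0); have [L h] := Ex_tmax_pow i0 (isT : (2 <= 8)%N).
apply: le_trans h; apply: Ex_norm_le => //; first exact: L1_prod.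
by move=> w; exact: prod_le_tmax.
Qed.

Lemma tenv_ge0 x : 0 <= tenv x.
Proof. by rewrite addr_ge0 ?sqr_ge0// mulr_ge0// sqr_ge0. Qed.

Lemma tQ_le a x : `|tQ a x| <= tenv x.
Proof.
apply: le_trans (ler_normB _ _) _; apply: lerD; [exact: prod_le_tmax|exact: Sigma_le].
Qed.

Lemma tenv2_le x : tenv x ^+ 2 <= 2 * tmax x ^+ 4 + 8 * nu ^+ 4.
Proof.
rewrite (_ : tmax x ^+ 4 = (tmax x ^+ 2) ^+ 2); last by rewrite -exprM.
rewrite (_ : nu ^+ 4 = (nu ^+ 2) ^+ 2); last by rewrite -exprM.
by rewrite /tenv; have := sqr_ge0 (tmax x ^+ 2 - 2 * nu ^+ 2); nra.
Qed.

Lemma tenv4_le x : tenv x ^+ 4 <= 8 * tmax x ^+ 8 + 128 * nu ^+ 8.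
Proof.
have h := tenv2_le x; have h0 : 0 <= tenv x ^+ 2 by rewrite sqr_ge0.
rewrite (_ : tenv x ^+ 4 = (tenv x ^+ 2) ^+ 2); last by rewrite -exprM.
rewrite (_ : tmax x ^+ 8 = (tmax x ^+ 4) ^+ 2); last by rewrite -exprM.
rewrite (_ : nu ^+ 8 = (nu ^+ 4) ^+ 2); last by rewrite -exprM.
apply: (@le_trans _ _ ((2 * tmax x ^+ 4 + 8 * nu ^+ 4) ^+ 2)).
  by rewrite lerXn2r// nnegrE (le_trans h0).
by have := sqr_ge0 (2 * tmax x ^+ 4 - 8 * nu ^+ 4); nra.
Qed.

Lemma Ex_tenv2 i : L1 P (fun w => tenv (X i w) ^+ 2) /\
  Ex P (fun w => tenv (X i w) ^+ 2) <= 12 * nu ^+ 4.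
Proof.
have [L h] := Ex_tmax_pow i (isT : (4 <= 8)%N).
have L2 : L1 P (fun w => 2 * tmax (X i w) ^+ 4 + 8 * nu ^+ 4).
  by apply: L1D; [exact: L1Z|exact: L1_cst].
have L3 : L1 P (fun w => tenv (X i w) ^+ 2).
  apply: L1_le L2; first exact: (meas_comp_data i (measurable_funX 2 meas_tenv)).
  by move=> w; rewrite ger0_norm ?sqr_ge0// tenv2_le.
split=> //; apply: le_trans (Ex_le L3 L2 (fun w => tenv2_le (X i w))) _.
rewrite ExD; [|exact: L1Z|exact: L1_cst]; rewrite Ex_cst ExZ//.
by lra.
Qed.

Lemma Ex_tenv4 i : L1 P (fun w => tenv (X i w) ^+ 4) /\
  Ex P (fun w => tenv (X i w) ^+ 4) <= 136 * nu ^+ 8.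
Proof.
have L2 : L1 P (fun w => 8 * tmax (X i w) ^+ 8 + 128 * nu ^+ 8).
  by apply: L1D; [exact: L1Z|exact: L1_cst].
have L3 : L1 P (fun w => tenv (X i w) ^+ 4).
  apply: L1_le L2; first exact: (meas_comp_data i (measurable_funX 4 meas_tenv)).
  by move=> w; rewrite ger0_norm ?exprn_ge0 ?tenv_ge0// tenv4_le.
split=> //; apply: le_trans (Ex_le L3 L2 (fun w => tenv4_le (X i w))) _.
rewrite ExD; [|exact: L1Z|exact: L1_cst]; rewrite Ex_cst ExZ//.
by have := E8 i; lra.
Qed.

(** The variance of a product is at least 4 C1 and at most the second moment 12 nu^4 of the
    envelope. This keeps nu away from 0, so that lower powers of nu can be absorbed into higher
    ones. *)
Lemma nu_lower : C1 <= 3 * nu ^+ 4.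
Proof.
pose k0 : 'I_p := Ordinal p0.
have [L h] := Ex_tenv2 i0.
suff : 4 * C1 <= 12 * nu ^+ 4 by lra.
apply: le_trans (Hv i0 (k0, k0)) _; apply: le_trans h; apply: Ex_le => //.
  apply: L1_le L; first exact: (meas_comp_data i0 (measurable_funX 2 (meas_tQ (k0, k0)))).
  move=> w; rewrite ger0_norm ?sqr_ge0//.
  by rewrite -[leLHS]real_normK ?num_real// lerXn2r ?nnegrE ?tenv_ge0// tQ_le.
move=> w; rewrite -[leLHS]real_normK ?num_real// lerXn2r ?nnegrE ?tenv_ge0//.
exact: tQ_le.
Qed.

(** The covariance of the products, four times that of the Hajek projection because [hajek] carries
    the factor 1/2; it is evaluated at the first observation. *)
Definition tGam a b : R := Ex P (fun w => tQ a (X i0 w) * tQ b (X i0 w)).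

Lemma meas_tQQ a b : measurable_fun setT (fun x => tQ a x * tQ b x).
Proof. by apply: measurable_funM; exact: meas_tQ. Qed.

Lemma tQQ_le a b x : `|tQ a x * tQ b x| <= tenv x ^+ 2.
Proof. by rewrite normrM expr2 ler_pM// tQ_le. Qed.

Lemma L1_tQQ i a b : L1 P (fun w => tQ a (X i w) * tQ b (X i w)).
Proof.
have [L _] := Ex_tenv2 i; apply: L1_le L.
  exact: meas_comp_data (meas_tQQ a b).
by move=> w; exact: tQQ_le.
Qed.

Lemma tGamE i a b : Ex P (fun w => tQ a (X i w) * tQ b (X i w)) = tGam a b.
Proof. exact: (Hid i (meas_tQQ a b) (L1_tQQ i0 a b)). Qed.

Lemma tGam_le a b : `|tGam a b| <= 12 * nu ^+ 4.
Proof.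
have [L h] := Ex_tenv2 i0; apply: le_trans h; apply: Ex_norm_le => //.
  exact: L1_tQQ.
by move=> w; exact: tQQ_le.
Qed.

Lemma tGam_diag a : 4 * C1 <= tGam a a.
Proof.
apply: le_trans (Hv i0 a) _; rewrite /tGam le_eqVlt; apply/orP; left; apply/eqP.
by congr (Ex P); apply/funext => w; rewrite expr2.
Qed.

Lemma L1_tQ i a : L1 P (fun w => tQ a (X i w)).
Proof. by apply: L1B; [exact: L1_prod|exact: L1_cst]. Qed.

Lemma Ex_tQ i a : Ex P (fun w => tQ a (X i w)) = 0.
Proof.
rewrite ExB; [|exact: L1_prod|exact: L1_cst].
by rewrite Ex_cst Hs subrr.
Qed.

(** This uses the sixth moments of single coordinates, not the envelope: (x + y)^3 <= 4 x^3 + 4 y^3,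
    then (u v)^3 <= (u^6 + v^6) / 2, and |Sigma| <= 2 s6^2 give 4 + 32 = 36. *)
Lemma Ex_tQ3 i a : L1 P (fun w => `|tQ a (X i w)| ^+ 3) /\
  Ex P (fun w => `|tQ a (X i w)| ^+ 3) <= 36 * s6 ^+ 6.
Proof.
have sq (y : R) : y ^+ 2 <= s6 ^+ 2 + s6 ^- 4 * `|y| ^+ 6.
  have t0 : 0 <= `|y| / s6 by rewrite divr_ge0// ltW.
  have : (`|y| / s6) ^+ 2 <= 1 + (`|y| / s6) ^+ 6.
    have [t1|t1] := lerP (`|y| / s6) 1.
      by apply: (@le_trans _ _ 1); [exact: exprn_ile1|rewrite lerDl exprn_ge0].
    by apply: (@le_trans _ _ ((`|y| / s6) ^+ 6)); [rewrite ler_weXn2l// ltW|rewrite lerDr].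
  rewrite !expr_div_n ler_pdivrMr ?exprn_gt0// real_normK ?num_real// => h.
  apply: le_trans h _; rewrite le_eqVlt; apply/orP; left; apply/eqP; field.
  by rewrite gt_eqF.
have L2 m : L1 P (fun w => tnth (X i w) m ^+ 2).
  by apply: L1_ext (L1_prod i m m) => w; rewrite expr2.
have E2 m : Ex P (fun w => tnth (X i w) m ^+ 2) <= 2 * s6 ^+ 2.
  have L : L1 P (fun w => s6 ^+ 2 + s6 ^- 4 * `|tnth (X i w) m| ^+ 6).
    by apply: L1D; [exact: L1_cst|exact: L1Z].
  apply: le_trans (Ex_le (L2 m) L (fun w => sq _)) _.
  rewrite ExD; [|exact: L1_cst|exact: L1Z]; rewrite Ex_cst ExZ//.
  have : s6 ^- 4 * Ex P (fun w => `|tnth (X i w) m| ^+ 6) <= s6 ^- 4 * s6 ^+ 6.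
    by rewrite ler_wpM2l// invr_ge0 exprn_ge0// ltW.
  have -> : s6 ^- 4 * s6 ^+ 6 = s6 ^+ 2 by field; rewrite gt_eqF.
  by lra.
have S2 : `|Sigma a.1 a.2| <= 2 * s6 ^+ 2.
  rewrite -(Hs i); apply: (@le_trans _ _ (Ex P (fun w =>
      2^-1 * (tnth (X i w) a.1 ^+ 2 + tnth (X i w) a.2 ^+ 2)))).
    apply: Ex_norm_le; [exact: L1_prod|by apply: L1Z; exact: L1D|].
    move=> w; rewrite normrM -[X in _ * (X + _)]real_normK ?num_real//.
    rewrite -[X in _ * (_ + X)]real_normK ?num_real//.
    by have := sqr_ge0 (`|tnth (X i w) a.1| - `|tnth (X i w) a.2|); nra.
  rewrite ExZ; last exact: L1D.
  by rewrite ExD//; have := E2 a.1; have := E2 a.2; lra.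
have S3 : `|Sigma a.1 a.2| ^+ 3 <= 8 * s6 ^+ 6.
  have -> : 8 * s6 ^+ 6 = (2 * s6 ^+ 2) ^+ 3 by ring.
  by rewrite lerXn2r// nnegrE mulr_ge0// sqr_ge0.
have cube (x y : R) : 0 <= x -> 0 <= y -> (x + y) ^+ 3 <= 4 * x ^+ 3 + 4 * y ^+ 3.
  move=> x0 y0; have : 0 <= (x + y) * (x - y) ^+ 2 by rewrite mulr_ge0 ?addr_ge0 ?sqr_ge0.
  have -> : 4 * x ^+ 3 + 4 * y ^+ 3 = (x + y) ^+ 3 + 3 * ((x + y) * (x - y) ^+ 2) by ring.
  lra.
have pt w : `|tQ a (X i w)| ^+ 3 <=
    2 * (`|tnth (X i w) a.1| ^+ 6 + `|tnth (X i w) a.2| ^+ 6) + 32 * s6 ^+ 6.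
  apply: (@le_trans _ _ ((`|tnth (X i w) a.1| * `|tnth (X i w) a.2| + `|Sigma a.1 a.2|) ^+ 3)).
    rewrite lerXn2r ?nnegrE ?addr_ge0 ?mulr_ge0// -normrM; exact: ler_normB.
  apply: le_trans (cube _ _ _ _) _; rewrite ?mulr_ge0//.
  set u := `|_|; set v := `|_|.
  have : (u * v) ^+ 3 <= 2^-1 * (u ^+ 6 + v ^+ 6).
    by have := sqr_ge0 (u ^+ 3 - v ^+ 3); rewrite exprMn sqrrB -!exprM; lra.
  by lra.
have L3 : L1 P (fun w => 2 * (`|tnth (X i w) a.1| ^+ 6 + `|tnth (X i w) a.2| ^+ 6) + 32 * s6 ^+ 6).
  by apply: L1D; [apply: L1Z; exact: L1D|exact: L1_cst].
have LQ : L1 P (fun w => `|tQ a (X i w)| ^+ 3).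
  apply: L1_le L3.
    exact: (measurable_funX 3 (meas_normr (meas_comp_data i (meas_tQ a)))).
  by move=> w; rewrite ger0_norm ?exprn_ge0.
split=> //; apply: le_trans (Ex_le LQ L3 pt) _.
rewrite ExD; [|by apply: L1Z; exact: L1D|exact: L1_cst].
rewrite Ex_cst ExZ; last exact: L1D.
rewrite ExD//; have := E6 i a.1; have := E6 i a.2; lra.
Qed.

Variables (L eps : R).
Hypothesis L0 : 0 < L.
Hypothesis e0 : 0 < eps.
Hypothesis hL : ln ((2 * p ^ 4).+1%:R : R) <= 4 * L.

(* 4 L dominates ln (2 N + 1) for each of the three families, of sizes N = p,
   p^2 and p^4; the numbers 2, 12 and 560 come from their second moments. *)
Definition goodset : set T := [set w |
  [/\ max_avg X (fun k (x : p.-tuple R) => tnth x k) w <= 5 * Num.sqrt (4 * L * (2 * nu ^+ 2) / n%:R) / eps,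
    max_avg X tQ w <= 5 * Num.sqrt (4 * L * (12 * nu ^+ 4) / n%:R) / eps,
    max_avg X (fun (c : ('I_p * 'I_p) * ('I_p * 'I_p)) x => tQ c.1 x * tQ c.2 x - tGam c.1 c.2) w <=
      5 * Num.sqrt (4 * L * (560 * nu ^+ 8) / n%:R) / eps &
    avg (fun i => tmax (X i w) ^+ 8) <= nu ^+ 8 / eps]].

Let lnp k : (0 < k <= 4)%N -> ln ((2 * p ^ k).+1%:R : R) <= 4 * L.
Proof.
move=> /andP[k0 k4]; apply: le_trans hL; rewrite ler_ln ?posrE ?ltr0n// ler_nat ltnS leq_mul2l/=.
by rewrite leq_pexp2l.
Qed.

Let x0 : p.-tuple R := [tuple 0 | _ < p].

Let LB1 i : L1 P (fun w => tmax (X i w) ^+ 2) /\ Ex P (fun w => tmax (X i w) ^+ 2) <= 2 * nu ^+ 2.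
Proof. exact: Ex_tmax_pow. Qed.

Lemma goodset_measurable_prob : measurable goodset /\ 1 - 4 * eps <= Pr P goodset.
Proof.
have mX i : measurable_fun setT (X i) by exact: measurable_funPT.
have n1 : 0 < n%:R :> R by rewrite ltr0n.
set c1 := 5 * Num.sqrt (4 * L * (2 * nu ^+ 2) / n%:R) / eps.
set c2 := 5 * Num.sqrt (4 * L * (12 * nu ^+ 4) / n%:R) / eps.
set c3 := 5 * Num.sqrt (4 * L * (560 * nu ^+ 8) / n%:R) / eps.
pose g3 (c : ('I_p * 'I_p) * ('I_p * 'I_p)) x := tQ c.1 x * tQ c.2 x - tGam c.1 c.2.
pose B3 x := tenv x ^+ 2 + 12 * nu ^+ 4.
have l0 : 0 < 4 * L by rewrite mulr_gt0.
have B30 x : 0 <= B3 x by rewrite addr_ge0 ?sqr_ge0// mulr_ge0// exprn_ge0// ltW.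
have mg3 c : measurable_fun setT (g3 c) by apply: measurable_funB => //; exact: meas_tQQ.
have gB3 c x : `|g3 c x| <= B3 x.
  by apply: le_trans (ler_normB _ _) _; apply: lerD; [exact: tQQ_le|exact: tGam_le].
have B32 x : B3 x ^+ 2 <= 2 * tenv x ^+ 4 + 288 * nu ^+ 8.
  rewrite (_ : tenv x ^+ 4 = (tenv x ^+ 2) ^+ 2); last by rewrite -exprM.
  rewrite (_ : nu ^+ 8 = (nu ^+ 4) ^+ 2); last by rewrite -exprM.
  by rewrite /B3; have := sqr_ge0 (tenv x ^+ 2 - 12 * nu ^+ 4); nra.
have LB3 i : L1 P (fun w => B3 (X i w) ^+ 2) /\ Ex P (fun w => B3 (X i w) ^+ 2) <= 560 * nu ^+ 8.
  have [l4 h4] := Ex_tenv4 i.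
  have L2 : L1 P (fun w => 2 * tenv (X i w) ^+ 4 + 288 * nu ^+ 8).
    by apply: L1D; [exact: L1Z|exact: L1_cst].
  have L3 : L1 P (fun w => B3 (X i w) ^+ 2).
    apply: L1_le L2.
      apply: (meas_comp_data i (f := fun x => B3 x ^+ 2)); apply: measurable_funX.
      by apply: measurable_funD => //; apply: measurable_funX; exact: meas_tenv.
    by move=> w; rewrite ger0_norm ?sqr_ge0.
  split=> //; apply: le_trans (Ex_le L3 L2 (fun w => B32 (X i w))) _.
  rewrite ExD; [|exact: L1Z|exact: L1_cst]; rewrite Ex_cst ExZ//.
  by lra.
have Eg3 i c : Ex P (fun w => g3 c (X i w)) = 0.
  rewrite ExB; [|exact: L1_tQQ|exact: L1_cst].
  by rewrite Ex_cst tGamE subrr.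
have cardp : #|{: 'I_p}| = (p ^ 1)%N by rewrite card_ord expn1.
have cardpp : #|{: 'I_p * 'I_p}| = (p ^ 2)%N by rewrite card_prod card_ord.
have cardp4 : #|{: ('I_p * 'I_p) * ('I_p * 'I_p)}| = (p ^ 4)%N.
  by rewrite card_prod cardpp -expnD.
pose A1 := [set w | c1 < max_avg X (fun k (x : p.-tuple R) => tnth x k) w].
pose A2 := [set w | c2 < max_avg X tQ w].
pose A3 := [set w | c3 < max_avg X g3 w].
pose A4 := [set w | nu ^+ 8 / eps < avg (fun i => tmax (X i w) ^+ 8)].
have h1 : measurable A1 /\ Pr P A1 <= eps.
  have EB i : Ex P (fun w => tmax (X i w) ^+ 2) <= 2 * nu ^+ 2 by have [] := LB1 i.
  have LB i : L1 P (fun w => tmax (X i w) ^+ 2) by have [] := LB1 i.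
  have q0 : 0 < 2 * nu ^+ 2 by rewrite mulr_gt0// exprn_gt0.
  have ll : ln ((2 * #|{: 'I_p}|).+1%:R : R) <= 4 * L by rewrite cardp lnp.
  split.
    apply: meas_lt => //; apply: L1_meas.
    exact: (L1_max_avg mX meas_co (fun j x => tnth_le_tmax x j) tmax_ge0 LB).
  exact: (Pr_max_avg n0 mX (xI x0) meas_co (fun j x => tnth_le_tmax x j) tmax_ge0 LB EB Hc q0 l0 ll e0).
have h2 : measurable A2 /\ Pr P A2 <= eps.
  have EB i : Ex P (fun w => tenv (X i w) ^+ 2) <= 12 * nu ^+ 4 by have [] := Ex_tenv2 i.
  have LB i : L1 P (fun w => tenv (X i w) ^+ 2) by have [] := Ex_tenv2 i.
  have q0 : 0 < 12 * nu ^+ 4 by rewrite mulr_gt0// exprn_gt0.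
  have ll : ln ((2 * #|{: 'I_p * 'I_p}|).+1%:R : R) <= 4 * L by rewrite cardpp lnp.
  split.
    apply: meas_lt => //; apply: L1_meas.
    exact: (L1_max_avg mX meas_tQ tQ_le tenv_ge0 LB).
  exact: (Pr_max_avg n0 mX (xI x0) meas_tQ tQ_le tenv_ge0 LB EB Ex_tQ q0 l0 ll e0).
have h3 : measurable A3 /\ Pr P A3 <= eps.
  have EB i : Ex P (fun w => B3 (X i w) ^+ 2) <= 560 * nu ^+ 8 by have [] := LB3 i.
  have LB i : L1 P (fun w => B3 (X i w) ^+ 2) by have [] := LB3 i.
  have q0 : 0 < 560 * nu ^+ 8 by apply: mulr_gt0; [rewrite ltr0n|exact: exprn_gt0].
  have ll : ln ((2 * #|{: ('I_p * 'I_p) * ('I_p * 'I_p)}|).+1%:R : R) <= 4 * L.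
    by rewrite cardp4 lnp.
  split.
    apply: meas_lt => //; apply: L1_meas.
    exact: (L1_max_avg mX mg3 gB3 B30 LB).
  exact: (Pr_max_avg n0 mX (xI x0) mg3 gB3 B30 LB EB Eg3 q0 l0 ll e0).
have L8 : L1 P (fun w => avg (fun i => tmax (X i w) ^+ 8)).
  by apply: L1Z; apply: L1_sum => i _.
have h4 : measurable A4 /\ Pr P A4 <= eps.
  split; first by apply: meas_lt => //; exact: (L1_meas L8).
  have q0 : 0 < nu ^+ 8 by rewrite exprn_gt0.
  apply: le_trans (Pr_markov L8 _ _) _.
  - by move=> w; apply: avg_ge0 => i; rewrite exprn_ge0 ?tmax_ge0.
  - by rewrite divr_gt0.
  rewrite ler_pdivrMr ?divr_gt0// mulrCA divff ?gt_eqF// mulr1.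
  rewrite /avg ExZ; last by apply: L1_sum => i _.
  rewrite Ex_sum; last by move=> i _.
  rewrite ler_pdivrMl//; apply: (@le_trans _ _ (\sum_(i < n) nu ^+ 8)).
    by apply: ler_sum => i _.
  by rewrite sumr_const card_ord -[_ *+ n]mulr_natl.
have gE : goodset = ~` (A1 `|` A2 `|` A3 `|` A4).
  apply/seteqP; split => w /=.
    move=> [q1 q2 q3 q4] [[[|]|]|]; rewrite /A1 /A2 /A3 /A4/=.
    - by rewrite ltNge => /negP; exact.
    - by rewrite ltNge => /negP; exact.
    - by rewrite ltNge => /negP; exact.
    - by rewrite ltNge => /negP; exact.
  move=> h; split; rewrite leNgt; apply/negP => h'; apply: h.
  - by left; left; left.
  - by left; left; right.
  - by left; right.
  - by right.
case: h1 h2 h3 h4 => [m1 q1] [m2 q2] [m3 q3] [m4 q4].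
have m12 := measurableU _ _ m1 m2; have m123 := measurableU _ _ m12 m3.
have m1234 := measurableU _ _ m123 m4.
split; first by rewrite gE; exact: measurableC.
rewrite gE PrC//.
have u1 := PrU P m1 m2; have u2 := PrU P m12 m3; have u3 := PrU P m123 m4.
move: q1 q2 q3 q4 u1 u2 u3.
move: (Pr _ _) (Pr _ _) (Pr _ _) (Pr _ _) (Pr _ _) (Pr _ _) (Pr _ _) => r1 r2 r3 r4 r5 r6 r7.
lra.
Qed.

End Moments.

(** * Choice of the smoothing level *)

Section Constants.
Context {R : realType}.
Variables (C1 C2 C4 : R).
(** [kc1] is such that C1 <= 3 nu^4 reads 1 <= kc1 nu^2. In [kc2], 240 = 5 * 48 and 35 = 5 * 7 stem
    from the levels of [goodset]. [kM3] and [kM4] bound the standardized moments by kM3 nu^2 and kM4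
    nu^8, and 17/2 is 136/16. [kbig] adds up whatever has to become small after multiplication by
    kap. *)
Definition kc1 : R := Num.sqrt (3 / C1).
Definition kc2 : R := 240 + 35 * kc1.
Definition kc4 : R := Num.sqrt C4.
Definition kD : R := cD kc1 (4 * C1) * kc2 * kc4.
Definition kM3 : R := kc1 + 36 * C2 ^+ 6 / (8 * (C1 * Num.sqrt C1)).
Definition kM4 : R := 17 / (2 * C1 ^+ 2).
Definition kcK : R := cK.
Definition kK1 : R := 12 * kD + 8 * kcK * kM3 * kc1 * kc4.
Definition krem : R := (454 * kc1 + 2 * kc1 ^+ 2) * kc4 / Num.sqrt C1.
Definition kbig : R := 1 + 16 * kK1 + 2 * kc1 ^+ 2 * kc4 + 2 * kM3 * kc1 * kc4 + kc2 * kc4 + kD + krem.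
Definition kerr : R := 21 * (6 + 4 * kD) + 64 * kcK * kM4 * C4 + 2.
End Constants.

Lemma kerr_ge0 (R : realType) (C1 C4 : R) : 0 < C1 -> 0 < C4 -> 0 <= kerr C1 C4.
Proof.
move=> C10 C40; have c10 : 0 <= kc1 C1 by rewrite sqrtr_ge0.
have c20 : 0 <= kc2 C1 by apply: addr_ge0; [rewrite ler0n|apply: mulr_ge0].
have h : 0 <= cR (kc1 C1).
  apply: mulr_ge0 => //; apply: addr_ge0; last exact: sqr_ge0.
  by apply: addr_ge0 => //; apply: mulr_ge0 => //; exact: sqr_ge0.
have kD0 : 0 <= kD C1 C4.
  apply: mulr_ge0 (sqrtr_ge0 _); apply: mulr_ge0 => //; apply: addr_ge0 => //.
  apply: divr_ge0; last by rewrite mulr_ge0// ltW.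
  by apply: mulr_ge0 => //; exact: addr_ge0.
have kK0 : 0 <= kcK :> R := mulr_ge0 (mulr_ge0 (ler0n _ _) (ler0n _ _)) (ler0n _ _).
have kM40 : 0 <= kM4 C1.
  by apply: divr_ge0 => //; apply: mulr_ge0 => //; exact: sqr_ge0.
apply: addr_ge0 => //; apply: addr_ge0.
  by apply: mulr_ge0 => //; apply: addr_ge0 => //; exact: mulr_ge0.
by apply: mulr_ge0 (ltW C40); apply: mulr_ge0 kM40; apply: mulr_ge0 kK0.
Qed.

(* kap stands for n^(-K/48), so that eps = kap^8 is the error rate n^(-K/6) and
   the growth condition reads nu^8 L^7 <= C4 n eps^7 with L = log(np). The good
   data satisfy their bounds up to rho = O(sqrt(L nu^8 / n) / eps), and the
   smoothing level pbeta = m sqrt L / eps is the largest one for which the error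
   of the windows of length m / pbeta is O(eps). All smallness conditions are
   collected in kap * kbig <= 1; otherwise the probability bound is trivial. *)
Section TuningConstants.
Context {R : realType}.
Variables (C1 C2 C4 nu kap L : R) (n m : nat).
Hypothesis C10 : 0 < C1.
Hypothesis C20 : 0 < C2.
Hypothesis C40 : 0 < C4.
Hypothesis nu0 : 0 < nu.
Hypothesis k0 : 0 < kap.
Hypothesis k1 : kap <= 1.
Hypothesis L1 : 1 <= L.
Hypothesis n0 : (0 < n)%N.
Hypothesis mL : L <= m%:R <= 2 * L.
Hypothesis nuC1 : C1 <= 3 * nu ^+ 4.
Hypothesis main : nu ^+ 8 * L ^+ 7 <= C4 * (n%:R * kap ^+ 56).
Hypothesis small : kap * kbig C1 C2 C4 <= 1.

Local Notation c1 := (kc1 C1).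
Local Notation c2 := (kc2 C1).
Local Notation c4 := (kc4 C4).
Local Notation cD' := (kD C1 C4).
Local Notation cM3 := (kM3 C1 C2).
Local Notation cM4 := (kM4 C1).
Local Notation kK := (@kcK R).

Definition rn : R := (Num.sqrt n%:R)^-1.
Definition sl : R := Num.sqrt L.
Definition vn : R := nu ^+ 4 * rn.
Definition rho : R := c2 * (sl * vn / kap ^+ 8).
Definition pD : R := cD c1 (4 * C1) * (rho / kap).
Definition pbeta : R := m%:R * sl / kap ^+ 8.
Definition pM3 : R := 1 + 36 * (C2 ^+ 6 * nu ^+ 2) / (8 * (C1 * Num.sqrt C1)).
Definition pM4 : R := cM4 * nu ^+ 8.

Let nR : 0 < n%:R :> R. Proof. by rewrite ltr0n. Qed.
Lemma rn_gt0 : 0 < rn. Proof. by rewrite invr_gt0 sqrtr_gt0. Qed.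
Lemma rn2 : rn ^+ 2 = n%:R^-1. Proof. by rewrite exprVn sqr_sqrtr// ltW. Qed.
Lemma sl2 : sl ^+ 2 = L. Proof. by rewrite sqr_sqrtr// (le_trans _ L1). Qed.
Lemma sl1 : 1 <= sl. Proof. by rewrite -[leLHS]sqrtr1 ler_wsqrtr. Qed.
Let sl0 : 0 < sl. Proof. exact: lt_le_trans ltr01 sl1. Qed.
Lemma c1_gt0 : 0 < c1. Proof. by rewrite sqrtr_gt0 divr_gt0. Qed.
Let c4_gt0 : 0 < c4. Proof. by rewrite sqrtr_gt0. Qed.
Let c10 := ltW c1_gt0.
Let c40 := ltW c4_gt0.
Let c20 : 0 < c2. Proof. by rewrite /kc2; have := c1_gt0; lra. Qed.
Let rn0 := rn_gt0.

Lemma c1nu : 1 <= c1 * nu ^+ 2.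
Proof.
have h : 0 <= c1 * nu ^+ 2 by rewrite mulr_ge0 ?sqr_ge0.
rewrite -[leRHS](ger0_norm h) -sqrtr_sqr -[leLHS]sqrtr1 ler_wsqrtr//.
rewrite exprMn sqr_sqrtr ?divr_ge0 ?(ltW C10)// -exprM [leRHS]mulrAC ler_pdivlMr// mul1r.
exact: nuC1.
Qed.

Lemma vn_gt0 : 0 < vn. Proof. by rewrite mulr_gt0// exprn_gt0. Qed.
Let v0 := ltW vn_gt0.

(** The square root of the growth condition. *)
Lemma vn_le : vn <= c4 * kap ^+ 28 / sl ^+ 7.
Proof.
have h0 : 0 <= c4 * kap ^+ 28 / sl ^+ 7.
  by rewrite divr_ge0 ?mulr_ge0 ?exprn_ge0 ?(ltW k0) ?(ltW sl0).
have e1 : vn ^+ 2 = nu ^+ 8 / n%:R by rewrite /vn exprMn rn2 -exprM.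
have e2 : (c4 * kap ^+ 28 / sl ^+ 7) ^+ 2 = C4 * kap ^+ 56 / L ^+ 7.
  have c4E : c4 ^+ 2 = C4 by rewrite sqr_sqrtr// ltW.
  rewrite -sl2 -[X in _ = X * _ / _]c4E; field.
  by rewrite gt_eqF.
have L70 : 0 < L ^+ 7 by rewrite exprn_gt0// (lt_le_trans ltr01).
have : vn ^+ 2 <= (c4 * kap ^+ 28 / sl ^+ 7) ^+ 2.
  rewrite e1 e2 ler_pdivlMr// [leLHS]mulrAC ler_pdivrMr//.
  by apply: le_trans main _; rewrite -mulrA [kap ^+ _ * _]mulrC.
by rewrite ler_sqr ?nnegrE.
Qed.

Lemma nu2_le : nu ^+ 2 * rn <= c1 * vn.
Proof.
rewrite /vn (_ : nu ^+ 4 = nu ^+ 2 * nu ^+ 2) -?exprD//.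
have h : 0 <= nu ^+ 2 * rn by rewrite mulr_ge0 ?sqr_ge0 ?(ltW rn0).
have := ler_wpM2r h c1nu; rewrite mul1r => q; apply: le_trans q _.
by rewrite le_eqVlt; apply/orP; left; apply/eqP; rewrite exprD; ring.
Qed.

Lemma rn_le : rn <= c1 ^+ 2 * vn.
Proof.
have := ler_wpM2r (ltW rn0) c1nu; rewrite mul1r => q; apply: le_trans q _.
have -> : c1 ^+ 2 * vn = c1 * (c1 * vn) by ring.
by rewrite -mulrA; apply: ler_wpM2l => //; exact: nu2_le.
Qed.

Let kp j : 0 < kap ^+ j. Proof. exact: exprn_gt0. Qed.
Let sp j : 0 < sl ^+ j. Proof. exact: exprn_gt0. Qed.
Let kle i j : (i <= j)%N -> kap ^+ j <= kap ^+ i.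
Proof. by move=> ij; apply: ler_wiXn2l => //; exact: ltW. Qed.
Let sge j : 1 <= sl ^+ j. Proof. exact: exprn_ege1 sl1. Qed.
Let siv j : (sl ^+ j)^-1 <= 1. Proof. by rewrite invf_le1. Qed.
Let kiv j : kap ^+ j <= 1. Proof. by rewrite exprn_ile1// ltW. Qed.

Lemma rho_gt0 : 0 < rho.
Proof. by rewrite mulr_gt0// divr_gt0// mulr_gt0// vn_gt0. Qed.

Lemma rho_le : rho <= c2 * c4 * kap ^+ 20 / sl ^+ 6.
Proof.
have h := vn_le; rewrite /rho.
have -> : c2 * c4 * kap ^+ 20 / sl ^+ 6 = c2 * (sl * (c4 * kap ^+ 28 / sl ^+ 7) / kap ^+ 8).
  by field; rewrite !gt_eqF.
by rewrite ler_pM2l// ler_pM2r ?invr_gt0// ler_pM2l.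
Qed.

Let M30 : 0 < cM3.
Proof. by rewrite addr_gt0 ?c1_gt0// divr_gt0 ?mulr_gt0 ?exprn_gt0 ?sqrtr_gt0. Qed.

Let kK0 : 0 < kK.
Proof. exact: (mulr_gt0 (mulr_gt0 (ltr0Sn _ 999) (ltr0Sn _ 999)) (ltr0Sn _ 9)). Qed.

Let cDp : 0 < cD c1 (4 * C1).
Proof.
have h : 0 <= cR c1.
  apply: mulr_ge0 => //; apply: addr_ge0; last exact: sqr_ge0.
  by apply: addr_ge0 => //; apply: mulr_ge0 => //; exact: sqr_ge0.
apply: ltr_pwDl => //; apply: divr_ge0; last by rewrite mulr_ge0// ltW.
by apply: mulr_ge0 => //; exact: addr_ge0.
Qed.

Let kD0 : 0 < cD'.
Proof. by rewrite /kD !mulr_gt0. Qed.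

Let kK10 : 0 < kK1 C1 C2 C4.
Proof.
apply: addr_gt0; first by rewrite mulr_gt0.
by apply: mulr_gt0 => //; apply: mulr_gt0; [apply: mulr_gt0 => //; exact: mulr_gt0|exact: c1_gt0].
Qed.

Let krem0 : 0 < krem C1 C4.
Proof.
have h2 : 0 < 2 * c1 ^+ 2 by rewrite mulr_gt0// exprn_gt0// c1_gt0.
have h1 : 0 < 454 * c1 by apply: mulr_gt0; [rewrite ltr0n|exact: c1_gt0].
have h3 : 0 < Num.sqrt C1 by rewrite sqrtr_gt0.
exact: (divr_gt0 (mulr_gt0 (addr_gt0 h1 h2) c4_gt0) h3).
Qed.

Let smalls : [/\ kap * (16 * kK1 C1 C2 C4) <= 1, kap * (2 * c1 ^+ 2 * c4) <= 1,
  kap * (2 * cM3 * c1 * c4) <= 1, kap * (c2 * c4) <= 1 & kap * cD' <= 1 /\ kap * krem C1 C4 <= 1].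
Proof.
have a1 : 0 <= 16 * kK1 C1 C2 C4 by rewrite mulr_ge0// ltW.
have a2 : 0 <= 2 * c1 ^+ 2 * c4 by rewrite mulr_ge0// mulr_ge0// sqr_ge0.
have a3 : 0 <= 2 * cM3 * c1 * c4 by rewrite mulr_ge0// mulr_ge0// mulr_ge0// ltW.
have a4 : 0 <= c2 * c4 by rewrite mulr_ge0// ltW.
have a5 := ltW kD0. have a6 := ltW krem0.
have h (y : R) : y <= kbig C1 C2 C4 -> kap * y <= 1.
  by move=> hy; apply: le_trans small; rewrite ler_pM2l.
move: a1 a2 a3 a4 a5 a6 h; rewrite /kbig.
move: (16 * _) (2 * _ * _) (2 * _ * _ * _) (c2 * c4) cD' (krem C1 C4) => y1 y2 y3 y4 y5 y6.
move=> a1 a2 a3 a4 a5 a6 h.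
have ar (x1 x2 x3 x4 x5 x6 : R) : 0 <= x1 -> 0 <= x2 -> 0 <= x3 -> 0 <= x4 -> 0 <= x5 -> 0 <= x6 ->
   [/\ x1 <= 1 + x1 + x2 + x3 + x4 + x5 + x6, x2 <= 1 + x1 + x2 + x3 + x4 + x5 + x6,
    x3 <= 1 + x1 + x2 + x3 + x4 + x5 + x6, x4 <= 1 + x1 + x2 + x3 + x4 + x5 + x6
    & x5 <= 1 + x1 + x2 + x3 + x4 + x5 + x6 /\ x6 <= 1 + x1 + x2 + x3 + x4 + x5 + x6].
  by move=> *; split; [lra|lra|lra|lra|split; lra].
have [b1 b2 b3 b4 [b5 b6]] := ar _ _ _ _ _ _ a1 a2 a3 a4 a5 a6.
by split; [exact: h|exact: h|exact: h|exact: h|split; exact: h].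
Qed.

Lemma rho_kap : rho <= kap.
Proof.
have [_ _ _ h _] := smalls; apply: le_trans rho_le _.
have h1 : 0 <= c2 * c4 by rewrite mulr_ge0// ltW.
apply: (@le_trans _ _ (c2 * c4 * kap ^+ 20)).
  by rewrite ler_piMr// mulr_ge0// ltW.
apply: (@le_trans _ _ (c2 * c4 * kap ^+ 2)); first by rewrite ler_wpM2l// kle.
by rewrite expr2 mulrA mulrC [_ * kap]mulrC ler_piMr// ltW.
Qed.

Lemma pD_le : pD <= cD' * kap ^+ 19 / sl ^+ 6.
Proof.
rewrite /pD /kD.
have -> : cD c1 (4 * C1) * c2 * c4 * kap ^+ 19 / sl ^+ 6 =
   cD c1 (4 * C1) * ((c2 * c4 * kap ^+ 20 / sl ^+ 6) / kap) by field; rewrite !gt_eqF.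
by rewrite ler_pM2l// ler_pM2r ?invr_gt0// rho_le.
Qed.

Lemma pD_ge0 : 0 <= pD.
Proof. by rewrite /pD mulr_ge0 ?(ltW cDp)// divr_ge0 ?(ltW rho_gt0) ?(ltW k0). Qed.

Let kD_kap j : (0 < j)%N -> cD' * kap ^+ j / sl ^+ 6 <= 1.
Proof.
move=> j0; have [_ _ _ _ [h _]] := smalls.
apply: (@le_trans _ _ (cD' * kap ^+ j)).
  by rewrite ler_piMr// mulr_ge0// ltW.
apply: le_trans h; rewrite mulrC ler_pM2r//; exact: (@kle 1).
Qed.

Lemma pD1 : pD <= 1.
Proof. exact: le_trans pD_le (kD_kap _). Qed.

Let mpos : 0 < m%:R :> R.
Proof. by case/andP: mL => h _; apply: lt_le_trans h; apply: lt_le_trans L1. Qed.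

Lemma pbeta_gt0 : 0 < pbeta.
Proof. by rewrite divr_gt0// mulr_gt0. Qed.

Lemma pbeta_le : pbeta <= 2 * sl ^+ 3 / kap ^+ 8.
Proof.
rewrite ler_pM2r ?invr_gt0//; case/andP: mL => _ h.
by rewrite (exprSr sl 2) sl2 mulrA ler_pM2r.
Qed.

Let pM3_le : pM3 <= cM3 * nu ^+ 2.
Proof.
rewrite /pM3 /kM3 [leRHS]mulrDl; apply: lerD; first exact: c1nu.
by rewrite le_eqVlt; apply/orP; left; apply/eqP; ring.
Qed.

Lemma pM31 : 1 <= pM3.
Proof.
rewrite lerDl divr_ge0 ?mulr_ge0 ?exprn_ge0 ?sqrtr_ge0 ?(ltW C20) ?(ltW C10) ?(ltW nu0)//.
Qed.

Let rnM3 : rn * pM3 <= cM3 * c1 * c4 * kap ^+ 28 / sl ^+ 7.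
Proof.
apply: (@le_trans _ _ (cM3 * (nu ^+ 2 * rn))).
  by rewrite mulrC mulrA ler_pM2r.
have -> : cM3 * c1 * c4 * kap ^+ 28 / sl ^+ 7 = cM3 * (c1 * (c4 * kap ^+ 28 / sl ^+ 7)) by ring.
rewrite (ler_pM2l M30); apply: le_trans nu2_le _.
by rewrite (ler_pM2l c1_gt0); exact: vn_le.
Qed.

(** In beta^2 pD the powers of L cancel, and beta^3 pM3 / sqrt n leaves exactly one factor L,
    matched by m >= L; this accounts for the seventh power of the logarithm. A positive power of kap
    is left over in both terms. *)
Lemma K1_small : 16 * K1 n pM3 pD pbeta <= m%:R.
Proof.
have bp := pbeta_gt0; have [h _ _ _ _] := smalls.
have b0 : 0 <= pbeta := ltW bp.
have hb (j : nat) : pbeta ^+ j <= (2 * sl ^+ 3 / kap ^+ 8) ^+ j.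
  by rewrite lerXn2r ?nnegrE// ?pbeta_le// (le_trans b0 pbeta_le).
have e1 : pbeta ^+ 2 * pD <= 4 * cD' * kap ^+ 3.
  apply: (@le_trans _ _ ((2 * sl ^+ 3 / kap ^+ 8) ^+ 2 * (cD' * kap ^+ 19 / sl ^+ 6))).
    by apply: ler_pM; rewrite ?exprn_ge0 ?pD_ge0 ?hb ?pD_le.
  by rewrite le_eqVlt; apply/orP; left; apply/eqP; field; rewrite !gt_eqF.
have e2 : pbeta ^+ 3 * (rn * pM3) <= 8 * cM3 * c1 * c4 * L * kap ^+ 4.
  have M3p : 0 <= rn * pM3 by rewrite mulr_ge0 ?(ltW rn0)// (le_trans ler01 pM31).
  apply: (@le_trans _ _ ((2 * sl ^+ 3 / kap ^+ 8) ^+ 3 * (cM3 * c1 * c4 * kap ^+ 28 / sl ^+ 7))).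
    by apply: ler_pM; rewrite ?exprn_ge0 ?hb.
  by rewrite -sl2 le_eqVlt; apply/orP; left; apply/eqP; field; rewrite !gt_eqF.
have e3 : K1 n pM3 pD pbeta <= kK1 C1 C2 C4 * kap * L.
  rewrite /K1 -/rn /kK1 -mulrA -[pbeta ^+ 3 * rn * pM3]mulrA -/kcK.
  rewrite [leRHS](_ : _ = 3 * (4 * cD' * kap * L) + kK * (8 * cM3 * c1 * c4 * L * kap)); last by ring.
  apply: lerD.
    rewrite ler_pM2l//; apply: le_trans e1 _.
    apply: (@le_trans _ _ (4 * cD' * kap)); last by rewrite ler_peMr// mulr_ge0 ?mulr_ge0// ltW.
    by rewrite ler_pM2l ?mulr_gt0//; exact: (@kle 1).
  rewrite ler_pM2l//; apply: le_trans e2 _; rewrite ler_pM2l; first exact: (@kle 1).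
  apply: mulr_gt0; last by exact: lt_le_trans ltr01 L1.
  by apply: mulr_gt0 => //; apply: mulr_gt0; [exact: mulr_gt0|exact: c1_gt0].
case/andP: mL => hm _; apply: le_trans hm.
apply: (@le_trans _ _ (16 * (kK1 C1 C2 C4 * kap * L))); first by rewrite ler_pM2l.
have -> : 16 * (kK1 C1 C2 C4 * kap * L) = kap * (16 * kK1 C1 C2 C4) * L by ring.
by rewrite ler_piMl// (le_trans ler01 L1).
Qed.

Lemma pbeta_rn : pbeta * rn <= 1.
Proof.
have [_ h _ _ _] := smalls.
apply: (@le_trans _ _ ((2 * sl ^+ 3 / kap ^+ 8) * (c1 ^+ 2 * (c4 * kap ^+ 28 / sl ^+ 7)))).
  apply: ler_pM; rewrite ?(ltW pbeta_gt0) ?(ltW rn0)// ?pbeta_le//.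
  by apply: le_trans rn_le _; rewrite ler_wpM2l ?sqr_ge0// vn_le.
have -> : 2 * sl ^+ 3 / kap ^+ 8 * (c1 ^+ 2 * (c4 * kap ^+ 28 / sl ^+ 7)) =
   kap * (2 * c1 ^+ 2 * c4) * (kap ^+ 19 / sl ^+ 4) by field; rewrite !gt_eqF.
apply: mulr_ile1 => //.
- by rewrite mulr_ge0 ?(ltW k0)// mulr_ge0// mulr_ge0// sqr_ge0.
- by rewrite divr_ge0 ?(ltW (kp _)) ?(ltW (sp _)).
- by rewrite mulr_ile1 ?(ltW (kp _)) ?invr_ge0 ?(ltW (sp _)).
Qed.

Lemma pbeta_rn3 : (pbeta * rn) ^+ 3 * pM3 <= 1.
Proof.
have [_ _ h _ _] := smalls.
have M3p : 0 <= rn * pM3 by rewrite mulr_ge0 ?(ltW rn0)// (le_trans ler01 pM31).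
have b1 := pbeta_rn; have b0 : 0 <= pbeta * rn by rewrite mulr_ge0 ?(ltW pbeta_gt0) ?(ltW rn0).
have e : pbeta * (rn * pM3) <= 1.
  apply: (@le_trans _ _ ((2 * sl ^+ 3 / kap ^+ 8) * (cM3 * c1 * c4 * kap ^+ 28 / sl ^+ 7))).
    by apply: ler_pM; rewrite ?(ltW pbeta_gt0)// ?pbeta_le.
  have -> : 2 * sl ^+ 3 / kap ^+ 8 * (cM3 * c1 * c4 * kap ^+ 28 / sl ^+ 7) =
     kap * (2 * cM3 * c1 * c4) * (kap ^+ 19 / sl ^+ 4) by field; rewrite !gt_eqF.
  apply: mulr_ile1 => //.
  - by rewrite mulr_ge0 ?(ltW k0)// mulr_ge0// mulr_ge0// mulr_ge0// ltW.
  - by rewrite divr_ge0 ?(ltW (kp _)) ?(ltW (sp _)).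
  - by rewrite mulr_ile1 ?(ltW (kp _)) ?invr_ge0 ?(ltW (sp _)).
have -> : (pbeta * rn) ^+ 3 * pM3 = (pbeta * rn) ^+ 2 * (pbeta * (rn * pM3)) by ring.
apply: mulr_ile1; [exact: exprn_ge0| |exact: exprn_ile1|exact: e].
by apply: mulr_ge0 => //; exact: ltW pbeta_gt0.
Qed.

Lemma K2_le : K2 n pM4 pbeta <= 16 * kK * cM4 * C4 * kap ^+ 8.
Proof.
have b0 : 0 <= pbeta := ltW pbeta_gt0.
have M40 : 0 < cM4 by rewrite divr_gt0 ?mulr_gt0 ?exprn_gt0// ltr0n.
have hb : pbeta ^+ 4 <= (2 * sl ^+ 3 / kap ^+ 8) ^+ 4.
  by rewrite lerXn2r ?nnegrE// ?pbeta_le// (le_trans b0 pbeta_le).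
have hv : nu ^+ 8 / n%:R <= C4 * kap ^+ 56 / sl ^+ 14.
  rewrite ler_pdivrMr// mulrAC ler_pdivlMr// (_ : 14 = 2 * 7)%N// exprM sl2.
  by apply: le_trans main _; rewrite -mulrA [kap ^+ _ * _]mulrC.
rewrite /K2 -/kcK.
have -> : pbeta ^+ 4 * pM4 / n%:R = cM4 * (pbeta ^+ 4 * (nu ^+ 8 / n%:R)) by rewrite /pM4; ring.
have e : pbeta ^+ 4 * (nu ^+ 8 / n%:R) <= 16 * C4 * kap ^+ 8.
  apply: (@le_trans _ _ ((2 * sl ^+ 3 / kap ^+ 8) ^+ 4 * (C4 * kap ^+ 56 / sl ^+ 14))).
    apply: ler_pM => //; first exact: exprn_ge0.
    by apply: divr_ge0 => //; apply: exprn_ge0; exact: ltW.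
  have -> : (2 * sl ^+ 3 / kap ^+ 8) ^+ 4 * (C4 * kap ^+ 56 / sl ^+ 14) =
     16 * C4 * kap ^+ 8 * (kap ^+ 16 / sl ^+ 2) by field; rewrite !gt_eqF.
  rewrite ler_piMr//; first by rewrite mulr_ge0 ?(ltW (kp _))// mulr_ge0// ltW.
  by rewrite mulr_ile1 ?(ltW (kp _)) ?invr_ge0 ?(ltW (sp _)).
have -> : 16 * kK * cM4 * C4 * kap ^+ 8 = kK * (cM4 * (16 * C4 * kap ^+ 8)) by ring.
by rewrite ler_pM2l// ler_pM2l.
Qed.

Lemma error_le (EG ex : R) : EG <= 6 * sl -> ex <= kap ^+ 8 ->
  21 * m%:R * (EG / pbeta + 2 * pD) + 4 * K2 n pM4 pbeta + 2 * ex <= kerr C1 C4 * kap ^+ 8.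
Proof.
move=> hG hx; have b0 := pbeta_gt0.
have e1 : m%:R * (EG / pbeta) <= 6 * kap ^+ 8.
  apply: (@le_trans _ _ (m%:R * (6 * sl / pbeta))); first by rewrite ler_pM2l// ler_pM2r ?invr_gt0.
  by rewrite /pbeta le_eqVlt; apply/orP; left; apply/eqP; field; rewrite !gt_eqF.
have e2 : m%:R * pD <= 2 * cD' * kap ^+ 8.
  apply: (@le_trans _ _ (2 * sl ^+ 2 * (cD' * kap ^+ 19 / sl ^+ 6))).
    by apply: ler_pM; rewrite ?pD_ge0 ?pD_le ?(ltW mpos)// sl2; case/andP: mL.
  have -> : 2 * sl ^+ 2 * (cD' * kap ^+ 19 / sl ^+ 6) = 2 * cD' * kap ^+ 8 * (kap ^+ 11 / sl ^+ 4).
    by field; rewrite !gt_eqF.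
  rewrite ler_piMr//; first by rewrite mulr_ge0 ?(ltW (kp _))// mulr_ge0// ltW.
  by rewrite mulr_ile1 ?(ltW (kp _)) ?invr_ge0 ?(ltW (sp _)).
have e3 := K2_le.
have -> : 21 * m%:R * (EG / pbeta + 2 * pD) = 21 * (m%:R * (EG / pbeta)) + 42 * (m%:R * pD) by ring.
rewrite [leRHS](_ : _ = 21 * (6 * kap ^+ 8) + 42 * (2 * cD' * kap ^+ 8) +
  4 * (16 * kK * cM4 * C4 * kap ^+ 8) + 2 * kap ^+ 8); last by rewrite /kerr; ring.
by apply: lerD; [apply: lerD; [apply: lerD|]|]; rewrite ler_pM2l.
Qed.

Lemma nu4_rho : nu ^+ 4 <= n%:R * (rho ^+ 2 * kap ^+ 4).
Proof.
have nn : n%:R * rn ^+ 2 = 1 by rewrite rn2 mulfV// gt_eqF.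
have -> : n%:R * (rho ^+ 2 * kap ^+ 4) = (n%:R * rn ^+ 2) * (c2 ^+ 2 * sl ^+ 2 * nu ^+ 8 * kap ^- 12).
  by rewrite /rho /vn; field; rewrite gt_eqF.
rewrite nn mul1r.
have h1 : 1 <= c1 * nu ^+ 2 := c1nu.
have h2 : 1 <= (c1 * nu ^+ 2) ^+ 2 by rewrite exprn_ege1.
have h3 : c1 ^+ 2 <= c2 ^+ 2.
  by rewrite lerXn2r ?nnegrE ?(ltW c20)//; have := c10; rewrite /kc2; lra.
apply: (@le_trans _ _ (nu ^+ 4 * (c1 * nu ^+ 2) ^+ 2)).
  by rewrite ler_peMr// exprn_ge0// ltW.
have -> : nu ^+ 4 * (c1 * nu ^+ 2) ^+ 2 = c1 ^+ 2 * nu ^+ 8 by ring.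
have n8 : 0 <= nu ^+ 8 by rewrite exprn_ge0// ltW.
apply: (@le_trans _ _ (c2 ^+ 2 * nu ^+ 8)); first by rewrite ler_wpM2r.
have -> : c2 ^+ 2 * sl ^+ 2 * nu ^+ 8 * kap ^- 12 = c2 ^+ 2 * nu ^+ 8 * (sl ^+ 2 * kap ^- 12) by ring.
apply: ler_peMr; first by apply: mulr_ge0 => //; exact: sqr_ge0.
by apply: mulr_ege1; [exact: sge|rewrite invf_ge1].
Qed.

Lemma sqrt_le (y k q : R) : 0 <= y -> 0 <= q -> 4 * k <= q ^+ 2 ->
  Num.sqrt (4 * L * (k * y ^+ 2) / n%:R) <= q * (sl * y * rn).
Proof.
move=> y0 q0 h.
have h0 : 0 <= q * (sl * y * rn) by rewrite !mulr_ge0 ?(ltW sl0) ?(ltW rn0).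
rewrite -[leRHS](ger0_norm h0) -sqrtr_sqr ler_wsqrtr// !exprMn sl2 rn2.
have -> : 4 * L * (k * y ^+ 2) / n%:R = (4 * k) * (L * y ^+ 2 / n%:R) by ring.
by rewrite ler_wpM2r// divr_ge0// mulr_ge0 ?sqr_ge0// (le_trans ler01).
Qed.

Lemma good_mean : 5 * Num.sqrt (4 * L * (2 * nu ^+ 2) / n%:R) / kap ^+ 8 <= 15 * (sl * nu * rn) / kap ^+ 8.
Proof.
rewrite ler_pM2r ?invr_gt0//.
have := @sqrt_le nu 2 3 (ltW nu0) (ler0n _ _).
have -> : 4 * 2 <= 3 ^+ 2 :> R by lra.
by move=> /(_ isT) h; lra.
Qed.

Lemma good_mean_rho : nu * (15 * (sl * nu * rn) / kap ^+ 8) <= rho.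
Proof.
have -> : nu * (15 * (sl * nu * rn) / kap ^+ 8) = 15 * (sl * (nu ^+ 2 * rn) / kap ^+ 8) by ring.
apply: (@le_trans _ _ (15 * (sl * (c1 * vn) / kap ^+ 8))).
  by rewrite ler_pM2l// ler_pM2r ?invr_gt0// ler_pM2l// nu2_le.
have -> : 15 * (sl * (c1 * vn) / kap ^+ 8) = 15 * c1 * (sl * vn / kap ^+ 8) by ring.
rewrite ler_wpM2r//; last by rewrite /kc2; have := c10; lra.
by rewrite divr_ge0 ?(ltW (kp _))// mulr_ge0// ltW.
Qed.

Lemma good_raw : 5 * Num.sqrt (4 * L * (12 * nu ^+ 4) / n%:R) / kap ^+ 8 <= rho.
Proof.
have h : Num.sqrt (4 * L * (12 * nu ^+ 4) / n%:R) <= 7 * (sl * nu ^+ 2 * rn).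
  have -> : nu ^+ 4 = (nu ^+ 2) ^+ 2 by rewrite -exprM.
  by apply: sqrt_le; [exact: sqr_ge0| |lra].
apply: (@le_trans _ _ (5 * (7 * (sl * (c1 * vn))) / kap ^+ 8)).
  rewrite ler_pM2r ?invr_gt0// ler_pM2l//; apply: le_trans h _.
  by rewrite ler_pM2l// -mulrA ler_pM2l// nu2_le.
have -> : 5 * (7 * (sl * (c1 * vn))) / kap ^+ 8 = 35 * c1 * (sl * vn / kap ^+ 8) by ring.
rewrite ler_wpM2r//; last by rewrite /kc2; have := c10; lra.
by rewrite divr_ge0 ?(ltW (kp _))// mulr_ge0// ltW.
Qed.

Lemma good_gram : 5 * Num.sqrt (4 * L * (560 * nu ^+ 8) / n%:R) / kap ^+ 8 <= rho.
Proof.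
have h : Num.sqrt (4 * L * (560 * nu ^+ 8) / n%:R) <= 48 * (sl * nu ^+ 4 * rn).
  have -> : nu ^+ 8 = (nu ^+ 4) ^+ 2 by rewrite -exprM.
  by apply: sqrt_le; [apply: exprn_ge0; exact: ltW| |lra].
apply: (@le_trans _ _ (5 * (48 * (sl * vn)) / kap ^+ 8)).
  by rewrite ler_pM2r ?invr_gt0// ler_pM2l// /vn [sl * _]mulrA.
have -> : 5 * (48 * (sl * vn)) / kap ^+ 8 = 240 * (sl * vn / kap ^+ 8) by ring.
rewrite ler_wpM2r//; last by rewrite /kc2; have := c10; lra.
by rewrite divr_ge0 ?(ltW (kp _))// mulr_ge0// ltW.
Qed.

(** Replacing the raw second moments by the sample covariance costs less, at scale sqrt n, than sqrt
    C1 times the gap m / beta left by the comparison. *)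
Lemma remainder_le (u : R) : 0 <= u -> u <= 15 * (sl * nu * rn) / kap ^+ 8 ->
  Num.sqrt n%:R * (2 * ((2 * nu ^+ 2 + rho) / n%:R) + 2 * (u * u)) <=
  Num.sqrt C1 * (m%:R / pbeta).
Proof.
move=> u0 hu; have [_ _ _ _ [_ h]] := smalls.
have s0 : 0 < Num.sqrt n%:R :> R by rewrite sqrtr_gt0.
have -> : m%:R / pbeta = kap ^+ 8 / sl by rewrite /pbeta; field; rewrite !gt_eqF.
have sn : Num.sqrt n%:R / n%:R = rn.
  by rewrite -[in X in _ / X](sqr_sqrtr (ltW nR)) /rn; field; rewrite gt_eqF.
have hr : rho * rn <= c1 ^+ 2 * vn.
  apply: le_trans rn_le; rewrite ler_piMl ?(ltW rn0)//; exact: le_trans rho_kap k1.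
have hn := nu2_le.
have su : Num.sqrt n%:R * (u * u) <= 225 * c1 * (sl ^+ 2 * vn / kap ^+ 16).
  apply: (@le_trans _ _ (Num.sqrt n%:R * ((15 * (sl * nu * rn) / kap ^+ 8) ^+ 2))).
    by rewrite ler_pM2l// -expr2 lerXn2r ?nnegrE// (le_trans u0).
  have -> : Num.sqrt n%:R * (15 * (sl * nu * rn) / kap ^+ 8) ^+ 2 =
      225 * (sl ^+ 2 * (nu ^+ 2 * rn) / kap ^+ 16).
    by rewrite /rn; field; rewrite !gt_eqF.
  rewrite -[225 * c1 * _]mulrA ler_pM2l//.
  have -> : c1 * (sl ^+ 2 * vn / kap ^+ 16) = sl ^+ 2 * (c1 * vn) / kap ^+ 16 by ring.
  by rewrite ler_pM2r ?invr_gt0// ler_pM2l.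
have -> : Num.sqrt n%:R * (2 * ((2 * nu ^+ 2 + rho) / n%:R) + 2 * (u * u)) =
   4 * (nu ^+ 2 * (Num.sqrt n%:R / n%:R)) + 2 * (rho * (Num.sqrt n%:R / n%:R)) + 2 * (Num.sqrt n%:R * (u * u)) by ring.
rewrite sn.
have w1 : vn <= sl ^+ 2 * vn / kap ^+ 16.
  rewrite [leRHS]mulrAC; apply: ler_peMl => //.
  by apply: mulr_ege1; [exact: sge|rewrite invf_ge1].
set w := sl ^+ 2 * vn / kap ^+ 16 in su w1.
have c11 : 0 <= c1 ^+ 2 by rewrite sqr_ge0.
apply: (@le_trans _ _ ((454 * c1 + 2 * c1 ^+ 2) * w)).
  have k2 : c1 * vn <= c1 * w by rewrite ler_wpM2l.
  have k3 : c1 ^+ 2 * vn <= c1 ^+ 2 * w by rewrite ler_wpM2l.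
  rewrite [leRHS](_ : _ = 4 * (c1 * w) + 2 * (c1 ^+ 2 * w) + 2 * (225 * c1 * w)); last by ring.
  apply: lerD; [apply: lerD|]; rewrite ler_pM2l//; first exact: le_trans hn k2.
  exact: le_trans hr k3.
have hw : w <= c4 * kap ^+ 12 / sl ^+ 5.
  apply: (@le_trans _ _ (sl ^+ 2 * (c4 * kap ^+ 28 / sl ^+ 7) / kap ^+ 16)).
    by rewrite ler_pM2r ?invr_gt0// ler_pM2l// vn_le.
  by rewrite le_eqVlt; apply/orP; left; apply/eqP; field; rewrite !gt_eqF.
have cc : 0 <= 454 * c1 + 2 * c1 ^+ 2.
  exact: (addr_ge0 (mulr_ge0 (ler0n _ _) c10) (mulr_ge0 (ler0n _ _) c11)).
apply: le_trans (ler_wpM2l cc hw) _.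
have sC : 0 < Num.sqrt C1 by rewrite sqrtr_gt0.
have -> : (454 * c1 + 2 * c1 ^+ 2) * (c4 * kap ^+ 12 / sl ^+ 5) =
  (Num.sqrt C1 * (kap ^+ 8 / sl)) * (kap * krem C1 C4 * (kap ^+ 3 / sl ^+ 4)).
  by rewrite /krem; field; rewrite !gt_eqF.
rewrite ler_piMr//; first by rewrite mulr_ge0 ?(ltW sC)// divr_ge0 ?(ltW (kp _)) ?(ltW sl0).
apply: mulr_ile1 => //.
- by rewrite mulr_ge0 ?(ltW k0) ?(ltW krem0).
- by rewrite divr_ge0 ?(ltW (kp _)) ?(ltW (sp _)).
- by rewrite mulr_ile1 ?(ltW (kp _)) ?invr_ge0 ?(ltW (sp _)).
Qed.

End TuningConstants.

(** * Coverage of the bootstrap quantile *)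

Lemma half_two (R : realType) : 2^-1 * (1 + 1) <= 1 :> R.
Proof. lra. Qed.

Lemma norm_mul_le_half (R : realType) (u v : R) : `|u * v| <= 2^-1 * (u ^+ 2 + v ^+ 2).
Proof.
rewrite normrM -[u ^+ 2]real_normK ?num_real// -[v ^+ 2]real_normK ?num_real//.
by have := sqr_ge0 (`|u| - `|v|); rewrite sqrrB; lra.
Qed.

Lemma norm_mul_le (R : realType) (u v : R) : `|u * v| <= u ^+ 2 + v ^+ 2.
Proof.
apply: le_trans (norm_mul_le_half u v) _.
by have := sqr_ge0 u; have := sqr_ge0 v; lra.
Qed.

Lemma coverage_arith (R : realType) (x c d s : R) : d * (2 * c) <= d * s ->
  x + c * d <= x - c * d + d * s.
Proof. lra. Qed.

Lemma coverage_arith0 (R : realType) (al y k : R) : 1 - 4 * k <= 0 -> 0 < al -> 0 <= y * k ->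
  1 - al - (y + 4) * k <= 0.
Proof. lra. Qed.

Lemma coverage_arith1 (R : realType) (al y k pv pg r : R) : 1 - al - y * k <= pv ->
  1 - 4 * k <= pg -> r <= 1 - pv + (1 - pg) -> 1 - al - (y + 4) * k <= 1 - r.
Proof. lra. Qed.

Section Coverage.
Context d (T : measurableType d) {R : realType} (P : probability T R).
Context (n p : nat).
Variables (X : 'I_n -> {RV P >-> p.-tuple R}) (e : 'I_n -> {RV P >-> R}).
Variables (Sigma : 'M[R]_p) (nu C1 C2 C4 s6 kap L : R) (m : nat).
Hypothesis n4 : (4 <= n)%N.
Hypothesis p0 : (0 < p)%N.
Hypothesis nu0 : 0 < nu.
Hypothesis C10 : 0 < C1.
Hypothesis C20 : 0 < C2.
Hypothesis C40 : 0 < C4.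
Hypothesis s60 : 0 < s6.
Hypothesis s6E : s6 ^+ 6 = C2 ^+ 6 * nu ^+ 2.
Hypothesis H8 : forall i, L1 P (fun w => tmax (X i w) ^+ 8).
Hypothesis E8 : forall i, Ex P (fun w => tmax (X i w) ^+ 8) <= nu ^+ 8.
Hypothesis H6 : forall i k, L1 P (fun w => `|tnth (X i w) k| ^+ 6).
Hypothesis E6 : forall i k, Ex P (fun w => `|tnth (X i w) k| ^+ 6) <= s6 ^+ 6.
Hypothesis Hc : forall i k, Ex P (fun w => tnth (X i w) k) = 0.
Hypothesis Hs : forall i m k, Ex P (fun w => tnth (X i w) m * tnth (X i w) k) = Sigma m k.
Hypothesis Hv : forall i a, 4 * C1 <= Ex P (fun w => tQ Sigma a (X i w) ^+ 2).
Hypothesis Hid : forall i j (f : p.-tuple R -> R), measurable_fun setT f ->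
  L1 P (fun w => f (X i w)) -> Ex P (fun w => f (X j w)) = Ex P (fun w => f (X i w)).
Hypothesis xI : forall x0 i, indep P (X i) (looX X e x0 i).
Hypothesis eN : forall i, standard_normal (e i).
Hypothesis eI : forall i, indep P (e i) (looE X e i).
Hypothesis k0 : 0 < kap.
Hypothesis k1 : kap <= 1.
Hypothesis L1' : 1 <= L.
Hypothesis mL : L <= m%:R <= 2 * L.
Hypothesis hL : ln ((2 * p ^ 4).+1%:R : R) <= 4 * L.
Hypothesis hJ : (2 * p ^ 2)%:R <= expR (2 * m%:R) :> R.
Hypothesis hm : expR (- m%:R) <= kap ^+ 8.
Hypothesis main : nu ^+ 8 * L ^+ 7 <= C4 * (n%:R * kap ^+ 56).
Hypothesis small : kap * kbig C1 C2 C4 <= 1.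

Let n0 : (0 < n)%N. Proof. exact: leq_trans n4. Qed.
Let nR : 0 < n%:R :> R. Proof. by rewrite ltr0n. Qed.
Let L0 : 0 < L. Proof. exact: lt_le_trans ltr01 L1'. Qed.

Local Notation J := (('I_p * 'I_p) * bool)%type.
Local Notation Q := (tQ Sigma).
Local Notation Gam := (tGam X Sigma n0).
Local Notation rho := (rho C1 nu kap L n).
Local Notation pD := (pD C1 nu kap L n).
Local Notation beta := (pbeta kap L m).
Local Notation rn := (@rn R n).
Local Notation good := (goodset X Sigma nu n0 L (kap ^+ 8)).

Let nuC1 : C1 <= 3 * nu ^+ 4 := nu_lower n0 p0 nu0 H8 E8 Hs Hv.
Let m0 : (0 < m)%N.
Proof. by rewrite -(ltr0n R); case/andP: mL => h _; exact: lt_le_trans L0 h. Qed.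

Definition sig a : R := Num.sqrt (Gam a a).

Let sC0 : 0 < Num.sqrt C1. Proof. by rewrite sqrtr_gt0. Qed.
Let Gam4 a : 4 * C1 <= Gam a a := tGam_diag n0 Hv a.
Let Gam0 a : 0 < Gam a a.
Proof. by apply: lt_le_trans (Gam4 a); rewrite mulr_gt0. Qed.
Lemma sig_ge a : 2 * Num.sqrt C1 <= sig a.
Proof.
have h : 0 <= 2 * Num.sqrt C1 by rewrite mulr_ge0// ltW.
rewrite -[leLHS](ger0_norm h) -sqrtr_sqr ler_wsqrtr// exprMn sqr_sqrtr ?(ltW C10)//.
by apply: le_trans (Gam4 a); rewrite expr2 -natrM.
Qed.
Let sig0 a : 0 < sig a. Proof. by rewrite sqrtr_gt0. Qed.
Let sig2 a : sig a * sig a = Gam a a.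
Proof. by rewrite -expr2 sqr_sqrtr// ltW. Qed.

Definition sgn (s : bool) : R := (-1) ^+ s.
Let sgn2 s : sgn s * sgn s = 1. Proof. by rewrite /sgn -expr2 sqrr_sign. Qed.
Let sgnN s : `|sgn s| = 1. Proof. by rewrite /sgn normr_sign. Qed.

(** The summands are standardized, so that their covariance [rmf] has the unit diagonal required by
    anti-concentration; the sign in the index turns a maximum of absolute values into a plain
    maximum. *)
Definition yf (j : J) (x : p.-tuple R) : R := sgn j.2 * (Q j.1 x / sig j.1).
Definition bmf (x : p.-tuple R) : R := tenv nu x / (2 * Num.sqrt C1).
Definition rmf (j k : J) : R := sgn j.2 * sgn k.2 * (Gam j.1 k.1 / (sig j.1 * sig k.1)).

Let my j : measurable_fun setT (yf j).
Proof.
apply: measurable_funM => //; apply: measurable_funM => //; exact: meas_tQ.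
Qed.

Let twoC : 0 < 2 * Num.sqrt C1. Proof. by rewrite mulr_gt0. Qed.

Let Bm0 x : 0 <= bmf x.
Proof. by rewrite divr_ge0 ?tenv_ge0// ltW. Qed.

Let yB j x : `|yf j x| <= bmf x.
Proof.
rewrite /yf normrM sgnN mul1r normrM [`|_^-1|]gtr0_norm ?invr_gt0//.
apply: ler_pM => //; first by rewrite invr_ge0 ltW.
  exact: (tQ_le n0 nu0 H8 E8 Hs).
by rewrite lef_pV2 ?posrE// sig_ge.
Qed.

Let bm4 x : bmf x ^+ 4 = (16 * C1 ^+ 2)^-1 * tenv nu x ^+ 4.
Proof.
rewrite /bmf expr_div_n mulrC; congr (_^-1 * _).
by rewrite exprMn (_ : 4 = 2 * 2)%N// [Num.sqrt C1 ^+ _]exprM sqr_sqrtr ?ltW//; ring.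
Qed.

Let LB i : L1 P (fun w => bmf (X i w) ^+ 4).
Proof.
have [l4 _] := Ex_tenv4 H8 E8 i.
by apply: L1_ext (L1Z (16 * C1 ^+ 2)^-1 l4) => w; rewrite bm4.
Qed.

Let EB i : Ex P (fun w => bmf (X i w) ^+ 4) <= pM4 C1 nu.
Proof.
have [l4 h4] := Ex_tenv4 H8 E8 i.
rewrite [X in Ex _ X](_ : _ = fun w => (16 * C1 ^+ 2)^-1 * tenv nu (X i w) ^+ 4); last first.
  by apply/funext => w; rewrite bm4.
rewrite ExZ//; apply: (@le_trans _ _ ((16 * C1 ^+ 2)^-1 * (136 * nu ^+ 8))).
  by rewrite ler_wpM2l// invr_ge0 mulr_ge0// sqr_ge0.
by rewrite /pM4 /kM4 le_eqVlt; apply/orP; left; apply/eqP; field; rewrite gt_eqF.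
Qed.

Let Ey i j : Ex P (fun w => yf j (X i w)) = 0.
Proof.
have l := L1_tQ Sigma H8 i j.1.
rewrite [X in Ex _ X](_ : _ = fun w => (sgn j.2 / sig j.1) * Q j.1 (X i w)); last first.
  by apply/funext => w; rewrite /yf; ring.
by rewrite ExZ// (Ex_tQ H8 Hs) mulr0.
Qed.

Let Eyy i j k : Ex P (fun w => yf j (X i w) * yf k (X i w)) = rmf j k.
Proof.
have l := L1_tQQ n0 nu0 H8 E8 Hs i j.1 k.1.
rewrite [X in Ex _ X](_ : _ = fun w => (sgn j.2 * sgn k.2 / (sig j.1 * sig k.1)) *
    (Q j.1 (X i w) * Q k.1 (X i w))); last first.
  by apply/funext => w; rewrite /yf; field; rewrite !gt_eqF.
by rewrite ExZ// (tGamE n0 nu0 H8 E8 Hs Hid) /rmf; ring.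
Qed.

Let Ey3 i j : Ex P (fun w => `|yf j (X i w)| ^+ 3) <= pM3 C1 C2 nu.
Proof.
have [l3 h3] := Ex_tQ3 s60 H8 H6 E6 Hs i j.1.
rewrite [X in Ex _ X](_ : _ = fun w => (sig j.1 ^+ 3)^-1 * `|Q j.1 (X i w)| ^+ 3); last first.
  apply/funext => w; rewrite /yf normrM sgnN mul1r normrM [`|_^-1|]gtr0_norm ?invr_gt0//.
  by rewrite exprMn exprVn mulrC.
rewrite ExZ//; apply: (@le_trans _ _ ((8 * (C1 * Num.sqrt C1))^-1 * (36 * (C2 ^+ 6 * nu ^+ 2)))).
  apply: ler_pM.
  - by rewrite invr_ge0 exprn_ge0// ltW.
  - by apply: Ex_ge0 => w; rewrite exprn_ge0.
  - rewrite lef_pV2 ?posrE ?exprn_gt0//; last by rewrite mulr_gt0// mulr_gt0.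
    have -> : 8 * (C1 * Num.sqrt C1) = (2 * Num.sqrt C1) ^+ 3.
      by rewrite -[X in 8 * (X * _)](sqr_sqrtr (ltW C10)); ring.
    by rewrite lerXn2r ?nnegrE ?(ltW twoC) ?(ltW (sig0 _))// sig_ge.
  - by rewrite -s6E.
by rewrite /pM3 mulrC lerDr.
Qed.

(** Both summands have second moment 1, so |u v| <= (u^2 + v^2) / 2 bounds the correlation. *)
Let Rm1 j k : `|rmf j k| <= 1.
Proof.
pose i0 := Ordinal n0.
have sq l : L1 P (fun w => yf l (X i0 w) ^+ 2) /\ Ex P (fun w => yf l (X i0 w) ^+ 2) = 1.
  have lq := L1_tQQ n0 nu0 H8 E8 Hs i0 l.1 l.1.
  have eq : (fun w => yf l (X i0 w) ^+ 2) = fun w => (Gam l.1 l.1)^-1 * (Q l.1 (X i0 w) * Q l.1 (X i0 w)).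
    apply/funext => w; rewrite -sig2 /yf expr2.
    rewrite [LHS](_ : _ = (sgn l.2 * sgn l.2) * ((sig l.1 * sig l.1)^-1 * (Q l.1 (X i0 w) * Q l.1 (X i0 w)))).
      by rewrite sgn2 mul1r.
    by field; rewrite gt_eqF.
  rewrite eq; split; first exact: L1Z.
  by rewrite ExZ// (tGamE n0 nu0 H8 E8 Hs Hid) mulVf// gt_eqF.
have [lj ej] := sq j; have [lk ek] := sq k.
rewrite -(Eyy i0).
have lyy : L1 P (fun w => yf j (X i0 w) * yf k (X i0 w)).
  apply: (L1_le (g := fun w => yf j (X i0 w) ^+ 2 + yf k (X i0 w) ^+ 2)).
  - by apply: measurable_funM; apply: measurableT_comp.
  - by move=> w; exact: norm_mul_le.
  - exact: L1D.
apply: (@le_trans _ _ (Ex P (fun w => 2^-1 * (yf j (X i0 w) ^+ 2 + yf k (X i0 w) ^+ 2)))).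
  apply: Ex_norm_le => //; first by apply: L1Z; exact: L1D.
  by move=> w; exact: norm_mul_le_half.
rewrite ExZ; last exact: L1D.
by rewrite ExD// ej ek half_two.
Qed.

Let Rd1 j : rmf j j = 1.
Proof. by rewrite /rmf sgn2 mul1r sig2 divff// gt_eqF. Qed.

Section GoodPoint.
Variable w0 : T.
Hypothesis gw : good w0.

Let x : 'I_n -> 'cV[R]_p := data X w0.
Let xE i k : x i k 0 = tnth (X i w0) k. Proof. by rewrite mxE. Qed.

Lemma good_xb k : `|sample_mean x k 0| <= 15 * (sl L * nu * rn) / kap ^+ 8.
Proof.
case: gw => h _ _ _; apply: le_trans (good_mean nu0 k0 L1' n0).
apply: le_trans h; rewrite sample_meanE.
rewrite [X in `|avg X|](_ : _ = fun i => tnth (X i w0) k); last by apply/funext => i; exact: xE.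
exact: (le_bigmax _ (fun k => `|avg (fun i => tnth (X i w0) k)|) k).
Qed.

Lemma good_rawE a : raw x a.1 a.2 - Sigma a.1 a.2 = avg (fun i => Q a (X i w0)).
Proof.
rewrite /tQ (avgB (fun i => tnth (X i w0) a.1 * tnth (X i w0) a.2)) avg_cst//; congr (_ - _).
by congr avg; apply/funext => i; rewrite !xE.
Qed.

Let hraw a : `|raw x a.1 a.2 - Sigma a.1 a.2| <= rho.
Proof.
case: gw => _ h _ _; apply: le_trans (good_raw C10 nu0 k0 L1' n0 nuC1).
rewrite good_rawE; apply: le_trans h.
exact: (le_bigmax _ (fun a => `|avg (fun i => Q a (X i w0))|) a).
Qed.

Let hGam a b : `|avg (fun i => (x i a.1 0 * x i a.2 0 - Sigma a.1 a.2) *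
   (x i b.1 0 * x i b.2 0 - Sigma b.1 b.2)) - Gam a b| <= rho.
Proof.
case: gw => _ _ h _; apply: le_trans (good_gram C10 nu0 k0 L1' n0).
apply: le_trans h.
have -> : avg (fun i => (x i a.1 0 * x i a.2 0 - Sigma a.1 a.2) *
   (x i b.1 0 * x i b.2 0 - Sigma b.1 b.2)) - Gam a b =
   avg (fun i => Q a (X i w0) * Q b (X i w0) - Gam a b).
  rewrite (avgB (fun i => Q a (X i w0) * Q b (X i w0))) avg_cst//; congr (_ - _).
  by congr avg; apply/funext => i; rewrite !xE.
exact: (le_bigmax _ (fun c : ('I_p * 'I_p) * ('I_p * 'I_p) =>
  `|avg (fun i => Q c.1 (X i w0) * Q c.2 (X i w0) - Gam c.1 c.2)|) (a, b)).
Qed.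

Let hz k : (k <= 8)%N -> avg (fun i => tmax (X i w0) ^+ k) <= 2 * (nu ^+ k / kap ^+ k).
Proof.
move=> k8; case: gw => _ _ _ h.
have s0 : 0 < nu / kap by rewrite divr_gt0.
apply: le_trans (avg_le (fun i => pow_le_scaled (tmax_ge0 _) s0 k8)) _.
rewrite avgD avg_cst// avgZ -expr_div_n mulr_natl mulr2n lerD2l.
rewrite -[leRHS]mulr1 -mulrA ler_wpM2l ?exprn_ge0 ?(ltW s0)//.
rewrite ler_pdivrMl ?exprn_gt0// mulr1; apply: le_trans h _.
by rewrite expr_div_n.
Qed.

Let Aj (j : J) i : R := sgn j.2 * (rn * bootB x i j.1.1 j.1.2 / sig j.1).

Let gramE j k : gram Aj j k = sgn j.2 * sgn k.2 *
  (avg (fun i => bootB x i j.1.1 j.1.2 * bootB x i k.1.1 k.1.2) / (sig j.1 * sig k.1)).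
Proof.
rewrite /gram /avg -rn2// mulr_sumr mulr_suml mulr_sumr; apply: eq_bigr => i _.
by rewrite /Aj; field; rewrite !gt_eqF.
Qed.

Let GD j k : `|gram Aj j k - rmf j k| <= pD.
Proof.
rewrite gramE /rmf -mulrBr -mulrBl normrM normrM !sgnN !mul1r normrM.
have s2 : 0 < sig j.1 * sig k.1 by rewrite mulr_gt0.
rewrite [`|_^-1|]gtr0_norm ?invr_gt0// ler_pdivrMr//.
have c10 : 0 <= kc1 C1 by rewrite sqrtr_ge0.
have rk : rho <= kap by apply: (rho_kap C10 C20 C40 nu0 k0 k1 L1' n0 main small).
have r0 : 0 < rho by apply: (rho_gt0 C10 nu0 k0 L1' n0).
apply: (@boot_gram R n p n4 x Sigma (fun i => tmax (X i w0)) nu kap rho (kc1 C1)) => //.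
- exact: (c1nu C10 nuC1).
- by move=> i l; rewrite xE tnth_le_tmax.
- exact: hz.
- exact: hz.
- move=> l; apply: le_trans (good_mean_rho C10 nu0 k0 L1' n0 nuC1).
  by rewrite ler_pM2l//; exact: good_xb.
- by move=> a b; exact: (hraw (a, b)).
- exact: (Sigma_le n0 nu0 H8 E8 Hs).
- exact: (nu4_rho C10 nu0 k0 k1 L1' n0 nuC1).
- by rewrite mulr_gt0.
Qed.

(** The data are frozen at the good point w0 on the bootstrap side only, where they give the
    constant coefficients [Aj] of a Gaussian field; on the right the sample is random. *)
Lemma good_comparison t :
  Pr P [set w | boot_Tbar x (fun i => e i w) <= t] - kerr C1 C4 * kap ^+ 8 <=
  Pr P [set w | forall j : J, rn * sumY X yf w j <= Num.sqrt n%:R * t / sig j.1 - m%:R / beta].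
Proof.
have sn : 0 < Num.sqrt n%:R :> R by rewrite sqrtr_gt0.
have nE : n%:R = Num.sqrt n%:R * Num.sqrt n%:R :> R by rewrite -expr2 sqr_sqrtr// ltW.
have rnE : rn = Num.sqrt n%:R / n%:R.
  have snz : Num.sqrt n%:R != 0 :> R by rewrite gt_eqF.
  transitivity ((Num.sqrt n%:R : R) / (Num.sqrt n%:R * Num.sqrt n%:R)); last by rewrite -nE.
  by rewrite invfM mulrA mulfV// mul1r.
have -> : [set w | boot_Tbar x (fun i => e i w) <= t] =
    [set w | forall j : J, gaussG e Aj w j <= Num.sqrt n%:R * t / sig j.1].
  have gE w (j : J) : gaussG e Aj w j = (Num.sqrt n%:R / sig j.1) *
     (sgn j.2 * (n%:R^-1 * \sum_i bootB x i j.1.1 j.1.2 * e i w)).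
    rewrite /gaussG !mulr_sumr; apply: eq_bigr => i _.
    by rewrite /Aj rnE; ring.
  have iff w j : (gaussG e Aj w j <= Num.sqrt n%:R * t / sig j.1) =
      (sgn j.2 * (n%:R^-1 * \sum_i bootB x i j.1.1 j.1.2 * e i w) <= t).
    rewrite gE (_ : Num.sqrt n%:R * t / sig j.1 = (Num.sqrt n%:R / sig j.1) * t); last by ring.
    by rewrite ler_pM2l// divr_gt0.
  apply/seteqP; split => w /=.
    move=> /(boot_Tbar_le n4 x (fun i => e i w) t p0) h j; rewrite iff.
    apply: le_trans (ler_norm _) _; rewrite normrM sgnN mul1r; exact: h.
  move=> h; apply/(boot_Tbar_le n4 x (fun i => e i w) t p0) => a b.
  have h1 := h ((a, b), true); have h2 := h ((a, b), false).
  rewrite !iff /sgn/= expr1 expr0 mul1r mulN1r in h1 h2.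
  by rewrite ler_norml h2 andbT lerNl.
pose x0 : p.-tuple R := [tuple 0 | _ < p].
have mX i : measurable_fun setT (X i) by exact: measurable_funPT.
have b0 : 0 < beta := pbeta_gt0 k0 L1' mL.
have D0 : 0 <= pD := pD_ge0 C10 nu0 k0 L1' n0.
have D1 : pD <= 1 := pD1 C10 C20 C40 nu0 k0 k1 L1' n0 main small.
have M31 := pM31 C10 C20 nu0.
have mJ : #|{: J}|%:R <= expR (2 * m%:R) :> R.
  by rewrite !card_prod card_bool card_ord mulnC.
have K1s := K1_small C10 C20 C40 nu0 k0 k1 L1' n0 mL nuC1 main small.
have br := pbeta_rn C10 C20 C40 nu0 k0 k1 L1' n0 mL nuC1 main small.
have br3 := pbeta_rn3 C10 C20 C40 nu0 k0 k1 L1' n0 mL nuC1 main small.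
have := gaussian_comparison n0 eN eI mX (xI x0) my Bm0 yB LB EB Ey Eyy Ey3 Rm1 Rd1 M31
  (fun j => Num.sqrt n%:R * t / sig j.1) D0 GD b0 br br3 m0 mJ K1s.
apply: le_trans; rewrite lerD2l lerN2.
apply: (error_le C10 C40 nu0 k0 k1 L1' n0 mL main) => //.
have slp : 0 < sl L by exact: lt_le_trans ltr01 (sl1 L1').
(* The expected maximum is bounded with lam = sqrt L: entropy gives 4 sqrt L and variances up to 2
   give 2 sqrt L, in total the 6 sqrt L of [error_le]. *)
have gd j : gram Aj j j <= 2.
  by have := GD j j; rewrite Rd1 ler_norml => /andP[_]; lra.
apply: le_trans (Ex_Gmax_le eN eI my mX slp gd _) _ => //.
have hl : ln (#|{: J}|.+1%:R) <= 4 * L.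
  apply: le_trans hL; rewrite !card_prod card_bool card_ord ler_ln ?posrE ?ltr0n// ler_nat ltnS.
  by rewrite mulnC leq_mul2l/= mulnn leq_pexp2l.
have : ln (#|{: J}|.+1%:R) / sl L <= 4 * sl L.
  by rewrite ler_pdivrMr// -mulrA -expr2 sl2.
by lra.
Qed.

End GoodPoint.

(** Let q be the infimum of a over the good data and w1 a good point with a w1 < q + eta. The
    comparison at data frozen in w1, for some level t < q + eta, produces an event V for the sample.
    Every good w satisfies t < a w + eta, so on V and the good set the deviation is at most a w. *)
Lemma coverage (a : T -> R) (alpha : R) :
  (forall w, 0 <= a w) ->
  (forall w s, a w < s -> exists2 t, t < s &
     1 - alpha <= Pr P [set w' | boot_Tbar (data X w) (fun i => e i w') <= t]) ->
  0 < alpha ->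
  exists U : set T, [/\ measurable U,
    forall w, U w -> forall a' b', `|sample_cov (data X w) a' b' - Sigma a' b'| <= a w &
    1 - alpha - (kerr C1 C4 + 4) * kap ^+ 8 <= Pr P U].
Proof.
move=> a0 aq al0.
have [mg pg] := goodset_measurable_prob n0 p0 nu0 H8 E8 Hc Hs Hid xI L0 (exprn_gt0 8 k0) hL.
have kp : 0 <= kap ^+ 8 by rewrite exprn_ge0// ltW.
have kerr0 := kerr_ge0 C10 C40.
(* An empty good set forces 1 - 4 kap^8 <= 0 and makes the claim trivial; otherwise the infimum is
   taken over a nonempty set. *)
have [g0|/set0P[wg gwg]] := eqVneq good set0.
  exists set0; split => //.
  have e0 : Pr P set0 = 0 by rewrite /Pr measure0.
  rewrite g0 e0 in pg; rewrite e0.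
  by apply: coverage_arith0 pg al0 _; rewrite mulr_ge0.
set delta := m%:R / beta.
have d0 : 0 < delta by rewrite divr_gt0 ?ltr0n// (pbeta_gt0 k0 L1' mL).
have sn : 0 < Num.sqrt n%:R :> R by rewrite sqrtr_gt0.
(* Standard deviations are at least 2 sqrt C1, so the gap is worth at least 2 sqrt C1 delta at scale
   sqrt n: one half pays for [eta], the other for [remainder_le]. *)
pose eta := Num.sqrt C1 * delta / Num.sqrt n%:R.
have eta0 : 0 < eta by rewrite divr_gt0// mulr_gt0.
have hi : has_inf [set a w | w in good].
  split; first by exists (a wg), wg.
  by exists 0 => _ [w _ <-].
have [_ [w1 gw1 <-] aw1] := inf_adherent eta0 hi.
set q := inf _ in aw1.
have [t tq Ft] := aq w1 _ aw1.
pose V := [set w | forall j : J, rn * sumY X yf w j <= Num.sqrt n%:R * t / sig j.1 - delta].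
have mV : measurable V.
  apply: measurable_forall_le => j; apply: measurable_funM => //.
  by apply: meas_sumY => //; exact: measurable_funPT.
have PV : 1 - alpha - kerr C1 C4 * kap ^+ 8 <= Pr P V.
  by apply: le_trans (good_comparison gw1 t); rewrite lerD2r.
have mU := measurableI _ _ mV mg.
exists (V `&` good); split => //.
- move=> w [Vw gw] a' b'.
  have qa : q <= a w by apply: ge_inf; [by exists 0 => _ [w' _ <-]|exists w].
  set u : R := 15 * (sl L * nu * rn) / kap ^+ 8.
  have u0 : 0 <= u.
    by apply: le_trans (good_xb gw a').
  have hr := remainder_le C10 C20 C40 nu0 k0 k1 L1' n0 mL nuC1 main small u0 (lexx _).
  have hraw m' k' : `|raw (data X w) m' k' - Sigma m' k'| <= rho.
    case: gw => _ h _ _; apply: le_trans (good_raw C10 nu0 k0 L1' n0 nuC1).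
    rewrite (good_rawE w (m', k')); apply: le_trans h.
    exact: (le_bigmax _ (fun a => `|avg (fun i => Q a (X i w))|) (m', k')).
  have hS := Sigma_le n0 nu0 H8 E8 Hs.
  have hc := sample_cov_raw n4 hraw hS a' b'.
  have hx : `|sample_mean (data X w) a' 0| * `|sample_mean (data X w) b' 0| <= u * u.
    by apply: ler_pM => //; exact: good_xb.
  have c1 : Num.sqrt n%:R * `|sample_cov (data X w) a' b' - raw (data X w) a' b'| <= Num.sqrt C1 * delta.
    apply: le_trans hr; rewrite ler_pM2l//; apply: le_trans hc _.
    by rewrite lerD2l ler_pM2l.
  have sE (s : bool) : Num.sqrt n%:R * (sgn s * (raw (data X w) a' b' - Sigma a' b')) <=
      Num.sqrt n%:R * a w - Num.sqrt C1 * delta.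
    have := Vw ((a', b'), s); rewrite -(ler_pM2r (sig0 (a', b'))) mulrBl divfK ?gt_eqF//=.
    have -> : rn * sumY X yf w ((a', b'), s) * sig (a', b') =
        Num.sqrt n%:R * (sgn s * (raw (data X w) a' b' - Sigma a' b')).
      rewrite (good_rawE w (a', b')) /avg /sumY /yf/= -mulr_sumr -mulr_suml.
      have -> : n%:R^-1 = rn * rn by rewrite -expr2 rn2.
      have snr : Num.sqrt n%:R * rn = 1 by rewrite /rn mulfV// gt_eqF.
      rewrite [RHS](_ : _ = (Num.sqrt n%:R * rn) * (rn * (sgn s * \sum_i Q (a', b') (X i w)))); last by ring.
      by rewrite snr mul1r; field; rewrite gt_eqF.
    move=> h; apply: le_trans h _.
    have h1 : Num.sqrt n%:R * t <= Num.sqrt n%:R * a w + Num.sqrt C1 * delta.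
      have -> : Num.sqrt n%:R * a w + Num.sqrt C1 * delta = Num.sqrt n%:R * (a w + eta).
        by rewrite /eta; field; rewrite gt_eqF.
      by rewrite ler_pM2l//; apply: ltW; apply: lt_le_trans tq _; rewrite lerD2r.
    have h2 : delta * (2 * Num.sqrt C1) <= delta * sig (a', b').
      by rewrite ler_pM2l// sig_ge.
    by rewrite lerBlDr; apply: le_trans h1 _; exact: coverage_arith h2.
  rewrite -(ler_pM2l sn).
  have hT := sE true; have hF := sE false.
  rewrite /sgn expr1 mulN1r in hT; rewrite /sgn expr0 mul1r in hF.
  have -> : sample_cov (data X w) a' b' - Sigma a' b' = (sample_cov (data X w) a' b' - raw (data X w) a' b') +
    (raw (data X w) a' b' - Sigma a' b') by ring.
  rewrite -[X in X * `|_|](gtr0_norm sn) -normrM mulrDr; apply: le_trans (ler_normD _ _) _.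
  rewrite normrM (gtr0_norm sn); rewrite addrC -lerBrDr; apply: (le_trans _ (lerB (lexx _) c1)).
  by rewrite ler_norml hF andbT lerNl -mulrN.
have -> : Pr P (V `&` good) = 1 - Pr P (~` V `|` ~` good).
  by rewrite -setCI PrC//; ring.
have := PrU P (measurableC mV) (measurableC mg); rewrite !PrC//.
exact: coverage_arith1 PV pg.
Qed.

End Coverage.

(** * Measurability of the quantile *)

Section Quantile.
Context d (T : measurableType d) {R : realType} (P : probability T R).
Context (n p : nat).
Variables (X : 'I_n -> {RV P >-> p.-tuple R}) (e : 'I_n -> {RV P >-> R}).
Hypothesis n4 : (4 <= n)%N.
Hypothesis p0 : (0 < p)%N.
Hypothesis eL : forall i, L1 P (fun w => e i w).
Variable alpha : R.
Hypothesis al0 : 0 < alpha.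
Hypothesis al1 : alpha < 1.

Implicit Types x : 'I_n -> 'cV[R]_p.

Definition boot_prob x t : R := Pr P [set w | boot_Tbar x (fun i => e i w) <= t].
Definition boot_mean x : R := Ex P (fun w => boot_Tbar x (fun i => e i w)).

Lemma L1_boot_Tbar x : L1 P (fun w => boot_Tbar x (fun i => e i w)).
Proof.
have Ls m k : L1 P (fun w => `|n%:R^-1 * \sum_i bootB x i m k * e i w|).
  by apply: L1_norm; apply: L1Z; apply: L1_sum => i _; exact: L1Z.
apply: (L1_le (g := fun w => \sum_m \sum_k `|n%:R^-1 * \sum_i bootB x i m k * e i w|)).
- rewrite (_ : (fun w => _) = fun w => \big[Num.max/0]_(m < p) \big[Num.max/0]_(k < p)
    `|n%:R^-1 * \sum_i bootB x i m k * e i w|); last by apply/funext => w; rewrite boot_TbarE.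
  by apply: meas_bigmax => m; apply: meas_bigmax => k; exact: L1_meas (Ls m k).
- move=> w; rewrite boot_TbarE// ger0_norm ?bigmax_ge_id//.
  apply/bigmax_leP; split => [|m _]; first by apply: sumr_ge0 => m _; exact: sumr_ge0.
  apply/bigmax_leP; split => [|k _]; first by apply: sumr_ge0 => m' _; exact: sumr_ge0.
  rewrite (bigD1 m)//= (bigD1 k)//= -addrA lerDl addr_ge0//.
    exact: sumr_ge0.
  by apply: sumr_ge0 => m' _; exact: sumr_ge0.
- by apply: L1_sum => m _; apply: L1_sum.
Qed.

Lemma boot_Tbar_ge0 x w : 0 <= boot_Tbar x (fun i => e i w).
Proof. by rewrite boot_TbarE// bigmax_ge_id. Qed.

Lemma meas_boot_le x t : measurable [set w | boot_Tbar x (fun i => e i w) <= t].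
Proof. by apply: meas_le => //; exact: L1_meas (L1_boot_Tbar x). Qed.

Lemma boot_prob_mono x s t : s <= t -> boot_prob x s <= boot_prob x t.
Proof.
move=> st; apply: Pr_le; [exact: meas_boot_le|exact: meas_boot_le|].
by move=> w /= h; exact: le_trans h st.
Qed.

Lemma boot_prob_lt0 x t : 1 - alpha <= boot_prob x t -> 0 <= t.
Proof.
move=> h; rewrite leNgt; apply/negP => t0.
have e0 : [set w | boot_Tbar x (fun i => e i w) <= t] = set0.
  apply/seteqP; split => // w /= hw.
  by have := le_lt_trans (le_trans (boot_Tbar_ge0 x w) hw) t0; rewrite ltxx.
by move: h; rewrite /boot_prob e0 /Pr measure0/= subr_le0 leNgt al1.
Qed.

Lemma boot_prob_markov x t : 0 < t -> boot_mean x <= alpha * t -> 1 - alpha <= boot_prob x t.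
Proof.
move=> t0 h; have := Pr_markov (L1_boot_Tbar x) (boot_Tbar_ge0 x) t0.
have -> : [set w | t < boot_Tbar x (fun i => e i w)] = ~` [set w | boot_Tbar x (fun i => e i w) <= t].
  by apply/seteqP; split => w /=; rewrite ltNge => /negP.
rewrite PrC; last exact: meas_boot_le.
move=> h1; have h2 : boot_mean x / t <= alpha by rewrite ler_pdivrMr.
by have := le_trans h1 h2; rewrite /boot_prob; lra.
Qed.

Definition quantile_set x : set R := [set t | 1 - alpha <= boot_prob x t].

Lemma quantile_setE x :
  [set t : R | ((1 - alpha)%:E <= boot_cdf e x t)%E] = quantile_set x.
Proof.
apply/seteqP; split => t /=; rewrite /boot_cdf PrE; try exact: meas_boot_le; by rewrite lee_fin.
Qed.

Definition quantile x : R := inf (quantile_set x).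

Lemma boot_quantileE w : boot_quantile X e w (1 - alpha) = quantile (data X w).
Proof. by rewrite /boot_quantile quantile_setE. Qed.

Lemma quantile_has_inf x : has_inf (quantile_set x).
Proof.
split; last by exists 0 => t; exact: boot_prob_lt0.
have m0 : 0 <= boot_mean x by apply: Ex_ge0 => w; exact: boot_Tbar_ge0.
exists ((boot_mean x + 1) / alpha); apply: boot_prob_markov; first by rewrite divr_gt0//; lra.
by rewrite mulrCA divff ?gt_eqF// mulr1; lra.
Qed.

Lemma quantile_ge0 x : 0 <= quantile x.
Proof.
apply: lb_le_inf; first by have [] := quantile_has_inf x.
by move=> t; exact: boot_prob_lt0.
Qed.

Lemma quantile_lt x s : quantile x < s -> exists2 t, t < s & 1 - alpha <= boot_prob x t.
Proof.
move=> h; have s0 : 0 < s - quantile x by rewrite subr_gt0.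
have [t ht ts] := inf_adherent s0 (quantile_has_inf x).
by exists t => //; move: ts; rewrite addrC subrK.
Qed.

Lemma quantile_le x t : 1 - alpha <= boot_prob x t -> quantile x <= t.
Proof. by move=> h; apply: ge_inf => //; have [] := quantile_has_inf x. Qed.

Lemma quantile_le_mean x : quantile x <= boot_mean x / alpha.
Proof.
have m0 : 0 <= boot_mean x by apply: Ex_ge0 => w; exact: boot_Tbar_ge0.
apply/ler_addgt0Pr => c c0; apply: quantile_le; apply: boot_prob_markov.
  by rewrite ltr_wpDl// divr_ge0// ltW.
by rewrite mulrDr mulrCA divff ?gt_eqF// mulr1 lerDl mulr_ge0 ?(ltW al0) ?(ltW c0).
Qed.

Hypothesis XE : independent_families X e.

Let TX := (p.-tuple R)%type.

Lemma indep_data : indep P (dataE e) (dataX X).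
Proof.
split.
- apply/measurable_fun_tnthP => k; rewrite (_ : _ \o _ = e k); last first.
    by apply/funext => w /=; rewrite tnth_mktuple.
  exact: measurable_funPT.
- apply/measurable_fun_tnthP => k; rewrite (_ : _ \o _ = X k); last first.
    by apply/funext => w /=; rewrite tnth_mktuple.
  exact: measurable_funPT.
move=> A B mA mB; rewrite setIC muleC; exact: (XE mB mA).
Qed.

Definition tdata (v : n.-tuple (p.-tuple R)) : 'I_n -> 'cV[R]_p := fun i => vec (tnth v i).

Lemma tdataE w : tdata (dataX X w) = data X w.
Proof. by apply/funext => i; rewrite /tdata tnth_mktuple. Qed.

Section Polynomials.
Context dS (S : measurableType dS).
Variable v : S -> 'I_n -> 'cV[R]_p.
Hypothesis mv : forall i k, measurable_fun setT (fun s => v s i k 0).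

Lemma meas_avg (F : S -> 'I_n -> R) : (forall i, measurable_fun setT (fun s => F s i)) ->
  measurable_fun setT (fun s => avg (F s)).
Proof. by move=> mF; apply: measurable_funM => //; apply: meas_sum. Qed.

Lemma meas_sample_mean k : measurable_fun setT (fun s => sample_mean (v s) k 0).
Proof.
rewrite (_ : (fun s => _) = fun s => avg (fun i => v s i k 0)); last first.
  by apply/funext => s; rewrite sample_meanE.
exact: meas_avg.
Qed.

Lemma meas_sample_cov m k : measurable_fun setT (fun s => sample_cov (v s) m k).
Proof.
rewrite (_ : (fun s => _) = fun s => n%:R / (n%:R - 1) * (avg (fun i => v s i m 0 * v s i k 0) -
   sample_mean (v s) m 0 * sample_mean (v s) k 0)); last first.
  by apply/funext => s; rewrite sample_covE.
apply: measurable_funM => //; apply: measurable_funB.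
  by apply: meas_avg => i; exact: measurable_funM.
by apply: measurable_funM; exact: meas_sample_mean.
Qed.

Lemma meas_bootB i m k : measurable_fun setT (fun s => bootB (v s) i m k).
Proof.
apply: measurable_funB; last exact: meas_sample_cov.
apply: measurable_funM => //; apply: measurable_funM;
  by apply: measurable_funB => //; exact: meas_sample_mean.
Qed.

Lemma meas_boot_Tbar (u : S -> 'I_n -> R) : (forall i, measurable_fun setT (fun s => u s i)) ->
  measurable_fun setT (fun s => boot_Tbar (v s) (u s)).
Proof.
move=> mu.
rewrite (_ : (fun s => _) = fun s => \big[Num.max/0]_(m < p) \big[Num.max/0]_(k < p)
  `|n%:R^-1 * \sum_i bootB (v s) i m k * u s i|); last by apply/funext => s; rewrite boot_TbarE.
apply: meas_bigmax => m; apply: meas_bigmax => k; apply: meas_normr.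
apply: measurable_funM => //; apply: meas_sum => i; apply: measurable_funM => //.
exact: meas_bootB.
Qed.

End Polynomials.

(** Freezing the data amounts to integrating out the multipliers, so measurability is the Fubini
    part of [indep_law] for a jointly measurable indicator. *)
Lemma meas_boot_prob t : measurable_fun setT (fun w => boot_prob (data X w) t).
Proof.
pose f (z : n.-tuple R * n.-tuple (p.-tuple R)) : R :=
  \1_[set z | boot_Tbar (tdata z.2) (fun i => tnth z.1 i) <= t] z.
have mv i k : measurable_fun setT (fun z : n.-tuple R * n.-tuple (p.-tuple R) => tdata z.2 i k 0).
  rewrite (_ : (fun z => _) = fun z : n.-tuple R * n.-tuple (p.-tuple R) => tnth (tnth z.2 i) k); last first.
    by apply/funext => z; rewrite mxE.
  apply: (measurableT_comp (measurable_tnth k)).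
  by apply: (measurableT_comp (measurable_tnth i)); exact: measurable_snd.
have mu i : measurable_fun setT (fun z : n.-tuple R * n.-tuple (p.-tuple R) => tnth z.1 i).
  by apply: (measurableT_comp (measurable_tnth i)); exact: measurable_fst.
have mS : measurable [set z : n.-tuple R * n.-tuple (p.-tuple R) |
    boot_Tbar (tdata z.2) (fun i => tnth z.1 i) <= t].
  by apply: meas_le => //; exact: (meas_boot_Tbar mv mu).
have mf : measurable_fun setT f by exact: measurable_indic.
have f1 z : `|f z| <= 1.
  by rewrite /f indicE; case: (_ \in _); rewrite ?normr1 ?normr0.
have [mE mX' _] := indep_data.
have [L _] := indep_law indep_data mf
  (L1_bnd _ (c := 1) (measurableT_comp mf (measurable_fun_pair mE mX')) (fun w => f1 _))
  (fun v => L1_bnd _ (c := 1) (measurableT_comp mf (measurable_fun_pair mE (measurable_cst v))) (fun w => f1 _)).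
rewrite (_ : (fun w => _) = fun w' => Ex P (fun w => f (dataE e w, dataX X w'))); first exact: L1_meas L.
apply/funext => w'; rewrite /boot_prob -Pr_indic; last exact: meas_boot_le.
have eA w : (w \in [set w | boot_Tbar (data X w') (fun i => e i w) <= t]) =
    ((dataE e w, dataX X w') \in [set z : n.-tuple R * n.-tuple (p.-tuple R) |
       boot_Tbar (tdata z.2) (fun i => tnth z.1 i) <= t]).
  have h : (fun i => tnth (dataE e w) i) = fun i => e i w.
    by apply/funext => i; rewrite tnth_mktuple.
  by apply/idP/idP => /set_mem/= hw; apply/mem_set; move: hw; rewrite /= tdataE h.
have -> : (\1_[set w | boot_Tbar (data X w') (fun i => e i w) <= t] : T -> R) =
    fun w => f (dataE e w, dataX X w').
  by apply/funext => w; rewrite /f !indicE eA.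
by [].
Qed.

(** The quantile is below c exactly when some rational level below c already has probability at
    least 1 - alpha, which is a countable union of measurable events. *)
Lemma meas_quantile : measurable_fun setT (fun w => quantile (data X w)).
Proof.
apply: (measurability _ (RGenInftyO.measurableE R)) => _ [_ [c ->] <-].
rewrite setTI (_ : _ @^-1` _ = \bigcup_q [set w | ratr q < c /\ 1 - alpha <= boot_prob (data X w) (ratr q)]).
  apply: bigcupT_measurable_rat => q.
  have [qc|qc] := boolP (ratr q < c :> R); last first.
    rewrite [X in measurable X](_ : _ = set0)//; apply/seteqP; split => // w /= [] //.
  rewrite [X in measurable X](_ : _ = [set w | 1 - alpha <= boot_prob (data X w) (ratr q)]).
    by apply: meas_le => //; exact: meas_boot_prob.
  by apply/seteqP; split => w /= => [[]|].
apply/seteqP; split => w /=.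
  rewrite in_itv/= => h; have [t tc ht] := quantile_lt h.
  have [q] := rat_in_itvoo tc; rewrite in_itv/= => /andP[tq qc].
  by exists q => //; split => //; apply: le_trans ht _; exact: boot_prob_mono (ltW tq).
move=> [q _ [qc hq]]; rewrite in_itv/=; exact: le_lt_trans (quantile_le hq) qc.
Qed.

Lemma meas_data i k : measurable_fun setT (fun w => data X w i k 0).
Proof.
rewrite (_ : (fun w => _) = fun w => tnth (X i w) k); last by apply/funext => w; rewrite mxE.
by apply: (measurableT_comp (measurable_tnth k)).
Qed.

Lemma measurable_spectral_le (A : T -> 'M[R]_p) (c : T -> R) :
  (forall i k, measurable_fun setT (fun w => A w i k)) -> measurable_fun setT c ->
  (forall w, 0 <= c w) -> measurable [set w | spectral_norm (A w) <= c w].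
Proof.
move=> mA mc c0.
rewrite (_ : [set w | _] = ~` \bigcup_v ~` [set w |
    \sum_i (\sum_k A w i k * ratr ((v : {ffun 'I_p -> rat}) k)) ^+ 2 <= c w ^+ 2 * \sum_k ratr (v k) ^+ 2]).
  apply: measurableC; apply: countable_bigcupT_measurable; first exact: countableP.
  move=> v; apply: measurableC; apply: meas_le.
    apply: meas_sum => i; apply: measurable_funX; apply: meas_sum => k.
    exact: measurable_funM.
  by apply: measurable_funM => //; exact: measurable_funX.
rewrite setC_bigcup; apply/seteqP; split => w /=.
  by move=> /(spectral_norm_le_rat _ (c0 w)) h v _; rewrite setCK; exact: h.
by move=> h; apply/(spectral_norm_le_rat _ (c0 w)) => v; have := h v Logic.I; rewrite setCK.
Qed.

Lemma measurable_thresholding (Sigma : 'M[R]_p) (beta r1 r2 c1 c2 : R) : 0 <= c1 ->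
  let a w := quantile (data X w) in
  measurable [set w |
    spectral_norm (threshold (beta^-1 * a w) (sample_cov (data X w)) - Sigma) <= c1 * a w `^ r1 /\
    p%:R^-1 * frob_norm (threshold (beta^-1 * a w) (sample_cov (data X w)) - Sigma) ^+ 2 <= c2 * a w `^ r2].
Proof.
move=> c10 a.
have ma : measurable_fun setT a by exact: meas_quantile.
have mp r : measurable_fun setT (fun w => a w `^ r).
  by apply: (measurableT_comp (measurable_powR r)).
have mS m k : measurable_fun setT (fun w => sample_cov (data X w) m k).
  exact: (meas_sample_cov meas_data).
have mA m k : measurable_fun setT
    (fun w => (threshold (beta^-1 * a w) (sample_cov (data X w)) - Sigma) m k).
  rewrite (_ : (fun w => _) = fun w => (if beta^-1 * a w < `|sample_cov (data X w) m k|
     then sample_cov (data X w) m k else 0) - Sigma m k); last by apply/funext => w; rewrite !mxE.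
  apply: measurable_funB => //; apply: measurable_fun_ifT => //.
  by apply: measurable_fun_ltr; [exact: measurable_funM|exact: meas_normr].
apply: measurableI.
  apply: measurable_spectral_le => //; first exact: measurable_funM.
  by move=> w; rewrite mulr_ge0// powR_ge0.
apply: meas_le; last exact: measurable_funM.
rewrite (_ : (fun w => _) = fun w => p%:R^-1 * \sum_i \sum_k
    (threshold (beta^-1 * a w) (sample_cov (data X w)) - Sigma) i k ^+ 2).
  apply: measurable_funM => //; apply: meas_sum => i; apply: meas_sum => k.
  exact: measurable_funX.
apply/funext => w; rewrite /frob_norm sqr_sqrtr//; apply: sumr_ge0 => i _; exact: sum_sqr_ge0.
Qed.

End Quantile.

(** * Size of the quantile *)

Section BootstrapSize.
Context {R : realType} (n p : nat).
Hypothesis n4 : (4 <= n)%N.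
Variable x : 'I_n -> 'cV[R]_p.

Let nR : 4 <= n%:R :> R. Proof. by rewrite (ler_nat R 4). Qed.

Lemma avg_jensen (f : 'I_n -> R) : avg f ^+ 2 <= avg (fun i => f i ^+ 2).
Proof.
have h : 0 <= avg (fun i => (f i - avg f) ^+ 2) by apply: avg_ge0 => i; exact: sqr_ge0.
have e : avg (fun i => (f i - avg f) ^+ 2) = avg (fun i => f i ^+ 2) - avg f ^+ 2.
  rewrite (_ : (fun i => _) = fun i => (f i ^+ 2 - (2 * avg f) * f i) + avg f * avg f); last first.
    by apply/funext => i; ring.
  rewrite (avgD (fun i => f i ^+ 2 - (2 * avg f) * f i)) avg_cst//.
  by rewrite (avgB (fun i => f i ^+ 2)) avgZ; ring.
by rewrite e subr_ge0 in h.
Qed.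

(** With g = n / (n - 1), bootB is g times the deviation of the centred product from its average, so
    its mean square is at most g^2 <= 2 times that of the product, which is at most 16 V. *)
Lemma avg_bootB_sqr (V : R) : (forall k, avg (fun i => x i k 0 ^+ 4) <= V) ->
  forall m k, avg (fun i => bootB x i m k ^+ 2) <= 32 * V.
Proof.
move=> hV m k.
pose g : R := n%:R / (n%:R - 1).
have g2 : g ^+ 2 <= 2.
  rewrite /g expr_div_n ler_pdivrMr ?exprn_gt0//; last by have := nR; lra.
  by have := nR; nra.
have SE : sample_cov x m k = g * avg (fun i => cprod x i m k) by rewrite (avg_cprod n4) (sample_covE n4).
have e1 : avg (fun i => bootB x i m k ^+ 2) <= g ^+ 2 * avg (fun i => cprod x i m k ^+ 2).
  set c := fun i => cprod x i m k.
  rewrite (_ : (fun i => bootB x i m k ^+ 2) =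
     fun i => g ^+ 2 * (c i ^+ 2 - (2 * avg c) * c i) + (g * avg c) * (g * avg c)); last first.
    by apply/funext => i; rewrite /bootB SE -/g -/c -/(c i); ring.
  rewrite (avgD (fun i => g ^+ 2 * (c i ^+ 2 - (2 * avg c) * c i))) avg_cst// avgZ.
  rewrite (avgB (fun i => c i ^+ 2)) avgZ.
  have : 0 <= g ^+ 2 * avg c ^+ 2 by rewrite mulr_ge0 ?sqr_ge0.
  have -> : g ^+ 2 * (avg (fun i => c i ^+ 2) - 2 * avg c * avg c) + g * avg c * (g * avg c) =
    g ^+ 2 * avg (fun i => c i ^+ 2) - g ^+ 2 * avg c ^+ 2 by ring.
  by rewrite lerBlDr lerDl.
have c4 l : avg (fun i => (x i l 0 - sample_mean x l 0) ^+ 4) <= 16 * V.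
  set mu := sample_mean x l 0.
  have mu4 : mu ^+ 4 <= V.
    rewrite (_ : 4 = 2 * 2)%N// exprM /mu sample_meanE.
    apply: (@le_trans _ _ (avg (fun i => x i l 0 ^+ 2) ^+ 2)).
      by rewrite lerXn2r ?nnegrE ?sqr_ge0 ?avg_jensen// avg_ge0// => i; exact: sqr_ge0.
    apply: le_trans (avg_jensen _) _; apply: le_trans (hV l).
    by apply: avg_le => i; rewrite -exprM.
  have pt i : (x i l 0 - mu) ^+ 4 <= 8 * x i l 0 ^+ 4 + 8 * mu ^+ 4.
    set a := x i l 0.
    have h1 : (a - mu) ^+ 2 <= 2 * (a ^+ 2 + mu ^+ 2) by have := sqr_ge0 (a + mu); nra.
    have h2 : (a - mu) ^+ 4 <= (2 * (a ^+ 2 + mu ^+ 2)) ^+ 2.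
      rewrite (_ : 4 = 2 * 2)%N// exprM lerXn2r// ?nnegrE ?sqr_ge0//.
      by rewrite mulr_ge0// addr_ge0// sqr_ge0.
    apply: le_trans h2 _; rewrite (_ : a ^+ 4 = (a ^+ 2) ^+ 2); last by rewrite -exprM.
    rewrite (_ : mu ^+ 4 = (mu ^+ 2) ^+ 2); last by rewrite -exprM.
    by have := sqr_ge0 (a ^+ 2 - mu ^+ 2); nra.
  apply: le_trans (avg_le pt) _.
  rewrite (avgD (fun i => 8 * x i l 0 ^+ 4)) avg_cst// avgZ.
  by have := hV l; lra.
have e2 : avg (fun i => cprod x i m k ^+ 2) <= 16 * V.
  pose h l i := (x i l 0 - sample_mean x l 0) ^+ 4.
  have pt i : cprod x i m k ^+ 2 <= 2^-1 * (h m i + h k i).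
    rewrite /cprod /h; set a := x i m 0 - _; set b := x i k 0 - _.
    rewrite (_ : a ^+ 4 = (a ^+ 2) ^+ 2); last by rewrite -exprM.
    rewrite (_ : b ^+ 4 = (b ^+ 2) ^+ 2); last by rewrite -exprM.
    by have := sqr_ge0 (a ^+ 2 - b ^+ 2); rewrite exprMn sqrrB; lra.
  apply: le_trans (avg_le pt) _; rewrite avgZ avgD.
  by have := c4 m; have := c4 k; rewrite /h; lra.
apply: le_trans e1 _; apply: (@le_trans _ _ (2 * (16 * V))); last by lra.
apply: ler_pM => //; first exact: sqr_ge0.
by apply: avg_ge0 => i; exact: sqr_ge0.
Qed.

End BootstrapSize.

Section ThresholdSize.
Context d (T : measurableType d) {R : realType} (P : probability T R).
Context (n p : nat).
Variables (X : 'I_n -> {RV P >-> p.-tuple R}) (e : 'I_n -> {RV P >-> R}).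
Variables (Sigma : 'M[R]_p) (nu C1 C4 m4 L lp alpha : R).
Hypothesis n4 : (4 <= n)%N.
Hypothesis p0 : (0 < p)%N.
Hypothesis nu0 : 0 < nu.
Hypothesis C10 : 0 < C1.
Hypothesis C40 : 0 < C4.
Hypothesis H8 : forall i, L1 P (fun w => tmax (X i w) ^+ 8).
Hypothesis E8 : forall i, Ex P (fun w => tmax (X i w) ^+ 8) <= nu ^+ 8.
Hypothesis Hs : forall i m k, Ex P (fun w => tnth (X i w) m * tnth (X i w) k) = Sigma m k.
Hypothesis Hv : forall i a, 4 * C1 <= Ex P (fun w => tQ Sigma a (X i w) ^+ 2).
Hypothesis Hid : forall i j (f : p.-tuple R -> R), measurable_fun setT f ->
  L1 P (fun w => f (X i w)) -> Ex P (fun w => f (X j w)) = Ex P (fun w => f (X i w)).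
Hypothesis xI : forall x0 i, indep P (X i) (looX X e x0 i).
Hypothesis eN : forall i, standard_normal (e i).
Hypothesis eI : forall i, indep P (e i) (looE X e i).
Hypothesis XE : independent_families X e.
Hypothesis L0 : 0 < L.
Hypothesis hL : ln ((2 * p ^ 4).+1%:R : R) <= 4 * L.
Hypothesis hLn : L * nu ^+ 8 <= C4 * n%:R.
Hypothesis lp0 : 0 < lp.
Hypothesis hlp : ln ((2 * p ^ 2).+1%:R : R) <= 4 * lp.
Hypothesis E4 : forall i k, Ex P (fun w => `|tnth (X i w) k| ^+ 4) <= m4.
Hypothesis al0 : 0 < alpha.
Hypothesis al1 : alpha < 1.

Let n0 : (0 < n)%N. Proof. exact: leq_trans n4. Qed.
Let nR : 0 < n%:R :> R. Proof. by rewrite ltr0n. Qed.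
Let i0 : 'I_n := Ordinal n0.

Local Notation J := (('I_p * 'I_p) * bool)%type.

Lemma L1_standard_normal i : L1 P (fun w => e i w).
Proof. exact: L1_e eN i. Qed.

Lemma boot_mean_le (x : 'I_n -> 'cV[R]_p) (lam s : R) : 0 < lam -> 0 <= s ->
  (forall m k, avg (fun i => bootB x i m k ^+ 2) <= s) ->
  boot_mean e x <= 4 * lp / lam + lam * (s / n%:R).
Proof.
move=> lam0 s0 hs.
pose A (j : J) i : R := (sgn j.2 : R) * (n%:R^-1 * bootB x i j.1.1 j.1.2).
have gj j : gram A j j <= s / n%:R.
  have -> : gram A j j = n%:R^-1 * avg (fun i => bootB x i j.1.1 j.1.2 ^+ 2).
    rewrite /gram /avg mulrA mulr_sumr; apply: eq_bigr => i _.
    rewrite /A [LHS](_ : _ = ((sgn j.2 : R) ^+ 2) * (n%:R^-1 * n%:R^-1 * bootB x i j.1.1 j.1.2 ^+ 2)).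
      by rewrite /sgn sqrr_sign mul1r.
    by ring.
  by rewrite mulrC ler_pM2r ?invr_gt0.
have mX i : measurable_fun setT (X i) by exact: measurable_funPT.
have hG := Ex_Gmax_le eN eI (y := fun (j : J) (_ : p.-tuple R) => 0 : R)
  (fun=> measurable_cst (0 : R)) mX lam0 gj (divr_ge0 s0 (ltW nR)).
apply: (@le_trans _ _ (Ex P (Gmax e A))).
  apply: Ex_le; first exact: (L1_boot_Tbar n4 L1_standard_normal).
    exact: L1_Gmax.
  move=> w; rewrite boot_TbarE//.
  apply/bigmax_leP; split => [|m _]; first exact: bigmax_ge_id.
  apply/bigmax_leP; split => [|k _]; first exact: bigmax_ge_id.
  have hj (b : bool) : (sgn b : R) * (n%:R^-1 * \sum_i bootB x i m k * e i w) <= Gmax e A w.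
    have -> : (sgn b : R) * (n%:R^-1 * \sum_i bootB x i m k * e i w) = gaussG e A w ((m, k), b).
      rewrite /gaussG !mulr_sumr; apply: eq_bigr => i _; rewrite /A/=; ring.
    exact: (le_bigmax _ (fun j => gaussG e A w j)).
  have h1 := hj true; have h2 := hj false.
  rewrite /sgn expr1 mulN1r in h1; rewrite /sgn expr0 mul1r in h2.
  by rewrite ler_norml h2 andbT lerNl.
apply: le_trans hG _; rewrite lerD2r ler_pM2r ?invr_gt0//.
apply: le_trans hlp; rewrite !card_prod card_bool card_ord ler_ln ?posrE ?ltr0n// ler_nat ltnS.
by rewrite mulnC mulnn.
Qed.

Definition max4 w : R := \big[Num.max/0]_(k < p) avg (fun i => tnth (X i w) k ^+ 4).

Let L4 i k : L1 P (fun w => `|tnth (X i w) k| ^+ 4).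
Proof.
apply: (L1_tmax H8 (f := fun x => `|tnth x k| ^+ 4) (c1 := 1) (c2 := 1) i).
  by apply: measurable_funX; apply: meas_normr; exact: meas_co.
move=> x; rewrite ger0_norm ?exprn_ge0// mul1r.
apply: (@le_trans _ _ (tmax x ^+ 4)); last by rewrite pow_le1// tmax_ge0.
by rewrite lerXn2r ?nnegrE ?tmax_ge0// tnth_le_tmax.
Qed.

(** The variance of a squared coordinate is at most its second moment. The lower bound allows an
    additive constant to be written as a multiple of m4. *)
Lemma m4_ge : 4 * C1 <= m4.
Proof.
pose k0 : 'I_p := Ordinal p0.
apply: le_trans (Hv i0 (k0, k0)) _; apply: le_trans (E4 i0 k0).
have l2 : L1 P (fun w => tnth (X i0 w) k0 * tnth (X i0 w) k0) by exact: (L1_prod H8).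
have e1 : (fun w => tQ Sigma (k0, k0) (X i0 w) ^+ 2) = fun w => `|tnth (X i0 w) k0| ^+ 4 -
   ((2 * Sigma k0 k0) * (tnth (X i0 w) k0 * tnth (X i0 w) k0) - Sigma k0 k0 ^+ 2).
  apply/funext => w; rewrite /tQ/= (_ : 4 = 2 * 2)%N// exprM real_normK ?num_real//; ring.
rewrite e1 ExB//; last by apply: L1B; [exact: L1Z|exact: L1_cst].
rewrite ExB; [|exact: L1Z|exact: L1_cst]; rewrite Ex_cst ExZ// Hs.
rewrite lerBlDr lerDl (_ : 2 * _ * _ - _ = Sigma k0 k0 ^+ 2) ?sqr_ge0//; ring.
Qed.

Let m40 : 0 < m4. Proof. by apply: lt_le_trans m4_ge; rewrite mulr_gt0. Qed.

Definition cV4 : R := 1 + 5 * Num.sqrt (40 * C4) / (4 * C1).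

(** By the maximal inequality the averages of fourth powers deviate from their means by O(sqrt (L
    nu^8 / n)), a constant under the growth condition, and [m4_ge] turns it into a multiple of
    m4. *)
Lemma Ex_max4 : L1 P max4 /\ Ex P max4 <= cV4 * m4.
Proof.
pose g k (x : p.-tuple R) := `|tnth x k| ^+ 4 - Ex P (fun w => `|tnth (X i0 w) k| ^+ 4).
have mf k : measurable_fun setT (fun x : p.-tuple R => `|tnth x k| ^+ 4).
  by apply: measurable_funX; apply: meas_normr; exact: meas_co.
have mg k : measurable_fun setT (g k) by exact: measurable_funB.
pose B (x : p.-tuple R) := tmax x ^+ 4 + 2 * nu ^+ 4.
have B0 x : 0 <= B x by rewrite addr_ge0 ?exprn_ge0 ?tmax_ge0// mulr_ge0// exprn_ge0// ltW.
have t4 (x : p.-tuple R) k : `|tnth x k| ^+ 4 <= tmax x ^+ 4.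
  by rewrite lerXn2r ?nnegrE ?tmax_ge0// tnth_le_tmax.
have [l4 h4] := Ex_tmax_pow nu0 H8 E8 i0 (isT : (4 <= 8)%N).
have gB k x : `|g k x| <= B x.
  apply: le_trans (ler_normB _ _) _; apply: lerD; first by rewrite ger0_norm ?exprn_ge0.
  rewrite ger0_norm; last by apply: Ex_ge0 => w; rewrite exprn_ge0.
  by apply: le_trans h4; apply: Ex_le => // w; exact: t4.
have B2 x : B x ^+ 2 <= 2 * tmax x ^+ 8 + 8 * nu ^+ 8.
  rewrite (_ : tmax x ^+ 8 = (tmax x ^+ 4) ^+ 2); last by rewrite -exprM.
  rewrite (_ : nu ^+ 8 = (nu ^+ 4) ^+ 2); last by rewrite -exprM.
  by rewrite /B; have := sqr_ge0 (tmax x ^+ 4 - 2 * nu ^+ 4); nra.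
have LL i : L1 P (fun w => 2 * tmax (X i w) ^+ 8 + 8 * nu ^+ 8).
  by apply: L1D; [exact: L1Z|exact: L1_cst].
have mB : measurable_fun setT (fun x => B x ^+ 2).
  by apply: measurable_funX; apply: measurable_funD => //; apply: measurable_funX; exact: meas_tmax.
have LB i : L1 P (fun w => B (X i w) ^+ 2).
  apply: L1_le (LL i); first exact: (meas_comp_data X i mB).
  by move=> w; rewrite ger0_norm ?sqr_ge0.
have EB i : Ex P (fun w => B (X i w) ^+ 2) <= 10 * nu ^+ 8.
  apply: le_trans (Ex_le (LB i) (LL i) (fun w => B2 (X i w))) _.
  rewrite ExD; [|exact: L1Z|exact: L1_cst]; rewrite Ex_cst ExZ//.
  by have := E8 i; lra.
have Eg i k : Ex P (fun w => g k (X i w)) = 0.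
  rewrite ExB//; last exact: L1_cst.
  by rewrite Ex_cst (Hid i (mf k) (L4 i0 k)) subrr.
have s0 : 0 < 10 * nu ^+ 8 by rewrite mulr_gt0// exprn_gt0.
have l0 : 0 < 4 * L by rewrite mulr_gt0.
have ll : ln ((2 * #|{: 'I_p}|).+1%:R : R) <= 4 * L.
  apply: le_trans hL; rewrite card_ord ler_ln ?posrE ?ltr0n// ler_nat ltnS leq_mul2l/=.
  by rewrite -[leqLHS]expn1 leq_pexp2l.
have mX i : measurable_fun setT (X i) by exact: measurable_funPT.
pose x0 : p.-tuple R := [tuple 0 | _ < p].
have Lm := L1_max_avg mX mg gB B0 LB.
have h := Ex_max_avg_le n0 mX (xI x0) mg gB B0 LB EB Eg s0 l0 ll.
have hq : Num.sqrt (4 * L * (10 * nu ^+ 8) / n%:R) <= Num.sqrt (40 * C4).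
  rewrite ler_wsqrtr// ler_pdivrMr//.
  have -> : 4 * L * (10 * nu ^+ 8) = 40 * (L * nu ^+ 8) by ring.
  by rewrite -mulrA ler_pM2l.
have La k : L1 P (fun w => avg (fun i => tnth (X i w) k ^+ 4)).
  apply: L1Z; apply: L1_sum => i _; apply: L1_ext (L4 i k) => w.
  by rewrite (_ : 4 = 2 * 2)%N// !exprM real_normK ?num_real.
have pt w : max4 w <= max_avg X g w + m4.
  apply/bigmax_leP; split => [|k _]; first by rewrite addr_ge0 ?bigmax_ge_id// ltW.
  apply: (@le_trans _ _ (avg (fun i => g k (X i w)) + m4)).
    rewrite /g (avgB (fun i => `|tnth (X i w) k| ^+ 4)) avg_cst//.
    have -> : avg (fun i => `|tnth (X i w) k| ^+ 4) = avg (fun i => tnth (X i w) k ^+ 4).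
      congr avg; apply/funext => i; by rewrite (_ : 4 = 2 * 2)%N// !exprM real_normK ?num_real.
    by rewrite -addrA lerDl addrC subr_ge0.
  rewrite lerD2r; apply: le_trans (ler_norm _) _.
  exact: (le_bigmax _ (fun k => `|avg (fun i => g k (X i w))|)).
have LM : L1 P (fun w => max_avg X g w + m4) by apply: L1D => //; exact: L1_cst.
have L4' : L1 P max4.
  apply: L1_le LM; first by apply: meas_bigmax => k; exact: L1_meas (La k).
  by move=> w; rewrite ger0_norm ?bigmax_ge_id.
split=> //; apply: le_trans (Ex_le L4' LM pt) _.
rewrite ExD//; last exact: L1_cst.
rewrite Ex_cst /cV4 [leRHS]mulrDl mul1r addrC lerD2l.
apply: le_trans h _; apply: (@le_trans _ _ (5 * Num.sqrt (40 * C4))); first by rewrite ler_pM2l.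
rewrite mulrAC ler_pdivlMr ?mulr_gt0//; apply: ler_wpM2l; last exact: m4_ge.
by rewrite mulr_ge0// sqrtr_ge0.
Qed.

(** The parameter [lam] is balanced with the deterministic m4 instead of the random [max4], so that
    the bound is linear in [max4] and its expectation can be taken. *)
Lemma Ex_quantile_le :
  L1 P (fun w => quantile e alpha (data X w)) /\
  Ex P (fun w => quantile e alpha (data X w)) <=
    (4 + 32 * cV4) / alpha * (Num.sqrt m4 * Num.sqrt (lp / n%:R)).
Proof.
pose u := Num.sqrt m4 * Num.sqrt (lp / n%:R).
have q0 : 0 < lp / n%:R by rewrite divr_gt0.
have u0 : 0 < u by rewrite mulr_gt0// sqrtr_gt0.
pose lam := lp / u.
have lam0 : 0 < lam by rewrite divr_gt0.
have u2 : u ^+ 2 = m4 * (lp / n%:R) by rewrite exprMn !sqr_sqrtr// ltW.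
have e1 : lp / lam = u by rewrite /lam; field; rewrite !gt_eqF.
have e2 : lam * (m4 / n%:R) = u.
  apply: (mulIf (lt0r_neq0 u0)); rewrite -expr2 u2 /lam; field.
  by rewrite !gt_eqF.
have [L4' h4] := Ex_max4.
have max40 w : 0 <= max4 w by exact: bigmax_ge_id.
have pt w : quantile e alpha (data X w) <=
   alpha^-1 * (4 * u + (lam * 32 / n%:R) * max4 w).
  apply: le_trans (quantile_le_mean n4 L1_standard_normal al0 al1 (data X w)) _.
  rewrite mulrC ler_pM2l ?invr_gt0//.
  have hV k : avg (fun i => data X w i k 0 ^+ 4) <= max4 w.
    rewrite (_ : (fun i => _) = fun i => tnth (X i w) k ^+ 4); last first.
      by apply/funext => i; rewrite mxE.
    exact: (le_bigmax _ (fun k => avg (fun i => tnth (X i w) k ^+ 4))).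
  have s0 : 0 <= 32 * max4 w by rewrite mulr_ge0.
  apply: le_trans (boot_mean_le lam0 s0 (avg_bootB_sqr n4 hV)) _.
  rewrite -mulrA e1 lerD2l le_eqVlt; apply/orP; left; apply/eqP; ring.
have LR : L1 P (fun w => alpha^-1 * (4 * u + (lam * 32 / n%:R) * max4 w)).
  by apply: L1Z; apply: L1D; [exact: L1_cst|exact: L1Z].
have Lq : L1 P (fun w => quantile e alpha (data X w)).
  apply: L1_le LR; first exact: (meas_quantile n4 L1_standard_normal al0 al1 XE).
  by move=> w; rewrite ger0_norm// (quantile_ge0 n4 L1_standard_normal).
split=> //; apply: le_trans (Ex_le Lq LR pt) _.
rewrite ExZ; last by apply: L1D; [exact: L1_cst|exact: L1Z].
rewrite ExD; [|exact: L1_cst|exact: L1Z]; rewrite Ex_cst ExZ// -/u.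
rewrite [leRHS](_ : _ = alpha^-1 * (4 * u + 32 * cV4 * u)); last by ring.
rewrite ler_pM2l ?invr_gt0// lerD2l.
apply: (@le_trans _ _ (lam * 32 / n%:R * (cV4 * m4))).
  by rewrite ler_pM2l// divr_gt0// mulr_gt0.
by rewrite -[X in _ <= 32 * cV4 * X]e2 le_eqVlt; apply/orP; left; apply/eqP; ring.
Qed.

End ThresholdSize.

(** * The model *)

Section SampleSize.
Context {R : realType}.
Variables (n p : nat) (K : R).
Hypothesis n4 : (4 <= n)%N.
Hypothesis p2 : (2 <= p)%N.
Hypothesis K01 : 0 < K < 1.

Let N : R := n%:R.
Let np : R := (n * p)%:R.

Definition skap : R := N `^ (- (K / 48)).
Definition sL : R := ln np.
Definition sm : nat := (Num.truncn sL).+1.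

Let N1 : 1 <= N. Proof. by rewrite ler1n (leq_trans _ n4). Qed.
Let N0 : 0 < N. Proof. exact: lt_le_trans ltr01 N1. Qed.
Let np0 : 0 < np. Proof. by rewrite ltr0n muln_gt0 (leq_trans _ n4)// (leq_trans _ p2). Qed.
Let K0 : 0 < K. Proof. by case/andP: K01. Qed.
Let K1 : K < 1. Proof. by case/andP: K01. Qed.

Lemma skap_gt0 : 0 < skap. Proof. exact: powR_gt0. Qed.

Lemma skap_pow j : skap ^+ j = N `^ (- (K / 48) * j%:R).
Proof. by rewrite -powR_mulrn ?powR_ge0// -powRrM. Qed.

Lemma skap_le1 : skap <= 1.
Proof.
rewrite -(powRr0 N) /skap ler_powR// oppr_le0 divr_ge0// ltW//.
Qed.

Lemma skap8 : skap ^+ 8 = N `^ (- (K / 6)).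
Proof. by rewrite skap_pow; congr (_ `^ _); field. Qed.

Lemma skap56 : N * skap ^+ 56 = N `^ (1 - 7 * K / 6).
Proof.
rewrite skap_pow -[X in X * _](powRr1 (ltW N0)) -powRD.
  by congr (_ `^ _); field.
by apply/implyP => _; rewrite gt_eqF.
Qed.

Lemma sL_ge1 : 1 <= sL.
Proof.
have h4 : expR 1 <= np.
  have one1 : `|1 : R| <= 1 by rewrite normr1.
  have /andP[_ h] := expR_bounds one1.
  apply: le_trans h _; rewrite (ler_nat R 4); apply: leq_trans n4 _.
  by rewrite leq_pmulr// (leq_trans _ p2).
by rewrite -[leLHS]expRK /sL ler_ln ?posrE ?expR_gt0.
Qed.

Lemma sm_bounds : sL <= sm%:R <= 2 * sL.
Proof.
have h1 := sL_ge1; have h0 : 0 <= sL := le_trans ler01 h1.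
apply/andP; split; first exact/ltW/truncnS_gt.
have : (Num.truncn sL)%:R <= sL by rewrite truncn_le.
by rewrite /sm -natr1; lra.
Qed.

Lemma expR_sL j : expR (j%:R * sL) = np ^+ j.
Proof. by rewrite expRM_natl lnK ?posrE. Qed.

(** 2 p^4 + 1 <= 4^4 p^4 <= (n p)^4, by n >= 4. *)
Lemma ln_p4 : ln ((2 * p ^ 4).+1%:R : R) <= 4 * sL.
Proof.
rewrite -[leRHS]expRK expR_sL ler_ln ?posrE ?ltr0n ?exprn_gt0// /np -natrX ler_nat.
have n4' : (4 ^ 4 <= n ^ 4)%N by rewrite leq_exp2r.
have pp : (0 < p ^ 4)%N by rewrite expn_gt0 (leq_trans _ p2).
rewrite expnMn; apply: leq_trans (_ : 4 ^ 4 * p ^ 4 <= _)%N; last by rewrite leq_mul2r n4' orbT.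
by rewrite (_ : 4 ^ 4 = 3 + 253)%N// mulnDl -addn1 (_ : 3 = 2 + 1)%N// mulnDl mul1n -addnA leq_add2l (leq_trans pp)// leq_addr.
Qed.

Lemma card_le_exp : (2 * p ^ 2)%:R <= expR (2 * sm%:R) :> R.
Proof.
apply: (@le_trans _ _ (expR (2 * sL))); last first.
  by rewrite ler_expR ler_pM2l//; case/andP: sm_bounds.
rewrite expR_sL /np -natrX ler_nat expnMn leq_mul2r; apply/orP; right.
by apply: leq_trans (_ : 4 ^ 2 <= _)%N => //; rewrite leq_exp2r.
Qed.

Lemma exp_sm : expR (- sm%:R) <= skap ^+ 8.
Proof.
apply: (@le_trans _ _ (expR (- sL))); first by rewrite ler_expR lerN2; case/andP: sm_bounds.
rewrite expRN lnK ?posrE// skap8; apply: (@le_trans _ _ (N `^ (-1))).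
  rewrite powR_inv1 ?(ltW N0)// lef_pV2 ?posrE// ler_nat leq_pmulr// (leq_trans _ p2)//.
by rewrite ler_powR// lerN2; have := K0; have := K1; lra.
Qed.

Lemma ln_p_gt0 : 0 < ln (p%:R : R).
Proof. by rewrite ln_gt0// ltr1n. Qed.

(** The expectation bound has log p and not log(np); here 2 p^2 + 1 <= 3 p^2 <= p^4 because p >=
    2. *)
Lemma ln_p2 : ln ((2 * p ^ 2).+1%:R : R) <= 4 * ln (p%:R : R).
Proof.
have pp : 0 < p%:R :> R by rewrite ltr0n (leq_trans _ p2).
rewrite mulr_natl -lnXn// ler_ln ?posrE ?ltr0n ?exprn_gt0// -natrX ler_nat.
rewrite (_ : 4 = 2 * 2)%N// [leqRHS]expnM.
have : (4 <= p ^ 2)%N by rewrite (leq_exp2r 2 p (isT : 0 < 2)%N).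
by move: (p ^ 2)%N => q q4; rewrite -mulnn; apply: leq_trans (_ : 3 * q <= _)%N;
  [rewrite (_ : 3 = 2 + 1)%N// mulnDl mul1n -addn1 leq_add2l (leq_trans _ q4)|rewrite leq_mul2r (leq_trans _ q4) ?orbT].
Qed.

End SampleSize.

(** * From the hypotheses on the first observation to moment bounds for all *)

Section Model.
Context d (T : measurableType d) {R : realType} (P : probability T R).
Variables (n p : nat) (hn : (4 <= n)%N).
Variables (X : 'I_n -> {RV P >-> p.-tuple R}).
Variables (Sigma : 'M[R]_p) (nu C1 c6 : R).
Let i1 := first_ord hn.
Let X1 := X i1.
Hypothesis XI : iid X.
Hypothesis Xc : forall i k, ('E_P[rv_coord (X i) k] = 0)%E.
Hypothesis Xs : forall i m k,
  covariance P (rv_coord (X i) m) (rv_coord (X i) k) = (Sigma m k)%:E.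
Hypothesis nu0 : 0 < nu.
Hypothesis X8 : (LqNorm P 8 (max_abs X1) <= nu%:E)%E.
Hypothesis Xv : forall j k, (C1%:E <= hajek_cov Sigma X1 (j, k) (j, k))%E.
Hypothesis c60 : 0 <= c6.
Hypothesis X6 : (xi X1 6 <= c6%:E)%E.

Lemma transfer i j (f : p.-tuple R -> R) : measurable_fun setT f -> L1 P (fun w => f (X i w)) ->
  L1 P (fun w => f (X j w)) /\ Ex P (fun w => f (X j w)) = Ex P (fun w => f (X i w)).
Proof. by move=> mf Lf; apply: (identical_law _ mf Lf) => B mB; case: XI => _; exact. Qed.

Lemma model_id i j (f : p.-tuple R -> R) : measurable_fun setT f ->
  L1 P (fun w => f (X i w)) -> Ex P (fun w => f (X j w)) = Ex P (fun w => f (X i w)).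
Proof. by move=> mf Lf; have [] := transfer j mf Lf. Qed.

Let M8 : L1 P (fun w => tmax (X1 w) ^+ 8) /\ Ex P (fun w => tmax (X1 w) ^+ 8) <= nu ^+ 8.
Proof.
have mf : measurable_fun setT (max_abs X1).
  exact: (meas_comp_data X i1 (meas_tmax (p := p))).
have [L h] := LqNorm_moment (isT : (0 < 8)%N) mf (ltW nu0) X8.
have e : (fun w => `|max_abs X1 w| ^+ 8) = fun w => tmax (X1 w) ^+ 8.
  by apply/funext => w; rewrite ger0_norm// tmax_ge0.
by rewrite e in L h.
Qed.

Let mt8 : measurable_fun setT (fun x : p.-tuple R => tmax x ^+ 8).
Proof. by apply: measurable_funX; exact: meas_tmax. Qed.

Lemma model_H8 i : L1 P (fun w => tmax (X i w) ^+ 8).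
Proof. by case: M8 => L _; have [] := transfer i mt8 L. Qed.

Lemma model_E8 i : Ex P (fun w => tmax (X i w) ^+ 8) <= nu ^+ 8.
Proof. by case: M8 => L h; have [_ ->] := transfer i mt8 L. Qed.

Let mt6 k : measurable_fun setT (fun x : p.-tuple R => `|tnth x k| ^+ 6).
Proof. by apply: measurable_funX; apply: meas_normr; exact: meas_co. Qed.

Let M6 k : L1 P (fun w => `|tnth (X1 w) k| ^+ 6) /\ Ex P (fun w => `|tnth (X1 w) k| ^+ 6) <= c6 ^+ 6.
Proof.
have mf : measurable_fun setT (rv_coord X1 k).
  exact: (meas_comp_data X i1 (meas_co k)).
apply: (LqNorm_moment (isT : (0 < 6)%N) mf c60); apply: le_trans X6.
exact: (le_bigmax _ (fun k => LqNorm P 6 (rv_coord X1 k))).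
Qed.

Lemma model_H6 i k : L1 P (fun w => `|tnth (X i w) k| ^+ 6).
Proof. by case: (M6 k) => L _; have [] := transfer i (mt6 k) L. Qed.

Lemma model_E6 i k : Ex P (fun w => `|tnth (X i w) k| ^+ 6) <= c6 ^+ 6.
Proof. by case: (M6 k) => L h; have [_ ->] := transfer i (mt6 k) L. Qed.

Lemma model_Hc i k : Ex P (fun w => tnth (X i w) k) = 0.
Proof. by have := Xc i k; rewrite unlock /Ex => ->. Qed.

Lemma model_Hs i m k : Ex P (fun w => tnth (X i w) m * tnth (X i w) k) = Sigma m k.
Proof. exact: (covariance_centered (Xc i m) (Xc i k) (Xs i m k)). Qed.

(** The factor 4 undoes the square of the 1/2 in [hajek]; the projection is centred, so its variance
    is a second moment. *)
Lemma model_Hv i a : 4 * C1 <= Ex P (fun w => tQ Sigma a (X i w) ^+ 2).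
Proof.
have n0 : (0 < n)%N := leq_trans (isT : (0 < 4)%N) hn.
have LQQ := L1_tQQ n0 nu0 model_H8 model_E8 model_Hs.
have e2 i' : (fun w => tQ Sigma a (X i' w) ^+ 2) = fun w => tQ Sigma a (X i' w) * tQ Sigma a (X i' w).
  by apply/funext => w; rewrite expr2.
rewrite e2 (model_id (i := i1) i (meas_tQQ Sigma a a) (LQQ i1 a a)).
pose h w := hajek Sigma (vec (X1 w)) a.1 a.2.
have hE : h = fun w => 2^-1 * tQ Sigma a (X1 w).
  by apply/funext => w; rewrite /h /hajek !mxE big_ord1 !mxE.
have LQ := L1_tQ Sigma model_H8 i1 a.
have Eh : ('E_P[h] = 0)%E.
  rewrite hE Ex_expectation; last exact: L1Z.
  by rewrite ExZ// (Ex_tQ model_H8 model_Hs) mulr0.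
have hhE : (fun w => h w * h w) = fun w => 4^-1 * (tQ Sigma a (X1 w) * tQ Sigma a (X1 w)).
  by apply/funext => w; rewrite hE; field.
have Lhh : L1 P (fun w => h w * h w) by rewrite hhE; apply: L1Z; exact: LQQ.
have Ehh : covariance P h h = (Ex P (fun w => h w * h w))%:E.
  rewrite unlock Eh/= unlock -(L1_EFin Lhh).
  by apply: eq_integral => w _; rewrite ?fctE /= ?subr0.
rewrite hhE ExZ in Ehh; last exact: LQQ.
have := Xv a.1 a.2; rewrite /hajek_cov -/h -/(h) => hv.
have {hv} : (C1%:E <= covariance P h h)%E by exact: hv.
by rewrite Ehh lee_fin ler_pdivlMl.
Qed.

(* The fourth moment bound is the fourth power of xi_4, so that its square
   root is xi_4 squared. *)
Lemma model_xi4 : exists2 y : R, xi X1 4 = y%:E &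
  0 <= y /\ forall i k, Ex P (fun w => `|tnth (X i w) k| ^+ 4) <= y ^+ 4.
Proof.
have mt4 k : measurable_fun setT (fun x : p.-tuple R => `|tnth x k| ^+ 4).
  by apply: measurable_funX; apply: meas_normr; exact: meas_co.
have L4 k : L1 P (fun w => `|tnth (X1 w) k| ^+ 4).
  apply: (L1_tmax model_H8 (f := fun x => `|tnth x k| ^+ 4) (c1 := 1) (c2 := 1) i1) => // x.
  rewrite ger0_norm ?exprn_ge0// mul1r.
  apply: (@le_trans _ _ (tmax x ^+ 4)); last by rewrite pow_le1// tmax_ge0.
  by rewrite lerXn2r ?nnegrE ?tmax_ge0// tnth_le_tmax.
pose F k : R := (Ex P (fun w => `|tnth (X1 w) k| ^+ 4)) `^ 4%:R^-1.
exists (\big[Num.max/0]_(k < p) F k).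
  rewrite /xi; elim/big_rec2 : _ => // k y1 y2 _ ->.
  by rewrite EFin_max (LqNormE (isT : (0 < 4)%N) (L4 k)).
split; first exact: bigmax_ge_id.
move=> i k; rewrite (model_id (i := i1) i (mt4 k) (L4 k)).
have E0 : 0 <= Ex P (fun w => `|tnth (X1 w) k| ^+ 4).
  by apply: Ex_ge0 => w; rewrite exprn_ge0.
have -> : Ex P (fun w => `|tnth (X1 w) k| ^+ 4) = F k ^+ 4.
  by rewrite /F -powR_mulrn ?powR_ge0// -powRrM mulVf ?powRr1.
by rewrite lerXn2r ?nnegrE ?powR_ge0 ?bigmax_ge_id//; exact: le_bigmax.
Qed.

End Model.

Lemma trivial_arith (R : realType) (al y z : R) : 1 <= y -> 0 < al -> 0 <= z ->
  1 - al - (y + z) <= 0.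
Proof. lra. Qed.

Theorem theorem4p2 (R : realType) (C1 C2 C3 C4 : R)
  (hC1 : 0 < C1) (hC2 : 0 < C2) (hC3 : 0 < C3) (hC4 : 0 < C4) :
  exists (C : R) (C' : R -> R), 0 < C /\ (forall alpha : R, 0 < C' alpha) /\
  forall (n p : nat) (hn : (4 <= n)%N) (hp : (3 <= p ^ 2)%N)
    (d : measure_display) (T : measurableType d) (P : probability T R)
    (X : 'I_n -> {RV P >-> p.-tuple R}) (e : 'I_n -> {RV P >-> R})
    (Sigma : 'M[R]_p) (r zeta nu alpha beta K : R),
  let X1 := X (first_ord hn) in
  let a := fun w : T => boot_quantile X e w (1 - alpha) in
  let tau := fun w : T => beta^-1 * a w in
  let Sigma_hat := fun w : T => threshold (tau w) (sample_cov (data X w)) in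
  iid X ->
  mutually_independent e -> (forall i, standard_normal (e i)) ->
  independent_families X e ->
  (forall i k, 'E_P[rv_coord (X i) k] = 0)%E ->
  (forall i m k,
    covariance P (rv_coord (X i) m) (rv_coord (X i) k) = (Sigma m k)%:E) ->
  0 <= r < 1 -> 0 < zeta -> sparse_class r zeta Sigma ->
  0 < nu -> (LqNorm P 8 (max_abs X1) <= nu%:E)%E ->
  (forall j k, (C1%:E <= hajek_cov Sigma X1 (j, k) (j, k))%E) ->
  (xi X1 6 <= (C2 * nu `^ (1 / 3))%:E)%E ->
  (xi X1 8 <= (C3 * nu `^ (1 / 2))%:E)%E ->
  0 < alpha < 1 -> 0 < beta < 1 -> 0 < K < 1 ->
  nu ^+ 8 * ln ((n * p)%:R : R) ^+ 7 <= C4 * n%:R `^ (1 - 7 * K / 6) ->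
  ((1 - alpha - C * n%:R `^ (- (K / 6)))%:E <=
   P [set w | (
     spectral_norm (Sigma_hat w - Sigma) <=
       ((3 + 2 * beta) / beta `^ (1 - r) + (beta / (1 - beta)) `^ r)
         * zeta * a w `^ (1 - r) /\
     p%:R^-1 * frob_norm (Sigma_hat w - Sigma) ^+ 2 <=
       2 * ((4 + 3 * beta ^+ 2) / beta `^ (2 - r)
            + 2 * (beta / (1 - beta)) `^ r)
         * zeta * a w `^ (2 - r))%R])%E /\
  ('E_P[tau] <=
    (C' alpha * beta^-1)%:E * xi X1 4 ^+ 2
      * ((ln p%:R / n%:R) `^ (1 / 2))%:E)%E.
Proof.
have cV0 : 0 <= cV4 C1 C4.
  by rewrite addr_ge0// divr_ge0// mulr_ge0 ?sqrtr_ge0// ltW.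
have kb0 : 0 <= kbig C1 C2 C4 ^+ 8 by rewrite (_ : 8 = 4 * 2)%N// exprM sqr_ge0.
have ke0 := kerr_ge0 hC1 hC4.
(* If kap * kbig > 1, the term kbig^8 alone makes the probability bound nonpositive; otherwise kerr
   + 4 is the constant of [coverage]. The absolute value and the summand 1 keep the second constant
   positive for every real alpha. *)
exists (kbig C1 C2 C4 ^+ 8 + (kerr C1 C4 + 4)), (fun alpha => (4 + 32 * cV4 C1 C4) * `|alpha|^-1 + 1).
have cv32 : 0 <= 4 + 32 * cV4 C1 C4 by rewrite addr_ge0// mulr_ge0.
split; first by rewrite ltr_wpDl// ltr_wpDl.
split; first by move=> al; rewrite ltr_wpDl// mulr_ge0// invr_ge0.
move=> n p hn hp d T P X e Sigma r zeta nu alpha beta K X1 a tau Sigma_hat.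
move=> iidX EI eN XE Xc Xs r01 z0 sparse nu0 X8 Xv X6 _ /andP[al0 al1] b01 K01 main.
have p2 : (2 <= p)%N by case: p hp {X X1 a tau Sigma_hat iidX XE Xc Xs X8 Xv X6 main Sigma sparse} => [|[|]].
have p0 : (0 < p)%N := leq_trans (isT : (0 < 2)%N) p2.
have n0 : (0 < n)%N := leq_trans (isT : (0 < 4)%N) hn.
have nR : 0 < n%:R :> R by rewrite ltr0n.
have c60 : 0 < C2 * nu `^ (1 / 3) by rewrite mulr_gt0// powR_gt0.
have c6E : (C2 * nu `^ (1 / 3)) ^+ 6 = C2 ^+ 6 * nu ^+ 2.
  rewrite exprMn -[(nu `^ (1 / 3)) ^+ 6]powR_mulrn ?powR_ge0// -powRrM.
  rewrite -[nu ^+ 2]powR_mulrn ?(ltW nu0)//; congr (_ * _).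
  by congr (_ `^ _); field.
have H8 := model_H8 iidX nu0 X8.
have E8 := model_E8 iidX nu0 X8.
have H6 := model_H6 iidX (ltW c60) X6.
have E6 := model_E6 iidX (ltW c60) X6.
have Hc := model_Hc Xc.
have Hs := model_Hs Xc Xs.
have Hv := model_Hv iidX Xc Xs nu0 X8 Xv.
have Hid := model_id iidX.
have [XI _] := iidX.
have xI := indep_looX XI EI XE.
have eI := indep_looE XI EI XE.
have eL := L1_standard_normal eN.
pose kap := skap n K; pose L : R := sL n p; pose m := @sm R n p.
have k0 : 0 < kap := skap_gt0 K hn.
have k1 : kap <= 1 := skap_le1 hn K01.
have k8 : kap ^+ 8 = n%:R `^ (- (K / 6)) := skap8 n K.
have k56 : n%:R * kap ^+ 56 = n%:R `^ (1 - 7 * K / 6) := skap56 K hn.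
have L1 : 1 <= L := sL_ge1 hn p2.
have L0 : 0 < L := lt_le_trans ltr01 L1.
have mL : L <= m%:R <= 2 * L := sm_bounds hn p2.
have hL : ln ((2 * p ^ 4).+1%:R : R) <= 4 * L := ln_p4 hn p2.
have hJ : (2 * p ^ 2)%:R <= expR (2 * m%:R) :> R := card_le_exp hn p2.
have hm : expR (- m%:R) <= kap ^+ 8 := exp_sm hn p2 K01.
have main' : nu ^+ 8 * L ^+ 7 <= C4 * (n%:R * kap ^+ 56) by rewrite k56.
have aE w : a w = quantile e alpha (data X w) := boot_quantileE X hn eL alpha w.
have a0 w : 0 <= a w by rewrite aE (quantile_ge0 hn eL).
split.
  rewrite -k8.
  have [small|large] := lerP (kap * kbig C1 C2 C4) 1; last first.
    apply: le_trans (measure_ge0 _ _); rewrite lee_fin.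
    have h : 1 <= kap ^+ 8 * kbig C1 C2 C4 ^+ 8 by rewrite -exprMn exprn_ege1// ltW.
    have h' : 0 <= (kerr C1 C4 + 4) * kap ^+ 8.
      by apply: mulr_ge0; [exact: addr_ge0|apply: exprn_ge0; exact: ltW].
    by rewrite mulrDl [kbig _ _ _ ^+ _ * _]mulrC; exact: trivial_arith h al0 h'.
  have aq w s : a w < s -> exists2 t, t < s &
     1 - alpha <= Pr P [set w' | boot_Tbar (data X w) (fun i => e i w') <= t].
    by rewrite aE; exact: (quantile_lt hn eL al0 al1).
  have [U [mU hU PU]] := coverage hn p0 nu0 hC1 hC2 hC4 c60 c6E H8 E8 H6 E6 Hc Hs Hv Hid xI eN eI
    k0 k1 L1 mL hL hJ hm main' small a0 aq al0.
  set S := [set w | _].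
  have mS : measurable S.
    have b1 : 0 < 1 - beta by case/andP: b01; rewrite subr_gt0.
    have b0 : 0 < beta by case/andP: b01.
    have := measurable_thresholding hn eL al0 al1 XE Sigma beta (1 - r) (2 - r)
      (c1 := ((3 + 2 * beta) / beta `^ (1 - r) + (beta / (1 - beta)) `^ r) * zeta)
      (2 * ((4 + 3 * beta ^+ 2) / beta `^ (2 - r) + 2 * (beta / (1 - beta)) `^ r) * zeta).
    rewrite /=.
    rewrite (_ : [set w | _] = S); last first.
      by apply/seteqP; split => w /=; rewrite -!aE.
    apply; rewrite mulr_ge0 ?(ltW z0)// addr_ge0 ?powR_ge0// divr_ge0 ?powR_ge0//.
    by rewrite addr_ge0// mulr_ge0// ltW.
  rewrite (PrE _ mS) lee_fin.
  apply: (@le_trans _ _ (Pr P U)).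
    apply: le_trans PU; rewrite lerD2l lerN2 ler_wpM2r ?exprn_ge0 ?(ltW k0)// lerDr//.
  apply: Pr_le => // w Uw.
  apply: (threshold_bounds r01 b01 (a0 w) (hU w Uw)) => //.
  by move=> i k; exact: sample_cov_sym.
have [y yE [y0 hy]] := model_xi4 iidX nu0 X8.
rewrite /X1 yE.
have lp0 : 0 < ln (p%:R : R) := ln_p_gt0 p2.
(* The growth condition implies this weaker form, since L >= 1 and kap <= 1. *)
have hLn : L * nu ^+ 8 <= C4 * n%:R.
  apply: (@le_trans _ _ (nu ^+ 8 * L ^+ 7)).
    rewrite mulrC ler_pM2l ?exprn_gt0// exprS ler_peMr ?(ltW L0)//.
    exact: exprn_ege1.
  apply: le_trans main' _; rewrite ler_pM2l// ler_piMr ?(ltW nR)//.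
  by rewrite exprn_ile1// ltW.
have [Lq hq] := Ex_quantile_le hn p0 nu0 hC1 H8 E8 Hs Hv Hid xI eN eI XE L0 hL hLn lp0
  (ln_p2 p2) hy al0 al1.
have b0 : 0 < beta by case/andP: b01.
have tE : tau = fun w => beta^-1 * quantile e alpha (data X w).
  by apply/funext => w; rewrite /tau aE.
rewrite tE Ex_expectation; last exact: L1Z.
rewrite ExZ// -EFin_expe -!EFinM lee_fin.
have -> : (ln p%:R / n%:R) `^ (1 / 2) = Num.sqrt (ln p%:R / n%:R) :> R.
  by rewrite div1r powR12_sqrt// divr_ge0// ltW.
have y4 : Num.sqrt (y ^+ 4) = y ^+ 2.
  by rewrite (_ : 4 = 2 * 2)%N// exprM sqrtr_sqr ger0_norm ?sqr_ge0.
rewrite y4 in hq; set s := Num.sqrt _ in hq *.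
have s0 : 0 <= y ^+ 2 * s by rewrite mulr_ge0 ?sqr_ge0 ?sqrtr_ge0.
apply: (@le_trans _ _ (beta^-1 * ((4 + 32 * cV4 C1 C4) / alpha * (y ^+ 2 * s)))).
  by rewrite ler_pM2l ?invr_gt0.
rewrite [leRHS](_ : _ = beta^-1 * (((4 + 32 * cV4 C1 C4) / `|alpha| + 1) * (y ^+ 2 * s))); last by ring.
rewrite ler_pM2l ?invr_gt0// ler_wpM2r// gtr0_norm// lerDl//.
Qed.
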